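(* Let $k$ be an algebraically closed field of prime characteristic $p$, let $G,H$ be finite groups, $b$ a block of $kG$ and $c$ a block of $kH$, and let $M$ be an indecomposable $(kGb,kHc)$-bimodule which induces a stable equivalence of Morita type between $kGb$ and $kHc$ and which, as a $k(G\times H)$-module, has an endopermutation module as a source for some vertex. Let $P,R,i,j,\mathcal F,\varphi,V$ be as fixed in the context, with $P$ and $R$ identified via $\varphi$, and with $P$ non-trivial. Let $e_P,f_P,G_P,H_P$ be as in the context, let $M_P$ be a $(\Delta P,e_P\otimes f_P^\circ)$-slashed module attached to $M$ over $N_{G\times H}(\Delta P,e_P\otimes f_P^\circ)$, and let $T_P:=N_{G\times H}(\Delta P,e_P\otimes f_P^\circ)\cap(G_P\times H_P)$. Then: (a) $\mathrm{Res}_{C_G(P)\times C_H(P)}^{N_{G\times H}(\Delta P,e_P\otimes f_P^\circ)}(M_P)$ is a $p$-permutation module and induces a Morita equivalence between $kC_G(P)e_P$ and $kC_H(P)f_P$. (b) $\mathrm{Ind}_{T_P}^{G_P\times H_P}(M_P)$ (where $M_P$ is restricted to $T_P$) is a $p$-permutation module and induces a Morita equivalence between $kG_Pe_P$ and $kH_Pf_P$. (c) $\mathrm{Ind}_{N_{G\times H}(\Delta P,e_P\otimes f_P^\circ)}^{N_G(P)\times N_H(P)}(M_P)$ is a $p$-permutation module and induces a Morita equivalence between the block algebras of the Brauer correspondent blocks of $b$ and $c$ (in $kN_G(P)$ and $kN_H(P)$ respectively).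
   Context: All modules are finite-dimensional over $k$. A block of $kG$ is a primitive idempotent of $Z(kG)$. A $(kG,kH)$-bimodule is regarded as a $k(G\times H)$-module via $(g,h)m=gmh^{-1}$, and its vertices and sources are taken in this sense. $c^\circ$ denotes the image of $c$ under the anti-automorphism of $kH$ inverting group elements; $(kGb,kHc)$-bimodules are the same as $k(G\times H)(b\otimes c^\circ)$-modules (similarly for other blocks). A $p$-permutation module is a direct summand of a permutation module. Stable equivalence of Morita type: for symmetric $k$-algebras $A,B$, an $(A,B)$-bimodule $M$ induces one if $M$ is finitely generated projective as a left $A$-module and as a right $B$-module, $M\otimes_BM^*\cong A\oplus W$ with $W$ a projective $A\otimes_kA^{\rm op}$-module, and $M^*\otimes_AM\cong B\oplus W'$ with $W'$ a projective $B\otimes_kB^{\rm op}$-module, where $M^*=\mathrm{Hom}_k(M,k)$. Brauer construction: for a $p$-subgroup $P$ of $G$ and a $G$-algebra or $kG$-module $A$, $\mathrm{Br}_P(A)=A^P/\sum_{Q<P}\mathrm{Tr}_Q^P(A^Q)$ with canonical map $\mathrm{br}_P^A:A^P\to\mathrm{Br}_P(A)$; $\mathrm{Br}_P(kG)$ is identified with $kC_G(P)$. Subpairs: a subpair of $G$ is $(Q,e)$ with $Q$ a $p$-subgroup and $e$ a block of $kC_G(Q)$; it is a $b$-subpair if $e\,\mathrm{br}_Q^{kG}(b)\ne0$. $N_G(Q,e)$ is the stabiliser of $e$ in $N_G(Q)$. $e$ remains a block of $kL$ whenever $C_G(Q)\le L\le N_G(Q,e)$. An endopermutation $kP$-module ($P$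 a finite $p$-group) is a $kP$-module $V$ such that $\mathrm{End}_k(V)$ has a $k$-basis stable under the conjugation action of $P$. For a fusion system $\mathcal F$ on $P$, an endopermutation $kP$-module $V$ is $\mathcal F$-stable if for every $R\le P$ and every $\varphi:R\to P$ in $\mathcal F$, the sets of isomorphism classes of indecomposable direct summands with vertex $R$ of $\mathrm{Res}^P_R(V)$ and of ${}_\varphi V$ (the restriction of $V$ along $\varphi$) are equal. Fixed data. $P$ is a defect group of $b$, $R$ a defect group of $c$; $i\in(kGb)^P$ and $j\in(kHc)^R$ are source idempotents, i.e. primitive idempotents with $\mathrm{br}_P^{kG}(i)\neq0$, $\mathrm{br}_R^{kH}(j)\ne0$. For $Q\le P$, $e_Q$ is the unique block of $kC_G(Q)$ with $\mathrm{br}_Q^{kG}(i)e_Q\ne0$; $\mathcal F$ is the fusion system on $P$ determined by $i$: $\mathrm{Hom}_{\mathcal F}(Q,S)$ is the set of homomorphisms $Q\to S$ of the form $u\mapsto xux^{-1}$ with $x\in G$ and $xe_Qx^{-1}=e_{xQx^{-1}}$. Let $\mathcal G$ be the analogous fusion system on $R$ determined by $j$. By a theorem of Puig there are an isomorphism $\varphi:P\to R$ and an indecomposable endopermutation $k\Delta\varphi$-module $V$, $\Delta\varphi=\{(u,\varphi(u))\mid u\in P\}$, such that $M$ is isomorphic to a direct summand of $kGi\otimes_{kP}\mathrm{Ind}_{\Delta\varphi}^{P\times R}(V)\otimes_{kR}jkH$; for any such $\varphi,V$, $\Delta\varphi$ is a vertex and $V$ a source of $M$, ${}^\varphi\mathcal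 F=\mathcal G$, and $V$ viewed as $kP$-module is $\mathcal F$-stable. Fix such $\varphi,V$ and identify $P$ with $R$ via $\varphi$, so that $P=R$, $\mathcal F=\mathcal G$, $\Delta\varphi=\Delta P=\{(u,u)\mid u\in P\}\le G\times H$. Let $f_P$ be the unique block of $kC_H(P)$ with $\mathrm{br}_P^{kH}(j)f_P\neq0$. Since $\mathcal F=\mathcal G$, one has $N_G(P,e_P)/C_G(P)\cong N_H(P,f_P)/C_H(P)$ (both identified with $\mathrm{Aut}_{\mathcal F}(P)$ via conjugation). $G_P$ is an arbitrary subgroup with $C_G(P)\le G_P\le N_G(P,e_P)$, and $H_P$ is the subgroup of $N_H(P,f_P)$ containing $C_H(P)$ such that $H_P/C_H(P)$ is the image of $G_P/C_G(P)$ under this isomorphism. Source triples and Brauer-friendly modules (Biland). Let $b$ be a block of $kG$. A source triple of an indecomposable $kGb$-module $N$ is $(P,e_P,V)$ where $(P,e_P)$ is a $b$-subpair, $P$ is a vertex of $N$, $V$ is a $kP$-source of $N$, and $N$ is isomorphic to a direct summand of $kGe_P\otimes_{kP}V$. A morphism of $b$-subpairs $(Q,e)\to(P,e_P)$ is a group homomorphism $Q\to P$ of the form $u\mapsto gug^{-1}$ with $g\in G$ and ${}^g(Q,e)\le(P,e_P)$. A source triple $(P,e_P,V)$ with $V$ endopermutation is fusion-stable if for every $b$-subpair $(Q,e)$ and all morphisms $\varphi_1,\varphi_2:(Q,e)\to(P,e_P)$, ${}_{\varphi_1}V\oplus{}_{\varphi_2}V$ is an endopermutation $kQ$-module. Two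 fusion-stable endopermutation source triples $(P_1,e_1,V_1)$, $(P_2,e_2,V_2)$ are compatible if for every $b$-subpair $(Q,e)$ and all morphisms $\varphi_l:(Q,e)\to(P_l,e_l)$ ($l=1,2$), ${}_{\varphi_1}V_1\oplus{}_{\varphi_2}V_2$ is an endopermutation $kQ$-module. A Brauer-friendly $kGb$-module is a direct sum of indecomposable $kGb$-modules with pairwise compatible fusion-stable endopermutation source triples. Slashed modules. For a Brauer-friendly $kGb$-module $N$, a $b$-subpair $(P,e_P)$ and a subgroup $L$ with $PC_G(P)\le L\le N_G(P,e_P)$, a $(P,e_P)$-slashed module attached to $N$ over $L$ is a Brauer-friendly $kLe_P$-module $N_P$ together with an isomorphism $\mathrm{Br}_P(\mathrm{End}_k(e_PN))\cong\mathrm{End}_k(N_P)$ of $C_G(P)$-interior $L$-algebras (i.e. of algebras, compatible with the actions of $L$ and with the structural homomorphisms from $C_G(P)$); such a module exists (Biland). Here this is applied to the group $G\times H$, the block $b\otimes c^\circ$, the module $M$ (which is Brauer-friendly) and the $(b\otimes c^\circ)$-subpair $(\Delta P,e_P\otimes f_P^\circ)$; note $C_{G\times H}(\Delta P)=C_G(P)\times C_H(P)$. *)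

(* Defs.v *)
From HB Require Import structures.
From mathcomp Require Import all_boot all_order all_algebra all_fingroup.
From mathcomp Require Import all_solvable all_field.

Set Implicit Arguments.
Unset Strict Implicit.
Unset Printing Implicit Defensive.
Import GroupScope GRing.Theory.
Local Open Scope ring_scope.

(* Conventions.  All modules are finite-dimensional left modules.  A          *)
(* (kG,kH)-bimodule is a k(G x H)-module via (g,h)m = g m h^-1, and a         *)
(* kGb-module is a kG-module on which b acts as the identity (in_block).      *)
(* MathComp conjugation is a right action, x ^ y = y^-1 x y, so the left      *)
(* conjugate y x y^-1 is written x ^ y^-1, and y Q y^-1 is Q :^ y^-1.         *)

Section GroupAlgebra.

Variables (k : fieldType) (gT : finGroupType).

Definition grpalg := {ffun gT -> k^o}.

HB.instance Definition _ := Vector.copy grpalg {ffun gT -> k^o}.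

Implicit Types (a b c : grpalg) (x y z : gT).

Definition gelt x : grpalg := [ffun y => (y == x)%:R].

Definition gmul a b : grpalg := [ffun z => \sum_x a x * b (x^-1 * z)%g].

Lemma gmulE a b z : gmul a b z = \sum_x a x * b (x^-1 * z)%g.
Proof. by rewrite ffunE. Qed.

Lemma gmulA : associative gmul.
Proof.
move=> a b c; apply/ffunP=> z; rewrite !gmulE.
under eq_bigr => x _ do rewrite gmulE mulr_sumr.
under [RHS]eq_bigr => y _ do rewrite gmulE mulr_suml.
rewrite [RHS]exchange_big; apply: eq_bigr => x _ /=.
rewrite [RHS](reindex_inj (mulgI x)); apply: eq_bigr => y _ /=.
by rewrite mulKg invMg mulrA mulgA.
Qed.

Lemma gmul_geltl x b z : gmul (gelt x) b z = b (x^-1 * z)%g.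
Proof.
rewrite gmulE (bigD1 x) //= big1 ?addr0 => [|y /negPf ne].
  by rewrite ffunE eqxx mul1r.
by rewrite ffunE ne mul0r.
Qed.

Lemma gmul_geltr x b z : gmul b (gelt x) z = b (z * x^-1)%g.
Proof.
rewrite gmulE (bigD1 (z * x^-1)%g) //= big1 ?addr0 => [|y ne]; rewrite ffunE.
  by rewrite invMg invgK mulgKV eqxx mulr1.
case: eqP => [e|_]; last by rewrite mulr0.
by case/eqP: ne; rewrite -e invMg invgK mulKVg.
Qed.

Lemma gmul1l : left_id (gelt 1%g) gmul.
Proof. by move=> a; apply/ffunP=> z; rewrite gmul_geltl invg1 mul1g. Qed.

Lemma gmul1r : right_id (gelt 1%g) gmul.
Proof. by move=> a; apply/ffunP=> z; rewrite gmul_geltr invg1 mulg1. Qed.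

Lemma gmulDl : left_distributive gmul +%R.
Proof.
move=> a b c; apply/ffunP=> z; rewrite !ffunE -big_split.
by apply: eq_bigr => x _ /=; rewrite ffunE mulrDl.
Qed.

Lemma gmulDr : right_distributive gmul +%R.
Proof.
move=> a b c; apply/ffunP=> z; rewrite !ffunE -big_split.
by apply: eq_bigr => x _ /=; rewrite ffunE mulrDr.
Qed.

Lemma gelt1_neq0 : gelt 1%g != 0.
Proof. by apply/eqP=> /ffunP/(_ 1%g)/eqP; rewrite !ffunE eqxx oner_eq0. Qed.

HB.instance Definition _ := GRing.Zmodule_isNzRing.Build grpalg
  gmulA gmul1l gmul1r gmulDl gmulDr gelt1_neq0.

Lemma grpalg_scalAl (s : k) a b : s *: (a * b) = (s *: a) * b.
Proof.
apply/ffunP=> z; rewrite !ffunE /= /GRing.scale /= mulr_sumr.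
by apply: eq_bigr => x _; rewrite ffunE /GRing.scale /= mulrA.
Qed.

HB.instance Definition _ :=
  GRing.Lmodule_isLalgebra.Build k grpalg grpalg_scalAl.

Lemma grpalg_scalAr (s : k) a b : s *: (a * b) = a * (s *: b).
Proof.
apply/ffunP=> z; rewrite !ffunE /= /GRing.scale /= mulr_sumr.
by apply: eq_bigr => x _; rewrite ffunE /GRing.scale /= mulrCA.
Qed.

HB.instance Definition _ :=
  GRing.Lalgebra_isAlgebra.Build k grpalg grpalg_scalAr.

HB.instance Definition _ := Algebra_isFalgebra.Build k grpalg.


Lemma geltM x y : gelt (x * y)%g = gelt x * gelt y.
Proof.
apply/ffunP=> z; rewrite [RHS]gmul_geltl !ffunE.
by rewrite -(inj_eq (mulgI x) (_ * z)%g) mulKVg.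
Qed.

(* The group algebra kG of a subgroup G, inside the group algebra of gT.      *)
Definition kspan (G : {set gT}) : {vspace grpalg} :=
  (\sum_(x in G) <[gelt x]>)%VS.

Lemma mem_kspan (G : {set gT}) x : x \in G -> gelt x \in kspan G.
Proof. by move=> Gx; rewrite memvE; apply: (sumv_sup x). Qed.

Lemma kspan_idem (G : {group gT}) : (kspan G * kspan G = kspan G)%VS.
Proof.
apply: subv_anti; apply/andP; split.
  rewrite /kspan big_distrl /=; apply/subv_sumP=> x Gx.
  rewrite big_distrr /=; apply/subv_sumP=> y Gy.
  by rewrite prodv_line -geltM -memvE mem_kspan ?groupM.
by rewrite -{1}[kspan G]prod1v prodvSl // -memvE mem_kspan.
Qed.

Definition gconj x a : grpalg := gelt x * a * gelt x^-1.

(* br_P^{kG} : (kG)^P -> kC_G(P), under the usual identification of Br_P(kG)  *)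
(* with kC_G(P); it is only meaningful on elements fixed by P.                *)
Definition brauer_map (P : {set gT}) a : grpalg :=
  [ffun x => if x \in 'C(P)%g then a x else 0].

End GroupAlgebra.

Arguments gelt {k gT} x.
Arguments kspan k {gT} G.

Definition galg_opp (k : fieldType) (gT : finGroupType) (a : grpalg k gT) :
  grpalg k gT := [ffun x => a x^-1%g].

(* b (x) c in k(G x H) = kG (x)_k kH.                                         *)
Definition galg_tens (k : fieldType) (gT hT : finGroupType)
    (a : grpalg k gT) (b : grpalg k hT) : grpalg k (gT * hT)%type :=
  [ffun z => (a z.1 : k) * b z.2].

Definition primitive_idempotent (k : fieldType) (A : falgType k)
    (U : {vspace A}) (e : A) : Prop :=
  [/\ e \in U, e != 0, e * e = e
    & forall f g : A, f \in U -> g \in U -> f * f = f -> g * g = g ->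
        f * g = 0 -> g * f = 0 -> e = f + g -> f = 0 \/ g = 0].

Section Blocks.

Variables (k : fieldType) (gT : finGroupType).
Implicit Types (G P Q : {group gT}) (b e f : grpalg k gT).

Definition block G b : Prop := primitive_idempotent 'Z(kspan k G)%VS b.

(* The defect groups of b are the maximal p-subgroups P with br_P(b) != 0.    *)
Definition defect_group (p : nat) G b P : Prop :=
  [max P of Q | [&& Q \subset G, p.-group Q & brauer_map Q b != 0]].

(* For P <= G and b central, 'C_(kspan k G)(kspan k P) is (kG)^P and its      *)
(* product with the line <[b]> is (kGb)^P.                                    *)
Definition source_idempotent G b P (i : grpalg k gT) : Prop :=
  primitive_idempotent ('C_(kspan k G)(kspan k P) * <[b]>)%VS i
  /\ brauer_map P i != 0.

Definition subpair (p : nat) G Q e : Prop :=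
  [/\ Q \subset G, p.-group Q & block 'C_G(Q) e].

Definition block_subpair (p : nat) G b Q e : Prop :=
  subpair p G Q e /\ e * brauer_map Q b != 0.

(* (Q, e) <= (P, f), in the sense of Broue and Puig.                          *)
Definition subpair_le G Q e P f : Prop :=
  Q \subset P /\
  exists i, [/\ primitive_idempotent 'C_(kspan k G)(kspan k P)%VS i,
                brauer_map P i * f != 0 & brauer_map Q i * e != 0].

(* u |-> x u x^-1 is a morphism of subpairs (Q, e) -> (P, f).                 *)
Definition subpair_hom G Q e P f (x : gT) : Prop :=
  x \in G /\ subpair_le G (Q :^ x^-1) (gconj x e) P f.

(* P is a defect group of b; by Brauer's first main theorem b' is unique.     *)
Definition brauer_correspondent (p : nat) G P b (b' : grpalg k gT) : Prop :=
  [/\ block 'N_G(P) b', defect_group p 'N_G(P) b' P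
    & brauer_map P b' = brauer_map P b].

Lemma gconjE (a : grpalg k gT) x z : gconj x a z = a (z ^ x)%g.
Proof.
rewrite /gconj [LHS]gmul_geltr invgK [LHS]gmul_geltl.
by rewrite conjgE mulgA.
Qed.

Lemma gconj_set G Q e : group_set [set x in 'N_G(Q) | gconj x e == e].
Proof.
apply/group_setP; split=> [|x y].
  apply/setIdP; split; first exact: group1.
  by apply/eqP/ffunP=> z; rewrite gconjE conjg1.
case/setIdP=> Nx /eqP ex /setIdP[Ny /eqP ey]; apply/setIdP.
split; first exact: groupM.
apply/eqP/ffunP=> z.
by rewrite gconjE conjgM -gconjE ey -gconjE ex.
Qed.

Definition stabiliser G Q e := Group (gconj_set G Q e).

Lemma stabiliser_sub G Q e : stabiliser G Q e \subset G.
Proof. by apply/subsetP=> x /setIdP[/setIP[]]. Qed.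

End Blocks.

Lemma linfunE (k : fieldType) (U V : vectType k) (f : U -> V) :
  linear f -> linfun f =1 f.
Proof.
move=> f_lin u.
pose F : {linear U -> V} :=
  HB.pack f (GRing.isLinear.Build k U V *:%R f f_lin).
exact: (lfunE F).
Qed.

Section Modules.

Variable k : fieldType.

(* The values of gact outside G are irrelevant.                               *)
Record gmod (gT : finGroupType) (G : {group gT}) := GMod {
  gcarrier :> vectType k;
  gact : gT -> 'End(gcarrier);
  gact1 : gact 1%g = \1%VF;
  gactM : {in G &, forall x y, gact (x * y)%g = (gact x \o gact y)%VF}
}.

Arguments gact {gT G} M x : rename.

Section OneGroup.

Variables (gT : finGroupType) (G : {group gT}).
Implicit Types (M N : gmod G).

Definition galg_act M (a : grpalg k gT) : 'End(M) :=
  \sum_(x in G) a x *: gact M x.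

Definition giso M N : Prop :=
  exists f : 'Hom(M, N),
    [/\ lker f = 0%VS, limg f = fullv
      & {in G, forall x, (f \o gact M x = gact N x \o f)%VF}].

Lemma gmod0_act1 : (fun _ : gT => \1 : 'End('rV[k]_0))%VF 1%g = \1%VF.
Proof. by []. Qed.

Lemma gmod0_actM : {in G &, forall x y,
  (\1 = \1 \o \1 :> 'End('rV[k]_0))%VF}.
Proof. by move=> x y _ _; rewrite comp_lfun1l. Qed.

Definition gmod0 : gmod G := GMod gmod0_act1 gmod0_actM.

Lemma dsum_lin M N (x : gT) :
  linear (fun v : M * N => (gact M x v.1, gact N x v.2)).
Proof. by move=> a u v /=; rewrite !linearP. Qed.

Definition dsum_act M N (x : gT) : 'End((M * N)%type) :=
  linfun (fun v : M * N => (gact M x v.1, gact N x v.2)).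

Lemma dsum_act1 M N : dsum_act M N 1%g = \1%VF.
Proof.
by apply/lfunP=> -[u v]; rewrite (linfunE (@dsum_lin M N _)) !gact1 !lfunE.
Qed.

Lemma dsum_actM M N : {in G &, forall x y,
  dsum_act M N (x * y)%g = (dsum_act M N x \o dsum_act M N y)%VF}.
Proof.
move=> x y Gx Gy; apply/lfunP=> v; rewrite comp_lfunE.
by rewrite !(linfunE (@dsum_lin M N _)) /= !gactM // !comp_lfunE.
Qed.

Definition dsum M N : gmod G := GMod (dsum_act1 M N) (@dsum_actM M N).

Definition dsums (s : seq (gmod G)) : gmod G := foldr dsum gmod0 s.

Definition dsummand N M : Prop := exists N', giso M (dsum N N').

Definition indecomposable M : Prop :=
  (fullv : {vspace M}) <> 0%VS /\
  forall N N', giso M (dsum N N') ->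
    (fullv : {vspace N}) = 0%VS \/ (fullv : {vspace N'}) = 0%VS.

Definition permutation_module M : Prop :=
  exists X : seq M, basis_of fullv X
    /\ {in G, forall x, {in X, forall m, gact M x m \in X}}.

Definition p_permutation M : Prop :=
  exists2 N, permutation_module N & dsummand M N.

Definition in_block (e : grpalg k gT) M : Prop := galg_act M e = \1%VF.

Lemma conj_lin M (x : gT) :
  linear (fun f : 'End(M) => gact M x \o f \o gact M x^-1)%VF.
Proof.
move=> a f g; apply/lfunP=> v.
by rewrite !(comp_lfunE, add_lfunE, scale_lfunE) linearP.
Qed.

Definition endm_act M (x : gT) : 'End('End(M)) :=
  linfun (fun f : 'End(M) => gact M x \o f \o gact M x^-1)%VF.

Lemma endm_act1 M : endm_act M 1%g = \1%VF.
Proof.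
apply/lfunP=> f; rewrite (linfunE (@conj_lin M _)) invg1 gact1.
by rewrite comp_lfun1l comp_lfun1r lfunE.
Qed.

Lemma endm_actM M : {in G &, forall x y,
  endm_act M (x * y)%g = (endm_act M x \o endm_act M y)%VF}.
Proof.
move=> x y Gx Gy; apply/lfunP=> f; rewrite comp_lfunE.
rewrite !(linfunE (@conj_lin M _)) invMg !gactM ?groupV //.
by rewrite !comp_lfunA.
Qed.

Definition endm M : gmod G := GMod (endm_act1 M) (@endm_actM M).

Definition endopermutation M : Prop := permutation_module (endm M).

Section Submodule.

Variables (M : gmod G) (U : {vspace M}).
Hypothesis stabU : {in G, forall x, (gact M x @: U <= U)%VS}.

Definition subm_act (x : gT) : 'End(subvs_of U) :=
  (linfun (vsproj U) \o gact M x \o linfun vsval)%VF.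

Lemma subm_act1 : subm_act 1%g = \1%VF.
Proof.
apply/lfunP=> v; rewrite /subm_act gact1 comp_lfun1r comp_lfunE.
by rewrite !lfunE /= vsvalK.
Qed.

Lemma subm_actM : {in G &, forall x y,
  subm_act (x * y)%g = (subm_act x \o subm_act y)%VF}.
Proof.
move=> x y Gx Gy; apply/lfunP=> v; rewrite /subm_act gactM // !comp_lfunE.
rewrite [linfun vsval v]lfunE ![linfun (vsproj U) _]lfunE.
rewrite [linfun vsval _]lfunE /=.
rewrite vsprojK //.
by apply: (subvP (stabU Gy)); rewrite memv_img // subvsP.
Qed.

Definition subm : gmod G := GMod subm_act1 subm_actM.

End Submodule.

(* quotv W is the quotient V / W, carried by a complement of W; quot_proj W   *)
(* is the canonical surjection (lker_quot_proj).                              *)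
Definition quotv (V : vectType k) (W : {vspace V}) : vectType k :=
  subvs_of (W^C)%VS.

Definition quot_proj (V : vectType k) (W : {vspace V}) : 'Hom(V, quotv W) :=
  (linfun (vsproj W^C) \o (\1 - projv W))%VF.

Definition quot_lift (V : vectType k) (W : {vspace V}) : 'Hom(quotv W, V) :=
  linfun vsval.

Lemma quot_projE (V : vectType k) (W : {vspace V}) v :
  vsval (quot_proj W v) = v - projv W v.
Proof.
rewrite comp_lfunE [linfun _ _]lfunE /= vsprojK !lfun_simp //.
exact: memv_projC.
Qed.

Lemma lker_quot_proj (V : vectType k) (W : {vspace V}) :
  lker (quot_proj W) = W.
Proof.
apply/vspaceP=> v; rewrite memv_ker -(inj_eq val_inj) /= quot_projE subr_eq0.
by apply/eqP/idP=> [->|Wv]; rewrite ?memv_proj ?projv_id.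
Qed.

Lemma quot_projK (V : vectType k) (W : {vspace V}) :
  (quot_proj W \o quot_lift W = \1)%VF.
Proof.
apply/lfunP=> u; rewrite comp_lfunE id_lfunE [quot_lift W u]lfunE.
apply: val_inj; rewrite /= quot_projE.
suff -> : projv W (vsval u) = 0 by rewrite subr0.
have := daddv_pi_add (capv_compl W) (w := vsval u).
rewrite addv_complf memvf => /(_ isT).
rewrite [X in _ + X]daddv_pi_id 1?capvC ?capv_compl ?subvsP //.
by move/(canRL (addrK _)); rewrite subrr.
Qed.

Section Quotient.

Variables (M : gmod G) (W : {vspace M}).
Hypothesis stabW : {in G, forall x, (gact M x @: W <= W)%VS}.

Definition quom_act (x : gT) : 'End(quotv W) :=
  (quot_proj W \o gact M x \o quot_lift W)%VF.

Lemma quom_act1 : quom_act 1%g = \1%VF.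
Proof. by rewrite /quom_act gact1 comp_lfun1r quot_projK. Qed.

Lemma quom_actE x v :
  quom_act x v = quot_proj W (gact M x (quot_lift W v)).
Proof. by rewrite 2!comp_lfunE. Qed.

Lemma quom_actM : {in G &, forall x y,
  quom_act (x * y)%g = (quom_act x \o quom_act y)%VF}.
Proof.
move=> x y Gx Gy; apply/lfunP=> v; rewrite comp_lfunE !quom_actE gactM //.
rewrite comp_lfunE; apply/eqP; rewrite -subr_eq0 -linearB -memv_ker.
rewrite lker_quot_proj -linearB; apply: (subvP (stabW Gx)); apply: memv_img.
rewrite (lfunE _ (quot_proj W _)) /= quot_projE.
by rewrite opprB addrC subrK memv_proj.
Qed.

Definition quom : gmod G := GMod quom_act1 quom_actM.

End Quotient.

End OneGroup.

Section Change.

Variables (gT hT : finGroupType) (G : {group gT}) (H : {group hT}).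
Variables (M : gmod H) (f : gT -> hT).
Hypothesis fM : {in G &, {morph f : x y / (x * y)%g}}.
Hypothesis fG : {in G, forall x, f x \in H}.

Definition pullm_act (x : gT) : 'End(M) := gact M (f x).

Lemma pullm_act1 : pullm_act 1%g = \1%VF.
Proof.
suff f1 : f 1%g = 1%g by rewrite /pullm_act f1 gact1.
by apply: (mulgI (f 1%g)); rewrite -fM ?group1 // !mulg1.
Qed.

Lemma pullm_actM : {in G &, forall x y,
  pullm_act (x * y)%g = (pullm_act x \o pullm_act y)%VF}.
Proof. by move=> x y Gx Gy; rewrite /pullm_act fM // gactM ?fG. Qed.

Definition pullm : gmod G := GMod pullm_act1 pullm_actM.

End Change.

Section Restriction.

Variables (gT hT : finGroupType).

Lemma id_morph (G : {group gT}) : {in G &, {morph @id gT : x y / (x * y)%g}}.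
Proof. by []. Qed.

Definition resm (L G : {group gT}) (sLG : L \subset G) (M : gmod G) : gmod L :=
  pullm M (id_morph (G := L)) (subsetP sLG).

Lemma conj_morph (Q : {group gT}) (x : gT) :
  {in Q &, {morph (fun u => u ^ x^-1)%g : u v / (u * v)%g}}.
Proof. by move=> u v _ _; rewrite /= conjMg. Qed.

Lemma conj_sub (Q P : {group gT}) (x : gT) : (Q :^ x^-1 \subset P)%g ->
  {in Q, forall u, (u ^ x^-1)%g \in P}.
Proof. by move=> /subsetP sQP u Qu; rewrite sQP ?memJ_conjg. Qed.

(* Restriction of V along the homomorphism Q -> P, u |-> x u x^-1.            *)
Definition conjm (Q P : {group gT}) (x : gT)
    (sQP : (Q :^ x^-1 \subset P)%g) (V : gmod P) : gmod Q :=
  pullm V (@conj_morph Q x) (conj_sub sQP).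

Variables (G : {group gT}) (H : {group hT}).

Lemma inl_morph : {in G &, {morph (fun x => (x, 1%g : hT)) : x y / (x * y)%g}}.
Proof. by move=> x y _ _; congr pair; rewrite mulg1. Qed.

Lemma inl_sub : {in G, forall x, (x, 1%g : hT) \in setX_group G H}.
Proof. by move=> x Gx; rewrite inE /= Gx group1. Qed.

Definition lresm (M : gmod (setX_group G H)) : gmod G :=
  pullm M inl_morph inl_sub.

Lemma inr_morph : {in H &, {morph (fun y => (1%g : gT, y)) : x y / (x * y)%g}}.
Proof. by move=> x y _ _; congr pair; rewrite mulg1. Qed.

Lemma inr_sub : {in H, forall y, (1%g : gT, y) \in setX_group G H}.
Proof. by move=> x Gx; rewrite inE /= Gx group1. Qed.

(* The right kH-module M, as a left module through h m = m h^-1; a right      *)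
(* kHc-module becomes a left module over kH(galg_opp c).                      *)
Definition rresm (M : gmod (setX_group G H)) : gmod H :=
  pullm M inr_morph inr_sub.

Lemma swap_mem x y : ((x, y) \in setX G H) = ((y, x) \in setX H G).
Proof. by rewrite !inE andbC. Qed.

Lemma dual_lin (M : gmod (setX_group G H)) (z : hT * gT) :
  linear (fun u : 'Hom(M, k^o) => u \o gact M (z.2^-1, z.1^-1)%g)%VF.
Proof.
by move=> a u v; apply/lfunP=> m; rewrite !(comp_lfunE, add_lfunE, scale_lfunE).
Qed.

(* M^* = Hom_k(M, k) with (h u g)(m) = u(g m h).                              *)
Definition dualm_act (M : gmod (setX_group G H)) (z : hT * gT) :
    'End('Hom(M, k^o)) :=
  linfun (fun u : 'Hom(M, k^o) => u \o gact M (z.2^-1, z.1^-1)%g)%VF.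

Lemma dualm_act1 M : dualm_act M 1%g = \1%VF.
Proof.
apply/lfunP=> u; rewrite (linfunE (@dual_lin M _)) /= !invg1.
by rewrite (gact1 M) comp_lfun1r lfunE.
Qed.

Lemma dualm_actM M : {in setX_group H G &, forall x y,
  dualm_act M (x * y)%g = (dualm_act M x \o dualm_act M y)%VF}.
Proof.
move=> [h g] [h' g'] /setXP[/= Hh Gg] /setXP[/= Hh' Gg'].
apply/lfunP=> u; rewrite comp_lfunE !(linfunE (@dual_lin M _)) /=.
rewrite -comp_lfunA -gactM ?inE /= ?groupV ?Hh ?Gg ?Hh' ?Gg' //.
by rewrite !invMg.
Qed.

Definition dualm (M : gmod (setX_group G H)) : gmod (setX_group H G) :=
  GMod (dualm_act1 M) (@dualm_actM M).

End Restriction.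

Section RegularBimodule.

Variables (gT : finGroupType).
Implicit Types (G L : {group gT}).

Lemma bireg_lin (z : gT * gT) :
  linear (fun a : grpalg k gT => gelt z.1 * a * gelt z.2^-1).
Proof.
by move=> s a b; rewrite mulrDr mulrDl -scalerAr -scalerAl.
Qed.

Definition bireg_act (z : gT * gT) : 'End(grpalg k gT) :=
  linfun (fun a : grpalg k gT => gelt z.1 * a * gelt z.2^-1).

Lemma bireg_act1 : bireg_act 1%g = \1%VF.
Proof.
apply/lfunP=> a; rewrite (linfunE (bireg_lin _)) /= invg1.
by rewrite [gelt 1]/(1 : grpalg k gT) mul1r mulr1 lfunE.
Qed.

Lemma bireg_actM G L : {in setX_group G L &, forall x y,
  bireg_act (x * y)%g = (bireg_act x \o bireg_act y)%VF}.
Proof.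
move=> [x y] [x' y'] _ _; apply/lfunP=> a.
rewrite comp_lfunE !(linfunE (bireg_lin _)) /= invMg !geltM.
by rewrite !mulrA.
Qed.

Definition biregm G L : gmod (setX_group G L) :=
  GMod bireg_act1 (@bireg_actM G L).

Lemma bim_stab G (e : grpalg k gT) L : {in setX_group G L, forall z,
  (gact (biregm G L) z @: (kspan k G * <[e]> * kspan k L)
     <= kspan k G * <[e]> * kspan k L)%VS}.
Proof.
move=> [x y] /setXP[/= Gx Ly]; apply/subvP=> _ /memv_imgP[u Uu ->].
rewrite (linfunE (bireg_lin _)) /=.
suff : gelt x * u * gelt y^-1%g \in
  (kspan k G * (kspan k G * <[e]> * kspan k L) * kspan k L)%VS.
  by rewrite !prodvA kspan_idem -!prodvA kspan_idem !prodvA.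
by rewrite !memv_mul ?mem_kspan ?groupV.
Qed.

(* The (kG,kL)-bimodule kG e kL.  It is kGe as soon as L <= G and L           *)
(* centralises e (bimod_space), which covers kGi, jkH, kGe_P, kGb and kG.     *)
Definition bimod G (e : grpalg k gT) L : gmod (setX_group G L) :=
  subm (@bim_stab G e L).

Lemma bimod_space G (e : grpalg k gT) L :
    L \subset G -> {in L, forall l, gelt l * e = e * gelt l} ->
  (kspan k G * <[e]> * kspan k L = kspan k G * <[e]>)%VS.
Proof.
move=> /subsetP sLG cLe; apply: subv_anti; apply/andP; split.
  rewrite /(kspan k L) big_distrr /=; apply/subv_sumP=> l Ll.
  rewrite -prodvA prodv_line -cLe // -prodv_line prodvA prodvSl //.
  by rewrite -[X in (_ <= X)%VS]kspan_idem prodvSr // -memvE mem_kspan ?sLG.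
by rewrite -{1}[(_ * <[e]>)%VS]prodv1 prodvSr // -memvE mem_kspan.
Qed.

End RegularBimodule.

Section Tensor.

(* A (x)_k B is realised as Hom_k(A^*, B), a (x) b being u |-> u(a) b.        *)
Definition tensv (A B : vectType k) : vectType k := 'Hom('Hom(A, k^o), B).

Definition pure_tens (A B : vectType k) (a : A) (b : B) : tensv A B :=
  linfun (fun u : 'Hom(A, k^o) => (u a : k) *: b).

Lemma precomp_lin (A : vectType k) (f : 'End(A)) :
  linear (fun u : 'Hom(A, k^o) => u \o f)%VF.
Proof.
by move=> a u v; apply/lfunP=> m; rewrite !(comp_lfunE, add_lfunE, scale_lfunE).
Qed.

Definition precomp (A : vectType k) (f : 'End(A)) : 'End('Hom(A, k^o)) :=
  linfun (fun u : 'Hom(A, k^o) => u \o f)%VF.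

Lemma tens_lin (A B : vectType k) (f : 'End(A)) (g : 'End(B)) :
  linear (fun t : tensv A B => g \o t \o precomp f)%VF.
Proof.
move=> a t t'; apply/lfunP=> m.
by rewrite !(comp_lfunE, add_lfunE, scale_lfunE) linearP.
Qed.

Definition tens_map (A B : vectType k) (f : 'End(A)) (g : 'End(B)) :
    'End(tensv A B) :=
  linfun (fun t : tensv A B => g \o t \o precomp f)%VF.

Lemma tens_mapE (A B : vectType k) (f : 'End(A)) (g : 'End(B)) t u :
  tens_map f g t u = g (t (u \o f)%VF).
Proof.
rewrite (linfunE (tens_lin f g)) 2!comp_lfunE.
by rewrite (linfunE (precomp_lin f)).
Qed.

Lemma pure_lin (A B : vectType k) (a : A) (b : B) :
  linear (fun u : 'Hom(A, k^o) => (u a : k) *: b).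
Proof. by move=> s u v; rewrite !lfun_simp scalerDl -scalerA. Qed.

Lemma tens_map_pure (A B : vectType k) (f : 'End(A)) (g : 'End(B)) a b :
  tens_map f g (pure_tens a b) = pure_tens (f a) (g b).
Proof.
apply/lfunP=> u; rewrite tens_mapE !(linfunE (pure_lin _ _)) linearZ.
by rewrite comp_lfunE.
Qed.

Lemma tens_map1 (A B : vectType k) :
  tens_map \1 \1 = \1%VF :> 'End(tensv A B).
Proof.
by apply/lfunP=> t; apply/lfunP=> u; rewrite tens_mapE comp_lfun1r !id_lfunE.
Qed.

Lemma tens_map_comp (A B : vectType k) (f f' : 'End(A)) (g g' : 'End(B)) :
  tens_map (f \o f')%VF (g \o g')%VF = (tens_map f g \o tens_map f' g')%VF.
Proof.
apply/lfunP=> t; apply/lfunP=> u.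
by rewrite [in RHS]comp_lfunE !tens_mapE comp_lfunE comp_lfunA.
Qed.

Definition dual_coord (A : vectType k) (n : 'I_(\dim {:A})) : 'Hom(A, k^o) :=
  linfun (coord (vbasis {:A}) n : A -> k^o).

Lemma dual_coordE (A : vectType k) n (a : A) :
  dual_coord n a = coord (vbasis {:A}) n a.
Proof. by rewrite (linfunE (f := coord _ n : A -> k^o)) //; exact: linearP. Qed.

Lemma pure_decomp (A B : vectType k) (t : tensv A B) :
  t = \sum_(n < \dim {:A}) pure_tens (vbasis {:A})`_n (t (dual_coord n)).
Proof.
apply/lfunP=> u; rewrite sum_lfunE.
have {1}-> : u = \sum_(n < \dim {:A}) u (vbasis {:A})`_n *: dual_coord n.
  apply/lfunP=> a; rewrite {1}(coord_vbasis (memvf a)) linear_sum sum_lfunE /=.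
  apply: eq_bigr => n _; rewrite linearZ scale_lfunE dual_coordE.
  exact: mulrC.
rewrite linear_sum; apply: eq_bigr => n _.
by rewrite (linfunE (pure_lin _ _)) linearZ.
Qed.

Definition tens_elim (A B W : vectType k) (f : 'Hom(A, 'Hom(B, W)))
    (t : tensv A B) : W :=
  \sum_(n < \dim {:A}) f (vbasis {:A})`_n (t (dual_coord n)).

Lemma tens_elim_lin (A B W : vectType k) (f : 'Hom(A, 'Hom(B, W))) :
  linear (tens_elim f).
Proof.
move=> s t t'; rewrite /tens_elim scaler_sumr -big_split.
by apply: eq_bigr => n _; rewrite !lfun_simp linearP.
Qed.

Lemma tens_elim_pure (A B W : vectType k) (f : 'Hom(A, 'Hom(B, W))) a b :
  tens_elim f (pure_tens a b) = f a b.
Proof.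
rewrite [in RHS](coord_vbasis (memvf a)) linear_sum sum_lfunE.
apply: eq_bigr => n _; rewrite (linfunE (pure_lin _ _)) dual_coordE.
by rewrite !linearZ scale_lfunE.
Qed.

Section Balanced.

Variables (lT : finGroupType) (L : {group lT}).
Variables (A B : vectType k) (rA : lT -> 'End(A)) (lB : lT -> 'End(B)).

Definition tens_rel : {vspace tensv A B} :=
  (\sum_(l in L) limg (tens_map (rA l) \1 - tens_map \1 (lB l)))%VS.

(* quotv tens_rel is A (x)_{kL} B: it has the universal property below.       *)
Lemma tens_universal (W : vectType k) (f : 'Hom(A, 'Hom(B, W))) :
    {in L, forall l a b, f (rA l a) b = f a (lB l b)} ->
  exists2 g : 'Hom(quotv tens_rel, W),
      forall a b, g (quot_proj tens_rel (pure_tens a b)) = f a b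
    & forall g' : 'Hom(quotv tens_rel, W),
        (forall a b, g' (quot_proj tens_rel (pure_tens a b)) = f a b) ->
        g' = g.
Proof.
move=> f_bal; pose G0 : 'Hom(tensv A B, W) := linfun (tens_elim f).
have G0E t : G0 t = tens_elim f t by rewrite (linfunE (tens_elim_lin f)).
have relK : (tens_rel <= lker G0)%VS.
  apply/subv_sumP=> l Ll; apply/subvP=> _ /memv_imgP[t _ ->].
  rewrite memv_ker [t]pure_decomp !linear_sum big1 //= => n _.
  rewrite !lfun_simp !tens_map_pure !id_lfunE linearB /= !G0E !tens_elim_pure.
  by rewrite f_bal // subrr.
have projK t : (G0 \o quot_lift tens_rel)%VF (quot_proj tens_rel t) = G0 t.
  rewrite comp_lfunE [quot_lift _ _]lfunE /= quot_projE linearB /=.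
  have /(subvP relK) := memv_proj tens_rel t.
  by rewrite memv_ker => /eqP->; rewrite subr0.
exists (G0 \o quot_lift tens_rel)%VF => [a b|g' g'E].
  by rewrite projK G0E tens_elim_pure.
apply/lfunP=> q; have -> : q = quot_proj tens_rel (quot_lift tens_rel q).
  by rewrite -[RHS]comp_lfunE quot_projK id_lfunE.
rewrite projK; move: (quot_lift _ q) => t; rewrite [t]pure_decomp !linear_sum.
by apply: eq_bigr => n _; rewrite /= g'E G0E tens_elim_pure.
Qed.

Lemma tens_rel_stab f g :
    {in L, forall l, (f \o rA l = rA l \o f)%VF} ->
    {in L, forall l, (g \o lB l = lB l \o g)%VF} ->
  (tens_map f g @: tens_rel <= tens_rel)%VS.
Proof.
move=> fA gB; rewrite limg_sum; apply/subv_sumP=> l Ll.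
apply: (sumv_sup l) => //; rewrite -!limg_comp.
rewrite comp_lfunDr comp_lfunNr -!tens_map_comp !comp_lfun1r fA // gB //.
rewrite -[X in tens_map _ X - _]comp_lfun1l -[X in _ - tens_map X _]comp_lfun1l.
by rewrite !tens_map_comp -comp_lfunNl -comp_lfunDl limg_comp limgS ?subvf.
Qed.

End Balanced.

Lemma lr_commute (gT1 gT2 : finGroupType) (G1 : {group gT1}) (G2 : {group gT2})
    (A : gmod (setX_group G1 G2)) x y : x \in G1 -> y \in G2 ->
  (gact A (x, 1%g) \o gact A (1%g, y) =
     gact A (1%g, y) \o gact A (x, 1%g))%VF.
Proof.
move=> Gx Gy; rewrite -!gactM ?inE /= ?Gx ?Gy ?group1 //.
by congr (gact A (_, _)); rewrite ?mul1g ?mulg1.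
Qed.

Variables (gT lT hT : finGroupType).
Variables (G : {group gT}) (L : {group lT}) (H : {group hT}).

(* The right action a l and the left action l b.                              *)
Definition ract (A : gmod (setX_group G L)) (l : lT) : 'End(A) :=
  gact A (1%g, l^-1)%g.

Definition lact (B : gmod (setX_group L H)) (l : lT) : 'End(B) :=
  gact B (l, 1%g).

Section TensorBimodule.

Variables (A : gmod (setX_group G L)) (B : gmod (setX_group L H)).

Definition tensb_act0 (z : gT * hT) : 'End(tensv A B) :=
  tens_map (gact A (z.1, 1%g)) (gact B (1%g, z.2)).

Lemma tensb_act01 : tensb_act0 1%g = \1%VF.
Proof. by rewrite /tensb_act0 (gact1 A) (gact1 B) tens_map1. Qed.

Lemma tensb_act0M : {in setX_group G H &, forall x y,
  tensb_act0 (x * y)%g = (tensb_act0 x \o tensb_act0 y)%VF}.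
Proof.
move=> [x y] [x' y'] /setXP[/= Gx Hy] /setXP[/= Gx' Hy'].
rewrite /tensb_act0 -tens_map_comp -!gactM ?inE /= ?group1 ?Gx ?Gx' //.
by congr tens_map; congr gact; congr pair; rewrite ?mulg1.
Qed.

Definition tensb0 : gmod (setX_group G H) := GMod tensb_act01 tensb_act0M.

Lemma tensb_stab : {in setX_group G H, forall z,
  (gact tensb0 z @: tens_rel L (ract A) (lact B)
     <= tens_rel L (ract A) (lact B))%VS}.
Proof.
move=> [x y] /setXP[/= Gx Hy]; apply: tens_rel_stab => l Ll.
  by rewrite lr_commute ?groupV.
by rewrite -lr_commute.
Qed.

Definition tensb : gmod (setX_group G H) := quom tensb_stab.

End TensorBimodule.

Section TensorModule.

Variables (A : gmod (setX_group G L)) (V : gmod L).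

Definition tensm_act0 (x : gT) : 'End(tensv A V) :=
  tens_map (gact A (x, 1%g)) \1.

Lemma tensm_act01 : tensm_act0 1%g = \1%VF.
Proof. by rewrite /tensm_act0 (gact1 A) tens_map1. Qed.

Lemma tensm_act0M : {in G &, forall x y,
  tensm_act0 (x * y)%g = (tensm_act0 x \o tensm_act0 y)%VF}.
Proof.
move=> x y Gx Gy.
rewrite /tensm_act0 -tens_map_comp -!gactM ?inE /= ?group1 ?Gx ?Gy //.
by rewrite comp_lfun1l; congr tens_map; congr gact; congr pair; rewrite mulg1.
Qed.

Definition tensm0 : gmod G := GMod tensm_act01 tensm_act0M.

Lemma tensm_stab : {in G, forall x,
  (gact tensm0 x @: tens_rel L (ract A) (gact V)
     <= tens_rel L (ract A) (gact V))%VS}.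
Proof.
move=> x Gx; apply: tens_rel_stab => l Ll.
  by rewrite lr_commute ?groupV.
by rewrite comp_lfun1l comp_lfun1r.
Qed.

Definition tensm : gmod G := quom tensm_stab.

End TensorModule.

End Tensor.

(* Ind_L^G(V) = kG (x)_{kL} V, for L <= G.                                    *)
Definition indm (gT : finGroupType) (G L : {group gT}) (V : gmod L) : gmod G :=
  tensm (bimod G 1 L) V.


Section VertexSource.

Variables (gT : finGroupType) (G : {group gT}).
Implicit Types (M : gmod G) (Q : {group gT}).

Definition rel_projective M Q : Prop :=
  exists V : gmod Q, dsummand M (indm G V).

Definition vertex M Q : Prop :=
  [/\ Q \subset G, rel_projective M Q
    & forall Q' : {group gT}, Q' \proper Q -> ~ rel_projective M Q'].

Definition source M Q (V : gmod Q) : Prop :=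
  indecomposable V /\ dsummand M (indm G V).

End VertexSource.

Section BrauerConstruction.

Variables (gT : finGroupType) (L : {group gT}) (A : gmod L).
Implicit Types (P Q : {group gT}).

Definition fixv P : {vspace A} := (\bigcap_(x in P) fixedSpace (gact A x))%VS.

(* The relative trace Tr_Q^P on Q-fixed points.                               *)
Definition reltr Q P : 'End(A) := \sum_(C in lcosets Q P) gact A (repr C).

Definition brauer_ker P : {vspace A} :=
  (\sum_(Q : {group gT} | Q \proper P) reltr Q P @: fixv Q)%VS.

Definition brauer_proj P : 'Hom(A, quotv (brauer_ker P)) :=
  quot_proj (brauer_ker P).

(* Br_P(A) = A^P / sum_(Q < P) Tr_Q^P(A^Q), inside the quotient of A.         *)
Definition brauer_quot P : {vspace quotv (brauer_ker P)} :=
  (brauer_proj P @: fixv P)%VS.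

End BrauerConstruction.

Section Slashed.

Variables (gT : finGroupType) (p : nat).
Implicit Types (G P Q L : {group gT}).

Lemma galg_act_comm G (M : gmod G) (e : grpalg k gT) x :
  x \in G -> gconj x e = e ->
  (gact M x \o galg_act M e = galg_act M e \o gact M x)%VF.
Proof.
move=> Gx xe; apply/lfunP=> m; rewrite !comp_lfunE !sum_lfunE linear_sum /=.
rewrite [RHS](reindex_inj (conjg_inj x^-1%g)) /=.
apply: eq_big => [z|z Gz]; first by rewrite groupJr ?groupV.
rewrite !scale_lfunE linearZ /= -!comp_lfunE -!gactM ?groupJr ?groupV //.
have -> : e (z ^ x^-1)%g = e z by rewrite -{1}xe gconjE conjgKV.
by rewrite conjgE invgK mulgA mulgKV.
Qed.

Lemma cutm_stab G (M : gmod G) P e L (sL : L \subset stabiliser G P e) :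
  let M' := resm (subset_trans sL (stabiliser_sub G P e)) M in
  {in L, forall x,
    (gact M' x @: limg (galg_act M e) <= limg (galg_act M e))%VS}.
Proof.
move=> M' x /(subsetP sL)/setIdP[/setIP[Gx _] /eqP xe].
by rewrite -limg_comp galg_act_comm // limg_comp limgS ?subvf.
Qed.

(* eM as a kL-module.                                                         *)
Definition cutm G (M : gmod G) P e L (sL : L \subset stabiliser G P e) :
    gmod L := subm (@cutm_stab G M P e L sL).

Record source_triple := SourceTriple {
  st_group : {group gT};
  st_idem : grpalg k gT;
  st_mod : gmod st_group
}.

Definition has_source_triple G b (N : gmod G) (t : source_triple) : Prop :=
  [/\ block_subpair p G b (st_group t) (st_idem t),
      vertex N (st_group t), source N (st_mod t)
    & dsummand N (tensm (bimod G (st_idem t) (st_group t)) (st_mod t))].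

Definition compatible G b (t1 t2 : source_triple) : Prop :=
  forall Q e x1 x2 (s1 : Q :^ x1^-1 \subset st_group t1)
      (s2 : Q :^ x2^-1 \subset st_group t2),
    block_subpair p G b Q e ->
    subpair_hom G Q e (st_group t1) (st_idem t1) x1 ->
    subpair_hom G Q e (st_group t2) (st_idem t2) x2 ->
  endopermutation (dsum (conjm s1 (st_mod t1)) (conjm s2 (st_mod t2))).

Definition fusion_stable G b (t : source_triple) : Prop :=
  endopermutation (st_mod t) /\ compatible G b t t.

Definition brauer_friendly G b (N : gmod G) : Prop :=
  exists n (S : 'I_n -> gmod G) (t : 'I_n -> source_triple),
  [/\ giso N (dsums [seq S i | i <- enum 'I_n]),
      forall i, [/\ indecomposable (S i), in_block b (S i),
                    has_source_triple b (S i) (t i) & fusion_stable G b (t i)]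
    & forall i j, compatible G b (t i) (t j)].

(* theta is the isomorphism Br_P(End_k(eM)) -> End_k(N) of C_G(P)-interior    *)
(* L-algebras; brauer_ker is an ideal, so the product of Br_P(End_k(eM)) is   *)
(* br(f) br(g) = br(f \o g).                                                  *)
Definition slashed G (M : gmod G) P e L (sL : L \subset stabiliser G P e)
    (N : gmod L) : Prop :=
  let eM := cutm M sL in
  let A := endm eM in
  [/\ (P * 'C_G(P) \subset L)%g, brauer_friendly e N
    & exists theta : 'Hom(quotv (brauer_ker A P), 'End(N)),
      let th (f : 'End(eM)) : 'End(N) := theta (brauer_proj A P f) in
      [/\ (brauer_quot A P :&: lker theta = 0)%VS,
          (theta @: brauer_quot A P = fullv)%VS,
          {in fixv A P &, forall f g, th (f \o g)%VF = (th f \o th g)%VF},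
          {in L, forall x, {in fixv A P, forall f,
              th (gact A x f) = gact (endm N) x (th f)}}
        & {in 'C_G(P), forall x, th (gact eM x) = gact N x}]].

End Slashed.

(* Finitely generated projective kGe-modules.                                 *)
Definition projective (gT : finGroupType) (G : {group gT}) (e : grpalg k gT)
    (M : gmod G) : Prop :=
  exists n, dsummand M (dsums (nseq n (lresm (bimod G e G)))).

Section Equivalences.

Variables (gT hT : finGroupType) (G : {group gT}) (H : {group hT}).
Variables (b : grpalg k gT) (c : grpalg k hT) (M : gmod (setX_group G H)).

Definition block_bimodule : Prop := in_block (galg_tens b (galg_opp c)) M.

Definition morita_equivalence : Prop :=
  block_bimodule /\
  exists N : gmod (setX_group H G),
    [/\ in_block (galg_tens c (galg_opp b)) N,
        giso (tensb M N) (bimod G b G) & giso (tensb N M) (bimod H c H)].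

Definition stable_equivalence_of_Morita_type : Prop :=
  [/\ block_bimodule,
      projective b (lresm M) /\ projective (galg_opp c) (rresm M),
      exists2 W : gmod (setX_group G G),
        projective (galg_tens b (galg_opp b)) W
        & giso (tensb M (dualm M)) (dsum (bimod G b G) W)
    & exists2 W : gmod (setX_group H H),
        projective (galg_tens c (galg_opp c)) W
        & giso (tensb (dualm M) M) (dsum (bimod H c H) W)].

End Equivalences.

End Modules.

Section Graph.

Variables (gT hT : finGroupType) (P : {group gT}).

Lemma graph_set (phi : {morphism P >-> hT}) :
  group_set [set (u, phi u) | u in P].
Proof.
apply/group_setP; split=> [|_ _ /imsetP[u Pu ->] /imsetP[v Pv ->]].
  by apply/imsetP; exists 1%g; rewrite ?morph1.
by apply/imsetP; exists (u * v)%g; rewrite ?groupM ?morphM.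
Qed.

Definition graph (phi : {morphism P >-> hT}) : {group gT * hT} :=
  Group (graph_set phi).

Lemma block_gconj (k : fieldType) (rT : finGroupType) (L : {group rT})
    (e : grpalg k rT) x : block L e -> x \in L -> gconj x e = e.
Proof.
case=> /memv_capP[_ /centvP cLe] _ _ _ Lx.
rewrite /gconj -cLe ?mem_kspan // -mulrA -geltM mulgV.
exact: mulr1.
Qed.

Lemma cent_sub_stabiliser (k : fieldType) (G : {group gT}) (H R : {group hT})
    (phi : {morphism P >-> hT}) (e : grpalg k gT) (f : grpalg k hT) :
    isom P R phi -> block 'C_G(P) e -> block 'C_H(R) f ->
  setX_group 'C_G(P) 'C_H(R) \subset
    stabiliser (setX_group G H) (graph phi) (galg_tens e (galg_opp f)).
Proof.
case/isomP=> _ phiP be bf; apply/subsetP=> -[x y] /setXP[Cx Cy].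
have [[Gx /centP cPx] [Hy /centP cRy]] := (setIP Cx, setIP Cy).
apply/setIdP; split.
  apply/setIP; split; first by rewrite inE /= Gx Hy.
  apply: (subsetP (cent_sub _)); apply/centP=> _ /imsetP[u Pu ->].
  congr pair; first exact: cPx.
  by apply: cRy; rewrite -phiP; apply: mem_morphim.
apply/eqP/ffunP=> -[z w]; rewrite gconjE !ffunE /=.
rewrite -gconjE (block_gconj be) //.
rewrite -conjVg -gconjE (block_gconj bf) //.
Qed.

End Graph.

(* Main.v *)
Require Import Defs.
From mathcomp Require Import all_boot all_order all_algebra all_fingroup.
From mathcomp Require Import all_solvable all_field.
From HB Require Import structures.
Require Import Defs.

Set Implicit Arguments.
Unset Strict Implicit.
Unset Printing Implicit Defensive.
Import GroupScope GRing.Theory.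
Local Open Scope ring_scope.

(* Write D for the diagonal of P, N for its stabiliser and C for C_G(P). The shape of the source
   bimodule gives psi in End_k(M)^D, supported on i (x) j, with Tr_D^(G x H)(psi) = 1. The slash
   map th : End_k(M)^D -> End_k(M_P) turns it into Tr_D^N(th psi) = 1, and D acts trivially on M_P;
   this makes M_P, and whatever is restricted or induced from it, a p-permutation module that is
   projective on either side.
   The stable equivalence enters through T = End_kH(M), a direct sum of kGb and a projective
   bimodule: as P <> 1, T^P is spanned by kC and proper traces, and an element of kCe that is a sum
   of proper traces vanishes. Hence kCe maps onto the endomorphisms of M_P over C_H(P). Let K be the
   image of N in G and e_K = Tr_P^K Tr_1^H(eps psi), eps = e (x) f. The kernel of kCe -> End_k(M_P)
   annihilates e_K modulo proper traces, and e_K acts as e on M_P; since kC is a symmetric algebra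
   this forces e_K = e modulo proper traces, so the kernel is zero and K = N_G(P, e).
   A bimodule L that is projective on both sides satisfies L (x) L^* = End_Y(L) by the norm map, so
   a Morita equivalence only requires End_Y(L) = kXb', which passes from M_P to induced modules with
   b' the sum of the X-conjugates of e. For X = N_G(P) this b' is the Brauer correspondent of b:
   a central idempotent of kN_G(P) killed by the Brauer map at P is zero. *)

(** * Relative traces *)

(** Everything is phrased in End_k(M) with G x H acting by conjugation: projectivity, being a
    summand of an induced or permutation module, and the norm map for tensor products with duals all
    become identities between relative traces, so no decomposition into indecomposable modules is
    needed. The obstacle is that M_P is known only through the slash map, which makes sense on
    D-fixed elements, kills proper traces and sees only the part cut out by eps; it does not commute
    with traces over H or G x H. One device bridges this gap: a sum over a set on which D acts
    equals, modulo proper traces, the sum over its fixed points ([orbit_sum_lower]), and these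
    belong to local subgroups. Faithfulness of kCe on M_P and surjectivity of N onto N_G(P, e) are
    entangled: the trace identity for e runs over N_G(P, e), while the slash map retains only the
    terms coming from K. Left and right are handled by one argument over an abstract product
    decomposition, applied twice with the factors exchanged; on the right the block appears as
    [galg_opp c], since H acts by m h^-1. *)

HB.instance Definition _ (k : fieldType) (V : vectType k) :=
  GRing.Zmodule_isPzRing.Build 'End(V) (@comp_lfunA _ _ _ _ _)
    (@comp_lfun1l _ _ _) (@comp_lfun1r _ _ _)
    (@comp_lfunDl _ _ _ _) (@comp_lfunDr _ _ _ _).

Section EndRing.

Variables (k : fieldType) (V : vectType k).
Implicit Types f g : 'End(V).

Lemma comp_lfun_mulE f g : (f \o g)%VF = f * g. Proof. by []. Qed.

Lemma mul_lfunE f g v : (f * g) v = f (g v). Proof. exact: comp_lfunE. Qed.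

Lemma one_lfunE v : (1 : 'End(V)) v = v. Proof. exact: id_lfunE. Qed.

Lemma lfun_scalerAl a f g : a *: (f * g) = (a *: f) * g.
Proof. exact: comp_lfunZl. Qed.

Lemma lfun_scalerAr a f g : a *: (f * g) = f * (a *: g).
Proof. exact: comp_lfunZr. Qed.

Lemma amul_lin f g : linear (fun s : 'End(V) => f * s * g).
Proof.
by move=> a s t; rewrite mulrDr mulrDl -lfun_scalerAr -lfun_scalerAl.
Qed.

(** Left and right multiplications are the cases where one factor is 1; packaged as a linear map on
    ['End(V)], they can be fed to [lower_map]. *)
Definition sandwich f g : 'End('End(V)) := linfun (fun s : 'End(V) => f * s * g).

Lemma sandwichE f g s : sandwich f g s = f * s * g.
Proof. exact: (linfunE (amul_lin f g)). Qed.

End EndRing.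

Section LcosetSum.

Variables (gT : finGroupType).
Implicit Types (P Q K : {group gT}).

Lemma lcoset_repr P Q (C : {set gT}) : Q \subset P -> C \in lcosets Q P ->
  repr C \in P /\ C = (repr C *: Q)%g.
Proof.
move=> sQP /lcosetsP[x Px ->].
have: repr (x *: Q)%g \in (x *: Q)%g by apply: mem_repr (lcoset_refl Q x).
move=> xr; split; last exact/esym/lcoset_eqP.
by case/lcosetP: xr => q Qq ->; rewrite groupM // (subsetP sQP).
Qed.

(** [trace] is written with the arbitrary representatives [repr C], while proofs need transversals
    adapted to the situation. The last two hypotheses say that [r] meets each coset exactly once. *)
Lemma lcosets_reindex (V : zmodType) P Q (I : finType) (A : pred I) (r : I -> gT)
    (F : gT -> V) : Q \subset P ->
    {in P & Q, forall x q, F (x * q)%g = F x} ->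
    {in A, forall i, r i \in P} ->
    {in A &, forall i j, r i \in (r j *: Q)%g -> i = j} ->
    {in P, forall x, exists2 i, A i & x \in (r i *: Q)%g} ->
  \sum_(C in lcosets Q P) F (repr C) = \sum_(i | A i) F (r i).
Proof.
move=> sQP FQ rP r_inj r_sur.
have -> : lcosets Q P = [set (r i *: Q)%g | i in A].
  apply/setP=> C; apply/lcosetsP/imsetP=> [[x Px ->]|[i Ai ->]].
    have [i Ai xi] := r_sur x Px; exists i => //; exact/lcoset_eqP.
  by exists (r i); rewrite ?rP.
rewrite big_imset /=; last first.
  by move=> i j Ai Aj /lcoset_eqP/r_inj->.
apply: eq_bigr => i Ai.
have: repr (r i *: Q)%g \in (r i *: Q)%g by apply: mem_repr (lcoset_refl Q _).
by case/lcosetP=> q Qq ->; rewrite FQ ?rP.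
Qed.

End LcosetSum.

Section Trace.

Variables (k : fieldType) (V : vectType k).

(** Multiplicativity is asked only inside [P], because [gact] is arbitrary outside the acting
    group. *)
Definition lin_action (gT : finGroupType) (P : {group gT}) (act : gT -> 'End(V)) : Prop :=
  act 1%g = 1 /\ {in P &, forall x y, act (x * y)%g = act x * act y}.

Variable gT : finGroupType.
Implicit Types (P Q K : {group gT}) (act : gT -> 'End(V)) (U W : {vspace V}).

Definition trace act Q P : 'End(V) := \sum_(C in lcosets Q P) act (repr C).

Definition fixed act U Q : {vspace V} :=
  (U :&: \bigcap_(x in Q) fixedSpace (act x))%VS.

(** The proper relative traces, taken of fixed points in [U] only. [U] will be all of End_k(M), the
    subalgebra End_kH(M) or a group algebra, and the resulting subspaces are compared with one
    another. *)
Definition lower act U P : {vspace V} :=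
  (\sum_(Q : {group gT} | Q \proper P) trace act Q P @: fixed act U Q)%VS.

Lemma fixedP act U Q v :
  reflect (v \in U /\ {in Q, forall x, act x v = v}) (v \in fixed act U Q).
Proof.
rewrite memv_cap; apply: (iffP andP) => [[Uv /subv_bigcapP Qv]|[Uv Qv]].
  split=> // x Qx; apply/fixedSpaceP; rewrite memvE; exact: Qv.
split=> //; apply/subv_bigcapP=> x Qx; rewrite -memvE; apply/fixedSpaceP.
exact: Qv.
Qed.

Lemma traceE act Q P v :
  trace act Q P v = \sum_(C in lcosets Q P) act (repr C) v.
Proof. exact: sum_lfunE. Qed.

Lemma lin_actionS P Q act : Q \subset P -> lin_action P act -> lin_action Q act.
Proof.
move=> /subsetP sQP [a1 aM]; split=> // x y Qx Qy; apply: aM; exact: sQP.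
Qed.

Lemma lin_actM P act x y v : lin_action P act -> x \in P -> y \in P ->
  act (x * y)%g v = act x (act y v).
Proof. by case=> _ aM Px Py; rewrite aM // mul_lfunE. Qed.

Lemma trace_reindex act Q P (I : finType) (A : pred I) (r : I -> gT) v :
    lin_action P act -> Q \subset P ->
    {in Q, forall x, act x v = v} ->
    {in A, forall i, r i \in P} ->
    {in A &, forall i j, r i \in (r j *: Q)%g -> i = j} ->
    {in P, forall x, exists2 i, A i & x \in (r i *: Q)%g} ->
  trace act Q P v = \sum_(i | A i) act (r i) v.
Proof.
move=> aP sQP Qv rP r_inj r_sur; rewrite traceE.
apply: (@lcosets_reindex _ _ _ _ _ _ _ (fun x => act x v)) => // x q Px Qq.
by rewrite (lin_actM _ aP) // ?(subsetP sQP) // Qv.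
Qed.

Lemma lcosets_act act Q P x v : lin_action P act -> Q \subset P ->
  {in Q, forall y, act y v = v} -> x \in P -> act (repr (x *: Q)%g) v = act x v.
Proof.
move=> aP sQP Qv Px.
have: repr (x *: Q)%g \in (x *: Q)%g by apply: mem_repr (lcoset_refl Q _).
by case/lcosetP=> q Qq ->; rewrite (lin_actM _ aP) // ?(subsetP sQP) // Qv.
Qed.

Lemma trace_trans act Q K P v : lin_action P act ->
    Q \subset K -> K \subset P -> {in Q, forall x, act x v = v} ->
  trace act Q P v = trace act K P (trace act Q K v).
Proof.
move=> aP sQK sKP Qv; have sQP := subset_trans sQK sKP.
(* Products of representatives of [K] in [P] and of [Q] in [K] form a transversal of [Q] in [P]. *)
rewrite (@trace_reindex _ _ _ _ [pred B | (B.1 \in lcosets K P) && (B.2 \in lcosets Q K)]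
   (fun B : {set gT} * {set gT} => repr B.1 * repr B.2)%g) //.
- rewrite traceE (eq_bigr (fun C => \sum_(C' in lcosets Q K)
      act (repr C * repr C')%g v)) => [|C CK]; first by rewrite pair_big.
  have [PC _] := lcoset_repr sKP CK.
  rewrite traceE linear_sum; apply: eq_bigr => C' CQ.
  have [KC _] := lcoset_repr sQK CQ.
  by rewrite (lin_actM _ aP) // (subsetP sKP).
- move=> [B C] /andP[/= BK CQ]; have [PB _] := lcoset_repr sKP BK.
  by have [KC _] := lcoset_repr sQK CQ; rewrite groupM // (subsetP sKP).
- move=> [B C] [B' C'] /andP[/= BK CQ] /andP[/= BK' CQ'].
  have [PB eB] := lcoset_repr sKP BK; have [KC eC] := lcoset_repr sQK CQ.
  have [PB' eB'] := lcoset_repr sKP BK'; have [KC' eC'] := lcoset_repr sQK CQ'.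
  case/lcosetP=> q Qq e.
  have eBB : B = B'.
    rewrite eB eB'; apply/lcoset_eqP/lcosetP.
    exists (repr C' * q * (repr C)^-1)%g; last by rewrite !mulgA -e mulgK.
    by rewrite !groupM ?groupV // (subsetP sQK).
  congr pair => //; rewrite eC eC'; apply/lcoset_eqP/lcosetP; exists q => //.
  by apply: (mulgI (repr B)); rewrite e eBB mulgA.
move=> x Px; have xK : (x *: K)%g \in lcosets K P by apply/lcosetsP; exists x.
have [PB eB] := lcoset_repr sKP xK; set B := (x *: K)%g in xK PB eB *.
have : x \in B by apply: lcoset_refl.
rewrite eB => /lcosetP[y Ky ex].
have yQ : (y *: Q)%g \in lcosets Q K by apply/lcosetsP; exists y.
exists (B, (y *: Q)%g); first by rewrite /= xK yQ.
have [KC eC] := lcoset_repr sQK yQ.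
have : y \in (y *: Q)%g by apply: lcoset_refl.
rewrite /= {1}eC => /lcosetP[q Qq ey]; apply/lcosetP; exists q => //.
by rewrite ex {1}ey mulgA.
Qed.

Lemma trace_fixed act Q P v x : lin_action P act -> Q \subset P ->
  {in Q, forall x, act x v = v} -> x \in P ->
  act x (trace act Q P v) = trace act Q P v.
Proof.
move=> aP sQP Qv Px; rewrite traceE linear_sum.
rewrite -traceE (@trace_reindex act Q P {set gT} (mem (lcosets Q P)) (fun C => x * repr C)%g) //.
- apply: eq_bigr => C CQ; have [PC _] := lcoset_repr sQP CQ.
  by rewrite (lin_actM _ aP).
- by move=> C CQ; have [PC _] := lcoset_repr sQP CQ; rewrite groupM.
- move=> C C' CQ CQ'; have [PC eC] := lcoset_repr sQP CQ.
  have [PC' eC'] := lcoset_repr sQP CQ'.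
  rewrite mem_lcoset invMg mulgA mulgKV -mem_lcoset => cc.
  by rewrite eC eC'; apply/lcoset_eqP.
move=> y Py; have yQ : ((x^-1 * y) *: Q)%g \in lcosets Q P.
  by apply/lcosetsP; exists (x^-1 * y)%g; rewrite ?groupM ?groupV.
exists ((x^-1 * y) *: Q)%g => //; have [_ eC] := lcoset_repr sQP yQ.
rewrite mem_lcoset invMg -mulgA -mem_lcoset -eC; exact: lcoset_refl.
Qed.

Lemma mem_lower act U P Q v : Q \proper P -> v \in U ->
  {in Q, forall x, act x v = v} -> trace act Q P v \in lower act U P.
Proof.
move=> pQ Uv Qv; rewrite memvE; apply: (sumv_sup Q) => //; rewrite -memvE.
by apply: memv_img; apply/fixedP.
Qed.

(** Induction principle for proper traces. The property proved must be stable under linear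
    combinations, so it is given as the preimage of a subspace [W] under a linear [f], which is
    often just the identity. *)
Lemma lower_ind act U P (V' : vectType k) (f : 'Hom(V, V')) (W : {vspace V'}) v :
    (forall (Q : {group gT}) u, Q \proper P -> u \in U ->
       {in Q, forall x, act x u = u} -> f (trace act Q P u) \in W) ->
  v \in lower act U P -> f v \in W.
Proof.
move=> gen lv; suff: (lower act U P <= f @^-1: W)%VS.
  by move/subvP/(_ v lv); rewrite -memv_preim.
apply/subv_sumP=> Q pQ; apply/subvP=> _ /memv_imgP[u /fixedP[Uu Qu] ->].
by rewrite -memv_preim gen.
Qed.

(** A sum over a [P]-set splits into orbits, and an equivariant [F] sums over the orbit of t to the
    trace of F t from the stabiliser of t. The induction on the size of [A] removes one orbit at a
    time. *)
Lemma orbit_sum_mem act P (X : finType) (a : gT -> X -> X) (A : pred X)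
    (F : X -> V) W :
    lin_action P act -> a 1%g =1 id ->
    {in P &, forall x y t, a (x * y)%g t = a x (a y t)} ->
    {in P, forall x t, A t -> A (a x t)} ->
    {in P, forall x t, A t -> F (a x t) = act x (F t)} ->
    (forall t (Q : {group gT}), A t -> Q :=: [set x in P | a x t == t] ->
       trace act Q P (F t) \in W) ->
  \sum_(t | A t) F t \in W.
Proof.
move=> aP a1 aM; have [n] := ubnP #|A|; elim: n A => // n IHn A ltAn aA aF stW.
have [t At | A0] := pickP A; last by rewrite big_pred0 // mem0v.
pose O := [set a x t | x in P].
have OA s : s \in O -> A s by case/imsetP=> x Px ->; apply: aA.
have Oa x s : x \in P -> (a x s \in O) = (s \in O).
  move=> Px; apply/imsetP/imsetP=> [[y Py e]|[y Py ->]]; last first.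
    by exists (x * y)%g; rewrite ?groupM ?aM.
  exists (x^-1 * y)%g; rewrite ?groupM ?groupV // aM ?groupV //.
  by rewrite -e -aM ?groupV // mulVg a1.
rewrite (bigID (mem O)) /= memvD //; last first.
  apply: IHn => [|x Px s /andP[As Os]|x Px s /andP[As _]|s Q /andP[As _]].
  - rewrite -ltnS (leq_trans _ ltAn) // ltnS; apply: proper_card.
    apply/properP; split; first by apply/subsetP=> s /andP[].
    exists t; first exact: At.
    rewrite unfold_in /= negb_and negbK; apply/orP; right.
    by apply/imsetP; exists 1%g; rewrite ?a1.
  - by rewrite aA //= Oa.
  - exact: aF.
  exact: stW.
have St_group : group_set [set x in P | a x t == t].
  apply/group_setP; split=> [|x y]; first by rewrite inE group1 a1 /=.
  rewrite !inE => /andP[Px /eqP ex] /andP[Py /eqP ey].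
  by rewrite groupM // aM // ey ex /=.
pose St := Group St_group.
have sSt : St \subset P by apply/subsetP=> x /setIdP[].
rewrite (eq_bigl (mem O)) => [|s]; last first.
  by apply/andP/idP=> [[]|Os] //; split; first exact: OA.
suff -> : \sum_(s in O) F s = trace act St P (F t) by apply: stW.
have OE : O = [set a (repr C) t | C in lcosets St P].
  apply/setP=> s; apply/imsetP/imsetP=> [[x Px ->]|[C CS ->]]; last first.
    by have [PC _] := lcoset_repr sSt CS; exists (repr C).
  have xS : (x *: St)%g \in lcosets St P by apply/lcosetsP; exists x.
  exists (x *: St)%g => //; have [PC eC] := lcoset_repr sSt xS.
  have : x \in (x *: St)%g by apply: lcoset_refl.
  rewrite {1}eC => /lcosetP[y /setIdP[Py /eqP ey] {1}->].
  by rewrite aM // ey.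
rewrite OE big_imset /= => [|C C' CS CS' e]; last first.
  have [PC eC] := lcoset_repr sSt CS; have [PC' eC'] := lcoset_repr sSt CS'.
  rewrite eC eC'; apply/lcoset_eqP; rewrite mem_lcoset inE groupM ?groupV //=.
  by rewrite aM ?groupV // e -aM ?groupV // mulVg a1.
rewrite traceE; apply: eq_bigr => C CS; have [PC _] := lcoset_repr sSt CS.
exact: aF.
Qed.

(** An orbit that is not a fixed point contributes a trace from a proper stabiliser, hence only
    fixed points survive. No assumption on the characteristic enters; it matters only where the
    proper traces have to vanish. *)
Lemma orbit_sum_lower act P (X : finType) (a : gT -> X -> X) (A : pred X)
    (F : X -> V) U :
    lin_action P act -> a 1%g =1 id ->
    {in P &, forall x y t, a (x * y)%g t = a x (a y t)} ->
    {in P, forall x t, A t -> A (a x t)} ->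
    {in P, forall x t, A t -> F (a x t) = act x (F t)} ->
    (forall t, A t -> F t \in U) ->
  \sum_(t | A t) F t
     - \sum_(t | A t && [forall x in P, a x t == t]) F t \in lower act U P.
Proof.
move=> aP a1 aM aA aF UF.
rewrite (bigID (fun t => [forall x in P, a x t == t])) /= addrAC subrr add0r.
apply: (orbit_sum_mem aP a1 aM) => [x Px t /andP[At nt]|x Px t /andP[At _]|].
- rewrite aA //=; apply: contra nt => /forall_inP nt; apply/forall_inP=> y Py.
  have := nt (x * y * x^-1)%g; rewrite !groupM ?groupV // => /(_ isT).
  rewrite -aM ?groupM ?groupV // mulgKV aM //.
  move/eqP/(congr1 (a x^-1%g)).
  by rewrite -!aM ?groupM ?groupV // mulVg mul1g a1 => ->.
- exact: aF.
move=> t Q /andP[At nt] eQ; apply: mem_lower; last 2 first.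
- exact: UF.
- by move=> x; rewrite eQ => /setIdP[Px /eqP e]; rewrite -aF // e.
rewrite properE eQ; apply/andP; split; first by apply/subsetP=> x /setIdP[].
apply: contra nt => /subsetP sP; apply/forall_inP=> x /sP.
by case/setIdP.
Qed.

End Trace.

Lemma trace_id (k : fieldType) (V : vectType k) (gT : finGroupType) (D : {group gT})
    (act : gT -> 'End(V)) v : {in D, forall d, act d v = v} -> trace act D D v = v.
Proof.
move=> Dv; rewrite traceE; have -> : lcosets D D = [set gval D].
  apply/setP=> C; rewrite inE; apply/lcosetsP/eqP=> [[x Dx ->]|->].
    by rewrite lcoset_id.
  by exists 1%g; rewrite ?group1 // lcoset1.
by rewrite big_set1 Dv //; exact: mem_repr (group1 D).
Qed.

Lemma trace_map (k : fieldType) (V V' : vectType k) (gT : finGroupType)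
    (Q P : {group gT}) (act : gT -> 'End(V)) (act' : gT -> 'End(V'))
    (f : 'Hom(V, V')) v : Q \subset P ->
    {in P, forall x, f (act x v) = act' x (f v)} ->
  f (trace act Q P v) = trace act' Q P (f v).
Proof.
move=> sQP fa; rewrite !traceE linear_sum; apply: eq_bigr => C CQ.
rewrite /= fa //; by case: (lcoset_repr sQP CQ).
Qed.

Lemma lower_map (k : fieldType) (V V' : vectType k) (gT : finGroupType)
    (P : {group gT}) (act : gT -> 'End(V)) (act' : gT -> 'End(V'))
    (U : {vspace V}) (U' : {vspace V'}) (f : 'Hom(V, V')) v :
    {in P, forall x, {in U, forall u, f (act x u) = act' x (f u)}} ->
    {in U, forall u, f u \in U'} ->
  v \in lower act U P -> f v \in lower act' U' P.
Proof.
move=> fa fU; apply: lower_ind => Q u pQ Uu Qu; have sQP := proper_sub pQ.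
rewrite (trace_map (act' := act')) // => [|x Px]; last exact: fa.
by apply: mem_lower (fU u Uu) _ => // x Qx; rewrite -fa ?Qu // (subsetP sQP).
Qed.

(** * Group algebras, Brauer maps and blocks *)

Section GroupAlgebra.

Variables (k : fieldType) (gT : finGroupType).
Implicit Types (a b c e : grpalg k gT) (x y z u : gT) (G P Q L : {group gT}).

Lemma amulrE a b : amulr a b = b * a. Proof. by rewrite lfunE. Qed.

Lemma amullE a b : amull a b = a * b. Proof. by rewrite lfunE. Qed.

Lemma gelt1E : gelt 1%g = 1 :> grpalg k gT. Proof. by []. Qed.

Lemma geltE x y : (gelt x : grpalg k gT) y = (y == x)%:R.
Proof. by rewrite ffunE. Qed.

Lemma grpalg_sum a : a = \sum_x (a x : k) *: gelt x.
Proof.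
apply/ffunP=> y; rewrite sum_ffunE (bigD1 y) //= big1 => [|x ne].
  by rewrite addr0 !ffunE eqxx /= [_ *: _]mulr1.
by rewrite !ffunE eq_sym (negPf ne) scaler0.
Qed.

Lemma kspanP (A : {set gT}) a :
  reflect (forall x, x \notin A -> a x = 0) (a \in kspan k A).
Proof.
apply: (iffP idP) => [/memv_sumP[f fA ->] y Ay | a0].
  rewrite sum_ffunE big1 // => x Ax; have /vlineP[s ->] := fA x Ax.
  rewrite !ffunE; case: eqP => [e|_]; last by rewrite scaler0.
  by rewrite e Ax in Ay.
rewrite (grpalg_sum a); apply: memv_suml => x _.
have [Ax|/a0->] := boolP (x \in A); last by rewrite scale0r mem0v.
by rewrite memvZ ?mem_kspan.
Qed.

Lemma kspan_sum (A : {set gT}) a : a \in kspan k A ->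
  a = \sum_(x in A) (a x : k) *: gelt x.
Proof.
move=> /kspanP Aa; rewrite {1}(grpalg_sum a) (bigID (mem A)) /=.
by rewrite [X in _ + X]big1 ?addr0 // => x /Aa->; rewrite scale0r.
Qed.

Lemma kspanS (A B : {set gT}) : A \subset B -> (kspan k A <= kspan k B)%VS.
Proof.
move=> /subsetP sAB; apply/subvP=> a /kspanP Aa; apply/kspanP=> x Bx.
by apply: Aa; apply: contra Bx; apply: sAB.
Qed.

Lemma kspanM G a b : a \in kspan k G -> b \in kspan k G -> a * b \in kspan k G.
Proof. by move=> Ga Gb; rewrite -kspan_idem memv_mul. Qed.

Lemma kspan1 G : 1 \in kspan k G. Proof. exact: (mem_kspan k (group1 G)). Qed.

Lemma gconj_lin x : linear (fun a : grpalg k gT => gconj x a).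
Proof. by move=> s a b; rewrite /gconj mulrDr mulrDl -scalerAr -scalerAl. Qed.

Definition gconjl x : 'End(grpalg k gT) := linfun (fun a => gconj x a).

Lemma gconjlE x a : gconjl x a = gconj x a.
Proof. exact: (linfunE (gconj_lin x)). Qed.

Lemma gconj1 a : gconj 1 a = a.
Proof. by apply/ffunP=> z; rewrite gconjE conjg1. Qed.

Lemma gconjM x y a : gconj (x * y) a = gconj x (gconj y a).
Proof. by apply/ffunP=> z; rewrite !gconjE conjgM. Qed.

Lemma gconjK x a : gconj x^-1 (gconj x a) = a.
Proof. by rewrite -gconjM mulVg gconj1. Qed.

Lemma gconjVK x a : gconj x (gconj x^-1 a) = a.
Proof. by rewrite -gconjM mulgV gconj1. Qed.

Lemma gelt_gconj x a : gelt x * a = gconj x a * gelt x.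
Proof. by rewrite /gconj -mulrA -geltM mulVg gelt1E mulr1. Qed.

Lemma gconj_mul x a b : gconj x (a * b) = gconj x a * gconj x b.
Proof. by rewrite {1}/gconj mulrA gelt_gconj [gconj x b]/gconj !mulrA. Qed.

Lemma gconj_one x : gconj x 1 = 1 :> grpalg k gT.
Proof. by rewrite /gconj mulr1 -geltM mulgV. Qed.

Lemma gconj_gelt x y : gconj x (gelt y) = gelt (y ^ x^-1)%g :> grpalg k gT.
Proof. by rewrite /gconj -!geltM conjgE invgK mulgA. Qed.

Lemma gconjl_action P : lin_action P gconjl.
Proof.
split=> [|x y _ _]; apply/lfunP=> a; first by rewrite gconjlE gconj1 one_lfunE.
by rewrite mul_lfunE !gconjlE gconjM.
Qed.

Lemma mem_kspan_gconj G x a : x \in 'N(G) -> a \in kspan k G ->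
  gconj x a \in kspan k G.
Proof.
move=> Nx /kspanP Ga; apply/kspanP=> y Gy; rewrite gconjE Ga //.
by rewrite memJ_norm.
Qed.

Lemma commute_gconj x a : gelt x * a = a * gelt x <-> gconj x a = a.
Proof.
split=> [e|]; last by rewrite gelt_gconj => ->.
by rewrite /gconj e -mulrA -geltM mulgV [gelt 1]gelt1E mulr1.
Qed.

Lemma cent_kspanP L a :
  reflect {in L, forall x, gconj x a = a} (a \in 'C(kspan k L))%VS.
Proof.
apply: (iffP centvP) => [cLa x Lx|cLa b Lb].
  by apply/commute_gconj; rewrite cLa ?mem_kspan.
rewrite (kspan_sum Lb) mulr_sumr mulr_suml; apply: eq_bigr => x Lx.
by rewrite -scalerAl -scalerAr (commute_gconj x a).2 ?cLa.
Qed.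

Lemma fix_kspanP G L a :
  reflect (a \in kspan k G /\ {in L, forall x, gconj x a = a})
    (a \in 'C_(kspan k G)(kspan k L))%VS.
Proof.
by apply: (iffP memv_capP) => -[Ga] /cent_kspanP.
Qed.

Lemma center_commute G a b : a \in 'Z(kspan k G)%VS -> b \in kspan k G ->
  a * b = b * a.
Proof. by move=> /memv_capP[_ /centvP cGa] Gb; rewrite cGa. Qed.

Definition galg_opp_lin : linear (@galg_opp k gT).
Proof. by move=> s a b; apply/ffunP=> x; rewrite !ffunE. Qed.

Lemma galg_oppK : involutive (@galg_opp k gT).
Proof. by move=> a; apply/ffunP=> x; rewrite !ffunE invgK. Qed.

Lemma galg_oppM a b : galg_opp (a * b) = galg_opp b * galg_opp a.
Proof.
apply/ffunP=> z; rewrite !ffunE [RHS](reindex_inj (mulgI z)) /=.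
by apply: eq_bigr => x _; rewrite !ffunE !invMg !invgK !mulKg mulrC.
Qed.

Lemma galg_opp_gelt x : galg_opp (gelt x) = gelt x^-1 :> grpalg k gT.
Proof. by apply/ffunP=> y; rewrite !ffunE (inv_eq invgK). Qed.

Lemma galg_opp_gconj x a : galg_opp (gconj x a) = gconj x (galg_opp a).
Proof. by apply/ffunP=> y; rewrite ffunE !gconjE ffunE conjVg. Qed.

Lemma mem_galg_opp G a : (galg_opp a \in kspan k G) = (a \in kspan k G).
Proof.
suff i c : c \in kspan k G -> galg_opp c \in kspan k G.
  by apply/idP/idP=> /i //; rewrite galg_oppK.
by move=> /kspanP Gc; apply/kspanP=> x Gx; rewrite ffunE Gc ?groupV.
Qed.

Section Brauer.

Variables (p : nat) (charkp : p \in [pchar k]).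

Lemma brauer_map_lin P : linear (@brauer_map k gT P).
Proof.
by move=> s a b; apply/ffunP=> x; rewrite !ffunE; case: ifP => // _; rewrite scaler0 add0r.
Qed.

Lemma brauer_mapB P a b :
  brauer_map P (a - b) = brauer_map P a - brauer_map P b.
Proof.
by rewrite -!(linfunE (brauer_map_lin P) (_ - _)) linearB /= !(linfunE (brauer_map_lin P)).
Qed.

Lemma brauer_map_kspan P a : brauer_map P a \in kspan k 'C(P)%g.
Proof. by apply/kspanP=> x /negPf Cx; rewrite ffunE Cx. Qed.

Lemma brauer_map_kspanI P G a : a \in kspan k G -> brauer_map P a \in kspan k 'C_G(P)%g.
Proof.
move=> /kspanP Ga; apply/kspanP=> x; rewrite inE negb_and ffunE.
by case: ifP => // Cx; rewrite orbF => /Ga.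
Qed.

Lemma brauer_map_id P a : a \in kspan k 'C(P)%g -> brauer_map P a = a.
Proof.
by move=> /kspanP Ca; apply/ffunP=> x; rewrite ffunE; case: ifPn => // /Ca->.
Qed.

(** This is the orbit sum for [P] acting on [G] by conjugation: the fixed points form the
    centraliser of [P], where the coefficients of [a] vanish by hypothesis. *)
Lemma brauer_map_lower P G a : P \subset G -> a \in kspan k G ->
    {in P, forall x, gconj x a = a} -> brauer_map P a = 0 ->
  a \in lower gconjl (kspan k G) P.
Proof.
move=> sPG Ga Pa br0.
have := @orbit_sum_lower k _ gT gconjl P gT (fun u x => x ^ u^-1)%g (mem G)
  (fun x => (a x : k) *: gelt x) (kspan k G) (gconjl_action P).
have -> : \sum_(x in G) (a x : k) *: gelt x = a by rewrite -kspan_sum.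
rewrite [X in a - X]big1 => [|x /andP[Gx /forall_inP xP]]; last first.
  suff -> : a x = 0 by rewrite scale0r.
  have <- : brauer_map P a x = a x.
    rewrite ffunE; case: ifPn => // /negP[]; apply/centP=> u Pu.
    by have /eqP := xP u^-1%g (groupVr Pu); rewrite invgK => /conjg_fixP/commgP.
  by rewrite br0 ffunE.
rewrite subr0; apply.
- by move=> x; rewrite invg1 conjg1.
- by move=> x y _ _ t; rewrite invMg conjgM.
- by move=> x Px t Gt; rewrite inE /= groupJr // groupV (subsetP sPG).
- move=> x Px t _; rewrite linearZ /= gconjlE gconj_gelt; congr (_ *: _).
  by rewrite -{1}(Pa x Px) gconjE conjgKV.
- by move=> x Gx; rewrite memvZ ?mem_kspan.
Qed.

Lemma index_pchar_eq0 P Q : p.-group P -> Q \proper P ->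
  (#|lcosets Q P|)%:R = 0 :> k.
Proof.
move=> pP /andP[sQP nPQ]; apply/eqP; rewrite card_lcosets -(dvdn_pcharf charkp).
have := pnat_dvd (dvdn_indexg P Q) pP; case/p_natP=> [n en].
rewrite en; case: n en => [|n] en; last by rewrite expnS dvdn_mulr.
by move: nPQ; rewrite -indexg_eq1 en.
Qed.

(** At an element z centralising [P] every conjugate of [a] has the same coefficient, so the trace
    has coefficient |P : Q| a(z), which is 0 in characteristic p. *)
Lemma brauer_map_trace P Q a : p.-group P -> Q \proper P ->
  {in Q, forall x, gconj x a = a} -> brauer_map P (trace gconjl Q P a) = 0.
Proof.
move=> pP pQ Qa; apply/ffunP=> z; rewrite !ffunE; case: ifP => // /centP Cz.
have sQP := proper_sub pQ.
rewrite traceE sum_ffunE (eq_bigr (fun=> a z)) => [|C CQ].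
  by rewrite sumr_const -mulr_natl (index_pchar_eq0 pP pQ) mul0r.
have [PC _] := lcoset_repr sQP CQ.
by rewrite gconjlE gconjE /conjg Cz ?mulgA ?mulVg ?mul1g.
Qed.

Lemma brauer_map_lower0 P U a : p.-group P -> a \in lower gconjl U P ->
  brauer_map P a = 0.
Proof.
move=> pP la; rewrite -(linfunE (brauer_map_lin P)).
apply/eqP; rewrite -memv0; apply: lower_ind la => Q u pQ _ Qu.
rewrite (linfunE (brauer_map_lin P)) brauer_map_trace ?mem0v // => x Qx.
by rewrite -gconjlE Qu.
Qed.

Lemma brauer_mapMl P a b : a \in kspan k 'C(P)%g ->
  brauer_map P (a * b) = a * brauer_map P b.
Proof.
move=> Ca; apply/ffunP=> z; rewrite ffunE !gmulE; case: ifP => Cz.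
  apply: eq_bigr => x _; have [Cx|/(kspanP _ _ Ca)->] := boolP (x \in 'C(P)%g).
    by rewrite ffunE groupM ?groupV.
  by rewrite !mul0r.
rewrite big1 // => x _; have [Cx|/(kspanP _ _ Ca)->] := boolP (x \in 'C(P)%g).
  by rewrite ffunE groupMl ?groupV // Cz mulr0.
by rewrite mul0r.
Qed.

Lemma brauer_map_gconj P x a : x \in 'N(P)%g ->
  brauer_map P (gconj x a) = gconj x (brauer_map P a).
Proof.
move=> Nx; apply/ffunP=> z; rewrite gconjE ffunE [in RHS]ffunE gconjE.
by rewrite (memJ_norm _ (subsetP (norms_cent (subxx _)) x Nx)).
Qed.

(** If the left factor is supported on C(P) the product rule is immediate. In general a - br(a) is a
    sum of proper traces, multiplication by the fixed element [b] preserves such sums, and the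
    Brauer map kills them. *)
Lemma brauer_mapM P a b : p.-group P -> {in P, forall x, gconj x a = a} ->
    {in P, forall x, gconj x b = b} ->
  brauer_map P (a * b) = brauer_map P a * brauer_map P b.
Proof.
move=> pP Pa Pb; rewrite -brauer_mapMl ?brauer_map_kspan //.
apply/eqP; rewrite -subr_eq0 -brauer_mapB -mulrBl.
have inT (c : grpalg k gT) : c \in kspan k [set: gT]%G.
  by apply/kspanP=> x; rewrite inE.
apply/eqP; apply: (@brauer_map_lower0 P (kspan k [set: gT])) => //.
rewrite -[_ * b]amulrE.
apply: (lower_map (act := gconjl) (U := kspan k [set: gT])) => //.
  by move=> x Px u _; rewrite !amulrE !gconjlE gconj_mul Pb.
apply: (@brauer_map_lower _ [set: gT]%G) => //; first exact: subsetT.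
  move=> x Px; rewrite -(gconjlE x) linearB /= !gconjlE Pa //.
  by rewrite -brauer_map_gconj ?Pa // (subsetP (normG P)).
by rewrite brauer_mapB [brauer_map P (brauer_map P a)]brauer_map_id ?subrr ?brauer_map_kspan.
Qed.

End Brauer.

End GroupAlgebra.

(** * Fitting's lemma, blocks and source idempotents *)

(** Fitting's lemma in a subspace closed under products that may lack a unit of its own: [g] is the
    idempotent of the part on which x is invertible. A linear dependence between powers of x gives
    x^m = x^m (x v) with v a polynomial in x, and g = (x v)^m. *)
Lemma fitting_idempotent (k : fieldType) (A : falgType k) (U : {vspace A}) (x : A) :
    (U * U <= U)%VS -> x \in U ->
  exists n g y, [/\ g \in U, y \in U, g * g = g, g = x * y /\ g = y * x
    & x ^+ n.+1 * g = x ^+ n.+1].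
Proof.
move=> UU Ux; have Xin n : x ^+ n.+1 \in U.
  by elim: n => // n IHn; rewrite exprS (subvP UU) // memv_mul.
have [n [v cxv [e Uv]]] : exists n, exists2 v, GRing.comm x v &
    x ^+ n.+1 = x ^+ n.+1 * (x * v) /\ {in U, forall w, v * w \in U}.
  pose X := [tuple x ^+ i.+1 | i < (\dim {:A}).+1].
  have /negP : ~ free X.
    move/eqP=> dX; have := dimvS (subvf <<X>>%VS).
    by rewrite dX size_tuple ltnn.
  (* Some entry lies in the span of the later ones. The entry of index n is x^(n+1), so it is a
     combination of powers from x^(n+2) on; the cofactor [v] may have a constant term, hence only v
     w with w in [U] is known to lie in [U]. *)
  rewrite freeNE => /existsP[n /coord_span].
  set Y := drop_tuple _ _ => e; exists n.
  have YE (j : 'I_((\dim {:A}).+1 - n.+1)) : Y`_j = x ^+ n.+1 * (x * x ^+ j).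
    rewrite nth_drop.
    have lt : (j + n.+1 < (\dim {:A}).+1)%N.
      by rewrite addnC -ltn_subRL.
    have := tnth_nth 0 X (Ordinal lt); rewrite tnth_mktuple /= addnC => <-.
    by rewrite -exprS -exprD addnS.
  exists (\sum_j coord Y j (x ^+ n.+1) *: x ^+ j).
    apply: commr_sum => j _; rewrite /GRing.comm -scalerAr -scalerAl.
    by rewrite -exprS -exprSr.
  split=> [|w Uw]; last first.
    rewrite mulr_suml rpred_sum // => j _; rewrite -scalerAl memvZ //.
    by case: (nat_of_ord j) => [|m]; rewrite ?mul1r // (subvP UU) // memv_mul.
  rewrite -(tnth_nth _ X n) tnth_mktuple in e; rewrite {1}e !mulr_sumr.
  by apply: eq_bigr => j _; rewrite YE -!scalerAr.
have Uxv : x * v \in U by rewrite cxv Uv.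
have UXv m : (x * v) ^+ m.+1 \in U.
  by elim: m => // m IHm; rewrite exprS (subvP UU) // memv_mul.
have eX m : x ^+ n.+1 * (x * v) ^+ m = x ^+ n.+1.
  by elim: m => [|m IHm]; rewrite ?mulr1 // (exprS (x * v)) mulrA -e.
pose g := (x * v) ^+ n.+1.
have gg : g * g = g.
  have cvX : GRing.comm (v ^+ n.+1) (x ^+ n.+1) by apply/commrX/commr_sym/commrX.
  by rewrite {1 3}/g exprMn_comm // -cvX -mulrA eX.
have cvg : GRing.comm v (x * v) by rewrite /GRing.comm mulrA -cxv.
have cxg : GRing.comm x (x * v) by rewrite /GRing.comm -mulrA -cxv.
have xy : x * (v * ((x * v) ^+ n * g)) = g.
  by rewrite [LHS]mulrA [LHS]mulrA -exprS gg.
have cxg' m : GRing.comm x ((x * v) ^+ m) by apply: commrX.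
exists n, g, (v * ((x * v) ^+ n * g)); split; last exact: eX.
- exact: UXv.
- by rewrite Uv // -exprD addnS UXv.
- exact: gg.
split; first by rewrite xy.
by rewrite -!mulrA -[g * x]cxg' [_ ^+ n * _]mulrA -[_ ^+ n * x]cxg' !mulrA -cxv
  -exprS gg.
Qed.

Section Blocks.

Variables (k : fieldType) (gT : finGroupType).
Implicit Types (a b c e f z : grpalg k gT) (x y u : gT) (G P Q L : {group gT}).

Lemma block_idem L e : block L e -> e * e = e. Proof. by case. Qed.

Lemma block_neq0 L e : block L e -> e != 0. Proof. by case. Qed.

Lemma block_center L e : block L e -> e \in 'Z(kspan k L)%VS. Proof. by case. Qed.

Lemma block_kspan L e : block L e -> e \in kspan k L.
Proof. by move/block_center; rewrite memv_cap => /andP[]. Qed.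

Lemma centerP L z :
  reflect (z \in kspan k L /\ {in L, forall x, gconj x z = z}) (z \in 'Z(kspan k L))%VS.
Proof. exact: fix_kspanP. Qed.

(** Primitivity of [e] is applied to the orthogonal decomposition e = e z + (e - e z). *)
Lemma block_mul_idem L e z : block L e -> z \in 'Z(kspan k L)%VS -> z * z = z ->
  e * z = 0 \/ e * z = e.
Proof.
case=> Ze ne0 ee prim Zz zz.
have ez : e * z = z * e by apply: center_commute Ze _; case/memv_capP: Zz.
have Zez : e * z \in 'Z(kspan k L)%VS.
  have [[Le ce] [Lz cz]] := (centerP _ _ Ze, centerP _ _ Zz).
  by apply/centerP; split=> [|x Lx]; rewrite ?kspanM // gconj_mul ce ?cz.
have ezez : e * z * (e * z) = e * z.
  by rewrite -mulrA [z * _]mulrA -ez -!mulrA zz !mulrA ee.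
have eez : e * (e * z) = e * z by rewrite mulrA ee.
have eze : e * z * e = e * z by rewrite -mulrA -ez eez.
have [|||||||ez0|/eqP] := prim (e * z) (e - e * z) => //.
- by rewrite rpredB.
- by rewrite mulrBr !mulrBl ee eze eez ezez subrr subr0.
- by rewrite mulrBr eze ezez subrr.
- by rewrite mulrBl eez ezez subrr.
- by rewrite addrC subrK.
- by left.
- by rewrite subr_eq0 => /eqP<-; right.
Qed.

Lemma block_gconj_normal L e x : block L e -> x \in 'N(L)%g -> block L (gconj x e).
Proof.
move=> [Ze ne0 ee prim] Nx.
have Zc y z : y \in 'N(L)%g -> z \in 'Z(kspan k L)%VS -> gconj y z \in 'Z(kspan k L)%VS.
  move=> Ny /centerP[Lz cz]; apply/centerP; split=> [|u Lu].
    exact: mem_kspan_gconj.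
  have -> : u = (y * (u ^ y) * y^-1)%g by rewrite conjgE !mulgA mulgV mul1g mulgK.
  rewrite gconjM gconjM gconjK cz // memJ_norm //.
split; first exact: Zc.
- by apply: contraNneq ne0 => e0; rewrite -(gconjK x e) e0 -gconjlE linear0.
- by rewrite -gconj_mul ee.
move=> f g Zf Zg ff gg fg gf ex.
have lin0 y : gconj y 0 = 0 :> grpalg k gT by rewrite -gconjlE linear0.
have [|||||||f0|g0] := prim (gconj x^-1 f) (gconj x^-1 g).
- by rewrite Zc ?groupV.
- by rewrite Zc ?groupV.
- by rewrite -gconj_mul ff.
- by rewrite -gconj_mul gg.
- by rewrite -gconj_mul fg lin0.
- by rewrite -gconj_mul gf lin0.
- by rewrite -!gconjlE -linearD /= gconjlE -ex gconjK.
- by left; rewrite -(gconjVK x f) f0 lin0.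
- by right; rewrite -(gconjVK x g) g0 lin0.
Qed.

Lemma block_gconj_orth L e x : block L e -> x \in 'N(L)%g ->
  gconj x e = e \/ e * gconj x e = 0.
Proof.
move=> be Nx; have bx := block_gconj_normal be Nx.
have [-> | ex] := block_mul_idem be (block_center bx) (block_idem bx); first by right.
have cx : e * gconj x e = gconj x e * e.
  exact: center_commute (block_center be) (block_kspan bx).
have [xe | xe] := block_mul_idem bx (block_center be) (block_idem be).
  by right; rewrite cx.
by left; rewrite -xe -cx ex.
Qed.

Variables (p : nat) (charkp : p \in [pchar k]).

Lemma source_idem_fix G b P i : block G b -> P \subset G -> source_idempotent G b P i ->
  [/\ i \in kspan k G, {in P, forall x, gconj x i = i}, i * b = i & i * i = i].
Proof.
move=> bb sPG [[Ui _ ii _] _].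
have sub : ('C_(kspan k G)(kspan k P) * <[b]> <= 'C_(kspan k G)(kspan k P))%VS.
  apply/prodvP=> a z /fix_kspanP[Ga Pa] /vlineP[s ->].
  have /centerP[Gb cb] := block_center bb.
  apply/fix_kspanP; split=> [|x Px]; first by rewrite kspanM ?memvZ.
  by rewrite gconj_mul Pa // -(gconjlE x (s *: b)) linearZ /= gconjlE cb // (subsetP sPG).
have /fix_kspanP[Gi Pi] := subvP sub i Ui; split=> //.
have : (i \in 'C_(kspan k G)(kspan k P) * <[b]>)%VS by [].
rewrite -limg_amulr => /memv_imgP[a _ ->].
by rewrite amulrE -mulrA (block_idem bb).
Qed.

(** The point is that br_P(i) stays primitive enough not to be split by [e]. The elements i e i and
    i - i e i of i (kG)^P i map to br(i) e and br(i) - br(i) e; each of them is killed by br_P or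
    invertible in i (kG)^P i, and both cannot be invertible. The second conclusion follows because
    br_P(b) is a central idempotent of kC_G(P) that fixes br_P(i). *)
Lemma source_brauer_block G b P i e : block G b -> P \subset G -> p.-group P ->
    source_idempotent G b P i -> block 'C_G(P) e -> brauer_map P i * e != 0 ->
  brauer_map P i * e = brauer_map P i /\ e * brauer_map P b = e.
Proof.
move=> bb sPG pP si be ie0.
have [Gi Pi ib ii] := source_idem_fix bb sPG si.
have [Gb cb] := centerP _ _ (block_center bb).
have Pb : {in P, forall x, gconj x b = b} by move=> x Px; rewrite cb // (subsetP sPG).
have sCC : 'C_G(P) \subset 'C(P) := subsetIr _ _.
have Ce := block_kspan be.
have Ge : e \in kspan k G by apply: subvP Ce; apply: kspanS; apply: subsetIl.
have Pe : {in P, forall x, gconj x e = e}.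
  move=> x Px; apply/ffunP=> z; rewrite gconjE.
  have [Cz|Cz] := boolP (z \in 'C(P)%g).
    by rewrite /conjg (centP Cz) // mulgA mulVg mul1g.
  have NC : x \in 'N('C(P))%g by rewrite (subsetP (norms_cent (normG P))).
  have nC y : y \notin 'C(P)%g -> e y = 0.
    by move=> Cy; move/kspanP: Ce => -> //; apply: contra Cy; apply: (subsetP sCC).
  by rewrite !nC ?memJ_norm.
have bre : brauer_map P e = e.
  by apply: brauer_map_id; apply: subvP Ce; apply: kspanS.
have brM := brauer_mapM charkp pP; set i0 := brauer_map P i.
have ee := block_idem be; have i00 : i0 * i0 = i0 by rewrite -brM // ii.
have ci0 : e * i0 = i0 * e.
  apply: center_commute (block_center be) _; exact: brauer_map_kspanI.
have Zbr : brauer_map P b \in 'Z(kspan k 'C_G(P)%g)%VS.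
  apply/centerP; split=> [|x /setIP[Gx Cx]]; first exact: brauer_map_kspanI.
  by rewrite -brauer_map_gconj ?cb // (subsetP (cent_sub _)).
have brbb : brauer_map P b * brauer_map P b = brauer_map P b.
  by rewrite -brM // (block_idem bb).
split; last first.
  have [eb0|//] := block_mul_idem be Zbr brbb.
  have i0b : i0 = i0 * brauer_map P b by rewrite -brM // ib.
  have cbe : e * brauer_map P b = brauer_map P b * e.
    exact: center_commute (block_center be) (brauer_map_kspanI _ Gb).
  by case/eqP: ie0; rewrite -/i0 i0b -mulrA -cbe eb0 mulr0.
pose U := 'C_(kspan k G)(kspan k P)%VS.
have UU : (U * U <= U)%VS.
  apply/prodvP=> a z /fix_kspanP[Ga Pa] /fix_kspanP[Gz Pz].
  apply/fix_kspanP; split=> [|x Px]; first exact: kspanM.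
  by rewrite gconj_mul Pa ?Pz.
(* The Fitting idempotent of x is 0 or i since [i] is primitive. If it is 0 then x is nilpotent, and
   br(x), being an idempotent equal to all its powers, is 0; if it is i then x is invertible. *)
have fitU (x : grpalg k gT) : x \in U -> i * x = x -> x * i = x ->
    brauer_map P x * brauer_map P x = brauer_map P x ->
    brauer_map P x = 0 \/ exists2 y : grpalg k gT, y \in U & i = x * y /\ i = y * x.
  move=> Ux ix xi xx.
  have [n [g [y [Ug Uy gg [gxy gyx] xg]]]] := fitting_idempotent UU Ux.
  have [_ Px] := fix_kspanP _ _ _ Ux.
  have Wb a : a \in U -> a * b = a -> (a \in 'C_(kspan k G)(kspan k P) * <[b]>)%VS.
    by move=> Ua <-; rewrite memv_mul ?memv_line.
  have ig : i * g = g by rewrite gxy mulrA ix.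
  have gi : g * i = g by rewrite gyx -mulrA xi.
  have gb : g * b = g by rewrite -gi -mulrA ib.
  have Ui : i \in U by apply/fix_kspanP.
  case: si => -[_ _ _ prim] _; have [|||||||g0|ig0] := prim g (i - g).
  - exact: Wb.
  - by rewrite Wb ?rpredB // mulrBl ib gb.
  - exact: gg.
  - by rewrite mulrBr mulrBl ii gi mulrBl ig gg subrr subr0.
  - by rewrite mulrBr gi gg subrr.
  - by rewrite mulrBl ig gg subrr.
  - by rewrite addrC subrK.
  - left; rewrite g0 mulr0 in xg.
    have PX m : {in P, forall u, gconj u (x ^+ m.+1) = x ^+ m.+1} /\
        brauer_map P (x ^+ m.+1) = brauer_map P x.
      elim: m => [|m [IH1 IH2]]; first by split.
      rewrite exprS; split=> [z Pz|]; first by rewrite gconj_mul Px ?IH1.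
      by rewrite brM // IH2.
    rewrite -(PX n).2 -xg; apply/ffunP=> z; rewrite !ffunE; by case: ifP.
  by right; exists y => //; rewrite -gxy -gyx; move/eqP: ig0; rewrite subr_eq0 => /eqP.
have Ui : i \in U by apply/fix_kspanP.
pose x := i * e * i; have Ux : x \in U.
  by apply/fix_kspanP; split=> [|z Pz]; rewrite ?kspanM // !gconj_mul Pi ?Pe.
have ix : i * x = x by rewrite /x !mulrA ii.
have xi : x * i = x by rewrite /x -!mulrA ii.
have [_ Px] := fix_kspanP _ _ _ Ux.
have brx : brauer_map P x = i0 * e.
  have Pie : {in P, forall u, gconj u (i * e) = i * e}.
    by move=> u Pu; rewrite gconj_mul Pi ?Pe.
  by rewrite /x !brM // bre -/i0 -mulrA ci0 mulrA i00.
have ieie : i0 * e * (i0 * e) = i0 * e by rewrite -mulrA [e * _]mulrA ci0 -mulrA ee mulrA i00.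
have brxx : brauer_map P x * brauer_map P x = brauer_map P x by rewrite brx.
have [x0|[y Uy [_ iyx]]] := fitU x Ux ix xi brxx.
  by case/eqP: ie0; rewrite -brx.
have brx' : brauer_map P (i - x) = i0 - i0 * e by rewrite brauer_mapB brx.
have iei : i0 * (i0 * e) = i0 * e by rewrite mulrA i00.
have [||||/eqP|[y' Uy' [ixy _]]] := fitU (i - x).
- by rewrite rpredB.
- by rewrite mulrBr ii ix.
- by rewrite mulrBl ii xi.
- rewrite brx' mulrBr !mulrBl i00 ieie iei -mulrA ci0 iei.
  by rewrite subrr subr0.
- by rewrite brx' subr_eq0 => /eqP<-.
(* When both are invertible, br(i) is a left multiple of br(i) e and a right multiple of br(i) -
   br(i) e. Then br(i) = br(i) br(i) contains the product of these two orthogonal idempotents, which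
   is 0. *)
case/eqP: ie0; rewrite -/i0; suff -> : i0 = 0 by rewrite mul0r.
have [[_ Py] [_ Py']] := (fix_kspanP _ _ _ Uy, fix_kspanP _ _ _ Uy').
have Pix : {in P, forall u, gconj u (i - x) = i - x}.
  by move=> u Pu; rewrite -(gconjlE u) linearB /= !gconjlE Pi ?Px.
have e1 : i0 = brauer_map P y * (i0 * e) by rewrite {1}/i0 iyx brM // brx.
have e2 : i0 = (i0 - i0 * e) * brauer_map P y' by rewrite {1}/i0 ixy brM // brx'.
rewrite -i00 {1}e1 {2}e2 -mulrA [i0 * e * _]mulrA.
by rewrite mulrBr ieie -mulrA ci0 iei subrr mul0r mulr0.
Qed.

End Blocks.

(** * Modules and operators *)

Section Modules.

Variables (k : fieldType) (gT : finGroupType) (G : {group gT}).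
Implicit Types (M N : gmod k G) (x y : gT).

Definition equivariant M N (f : 'Hom(M, N)) : Prop :=
  {in G, forall x v, f (gact M x v) = gact N x (f v)}.

Lemma gactMv M x y v : x \in G -> y \in G ->
  gact M (x * y)%g v = gact M x (gact M y v).
Proof. by move=> Gx Gy; rewrite gactM // comp_lfunE. Qed.

Lemma gact1v M v : gact M 1%g v = v. Proof. by rewrite gact1 id_lfunE. Qed.

Lemma gactKv M x v : x \in G -> gact M x^-1%g (gact M x v) = v.
Proof. by move=> Gx; rewrite -gactMv ?groupV // mulVg gact1v. Qed.

Lemma gactVKv M x v : x \in G -> gact M x (gact M x^-1%g v) = v.
Proof. by move=> Gx; rewrite -gactMv ?groupV // mulgV gact1v. Qed.

Lemma gactMr M x y : x \in G -> y \in G -> gact M (x * y)%g = gact M x * gact M y.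
Proof. by move=> Gx Gy; rewrite gactM. Qed.

Lemma gactV M x : x \in G -> gact M x * gact M x^-1%g = 1.
Proof. by move=> Gx; rewrite -gactMr ?groupV // mulgV (gact1 M). Qed.

Lemma gactVl M x : x \in G -> gact M x^-1%g * gact M x = 1.
Proof. by move=> Gx; rewrite -gactMr ?groupV // mulVg (gact1 M). Qed.

Lemma gact_action M : lin_action G (gact M).
Proof. by split; [exact: gact1 | exact: gactM]. Qed.

Lemma endmE M x (s : 'End(M)) : gact (endm M) x s = gact M x * s * gact M x^-1%g.
Proof. exact: (linfunE (conj_lin (M := M) x)). Qed.

Lemma endm_mul M x (s t : 'End(M)) : x \in G ->
  gact (endm M) x (s * t) = gact (endm M) x s * gact (endm M) x t.
Proof.
move=> Gx; rewrite !endmE -[RHS]mulrA [X in _ = _ * X]mulrA.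
by rewrite [gact M x^-1%g * (_ * t)]mulrA gactVl // mul1r !mulrA.
Qed.

Lemma endm_one M x : x \in G -> gact (endm M) x (1 : 'End(M)) = 1.
Proof. by move=> Gx; rewrite endmE mulr1 gactV. Qed.

Lemma endm_commute M x (s : 'End(M)) : x \in G ->
  (gact (endm M) x s = s) <-> (gact M x * s = s * gact M x).
Proof.
move=> Gx; rewrite endmE; split=> [e|->]; last by rewrite -mulrA gactV ?mulr1.
by rewrite -{2}e -!mulrA gactVl // mulr1.
Qed.

Definition retract M N : Prop := exists (i : 'Hom(M, N)) (r : 'Hom(N, M)),
  [/\ equivariant i, equivariant r & forall v, r (i v) = v].

Lemma giso_equivariant M N (f : 'Hom(M, N)) :
  {in G, forall x, (f \o gact M x = gact N x \o f)%VF} -> equivariant f.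
Proof. by move=> ef x Gx v; rewrite -[LHS]comp_lfunE ef // comp_lfunE. Qed.

Lemma equivariant_giso M N (f : 'Hom(M, N)) : equivariant f ->
  {in G, forall x, (f \o gact M x = gact N x \o f)%VF}.
Proof. by move=> ef x Gx; apply/lfunP=> v; rewrite !comp_lfunE ef. Qed.

Lemma giso_inv M N : giso M N -> exists (f : 'Hom(M, N)) (g : 'Hom(N, M)),
  [/\ equivariant f, equivariant g, cancel f g & cancel g f].
Proof.
move=> [f [/eqP kf If ef]]; exists f, (f^-1)%VF.
have fK : cancel f f^-1%VF by apply: lker0_lfunK.
have Kf : cancel f^-1%VF f by move=> v; apply: limg_lfunVK; rewrite If memvf.
split=> //; first exact: giso_equivariant.
move=> x Gx v; apply: (can_inj fK); rewrite Kf (giso_equivariant ef) //.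
by rewrite Kf.
Qed.

Lemma inv_giso M N (f : 'Hom(M, N)) (g : 'Hom(N, M)) :
  equivariant f -> cancel f g -> cancel g f -> giso M N.
Proof.
move=> ef fK gK; exists f; split; last exact: equivariant_giso.
  apply/eqP/lker0P; exact: can_inj fK.
apply/vspaceP=> v; rewrite memvf; apply/memv_imgP; exists (g v); rewrite ?memvf //.
Qed.

Lemma dsumE M N x v : gact (dsum M N) x v = (gact M x v.1, gact N x v.2).
Proof. exact: (linfunE (dsum_lin (M := M) (N := N) x)). Qed.

Lemma dsummand_retract M N : dsummand M N -> retract M N.
Proof.
move=> [N' /giso_inv[f [g [ef eg fK gK]]]].
have l1 : linear (fun v : M => (v, 0 : N')).
  by move=> s u v; congr pair; rewrite /= scaler0 add0r.
have l2 : linear (fun v : dsum M N' => v.1) by move=> s u v.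
exists (g \o linfun (fun v : M => (v, 0 : N') : dsum M N'))%VF.
exists (linfun (fun v : dsum M N' => v.1 : M) \o f)%VF; split.
- move=> x Gx v; rewrite !comp_lfunE -eg // dsumE !(linfunE l1) /=.
  by rewrite linear0.
- by move=> x Gx v; rewrite !comp_lfunE !(linfunE l2) ef // dsumE.
by move=> v; rewrite !comp_lfunE gK (linfunE l2) (linfunE l1).
Qed.

Lemma subm_gact M (U : {vspace M}) (sU : {in G, forall x, (gact M x @: U <= U)%VS})
    x (v : subm sU) : x \in G -> vsval (gact (subm sU) x v) = gact M x (vsval v).
Proof.
move=> Gx; rewrite /= /subm_act 2!comp_lfunE [linfun vsval v]lfunE.
rewrite [linfun (vsproj U) _]lfunE /= vsprojK //.
by apply: (subvP (sU x Gx)); rewrite memv_img // subvsP.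
Qed.

Lemma retract_dsummand M N : retract M N -> dsummand M N.
Proof.
move=> [i [r [ei er ri]]].
have sK : {in G, forall x, (gact N x @: lker r <= lker r)%VS}.
  move=> x Gx; apply/subvP=> _ /memv_imgP[v kv ->]; rewrite memv_ker er //.
  by move: kv; rewrite memv_ker => /eqP->; rewrite linear0.
exists (subm sK).
have kr v : v - i (r v) \in lker r by rewrite memv_ker linearB /= ri subrr.
have l1 : linear (fun v : N => (r v, vsproj (lker r) (v - i (r v))) : dsum M (subm sK)).
  move=> s u v; congr pair; first by rewrite linearP.
  have -> : s *: u + v - i (r (s *: u + v)) = s *: (u - i (r u)) + (v - i (r v)).
    rewrite [r (_ + _)]linearP [i (_ + _)]linearP /=.
    by rewrite scalerBr opprD addrACA.
  by rewrite linearP.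
have l2 : linear (fun v : dsum M (subm sK) => i v.1 + vsval v.2).
  by move=> s u v; rewrite /= !linearP /= addrACA scalerDr.
pose f : 'Hom(N, dsum M (subm sK)) :=
  linfun (fun v : N => (r v, vsproj (lker r) (v - i (r v))) : dsum M (subm sK)).
pose g : 'Hom(dsum M (subm sK), N) :=
  linfun (fun v : dsum M (subm sK) => i v.1 + vsval v.2).
have fE v : f v = (r v, vsproj (lker r) (v - i (r v))) by apply: (linfunE l1).
have gE v : g v = i v.1 + vsval v.2 by apply: (linfunE l2).
apply: (@inv_giso _ _ f g).
- move=> x Gx v; rewrite dsumE !fE /=; congr pair; first exact: er.
  apply: val_inj; rewrite /= subm_gact // !vsprojK //.
  by rewrite er // ei // linearB.
- move=> v; rewrite fE gE /= vsprojK // addrC subrK //.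
move=> [u w]; rewrite fE gE /=.
have kw : r (vsval w) = 0 by apply/eqP; rewrite -memv_ker subvsP.
by rewrite linearD /= ri kw addr0 addrAC subrr add0r vsvalK.
Qed.

End Modules.

Lemma trace1 (k : fieldType) (V : vectType k) (zT : finGroupType) (Z : {group zT})
    (act : zT -> 'End(V)) v : act 1%g = 1 -> lin_action Z act ->
  trace act 1%G Z v = \sum_(z in Z) act z v.
Proof.
move=> a1 aZ; apply: (trace_reindex aZ) => //; first exact: sub1G.
- by move=> x /set1P->; rewrite a1 one_lfunE.
- by move=> i j Zi Zj; rewrite mem_lcoset => /set1P e; apply: (mulgI j^-1%g); rewrite e mulVg.
by move=> x Zx; exists x => //; apply: lcoset_refl.
Qed.

Section MoreTrace.

Variables (k : fieldType) (V : vectType k) (zT : finGroupType).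
Implicit Types (D Z K : {group zT}) (act : zT -> 'End(V)) (U : {vspace V}).

Lemma lcosets_fixed D Z (C : {set zT}) : D \subset Z ->
  (C \in lcosets D Z) && [forall d in D, (d *: C)%g == C] = (C \in lcosets D 'N_Z(D)).
Proof.
move=> sDZ; apply/andP/lcosetsP=> [[/lcosetsP[z Zz ->] /forall_inP Cfix]|].
  exists z => //; rewrite inE Zz inE; apply/subsetP=> _ /imsetP[d Dd ->].
  have : (d * z)%g \in (z *: D)%g.
    by rewrite -(eqP (Cfix d Dd)) mem_lcoset mulKg lcoset_refl.
  by rewrite mem_lcoset conjgE.
case=> z /setIP[Zz Nz] ->; split; first by apply/lcosetsP; exists z.
apply/forall_inP=> d Dd; rewrite -lcosetM; apply/eqP/lcoset_eqP.
by rewrite mem_lcoset -conjgE memJ_norm.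
Qed.

Lemma lcosets_translate D Z x (C : {set zT}) : x \in Z -> C \in lcosets D Z ->
  (x *: C)%g \in lcosets D Z.
Proof.
move=> Zx /lcosetsP[z Zz ->]; rewrite -lcosetM.
by apply/lcosetsP; exists (x * z)%g; rewrite ?groupM.
Qed.

Lemma act_repr_translate D Z act x (C : {set zT}) v : lin_action Z act ->
    D \subset Z -> {in D, forall d, act d v = v} -> x \in Z -> C \in lcosets D Z ->
  act (repr (x *: C)%g) v = act x (act (repr C) v).
Proof.
move=> aZ sDZ Dv Zx CZ; have [ZC {1}->] := lcoset_repr sDZ CZ.
by rewrite -lcosetM (lcosets_act aZ) ?groupM // (lin_actM _ aZ).
Qed.

(** [D] permutes its left cosets in [Z] by translation, and by [lcosets_fixed] the fixed ones are
    the cosets inside N_Z(D); all others group into proper traces. *)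
Lemma trace_normaliser D Z act U v : lin_action Z act -> D \subset Z ->
    {in D, forall d, act d v = v} -> {in Z, forall z u, u \in U -> act z u \in U} ->
    v \in U ->
  trace act D Z v - trace act D 'N_Z(D) v \in lower act U D.
Proof.
move=> aZ sDZ Dv ZU Uv; have aD := lin_actionS sDZ aZ.
have := @orbit_sum_lower k V zT act D {set zT} (fun d C => (d *: C)%g)
  (mem (lcosets D Z)) (fun C => act (repr C) v) U aD.
rewrite !traceE [in X in _ - X](eq_bigl (mem (lcosets D 'N_Z(D)))); last first.
  by move=> C; rewrite /= -(lcosets_fixed _ sDZ).
apply=> [C|x y _ _ C|x Dx C CZ|x Dx C CZ|C CZ].
- by rewrite lcoset1.
- exact: lcosetM.
- by rewrite /= lcosets_translate // (subsetP sDZ).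
- exact: (act_repr_translate aZ sDZ Dv (subsetP sDZ x Dx) CZ).
by have [ZC _] := lcoset_repr sDZ CZ; apply: ZU.
Qed.

(* Mackey's formula, when K meets every conjugate of D trivially. *)
Lemma trace_free D Z act v (T : finGroupType) (K : {group T}) (j : T -> zT) :
    lin_action Z act -> D \subset Z -> {in D, forall d, act d v = v} ->
    {in K &, {morph j : x y / (x * y)%g}} -> {in K, forall x, j x \in Z} ->
    {in Z & K, forall z x, (j x ^ z)%g \in D -> x = 1%g} ->
  exists s, trace act D Z v = \sum_(x in K) act (j x) s.
Proof.
move=> aZ sDZ Dv jM jK KD; rewrite traceE.
have j1 : j 1%g = 1%g.
  by apply: (mulgI (j 1%g)); rewrite -jM ?mulg1.
have aK : lin_action K (fun x => act (j x)).
  by split=> [|x y Kx Ky]; rewrite ?j1 ?aZ.1 // jM // aZ.2 ?jK.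
(* The existence of s becomes membership in the image of a linear operator, a subspace, so that the
   orbit sum lemma applies; the orbits of [K] are regular. *)
suff : \sum_(C in lcosets D Z) act (repr C) v
     \in limg (\sum_(x in K) act (j x)).
  by case/memv_imgP=> s _ ->; exists s; rewrite sum_lfunE.
apply: (orbit_sum_mem (a := fun x C => (j x *: C)%g) aK)
  => [C|x y Kx Ky C|x Kx C CZ|x Kx C CZ|C Q CZ eQ].
- by rewrite j1 lcoset1.
- by rewrite jM // lcosetM.
- by rewrite lcosets_translate ?jK.
- exact: (act_repr_translate aZ sDZ Dv (jK x Kx) CZ).
have -> : Q = 1%G.
  apply/trivGP/subsetP=> x; rewrite eQ !inE => /andP[Kx /eqP fx].
  have [ZC eC] := lcoset_repr sDZ CZ; apply/eqP/(KD _ _ ZC Kx).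
  have : (j x * repr C)%g \in (j x *: C)%g by rewrite mem_lcoset mulKg {2}eC lcoset_refl.
  by rewrite fx {2}eC mem_lcoset -conjgE.
rewrite trace1 //= ?j1 ?aZ.1 // -sum_lfunE; exact: memv_img (memvf _).
Qed.

End MoreTrace.

Section ImageGroup.

Variables (aT rT : finGroupType) (f : aT -> rT).
Hypothesis fM : {morph f : x y / (x * y)%g}.

Lemma imgroup_set (K : {group aT}) : group_set [set f x | x in K].
Proof.
apply/group_setP; split=> [|_ _ /imsetP[x Kx ->] /imsetP[y Ky ->]].
  have f1 : f 1%g = 1%g by apply: (mulgI (f 1%g)); rewrite -fM !mulg1.
  by apply/imsetP; exists 1%g.
by apply/imsetP; exists (x * y)%g; rewrite ?groupM ?fM.
Qed.

Definition imgroup K := Group (imgroup_set K).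

End ImageGroup.

(* An internal product decomposition of zT; keeping the two factors abstract *)
(* lets every statement on the left factor be applied to the right one. *)
Record prodcoord (gT hT zT : finGroupType) := ProdCoord {
  inL : gT -> zT; inR : hT -> zT; prL : zT -> gT; prR : zT -> hT;
  inLM : {morph inL : x y / (x * y)%g};
  inRM : {morph inR : x y / (x * y)%g};
  prLM : {morph prL : x y / (x * y)%g};
  prRM : {morph prR : x y / (x * y)%g};
  prL_inL : forall x, prL (inL x) = x;
  prR_inL : forall x, prR (inL x) = 1%g;
  prL_inR : forall y, prL (inR y) = 1%g;
  prR_inR : forall y, prR (inR y) = y;
  inLR : forall z, z = (inL (prL z) * inR (prR z))%g
}.

Section Prodcoord.

Variables (gT hT zT : finGroupType) (c : prodcoord gT hT zT).

Lemma prod_eq z z' : prL c z = prL c z' -> prR c z = prR c z' -> z = z'.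
Proof. by move=> eL eR; rewrite (inLR c z) eL eR -(inLR c). Qed.

Lemma inRL z : z = (inR c (prR c z) * inL c (prL c z))%g.
Proof.
by apply: prod_eq; rewrite ?prLM ?prRM ?prL_inL ?prL_inR ?prR_inL ?prR_inR ?mul1g ?mulg1.
Qed.

Definition prodswap : prodcoord hT gT zT := ProdCoord (inRM c) (inLM c)
  (prRM c) (prLM c) (prR_inR c) (prL_inR c) (prR_inL c) (prL_inL c) inRL.

Lemma inL1 : inL c 1%g = 1%g.
Proof. by apply: (mulgI (inL c 1%g)); rewrite -inLM !mulg1. Qed.

Lemma prL1 : prL c 1%g = 1%g.
Proof. by apply: (mulgI (prL c 1%g)); rewrite -prLM !mulg1. Qed.

Lemma inLV x : inL c x^-1%g = (inL c x)^-1%g.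
Proof. by apply: (mulgI (inL c x)); rewrite -inLM !mulgV inL1. Qed.

Lemma prLV x : prL c x^-1%g = (prL c x)^-1%g.
Proof. by apply: (mulgI (prL c x)); rewrite -prLM !mulgV prL1. Qed.

Lemma inLRC x y : (inL c x * inR c y = inR c y * inL c x)%g.
Proof.
by apply: prod_eq; rewrite ?prLM ?prRM ?prL_inL ?prL_inR ?prR_inL ?prR_inR ?mul1g ?mulg1.
Qed.

Lemma prLJ x y : prL c (x ^ y)%g = (prL c x ^ prL c y)%g.
Proof. by rewrite !conjgE !prLM prLV. Qed.

End Prodcoord.

Lemma inR1 (gT hT zT : finGroupType) (c : prodcoord gT hT zT) : inR c 1%g = 1%g.
Proof. exact: inL1 (prodswap c). Qed.

Lemma prR1 (gT hT zT : finGroupType) (c : prodcoord gT hT zT) : prR c 1%g = 1%g.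
Proof. exact: prL1 (prodswap c). Qed.

Lemma prRJ (gT hT zT : finGroupType) (c : prodcoord gT hT zT) z t :
  prR c (z ^ t)%g = (prR c z ^ prR c t)%g.
Proof. exact: prLJ (prodswap c) z t. Qed.

(** Kept transparent, so that the coordinate maps convert to pairing with 1 and to the projections
    of a pair. *)
Definition stdcoord (gT hT : finGroupType) : prodcoord gT hT (gT * hT)%type.
Proof.
exists (fun x => (x, 1%g)) (fun y => (1%g, y)) fst snd => //=.
- by move=> x y; congr pair; rewrite mulg1.
- by move=> x y; congr pair; rewrite mulg1.
by case=> x y; congr pair; rewrite /= ?mulg1 ?mul1g.
Defined.

Section GroupOperators.

Variables (k : fieldType) (zT : finGroupType) (Z : {group zT}) (M : gmod k Z).
Variables (T : finGroupType) (j : T -> zT).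
Implicit Types (K L : {group T}) (a b : grpalg k T).

(** Action of a group algebra over another group [T], through a map [j] into the acting group. With
    [inL] and [inR] these are the two commuting actions on a bimodule, the right one turned into a
    left one by inversion. *)
Definition gop K a : 'End(M) := \sum_(x in K) (a x : k) *: gact M (j x).

Lemma gop_lin K : linear (gop K).
Proof.
move=> s a b; rewrite /gop scaler_sumr -big_split; apply: eq_bigr => x _ /=.
by rewrite !ffunE /= scalerDl scalerA.
Qed.

Lemma gopE K a v : gop K a v = \sum_(x in K) (a x : k) *: gact M (j x) v.
Proof. by rewrite sum_lfunE; apply: eq_bigr => x _; rewrite scale_lfunE. Qed.

Lemma gop_gelt K x : x \in K -> gop K (gelt x) = gact M (j x).
Proof.
move=> Kx; rewrite /gop (bigD1 x) //= geltE eqxx scale1r big1 ?addr0 // => y /andP[_ ne].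
by rewrite geltE (negPf ne) scale0r.
Qed.

Lemma gopS K L a : K \subset L -> a \in kspan k K -> gop L a = gop K a.
Proof.
move=> /subsetP sKL /kspanP a0; rewrite /gop (bigID (mem K)) /= addrC big1 => [|x /andP[_ /a0->]].
  by rewrite add0r; apply: eq_bigl => x; rewrite andb_idl // => /sKL.
exact: scale0r.
Qed.

Lemma gopB K a b : gop K (a - b) = gop K a - gop K b.
Proof.
by rewrite addrC -[- b]scaleN1r gop_lin scaleN1r addrC.
Qed.

Lemma gop0 K : gop K 0 = 0.
Proof. by rewrite -(subrr 0) gopB subrr. Qed.

Lemma gop_sum K (I : finType) (A : pred I) (F : I -> grpalg k T) :
  gop K (\sum_(i | A i) F i) = \sum_(i | A i) gop K (F i).
Proof.
apply: (big_morph (gop K)) => [a b|]; last exact: gop0.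
by rewrite -[a]scale1r gop_lin !scale1r.
Qed.

Lemma gopZ K s a : gop K (s *: a) = s *: gop K a.
Proof. by rewrite -[s *: a]addr0 gop_lin gop0 addr0. Qed.

Hypothesis jM : {morph j : x y / (x * y)%g}.

Lemma gopM K a b : {in K, forall x, j x \in Z} -> a \in kspan k K ->
  b \in kspan k K -> gop K (a * b) = gop K a * gop K b.
Proof.
move=> KZ Ka Kb; rewrite {1}(kspan_sum Ka) {1}(kspan_sum Kb) mulr_suml gop_sum.
rewrite [in RHS]/gop mulr_suml; apply: eq_bigr => x Kx.
rewrite mulr_sumr gop_sum mulr_sumr; apply: eq_bigr => y Ky.
rewrite -scalerAl -scalerAr !gopZ -geltM gop_gelt ?groupM // jM gactMr ?KZ //.
by rewrite -lfun_scalerAl -lfun_scalerAr.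
Qed.

Lemma endm_gop K a z x : z \in Z -> {in K, forall y, j y \in Z} -> x \in 'N(K)%g ->
    {in K, forall y, (z * j y)%g = (j (y ^ x^-1) * z)%g} ->
  gact (endm M) z (gop K a) = gop K (gconj x a).
Proof.
move=> Zz KZ Nx zj; rewrite endmE [in RHS]/gop [gop _ _ in LHS]/gop.
rewrite mulr_sumr mulr_suml [RHS](reindex_inj (conjg_inj x^-1%g)) /=.
apply: eq_big => [y|y Ky]; first by rewrite memJ_norm ?groupV.
rewrite gconjE conjgKV -lfun_scalerAr -lfun_scalerAl -gactMr ?KZ // zj //.
by rewrite gactMr ?KZ ?memJ_norm ?groupV // -mulrA gactV // mulr1.
Qed.

End GroupOperators.

(** * The slashed module *)

(* The part of a Morita equivalence between kCP.e and its counterpart over CR *)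
(* that concerns the left action, together with the extension of the left    *)
(* stabiliser of e to N.                                                      *)
Definition left_local_data (k : fieldType) (gT hT zT : finGroupType)
    (c : prodcoord gT hT zT) (CP Ne : {group gT}) (CR : {group hT}) (N : {group zT})
    (MP : gmod k N) (e : grpalg k gT) : Prop :=
  [/\ forall t : 'End(MP), {in CR, forall y, gact (endm MP) (inR c y) t = t} ->
        exists2 a, a \in kspan k CP & t = gop MP (inL c) CP a,
      forall a, a \in kspan k CP -> a * e = a -> gop MP (inL c) CP a = 0 -> a = 0,
      gop MP (inL c) CP e = 1
    & {in Ne, forall x, exists2 z, z \in N & prL c z = x}].

Lemma mem_norm_cent (rT : finGroupType) (K Q : {group rT}) x :
  x \in 'N_K(Q)%g -> x \in 'N('C_K(Q))%g.
Proof.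
apply/subsetP; apply: normsI; first exact: subset_trans (subsetIl _ _) (normG K).
exact: norms_cent (subsetIr _ _).
Qed.

(** Compare g with the rank one map sending x to x_0 v, where x_0 is the first coordinate, and
    evaluate at the first basis vector: one side is g v, the other a fixed multiple of v. The zero
    space has no such vector and is treated apart. *)
Lemma commute_all_scalar (k : fieldType) (V : vectType k) (g : 'End(V)) :
  (forall t : 'End(V), g * t = t * g) -> exists s, g = s *: (1 : 'End(V)).
Proof.
move=> gC; case dV: (\dim {:V}) => [|n].
  exists 0; apply/lfunP=> v; have : v \in {:V}%VS by apply: memvf.
  move/eqP: dV; rewrite dimv_eq0 => /eqP->; rewrite memv0 => /eqP->.
  by rewrite !linear0.
have lt0 : (0 < \dim {:V})%N by rewrite dV.
pose i := Ordinal lt0; pose w := (vbasis {:V})`_i; exists (coord (vbasis {:V}) i (g w)).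
apply/lfunP=> v; have tl : linear (fun x : V => (coord (vbasis {:V}) i x) *: v).
  by move=> s x y; rewrite linearP scalerDl scalerA.
have /lfunP/(_ w) := gC (linfun (fun x : V => (coord (vbasis {:V}) i x) *: v)).
rewrite !mul_lfunE !(linfunE tl) linearZ /= coord_free ?(basis_free (vbasisP _)) //.
by rewrite eqxx scale1r scale_lfunE one_lfunE.
Qed.

(** Iterated Frobenius sends s and 1 to the same element, and Frobenius is injective on a field. *)
Lemma pgroup_root1 (k : fieldType) (p : nat) (rT : finGroupType) (D : {group rT}) (s : k) :
  p \in [pchar k] -> p.-group D -> s ^+ #|D| = 1 -> s = 1.
Proof.
move=> charkp /p_natP[n ->] sn.
have: iter n (pFrobenius_aut charkp) s = iter n (pFrobenius_aut charkp) 1.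
  have it x : iter n (pFrobenius_aut charkp) x = x ^+ (p ^ n).
    elim: n {sn} => // n IHn; rewrite iterS IHn pFrobenius_autE -exprM.
    by rewrite expnSr.
  by rewrite !it sn expr1n.
by elim: n {sn} => // n IHn /fmorph_inj/IHn.
Qed.

Section Core.

Variables (k : fieldType) (p : nat) (charkp : p \in [pchar k]).
Variables (gT hT zT : finGroupType) (c : prodcoord gT hT zT).
Variables (G : {group gT}) (H : {group hT}) (Z : {group zT}).
Hypothesis memZ : forall z, (z \in Z) = (prL c z \in G) && (prR c z \in H).
Variable M : gmod k Z.

Local Notation S := 'End(M).
Local Notation act := (gact (endm M)).
Local Notation actL := (fun x => act (inL c x)).
Local Notation actR := (fun y => act (inR c y)).
Local Notation lop := (gop M (inL c) G).
Local Notation rop := (gop M (inR c) H).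

Definition right_endo : {vspace S} := fixed actR fullv H.
Local Notation T := right_endo.

Definition traceR : 'End(S) := \sum_(y in H) actR y.

Lemma inL_mem x : x \in G -> inL c x \in Z.
Proof. by move=> Gx; rewrite memZ prL_inL prR_inL Gx group1. Qed.

Lemma inR_mem y : y \in H -> inR c y \in Z.
Proof. by move=> Hy; rewrite memZ prL_inR prR_inR Hy group1. Qed.

Lemma prL_mem z : z \in Z -> prL c z \in G. Proof. by rewrite memZ => /andP[]. Qed.

Lemma prR_mem z : z \in Z -> prR c z \in H. Proof. by rewrite memZ => /andP[]. Qed.

Lemma act_action : lin_action Z act. Proof. exact: gact_action. Qed.

Lemma actL_action : lin_action G actL.
Proof.
split=> [|x y Gx Gy]; first by rewrite inL1 (gact1 (endm M)).
by rewrite inLM gactMr ?inL_mem.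
Qed.

Lemma actR_action : lin_action H actR.
Proof.
split=> [|x y Gx Gy]; first by rewrite inR1 (gact1 (endm M)).
by rewrite inRM gactMr ?inR_mem.
Qed.

Lemma act_LR z s : z \in Z -> act z s = actL (prL c z) (actR (prR c z) s).
Proof.
move=> Zz; rewrite {1}(inLR c z) (lin_actM _ act_action) //.
  by rewrite inL_mem ?prL_mem.
by rewrite inR_mem ?prR_mem.
Qed.

Lemma act_LRC x y s : x \in G -> y \in H -> actL x (actR y s) = actR y (actL x s).
Proof.
by move=> Gx Hy; rewrite -!(lin_actM _ act_action) ?inL_mem ?inR_mem // inLRC.
Qed.

Lemma right_endoP t : reflect {in H, forall y, actR y t = t} (t \in T).
Proof.
by apply: (iffP (fixedP _ _ _ _)) => [[]//|]; split; rewrite ?memvf.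
Qed.

Lemma traceRE s : traceR s = \sum_(y in H) actR y s.
Proof. exact: sum_lfunE. Qed.

Lemma actR_mul y s t : y \in H -> actR y (s * t) = actR y s * actR y t.
Proof. by move=> Hy; rewrite endm_mul ?inR_mem. Qed.

Lemma traceR_mem s : traceR s \in T.
Proof.
apply/right_endoP=> y Hy; rewrite traceRE linear_sum /=.
rewrite [RHS](reindex_inj (mulgI y)) /=.
apply: eq_big => [x|x Hx]; first by rewrite groupMl.
by rewrite (lin_actM _ actR_action).
Qed.

Lemma traceR_actL x s : x \in G -> traceR (actL x s) = actL x (traceR s).
Proof.
move=> Gx; rewrite !traceRE linear_sum; apply: eq_bigr => y Hy /=.
by rewrite act_LRC.
Qed.

Lemma traceR_actR y s : y \in H -> traceR (actR y s) = traceR s.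
Proof.
move=> Hy; rewrite !traceRE [RHS](reindex_inj (mulIg y)) /=.
apply: eq_big => [x|x Hx]; first by rewrite groupMr.
by rewrite (lin_actM _ actR_action).
Qed.

Lemma traceR_act z s : z \in Z -> traceR (act z s) = actL (prL c z) (traceR s).
Proof.
by move=> Zz; rewrite act_LR // traceR_actL ?prL_mem // traceR_actR ?prR_mem.
Qed.

Lemma traceR_mull t s : t \in T -> traceR (t * s) = t * traceR s.
Proof.
move/right_endoP=> Ht; rewrite !traceRE mulr_sumr; apply: eq_bigr => y Hy.
by rewrite actR_mul // Ht.
Qed.

Lemma lop_T a : lop a \in T.
Proof.
apply/right_endoP=> y Hy; apply/endm_commute; first exact: inR_mem.
rewrite mulr_sumr mulr_suml; apply: eq_bigr => x Gx.
by rewrite -lfun_scalerAl -lfun_scalerAr -!gactMr ?inL_mem ?inR_mem // inLRC.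
Qed.

Lemma act_lop z a : z \in Z -> act z (lop a) = lop (gconj (prL c z) a).
Proof.
move=> Zz; apply: endm_gop => //; first exact: inL_mem.
  by rewrite (subsetP (normG G)) ?prL_mem.
move=> x Gx; apply: (prod_eq (c := c)).
  by rewrite !prLM !prL_inL conjgE invgK !mulgA mulgKV.
by rewrite !prRM !prR_inL mulg1 mul1g.
Qed.

Lemma act_rop z a : z \in Z -> act z (rop a) = rop (gconj (prR c z) a).
Proof.
move=> Zz; apply: endm_gop => //; first exact: inR_mem.
  by rewrite (subsetP (normG H)) ?prR_mem.
move=> x Gx; apply: (prod_eq (c := c)).
  by rewrite !prLM !prL_inR mulg1 mul1g.
by rewrite !prRM !prR_inR conjgE invgK !mulgA mulgKV.
Qed.

Lemma lopM a b : a \in kspan k G -> b \in kspan k G -> lop (a * b) = lop a * lop b.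
Proof. by apply: gopM; [exact: inLM | exact: inL_mem]. Qed.

Lemma ropM a b : a \in kspan k H -> b \in kspan k H -> rop (a * b) = rop a * rop b.
Proof. by apply: gopM; [exact: inRM | exact: inR_mem]. Qed.

Lemma lop_ropC a b : lop a * rop b = rop b * lop a.
Proof.
rewrite mulr_sumr mulr_suml; apply: eq_bigr => y Hy.
rewrite -lfun_scalerAl -lfun_scalerAr; congr (_ *: _).
have /right_endoP/(_ y Hy)/endm_commute-> // := lop_T a.
exact: inR_mem.
Qed.

Variable D : {group zT}.
Hypotheses (sDZ : D \subset Z) (pD : p.-group D).
Hypothesis prL_inj : {in D, forall d, prL c d = 1%g -> d = 1%g}.
Hypothesis prR_inj : {in D, forall d, prR c d = 1%g -> d = 1%g}.
Variables (P : {group gT}) (R : {group hT}).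
Hypothesis defP : P :=: [set prL c d | d in D].
Hypothesis defR : R :=: [set prR c d | d in D].

Local Notation lowD := (lower act fullv D).
Local Notation lowP := (lower actL T P).

Lemma prL_D d : d \in D -> prL c d \in P.
Proof. by move=> Dd; rewrite defP; apply: imset_f. Qed.

Lemma prR_D d : d \in D -> prR c d \in R.
Proof. by move=> Dd; rewrite defR; apply: imset_f. Qed.

Lemma sPG : P \subset G.
Proof.
apply/subsetP=> x; rewrite defP => /imsetP[d Dd ->].
by rewrite prL_mem ?(subsetP sDZ).
Qed.

(** Inverse of the projection from [D] to [P], which is injective by [prL_inj]; the value 1 outside
    [P] is a default. *)
Definition liftD x : zT := odflt 1%g [pick d in D | prL c d == x].

Lemma liftDP x : x \in P -> liftD x \in D /\ prL c (liftD x) = x.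
Proof.
rewrite defP /liftD => /imsetP[d Dd ->]; case: pickP => [d' /andP[Dd' /eqP]|] //=.
by move/(_ d); rewrite Dd eqxx.
Qed.

Lemma prL_D_inj : {in D &, injective (prL c)}.
Proof.
move=> d d' Dd Dd' e; apply/eqP; rewrite eq_mulgV1; apply/eqP/prL_inj.
  by rewrite groupM ?groupV.
by rewrite prLM prLV e mulgV.
Qed.

Lemma liftDK d : d \in D -> liftD (prL c d) = d.
Proof.
by move=> Dd; have [Dl e] := liftDP (prL_D Dd); apply: prL_D_inj.
Qed.

Lemma liftDM x y : x \in P -> y \in P -> liftD (x * y)%g = (liftD x * liftD y)%g.
Proof.
move=> Px Py; have [[Dx ex] [Dy ey]] := (liftDP Px, liftDP Py).
by rewrite -[in LHS]ex -[in LHS]ey -prLM liftDK ?groupM.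
Qed.

Lemma act_action_D : lin_action D act.
Proof. exact: lin_actionS sDZ act_action. Qed.

Lemma actL_action_P : lin_action P actL.
Proof. exact: lin_actionS sPG actL_action. Qed.

Lemma T_actL t x : x \in G -> t \in T -> actL x t \in T.
Proof.
move=> Gx /right_endoP Ht; apply/right_endoP=> y Hy.
by rewrite -act_LRC // Ht.
Qed.

Lemma T_act t z : z \in Z -> t \in T -> act z t = actL (prL c z) t.
Proof. by move=> Zz /right_endoP Ht; rewrite act_LR // Ht ?prR_mem. Qed.

Lemma traceR_fix s (E : {group zT}) : E \subset Z -> {in E, forall z, act z s = s} ->
  {in E, forall z, actL (prL c z) (traceR s) = traceR s}.
Proof.
by move=> /subsetP sEZ Es z Ez; rewrite -traceR_act ?Es ?sEZ.
Qed.

(** [traceR] absorbs the right component, so it turns the action of d into that of [prL c d] and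
    carries a trace from E to [D] into the trace from the projection of E to [P]. That projection is
    proper because [D] maps injectively onto [P]. *)
Lemma traceR_lower s : s \in lowD -> traceR s \in lowP.
Proof.
apply: lower_ind => E u pE _ Eu; have sED := proper_sub pE.
have sEZ := subset_trans sED sDZ; pose Q := imgroup (prLM c) E.
have QP x : x \in Q -> exists2 d, d \in E & x = prL c d by move/imsetP.
have Qm d : d \in E -> prL c d \in Q by move=> Ed; apply/imsetP; exists d.
have sQP : Q \subset P.
  by apply/subsetP=> _ /QP[d Ed ->]; rewrite prL_D ?(subsetP sED).
have Qu : {in Q, forall x, actL x (traceR u) = traceR u}.
  by move=> _ /QP[d Ed ->]; apply: traceR_fix Ed.
have -> : traceR (trace act E D u) = trace actL Q P (traceR u).
  rewrite (@trace_reindex _ _ _ actL Q P _ (mem (lcosets E D)) (fun C => prL c (repr C))) //.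
  - rewrite traceE linear_sum; apply: eq_bigr => C CE.
    have [DC _] := lcoset_repr sED CE; rewrite /= traceR_act //.
    exact: (subsetP sDZ).
  - exact: actL_action_P.
  - by move=> C CE; have [DC _] := lcoset_repr sED CE; apply: prL_D.
  - move=> C C' CE CE'; have [DC eC] := lcoset_repr sED CE.
    have [DC' eC'] := lcoset_repr sED CE'; rewrite mem_lcoset => /QP[d Ed].
    rewrite -prLV -prLM => /prL_D_inj; rewrite !groupM ?groupV //.
    move/(_ isT (subsetP sED d Ed)) => e.
    by rewrite eC eC'; apply/lcoset_eqP; rewrite mem_lcoset e.
  move=> x Px; have [Dl el] := liftDP Px.
  exists (liftD x *: E)%g; first by apply/lcosetsP; exists (liftD x).
  have lE : (liftD x *: E)%g \in lcosets E D by apply/lcosetsP; exists (liftD x).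
  have [DC eC] := lcoset_repr sED lE; have : liftD x \in (liftD x *: E)%g by apply: lcoset_refl.
  rewrite {1}eC => /lcosetP[d Ed e]; rewrite -el {1}e prLM; apply/lcosetP.
  by exists (prL c d); [exact: Qm | rewrite el].
apply: (mem_lower (act := actL) _ (traceR_mem u) Qu).
rewrite properE sQP; apply: contraL pE => /subsetP sPQ; rewrite properE negb_and negbK.
apply/orP; right; apply/subsetP=> d Dd; have /QP[d' Ed' e] := sPQ _ (prL_D Dd).
by rewrite (prL_D_inj Dd _ e) ?(subsetP sED).
Qed.

(** On [T] the right factor acts trivially, so [D] acts through [P]; a trace from Q to [P] is
    therefore the trace from the preimage of Q to [D]. *)
Lemma lowP_lowD t : t \in lowP -> t \in lowD.
Proof.
move=> lt; rewrite -[t](id_lfunE t); apply: lower_ind lt => Q u pQ Tu Qu.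
have sQP := proper_sub pQ; rewrite id_lfunE.
have EG : group_set [set d in D | prL c d \in Q].
  apply/group_setP; split=> [|x y]; first by rewrite inE group1 prL1 group1.
  by rewrite !inE => /andP[Dx Qx] /andP[Dy Qy]; rewrite !groupM // prLM groupM.
pose E := Group EG; have EP d : (d \in E) = (d \in D) && (prL c d \in Q) by rewrite inE.
have sED : E \subset D by apply/subsetP=> d; rewrite EP => /andP[].
have Eu : {in E, forall d, act d u = u}.
  move=> d; rewrite EP => /andP[Dd Qd]; rewrite T_act ?(subsetP sDZ) //; exact: Qu.
have -> : trace actL Q P u = trace act E D u.
  rewrite (@trace_reindex _ _ _ act E D _ (mem (lcosets Q P)) (fun C => liftD (repr C))) //.
  - rewrite traceE; apply: eq_bigr => C CQ; have [PC _] := lcoset_repr sQP CQ.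
    by have [Dl el] := liftDP PC; rewrite [RHS]T_act ?(subsetP sDZ) // el.
  - exact: act_action_D.
  - by move=> C CQ; have [PC _] := lcoset_repr sQP CQ; have [] := liftDP PC.
  - move=> C C' CQ CQ'; have [PC eC] := lcoset_repr sQP CQ.
    have [PC' eC'] := lcoset_repr sQP CQ'; rewrite mem_lcoset EP => /andP[_].
    have [[_ e] [_ e']] := (liftDP PC, liftDP PC').
    rewrite prLM prLV e e' -mem_lcoset => cc; rewrite eC eC'; exact/lcoset_eqP.
  move=> d Dd; have Pd := prL_D Dd; pose C := (prL c d *: Q)%g.
  have CQ : C \in lcosets Q P by apply/lcosetsP; exists (prL c d).
  exists C => //; have [PC eC] := lcoset_repr sQP CQ; have [Dl el] := liftDP PC.
  rewrite mem_lcoset EP groupM ?groupV // prLM prLV el -mem_lcoset -eC.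
  exact: lcoset_refl.
apply: (mem_lower (act := act) _ (memvf u) Eu).
rewrite properE sED; apply: contraL pQ => /subsetP sDE; rewrite properE negb_and negbK.
apply/orP; right; apply/subsetP=> x Px; have [Dl el] := liftDP Px.
by have := sDE _ Dl; rewrite EP el => /andP[].
Qed.

Lemma lowD_mulr s t : {in D, forall d, act d t = t} -> s \in lowD -> s * t \in lowD.
Proof.
move=> Dt; rewrite -[s * t]mul1r mulrA -sandwichE; apply: lower_map => [d Dd u _|u _].
  by rewrite !(sandwichE 1 t) !mul1r endm_mul ?(subsetP sDZ) // Dt.
exact: memvf.
Qed.

Lemma lowD_mull s t : {in D, forall d, act d t = t} -> s \in lowD -> t * s \in lowD.
Proof.
move=> Dt; rewrite -[t * s]mulr1 -sandwichE; apply: lower_map => [d Dd u _|u _].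
  by rewrite !(sandwichE t 1) !mulr1 endm_mul ?(subsetP sDZ) // Dt.
exact: memvf.
Qed.

Lemma T_mul s t : s \in T -> t \in T -> s * t \in T.
Proof.
move=> /right_endoP Hs /right_endoP Ht; apply/right_endoP=> y Hy.
by rewrite actR_mul // Hs ?Ht.
Qed.

Lemma lowP_mull s t : t \in T -> {in P, forall x, actL x t = t} ->
  s \in lowP -> t * s \in lowP.
Proof.
move=> Tt Pt; rewrite -[t * s]mulr1 -sandwichE.
apply: lower_map => [x Px u _|u Tu]; rewrite !(sandwichE t 1) !mulr1.
  by rewrite endm_mul ?inL_mem ?(subsetP sPG) // Pt.
exact: T_mul.
Qed.

Lemma lowP_act s x : x \in 'N_G(P)%g -> s \in lowP -> actL x s \in lowP.
Proof.
move=> /setIP[Gx Nx]; apply: lower_ind => Q u pQ Tu Qu.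
have sQP := proper_sub pQ; have aG := actL_action.
have -> : actL x (trace actL Q P u) = trace actL (Q :^ x^-1)%G P (actL x u).
  rewrite [RHS](@trace_reindex _ _ _ actL _ P _ (mem (lcosets Q P))
     (fun C => (repr C) ^ x^-1)%g) //.
  - rewrite traceE linear_sum; apply: eq_bigr => C CQ; have [PC _] := lcoset_repr sQP CQ.
    rewrite /= -!(lin_actM _ aG) ?groupJ ?groupV // ?(subsetP sPG) //.
    by rewrite conjgE invgK !mulgA mulgKV.
  - exact: actL_action_P.
  - by rewrite -(normP (groupVr Nx)) conjSg.
  - move=> _ /imsetP[q Qq ->]; have Gq : q \in G by rewrite (subsetP sPG) ?(subsetP sQP).
    rewrite -(lin_actM _ aG) ?groupJ ?groupV // conjgE invgK !mulgA mulgKV.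
    by rewrite (lin_actM _ aG) // Qu.
  - by move=> C CQ; have [PC _] := lcoset_repr sQP CQ; rewrite memJ_norm ?groupV.
  - move=> C C' CQ CQ'; have [PC eC] := lcoset_repr sQP CQ.
    have [PC' eC'] := lcoset_repr sQP CQ'; rewrite mem_lcoset -conjVg -conjMg memJ_conjg.
    by rewrite -mem_lcoset => cc; rewrite eC eC'; apply/lcoset_eqP.
  move=> y Py; have Py' : (y ^ x)%g \in P by rewrite memJ_norm.
  pose C := ((y ^ x) *: Q)%g; have CQ : C \in lcosets Q P by apply/lcosetsP; exists (y ^ x)%g.
  exists C => //; have [PC eC] := lcoset_repr sQP CQ.
  rewrite mem_lcoset -[y](conjgK x) -conjVg -conjMg memJ_conjg -mem_lcoset -eC.
  exact: lcoset_refl.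
apply: mem_lower; last 2 first.
- exact: T_actL.
- move=> _ /imsetP[q Qq ->]; have Gq : q \in G by rewrite (subsetP sPG) ?(subsetP sQP).
  rewrite -(lin_actM _ aG) ?groupJ ?groupV // conjgE invgK !mulgA mulgKV.
  by rewrite (lin_actM _ aG) // Qu.
by rewrite -(normP (groupVr Nx)) properJ.
Qed.

(** * The slash map and the trace form of the slashed module *)

Variables (e : grpalg k gT) (f : grpalg k hT).
Hypotheses (be : block 'C_G(P) e) (bf : block 'C_H(R) f).

Local Notation eps := (lop e * rop f).

Variable N : {group zT}.
Hypothesis memN : forall z, (z \in N) =
  [&& z \in Z, z \in 'N(D)%g, gconj (prL c z) e == e & gconj (prR c z) f == f].
Variable MP : gmod k N.

Local Notation actN := (gact (endm MP)).
Local Notation lopP := (gop MP (inL c) 'C_G(P)).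

(** [th] abstracts the passage from End_k(M) to the endomorphisms of its cut by [eps], then to the
    Brauer quotient at [D], then to End_k(M_P). It is defined on all of End_k(M) but meaningful on
    D-fixed elements only, and it is multiplicative only with [eps] inserted between the factors. *)
Variable th : 'Hom(S, 'End(MP)).
Hypothesis th_lower : forall y, y \in lowD -> th y = 0.
Hypothesis th_ker : forall y, {in D, forall d, act d y = y} -> th y = 0 ->
  eps * y * eps \in lowD.
Hypothesis th_sur : forall t, exists y, {in D, forall d, act d y = y} /\ th y = t.
Hypothesis thM : forall y y', {in D, forall d, act d y = y} ->
  {in D, forall d, act d y' = y'} -> th (y * eps * y') = th y * th y'.
Hypothesis th_epsl : forall y, {in D, forall d, act d y = y} -> th (eps * y) = th y.
Hypothesis th_epsr : forall y, {in D, forall d, act d y = y} -> th (y * eps) = th y.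
Hypothesis th_act : {in N, forall z y, {in D, forall d, act d y = y} ->
  th (act z y) = actN z (th y)}.
Hypothesis th_gact : {in 'C_Z(D), forall z, th (gact M z) = gact MP z}.

(** A trace form for M relative to [D], as in Higman's criterion; up to proper traces it is
    supported on the cut by [eps]. *)
Variable psi : S.
Hypothesis psi_fix : {in D, forall d, act d psi = psi}.
Hypothesis psi_eps : psi - eps * psi \in lowD.
Hypothesis psi_trace : trace act D Z psi = 1.

Hypothesis T_brauer : forall t, t \in T -> {in P, forall x, actL x t = t} ->
  exists2 a, a \in kspan k 'C_G(P) & t - lop a \in lowP.
Hypothesis T_faithful : forall a, a \in kspan k 'C_G(P) -> a * e = a ->
  lop a \in lowP -> a = 0.

Lemma kspan_cent_sub : (kspan k 'C_G(P)%g <= kspan k G)%VS.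
Proof. by apply: kspanS; apply: subsetIl. Qed.

Lemma left_block_kspan : e \in kspan k G. Proof. exact: subvP kspan_cent_sub _ (block_kspan be). Qed.

Lemma right_block_kspan : f \in kspan k H.
Proof. by apply: subvP (block_kspan bf); apply: kspanS; apply: subsetIl. Qed.

Lemma eC a : a \in kspan k 'C_G(P) -> e * a = a * e.
Proof. exact: center_commute (block_center be). Qed.

Lemma stab_subZ : N \subset Z.
Proof. by apply/subsetP=> z; rewrite memN => /andP[]. Qed.

Lemma N_norm z : z \in N -> z \in 'N(D)%g.
Proof. by rewrite memN => /and4P[]. Qed.

Lemma eps_fixN z : z \in N -> act z eps = eps.
Proof.
rewrite memN => /and4P[Zz _ /eqP ez /eqP fz].
by rewrite endm_mul // act_lop // act_rop // ez fz.
Qed.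

Lemma gconj_cent (rT : finGroupType) (K Q : {group rT}) (a : grpalg k rT) x :
  a \in kspan k 'C_K(Q) -> x \in Q -> gconj x a = a.
Proof.
move=> /kspanP Ca Qx; apply/ffunP=> z; rewrite gconjE.
have [Cz|Cz] := boolP (z \in 'C(Q)%g).
  by rewrite /conjg (centP Cz) // mulgA mulVg mul1g.
have NC : x \in 'N('C(Q))%g by rewrite (subsetP (norms_cent (normG Q))).
have nC y : y \notin 'C(Q)%g -> a y = 0.
  by move=> Cy; apply: Ca; apply: contra Cy => /setIP[].
by rewrite !nC ?memJ_norm.
Qed.

Lemma sDN : D \subset N.
Proof.
apply/subsetP=> d Dd; rewrite memN (subsetP sDZ) // (subsetP (normG D)) //=.
rewrite (gconj_cent (block_kspan be)) ?prL_D // eqxx.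
by rewrite (gconj_cent (block_kspan bf)) ?prR_D // eqxx.
Qed.

Lemma eps_fix : {in D, forall d, act d eps = eps}.
Proof. by move=> d /(subsetP sDN); apply: eps_fixN. Qed.

Lemma act_epsl d y : d \in D -> act d (eps * y) = eps * act d y.
Proof. by move=> Dd; rewrite endm_mul ?(subsetP sDZ) // eps_fix. Qed.

Lemma act_epsr d y : d \in D -> act d (y * eps) = act d y * eps.
Proof. by move=> Dd; rewrite endm_mul ?(subsetP sDZ) // eps_fix. Qed.

Lemma lop_fix a : a \in kspan k 'C_G(P) -> {in D, forall d, act d (lop a) = lop a}.
Proof.
move=> Ca d Dd; rewrite act_lop ?(subsetP sDZ) //.
by rewrite (gconj_cent Ca) ?prL_D.
Qed.

Lemma lop_fixP a : a \in kspan k 'C_G(P) -> {in P, forall x, actL x (lop a) = lop a}.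
Proof.
move=> Ca x Px; rewrite act_lop ?inL_mem ?(subsetP sPG) // prL_inL.
by rewrite (gconj_cent Ca).
Qed.

Lemma cent_N x : x \in 'C_G(P) -> inL c x \in N.
Proof.
move=> Cx; have /setIP[Gx Px] := Cx; rewrite memN inL_mem // prL_inL prR_inL gconj1 eqxx.
have /centerP[_ /(_ x Cx) ->] := block_center be; rewrite eqxx !andbT /=.
apply: (subsetP (cent_sub _)); apply/centP=> d Dd; apply: (prod_eq (c := c)).
  by rewrite !prLM prL_inL (centP Px) ?prL_D.
by rewrite !prRM prR_inL mulg1 mul1g.
Qed.

Lemma cent_CD x : x \in 'C_G(P) -> inL c x \in 'C_Z(D).
Proof.
move=> /setIP[Gx Px]; rewrite inE inL_mem //=; apply/centP=> d Dd.
apply: (prod_eq (c := c)); first by rewrite !prLM prL_inL (centP Px) ?prL_D.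
by rewrite !prRM prR_inL mulg1 mul1g.
Qed.

Lemma th_lop a : a \in kspan k 'C_G(P) -> th (lop a) = lopP a.
Proof.
move=> Ca; rewrite (@gopS _ _ _ M _ _ 'C_G(P)%G) ?subsetIl // /gop linear_sum.
by apply: eq_bigr => x Cx; rewrite linearZ /= th_gact ?cent_CD.
Qed.

Lemma lopPM a a' : a \in kspan k 'C_G(P) -> a' \in kspan k 'C_G(P) ->
  lopP (a * a') = lopP a * lopP a'.
Proof. by apply: gopM; [exact: inLM | exact: cent_N]. Qed.

Lemma th1 : th 1 = 1.
Proof. by rewrite -(gact1 M : _ = 1) th_gact ?group1 // (gact1 MP). Qed.

Lemma one_fix : {in D, forall d, act d 1 = 1}.
Proof. by move=> d Dd; rewrite endm_one ?(subsetP sDZ). Qed.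

Lemma lop_ee : lop e * lop e = lop e.
Proof. by rewrite -lopM ?left_block_kspan // (block_idem be). Qed.

Lemma lop_eps : lop e * eps = eps.
Proof. by rewrite mulrA lop_ee. Qed.

Lemma lopP_e : lopP e = 1.
Proof.
rewrite -th_lop ?(block_kspan be) // -[RHS]th1 -(th_epsr one_fix) mul1r -lop_eps th_epsr //.
exact: lop_fix (block_kspan be).
Qed.

Lemma act_fixN y z : z \in 'N(D)%g -> z \in Z -> {in D, forall d, act d y = y} ->
  {in D, forall d, act d (act z y) = act z y}.
Proof.
move=> Nz Zz Dy d Dd; have Zd := subsetP sDZ d Dd.
rewrite -(lin_actM _ act_action) // -{2}(Dy (d ^ z)%g) ?memJ_norm //.
rewrite -(lin_actM _ act_action) ?groupJ //.
by rewrite conjgE !mulgA mulgV mul1g.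
Qed.

Lemma lowD_act s z : z \in 'N_Z(D)%g -> s \in lowD -> act z s \in lowD.
Proof.
move=> /setIP[Zz Nz]; apply: lower_ind => Q u pQ _ Qu.
have sQD := proper_sub pQ; have aZ := act_action.
have -> : act z (trace act Q D u) = trace act (Q :^ z^-1)%G D (act z u).
  rewrite [RHS](@trace_reindex _ _ _ act _ D _ (mem (lcosets Q D))
     (fun C => (repr C) ^ z^-1)%g) //.
  - rewrite traceE linear_sum; apply: eq_bigr => C CQ; have [PC _] := lcoset_repr sQD CQ.
    rewrite /= -!(lin_actM _ aZ) ?groupJ ?groupV // ?(subsetP sDZ) //.
    by rewrite conjgE invgK !mulgA mulgKV.
  - exact: act_action_D.
  - by rewrite -(normP (groupVr Nz)) conjSg.
  - move=> _ /imsetP[q Qq ->]; have Zq : q \in Z by rewrite (subsetP sDZ) ?(subsetP sQD).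
    rewrite -(lin_actM _ aZ) ?groupJ ?groupV // conjgE invgK !mulgA mulgKV.
    by rewrite (lin_actM _ aZ) // Qu.
  - by move=> C CQ; have [PC _] := lcoset_repr sQD CQ; rewrite memJ_norm ?groupV.
  - move=> C C' CQ CQ'; have [PC eC] := lcoset_repr sQD CQ.
    have [PC' eC'] := lcoset_repr sQD CQ'; rewrite mem_lcoset -conjVg -conjMg memJ_conjg.
    by rewrite -mem_lcoset => cc; rewrite eC eC'; apply/lcoset_eqP.
  move=> y Py; have Py' : (y ^ z)%g \in D by rewrite memJ_norm.
  pose C := ((y ^ z) *: Q)%g; have CQ : C \in lcosets Q D by apply/lcosetsP; exists (y ^ z)%g.
  exists C => //; have [PC eC] := lcoset_repr sQD CQ.
  rewrite mem_lcoset -[y](conjgK z) -conjVg -conjMg memJ_conjg -mem_lcoset -eC.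
  exact: lcoset_refl.
apply: mem_lower; last 2 first.
- exact: memvf.
- move=> _ /imsetP[q Qq ->]; have Zq : q \in Z by rewrite (subsetP sDZ) ?(subsetP sQD).
  rewrite -(lin_actM _ aZ) ?groupJ ?groupV // conjgE invgK !mulgA mulgKV.
  by rewrite (lin_actM _ aZ) // Qu.
by rewrite -(normP (groupVr Nz)) properJ.
Qed.

Lemma prL_normD z : z \in 'N(D)%g -> prL c z \in 'N(P)%g.
Proof.
move=> Nz; rewrite inE; apply/subsetP=> _ /imsetP[x Px ->].
have [Dl el] := liftDP Px; rewrite -el -prLJ prL_D //.
by rewrite memJ_norm.
Qed.

Lemma prR_normD z : z \in 'N(D)%g -> prR c z \in 'N(R)%g.
Proof.
move=> Nz; rewrite inE; apply/subsetP=> _ /imsetP[x Rx ->].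
move: Rx; rewrite defR => /imsetP[d Dd ->]; rewrite -prRJ.
by rewrite -defR prR_D // memJ_norm.
Qed.

(** An element normalising [D] but not in [N] moves [e] or [f] to another block of the same
    centraliser algebra, and distinct blocks are orthogonal. *)
Lemma eps_orth z s : z \in 'N_Z(D)%g -> z \notin N -> eps * act z (eps * s) = 0.
Proof.
move=> /setIP[Zz Nz] nNz; rewrite endm_mul // mulrA.
suff -> : eps * act z eps = 0 by rewrite mul0r.
rewrite endm_mul // act_lop // act_rop //.
have NL : prL c z \in 'N('C_G(P))%g.
  apply: mem_norm_cent.
  by rewrite inE prL_mem ?prL_normD.
have NR : prR c z \in 'N('C_H(R))%g.
  apply: mem_norm_cent.
  by rewrite inE prR_mem ?prR_normD.
have Gez : gconj (prL c z) e \in kspan k G.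
  by rewrite mem_kspan_gconj ?left_block_kspan // (subsetP (normG G)) ?prL_mem.
have Hfz : gconj (prR c z) f \in kspan k H.
  by rewrite mem_kspan_gconj ?right_block_kspan // (subsetP (normG H)) ?prR_mem.
have -> : lop e * rop f * (lop (gconj (prL c z) e) * rop (gconj (prR c z) f)) =
   lop (e * gconj (prL c z) e) * rop (f * gconj (prR c z) f).
  rewrite lopM ?left_block_kspan // ropM ?right_block_kspan // -!mulrA; congr (_ * _).
  by rewrite !mulrA lop_ropC.
have [ee|e0] := block_gconj_orth be NL; last by rewrite e0 gop0 mul0r.
have [ff|f0] := block_gconj_orth bf NR; last by rewrite f0 gop0 mulr0.
by case/negP: nNz; rewrite memN Zz Nz ee ff !eqxx.
Qed.

Lemma epspsi_fix : {in D, forall d, act d (eps * psi) = eps * psi}.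
Proof. by move=> d Dd; rewrite endm_mul ?(subsetP sDZ) // eps_fix ?psi_fix. Qed.

Lemma th_act_psi z : z \in 'N_Z(D)%g ->
  th (act z psi) = if z \in N then actN z (th psi) else 0.
Proof.
move=> NZz; have /setIP[Zz Nz] := NZz; case: ifPn => [Nz'|Nz']; first exact: th_act.
have -> : th (act z psi) = th (act z (eps * psi)).
  apply/eqP; rewrite -subr_eq0 -!linearB; apply/eqP/th_lower.
  exact: lowD_act.
rewrite -th_epsl; last exact: act_fixN epspsi_fix.
by rewrite eps_orth // linear0.
Qed.

(** Modulo proper traces, 1 is the trace of [psi] from [D] to N_Z(D). Under [th] the cosets outside
    [N] disappear, because there [eps] is moved to an orthogonal idempotent. *)
Lemma normal_N_trace : trace actN D N (th psi) = 1.
Proof.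
have := trace_normaliser (U := fullv) act_action sDZ psi_fix (fun _ _ _ _ => memvf _) (memvf _).
move/th_lower; rewrite linearB /= psi_trace th1 => /eqP; rewrite subr_eq0 => /eqP->.
rewrite !traceE linear_sum [RHS](bigID (mem (lcosets D N))) /= [X in _ = _ + X]big1 ?addr0.
  apply: eq_big => [C|C CN]; last first.
    have [NC _] := lcoset_repr sDN CN; rewrite th_act_psi ?NC //.
    by rewrite inE (subsetP stab_subZ) ?N_norm.
  apply/idP/andP=> [CN|[]//]; split=> //; case/lcosetsP: CN => z Nz ->.
  by apply/lcosetsP; exists z => //; rewrite inE (subsetP stab_subZ) ?N_norm.
move=> C /andP[CZ CN]; have sDNZ : D \subset 'N_Z(D)%g by rewrite subsetI sDZ normG.
have [NC eC] := lcoset_repr sDNZ CZ; rewrite th_act_psi //; case: ifPn => // Nr.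
by case/negP: CN; apply/lcosetsP; exists (repr C).
Qed.

(* D acts on M_P by central automorphisms, i.e. by scalars of p-power order. *)
Lemma D_trivial d : d \in D -> gact MP d = 1.
Proof.
move=> Dd; have Nd := subsetP sDN d Dd.
have [t|s es] := @commute_all_scalar _ _ (gact MP d).
  apply/endm_commute=> //; have [y [Dy <-]] := th_sur t.
  by rewrite -th_act ?Dy.
have [z0|/eqP nz] := eqVneq (1 : 'End(MP)) 0; first by rewrite es z0 scaler0.
suff s1 : s = 1 by rewrite es s1 scale1r.
have dn n : gact MP (d ^+ n)%g = s ^+ n *: (1 : 'End(MP)).
  elim: n => [|n IHn]; first by rewrite scale1r; apply: (gact1 MP).
  by rewrite expgS gactMr ?groupX // es IHn -lfun_scalerAl mul1r scalerA exprS.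
apply: (pgroup_root1 charkp pD).
have: s ^+ #|D| *: (1 : 'End(MP)) = 1.
  have d1 : (d ^+ #|D|)%g = 1%g by apply/eqP; rewrite -order_dvdn order_dvdG.
  by rewrite -dn d1; apply: (gact1 MP).
move/eqP; rewrite -[X in _ == X]scale1r -subr_eq0 -scalerBl scaler_eq0 subr_eq0.
by case/orP=> [/eqP//|/eqP].
Qed.

Lemma tau_fix s : {in D, forall d, act d s = s} ->
  {in P, forall x, actL x (traceR s) = traceR s}.
Proof.
move=> Ds x Px; have [Dl el] := liftDP Px; rewrite -{1}el.
by rewrite -traceR_act ?Ds // (subsetP sDZ).
Qed.

Lemma inR_N y : y \in 'C_H(R) -> inR c y \in N.
Proof.
move=> Cy; have /setIP[Hy Ry] := Cy; rewrite memN inR_mem // prL_inR prR_inR gconj1 eqxx.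
have /centerP[_ /(_ y Cy) ->] := block_center bf; rewrite eqxx !andbT /=.
apply: (subsetP (cent_sub _)); apply/centP=> d Dd; apply: (prod_eq (c := c)).
  by rewrite !prLM prL_inR mulg1 mul1g.
by rewrite !prRM prR_inR (centP Ry) ?prR_D.
Qed.

(** This is projectivity of M_P over kC_H(R), in Higman's form. A conjugate of (1, y) lying in [D]
    has trivial left component and is therefore trivial, so [trace_free] applies to the trace form
    [th psi]. *)
Lemma free_right : exists s, 1 = \sum_(y in 'C_H(R)) actN (inR c y) s.
Proof.
have [||||s es] := @trace_free k _ zT D N actN (th psi) hT 'C_H(R) (inR c)
  (gact_action (endm MP)) sDN.
- by move=> d Dd; rewrite -th_act ?psi_fix // (subsetP sDN).
- by move=> x y _ _; apply: inRM.
- exact: inR_N.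
- move=> z y Nz Cy Dyz; have e1 : (inR c y ^ z)%g = 1%g.
    by apply: prL_inj => //; rewrite prLJ prL_inR conj1g.
  by rewrite -(prR_inR c y) -[inR c y](conjgK z) e1 conj1g prR1.
by exists s; rewrite -normal_N_trace es.
Qed.

(* An endomorphism is a trace over C_H(R); it lifts to the trace over H of an element of *)
(* End_k(M)^D, the H-orbits not fixed by D contributing proper traces only. *)
Lemma right_endo_MP (t : 'End(MP)) : {in 'C_H(R), forall y, actN (inR c y) t = t} ->
  exists2 a, a \in kspan k 'C_G(P) & t = lopP a.
Proof.
move=> Ct; have [s0 es0] := free_right.
have [y1 [Dy1 ey1]] := th_sur (t * s0).
pose y := eps * y1 * eps.
have Dy : {in D, forall d, act d y = y}.
  by move=> d Dd; rewrite act_epsr // act_epsl // Dy1.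
have ey : th y = t * s0.
  rewrite th_epsr ?th_epsl //.
  by move=> d Dd; rewrite act_epsl // Dy1.
have [a Ca la] := T_brauer (traceR_mem y) (tau_fix Dy).
exists a => //.
have : th (traceR y - lop a) = 0 by apply/th_lower/lowP_lowD.
rewrite linearB /= th_lop // => /eqP; rewrite subr_eq0 => /eqP <-.
have Dty : {in D, forall d, act d (traceR y) = traceR y}.
  by move=> d Dd; rewrite T_act ?traceR_mem ?(subsetP sDZ) // tau_fix ?prL_D.
rewrite -(th_epsr Dty) -th_epsl; last first.
  by move=> d Dd; rewrite act_epsr // Dty.
pose F h := eps * actR h y * eps.
have RV d h : d \in D -> h \in H -> (prR c d * h * (prR c d)^-1)%g \in H.
  by move=> Dd Hh; rewrite !groupM ?groupV ?prR_mem ?(subsetP sDZ).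
have : \sum_(h in H) F h - \sum_(h in H | [forall d in D,
    (prR c d * h * (prR c d)^-1)%g == h]) F h \in lowD.
  apply: (@orbit_sum_lower k _ zT act D hT (fun d h => prR c d * h * (prR c d)^-1)%g
    (mem H) F fullv act_action_D)
    => [h|d d' _ _ h|d Dd h|d Dd h Hh|h _].
  - by rewrite prR1 invg1 mulg1 mul1g.
  - by rewrite !prRM invMg !mulgA.
  - exact: RV.
  - rewrite /F act_epsr // act_epsl //; congr (_ * _ * _).
    have Zd := subsetP sDZ d Dd.
    rewrite -(lin_actM _ act_action) ?inR_mem // -{1}(Dy d Dd).
    rewrite -(lin_actM _ act_action) ?inR_mem ?RV //; congr (act _ y).
    apply: (prod_eq (c := c)); first by rewrite !prLM !prL_inR mulg1 mul1g.
    by rewrite !prRM !prR_inR mulgKV.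
  - exact: memvf.
have <- : eps * (traceR y * eps) = \sum_(h in H) F h.
  by rewrite traceRE [X in _ * X]mulr_suml [LHS]mulr_sumr; apply: eq_bigr => h _; rewrite /F mulrA.
move/th_lower; rewrite linearB /= => /eqP; rewrite subr_eq0 => /eqP->.
rewrite (eq_bigl (mem 'C_H(R)%g)) => [|h]; last first.
  rewrite /= inE; case Hh: (h \in H) => //=; apply/forall_inP/centP=> [hD x|hR d Dd].
    rewrite defR => /imsetP[d Dd ->]; have /eqP e1 := hD d Dd.
    by rewrite /commute -{1}e1 mulgKV.
  by rewrite -hR ?prR_D // mulgK.
(* As t is fixed by C_H(R), it can be moved inside the trace of [s0], whose value is 1. *)
have eyt : t = \sum_(h in 'C_H(R)) actN (inR c h) (t * s0).
  rewrite -[LHS]mulr1 {1}es0 mulr_sumr; apply: eq_bigr => h Ch.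
  by rewrite endm_mul ?inR_N // Ct.
rewrite [LHS]eyt linear_sum; apply: eq_bigr => h Ch.
have Dhy : {in D, forall d, act d (actR h y) = actR h y}.
  by apply: act_fixN => //; [exact: N_norm (inR_N Ch) | apply: inR_mem; case/setIP: Ch].
rewrite /= /F th_epsr ?th_epsl // ?th_act ?inR_N // ?ey //.
by move=> d Dd; rewrite act_epsl // Dhy.
Qed.

(** Translating the trace over [H] by x gives a sum over the elements (x, h). For d in [D], left
    multiplication by d sends (x, h) to (x, h') d', where d' is the lift to [D] of the conjugate of
    d by x. This defines a twisted action of [D] on [H], whose fixed points are the h for which (x,
    h) normalises [D]. *)
Lemma sum_translate_lower x s : x \in 'N_G(P)%g -> {in D, forall d, act d s = s} ->
  eps * actL x (traceR s)
   - \sum_(h in H | (inL c x * inR c h)%g \in 'N(D)%g)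
       eps * act (inL c x * inR c h)%g s \in lowD.
Proof.
move=> /setIP[Gx Nx] Ds.
have Pd d : d \in D -> (prL c d ^ x)%g \in P by move=> Dd; rewrite memJ_norm ?prL_D.
pose d' d := liftD (prL c d ^ x)%g.
have d'D d : d \in D -> d' d \in D by move=> Dd; have [] := liftDP (Pd d Dd).
have d'L d : d \in D -> prL c (d' d) = (prL c d ^ x)%g by move=> Dd; have [] := liftDP (Pd d Dd).
have RV d h : d \in D -> h \in H -> (prR c d * h * (prR c (d' d))^-1)%g \in H.
  by move=> Dd Hh; rewrite !groupM ?groupV ?prR_mem ?(subsetP sDZ) ?d'D.
pose F h := eps * act (inL c x * inR c h)%g s.
have comm d h : d \in D -> (d * (inL c x * inR c h) =
    inL c x * inR c (prR c d * h * (prR c (d' d))^-1) * d' d)%g.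
  move=> Dd; apply: (prod_eq (c := c)).
    by rewrite !prLM prL_inL !prL_inR !mulg1 d'L // conjgE !mulgA mulgV mul1g.
  by rewrite !prRM !prR_inL !prR_inR !mul1g mulgKV.
have : \sum_(h in H) F h - \sum_(h in H | [forall d in D,
    (prR c d * h * (prR c (d' d))^-1)%g == h]) F h \in lowD.
  apply: (@orbit_sum_lower k _ zT act D hT (fun d h => prR c d * h * (prR c (d' d))^-1)%g
    (mem H) F fullv act_action_D)
    => [h|d1 d2 D1 D2 h|d Dd h|d Dd h Hh|h _].
  - rewrite /d' prL1 conj1g -{1}(prL1 c) liftDK ?group1 // prR1 invg1 mulg1 mul1g //.
  - by rewrite /d' prLM conjMg liftDM ?Pd // !prRM invMg !mulgA.
  - exact: RV.
  - rewrite /F act_epsl //; congr (_ * _).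
    have Zd := subsetP sDZ d Dd.
    rewrite -[in RHS](lin_actM _ act_action) ?groupM ?inL_mem ?inR_mem // comm //.
    rewrite [RHS](lin_actM _ act_action) ?groupM ?inL_mem ?inR_mem ?RV //.
      by rewrite (Ds (d' d)) ?d'D.
    by rewrite (subsetP sDZ) ?d'D.
  - exact: memvf.
have <- : eps * actL x (traceR s) = \sum_(h in H) F h.
  rewrite traceRE linear_sum [LHS]mulr_sumr; apply: eq_bigr => h Hh.
  by rewrite /F (lin_actM _ act_action) ?inL_mem ?inR_mem.
rewrite (eq_bigl (fun h => (h \in H) && ((inL c x * inR c h)%g \in 'N(D)%g))) // => h.
case Hh: (h \in H) => //=; apply/forall_inP/idP=> [hD|Nz d Dd].
  rewrite inE; apply/subsetP=> _ /imsetP[d Dd ->].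
  have /eqP hd := hD d Dd; have := comm d h Dd; rewrite hd => e1.
  by rewrite conjgE e1 mulKg d'D.
have Dz : (d ^ (inL c x * inR c h))%g \in D by rewrite memJ_norm.
have e1 : (d ^ (inL c x * inR c h))%g = d' d.
  apply: prL_D_inj; rewrite ?d'D // d'L // prLJ !prLM prL_inL prL_inR mulg1 //.
by rewrite -e1 prRJ !prRM prR_inL prR_inR mul1g conjgE invMg invgK mulKVg.
Qed.

(** * Fusion and the kernel of the action on the slashed module *)

Definition fusion_group : {group gT} := imgroup (prLM c) N.
Local Notation K := fusion_group.
Local Notation Ne := (stabiliser G P e).
Local Notation tau0 := (traceR (eps * psi)).

Lemma fusion_groupP x : reflect (exists2 z, z \in N & x = prL c z) (x \in K).
Proof. exact: imsetP. Qed.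

Lemma NeP x : (x \in Ne) = (x \in 'N_G(P)%g) && (gconj x e == e).
Proof. by rewrite inE. Qed.

Lemma sKNe : K \subset Ne.
Proof.
apply/subsetP=> x /fusion_groupP[z Nz ->]; rewrite NeP inE.
rewrite prL_normD ?N_norm // prL_mem ?(subsetP stab_subZ) //.
by move: Nz; rewrite memN => /and4P[].
Qed.

Lemma sPK : P \subset K.
Proof.
apply/subsetP=> x Px; have [Dl el] := liftDP Px; apply/fusion_groupP.
by exists (liftD x); rewrite ?(subsetP sDN).
Qed.

Lemma Ne_normal x : x \in Ne -> x \in 'N_G(P)%g. Proof. by rewrite NeP => /andP[]. Qed.

Lemma Ne_G x : x \in Ne -> x \in G. Proof. by move/Ne_normal/setIP=> []. Qed.

Lemma Ne_e x : x \in Ne -> gconj x e = e. Proof. by rewrite NeP => /andP[_ /eqP]. Qed.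

Lemma actL_lop x a : x \in G -> actL x (lop a) = lop (gconj x a).
Proof. by move=> Gx; rewrite act_lop ?inL_mem // prL_inL. Qed.

Lemma actL_mul x s t : x \in G -> actL x (s * t) = actL x s * actL x t.
Proof. by move=> Gx; rewrite endm_mul ?inL_mem. Qed.

Lemma lop_tau0 : lop e * tau0 = tau0.
Proof. by rewrite -traceR_mull ?lop_T // mulrA lop_eps. Qed.

Lemma tau0_fix : {in P, forall x, actL x tau0 = tau0}.
Proof. exact: tau_fix epspsi_fix. Qed.

(** After [sum_translate_lower] only pairs (x, h) normalising [D] are left; none of them lies in
    [N], as x is not in its image, so [eps_orth] kills every term. *)
Lemma th_actL_tau0 x : x \in Ne -> x \notin K -> th (actL x tau0) = 0.
Proof.
move=> Nex nKx; have Gx := Ne_G Nex; have NPx := Ne_normal Nex.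
have := th_lower (sum_translate_lower NPx epspsi_fix).
rewrite [X in _ - X]big1 ?subr0 => [|h /andP[Hh Nz]]; last first.
  apply: eps_orth; first by rewrite inE Nz groupM ?inL_mem ?inR_mem.
  apply: contra nKx => Nz'; apply/fusion_groupP; exists (inL c x * inR c h)%g => //.
  by rewrite prLM prL_inL prL_inR mulg1.
rewrite th_epsl // => d Dd; rewrite -(lin_actM _ act_action) ?inL_mem ?(subsetP sDZ) //.
have Pdx : (prL c d ^ x)%g \in P by rewrite memJ_norm ?prL_D //; case/setIP: NPx.
rewrite act_LR ?groupM ?inL_mem ?(subsetP sDZ) // prLM prL_inL prRM prR_inL mulg1.
have /right_endoP-> := traceR_mem (eps * psi); rewrite ?prR_mem ?(subsetP sDZ) //.
have -> : (prL c d * x = x * prL c d ^ x)%g by rewrite conjgE !mulgA mulgV mul1g.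
by rewrite (lin_actM _ actL_action) ?(subsetP sPG _ Pdx) // tau0_fix.
Qed.

(** Start from 1 as the trace from [P] to [G] of [traceR psi], restrict to N_G(P) modulo proper
    traces, and multiply by [e]: since [tau0] is fixed by [e], elements of N_G(P) moving [e] to an
    orthogonal block contribute 0, and the trace over the stabiliser of [e] remains. *)
Lemma trace_Ne_lower : lop e - trace actL P Ne tau0 \in lowP.
Proof.
pose tau := traceR psi.
(* A representative of a coset of [P] in [G] paired with an arbitrary h in [H] runs through a
   transversal of [D] in [Z], since [D] projects isomorphically onto [P]. *)
have tr1 : trace actL P G tau = 1.
  rewrite -psi_trace (@trace_reindex _ _ _ act D Z _
    [pred Bh : {set gT} * hT | (Bh.1 \in lcosets P G) && (Bh.2 \in H)]
    (fun Bh => inL c (repr Bh.1) * inR c Bh.2)%g) //.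
  - rewrite traceE (eq_bigr (fun B => \sum_(h in H) act (inL c (repr B) * inR c h)%g psi)).
      by rewrite pair_big.
    move=> B BP; have [GB _] := lcoset_repr sPG BP.
    rewrite /tau traceRE linear_sum; apply: eq_bigr => h Hh.
    by rewrite (lin_actM _ act_action) ?inL_mem ?inR_mem.
  - exact: act_action.
  - move=> [B h] /andP[/= BP Hh]; have [GB _] := lcoset_repr sPG BP.
    by rewrite groupM ?inL_mem ?inR_mem.
  - move=> [B h] [B' h'] /andP[/= BP Hh] /andP[/= BP' Hh'].
    have [GB eB] := lcoset_repr sPG BP; have [GB' eB'] := lcoset_repr sPG BP'.
    case/lcosetP=> d Dd ed.
    have eBB : B = B'.
      rewrite eB eB'; apply/lcoset_eqP/lcosetP; exists (prL c d); first exact: prL_D.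
      by have := congr1 (prL c) ed; rewrite !prLM !prL_inL !prL_inR !mulg1.
    have d1 : d = 1%g.
      apply: prL_inj => //; have := congr1 (prL c) ed.
      rewrite !prLM !prL_inL !prL_inR !mulg1 eBB => /eqP.
      by rewrite -{1}[repr B']mulg1 (inj_eq (mulgI _)) eq_sym => /eqP.
    have := congr1 (prR c) ed.
    by rewrite d1 mulg1 !prRM !prR_inL !prR_inR !mul1g eBB => ->.
  move=> z Zz; pose B := (prL c z *: P)%g.
  have BP : B \in lcosets P G by apply/lcosetsP; exists (prL c z); rewrite ?prL_mem.
  have [GB eB] := lcoset_repr sPG BP.
  have : prL c z \in B by apply: lcoset_refl.
  rewrite eB => /lcosetP[x Px ex]; have [Dl el] := liftDP Px.
  exists (B, prR c z * (prR c (liftD x))^-1)%g.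
    by rewrite /= BP groupM ?groupV ?prR_mem //; apply: (subsetP sDZ).
  apply/lcosetP; exists (liftD x) => //; apply: (prod_eq (c := c)).
    by rewrite !prLM prL_inL prL_inR mulg1 el.
  by rewrite !prRM prR_inL prR_inR mul1g mulgKV.
have Ptau : {in P, forall x, actL x tau = tau} by apply: tau_fix psi_fix.
have := trace_normaliser (U := T) actL_action sPG Ptau _ (traceR_mem psi).
rewrite -/tau tr1 => /(_ (fun x Gx u => T_actL Gx)).
have Ce := block_kspan be.
move/(lowP_mull (lop_T e) (lop_fixP Ce)); rewrite mulrBr mulr1.
have tau0l : tau - tau0 \in lowP by rewrite -linearB; apply: traceR_lower.
suff: lop e * trace actL P 'N_G(P) tau - trace actL P Ne tau0 \in lowP.
  by move=> l1 l2; have := memvD l2 l1; rewrite addrA subrK.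
have sPN : P \subset 'N_G(P)%g by rewrite subsetI sPG normG.
have sPNe := subset_trans sPK sKNe.
rewrite !traceE [X in X - _]mulr_sumr (bigID (mem (lcosets P Ne))) /= addrAC memvD //.
  rewrite (eq_bigl (mem (lcosets P Ne))) => [|C].
    rewrite -sumrB; apply: memv_suml => C CNe; have [NC _] := lcoset_repr sPNe CNe.
    have GC := Ne_G NC.
    rewrite -[X in _ - actL _ X]lop_tau0 actL_mul // actL_lop // Ne_e // -mulrBr -linearB.
    apply: lowP_mull (lop_T e) (lop_fixP Ce) _; apply: lowP_act tau0l.
    exact: Ne_normal.
  apply/andP/idP=> [[]//|CNe]; split=> //; case/lcosetsP: CNe => x Nx ->.
  by apply/lcosetsP; exists x => //; apply: Ne_normal.
apply: memv_suml => C /andP[CN CNe]; have [NC eC] := lcoset_repr sPN CN.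
have GC : repr C \in G by case/setIP: NC.
rewrite -[X in X \in _]subr0 -[X in _ - X](_ : lop e * actL (repr C) tau0 = 0).
  rewrite -mulrBr -linearB; apply: lowP_mull (lop_T e) (lop_fixP Ce) _.
  exact: lowP_act.
rewrite -lop_tau0 actL_mul // mulrA actL_lop // -lopM ?left_block_kspan //; last first.
  by rewrite mem_kspan_gconj ?left_block_kspan // (subsetP (normG G)).
have [ee|e0] := block_gconj_orth be (mem_norm_cent NC); last by rewrite e0 gop0 mul0r.
by case/negP: CNe; apply/lcosetsP; exists (repr C); rewrite // NeP NC ee eqxx.
Qed.

Local Notation eK := (trace actL P K tau0).
Local Notation kC := (kspan k 'C_G(P)%g).

Lemma sKG : K \subset G. Proof. by apply/subsetP=> x /(subsetP sKNe)/Ne_G. Qed.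

Lemma eK_T : eK \in T.
Proof.
rewrite traceE; apply: memv_suml => C CP; have [KC _] := lcoset_repr sPK CP.
by apply: T_actL (traceR_mem _); apply: (subsetP sKG).
Qed.

Lemma eK_fix : {in K, forall x, actL x eK = eK}.
Proof.
move=> x Kx; apply: (@trace_fixed _ _ _ actL P K) => //; last exact: tau0_fix.
  exact: lin_actionS sKG actL_action.
exact: sPK.
Qed.

Lemma lop_eK : lop e * eK = eK.
Proof.
rewrite traceE mulr_sumr; apply: eq_bigr => C CP; have [KC _] := lcoset_repr sPK CP.
have NC := subsetP sKNe _ KC; have GC := Ne_G NC.
by rewrite -{2}lop_tau0 actL_mul // actL_lop // Ne_e.
Qed.

(** By [trace_Ne_lower] the image of [e] is that of the trace of [tau0] over the whole stabiliser,
    and [th] kills the cosets outside [K]. *)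
Lemma th_eK : th eK = th (lop e).
Proof.
have /lowP_lowD/th_lower := trace_Ne_lower; rewrite linearB /= => /eqP.
rewrite subr_eq0 => /eqP->; rewrite !traceE !linear_sum.
have sPNe := subset_trans sPK sKNe.
rewrite [RHS](bigID (mem (lcosets P K))) /= [X in _ = _ + X]big1 ?addr0.
  apply: eq_bigl => C; apply/idP/andP=> [CK|[]//]; split=> //.
  case/lcosetsP: CK => x Kx ->; apply/lcosetsP; exists x => //.
  exact: (subsetP sKNe).
move=> C /andP[CN CK]; have [NC eC] := lcoset_repr sPNe CN; apply: th_actL_tau0 => //.
by apply: contra CK => KC; apply/lcosetsP; exists (repr C).
Qed.

Lemma th_actL_eK x : x \in Ne -> x \notin K -> th (actL x eK) = 0.
Proof.
move=> Nx Kx; rewrite traceE !linear_sum big1 // => C CP.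
have [KC _] := lcoset_repr sPK CP; have NC := subsetP sKNe _ KC.
rewrite /= -(lin_actM _ actL_action) ?Ne_G //.
by rewrite th_actL_tau0 // ?groupMr // groupM.
Qed.

Lemma eK_kC : exists v, [/\ v \in kC, v * e = v & eK - lop v \in lowP].
Proof.
have [|a Ca la] := T_brauer eK_T; first by move=> x Px; rewrite eK_fix ?(subsetP sPK).
have Ce := block_kspan be; exists (e * a); split; first exact: kspanM.
  by rewrite -eC ?kspanM // mulrA (block_idem be).
have Ga : a \in kspan k G by apply: subvP kspan_cent_sub _ Ca.
rewrite lopM ?left_block_kspan // -{1}lop_eK -mulrBr.
exact: lowP_mull (lop_T e) (lop_fixP Ce) la.
Qed.

Lemma kspan_cent_mem a : a \in kC -> a \in kspan k G. Proof. exact: (subvP kspan_cent_sub). Qed.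

(** If a acts as 0 on M_P, then [th_ker] makes the operator a eps a proper trace over [D]. The
    elements of [N] fix [eps], so each term of a e_K is [traceR] of a eps times a D-fixed element,
    hence a proper trace over [P]. *)
Lemma annihilator_eK a : a \in kC -> a * e = a -> lopP a = 0 -> lop a * eK \in lowP.
Proof.
move=> Ca ae La; have Ce := block_kspan be.
have lae : lop a * eps \in lowD.
  have := th_ker (lop_fix Ca); rewrite th_lop // => /(_ La).
  have e1 : eps * lop a = lop a * rop f.
    by rewrite -mulrA -lop_ropC mulrA -lopM ?kspan_cent_mem // eC // ae.
  have ff : rop f * rop f = rop f by rewrite -ropM ?right_block_kspan // (block_idem bf).
  have e2 : rop f * eps = eps by rewrite lop_ropC mulrA ff.
  by rewrite e1 -[lop a * _ * _]mulrA e2.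
rewrite traceE mulr_sumr; apply: memv_suml => C CP; have [KC _] := lcoset_repr sPK CP.
have /fusion_groupP[z Nz ->] := KC; rewrite -traceR_act ?(subsetP stab_subZ) //.
rewrite endm_mul ?(subsetP stab_subZ) // eps_fixN // -traceR_mull ?lop_T //.
apply: traceR_lower; rewrite mulrA; apply: lowD_mulr lae.
by apply: act_fixN psi_fix; rewrite ?N_norm ?(subsetP stab_subZ).
Qed.

(** Nondegeneracy of the form (a, b) -> (a b)(1) on kC_G(P); its symmetry is [coef1C]. *)
Lemma kC_coef0 a : a \in kC -> (forall x, x \in 'C_G(P)%g -> (a * gelt x) 1%g = 0) -> a = 0.
Proof.
move=> /kspanP Ca a0; apply/ffunP=> x; rewrite [RHS]ffunE.
have [Cx|/Ca//] := boolP (x \in 'C_G(P)%g).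
by have := a0 x^-1%g (groupVr Cx); rewrite gmul_geltr invgK mul1g.
Qed.

Lemma coef1C (a b : grpalg k gT) : (a * b) 1%g = (b * a) 1%g.
Proof.
rewrite !gmulE (reindex_inj invg_inj) /=; apply: eq_bigr => x _.
by rewrite invgK !mulg1 mulrC.
Qed.

Lemma lowP_trace_Ne t : t \in lowP -> trace actL K Ne t \in lowP.
Proof.
move=> lt; rewrite traceE; apply: memv_suml => C CK.
have [NC _] := lcoset_repr sKNe CK; apply: lowP_act => //; exact: Ne_normal.
Qed.

(* e_K corresponds to v in kC_G(P)e; u = e - v generates the annihilator of M_P, on which it is *)
(* a right identity. The symmetric form a |-> a(1) of kC_G(P) makes it a left identity too, so u *)
(* is a central idempotent and primitivity of e leaves only u = 0. *)
Lemma eK_lop_e : eK - lop e \in lowP.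
Proof.
have [v [Cv ve lv]] := eK_kC; have Ce := block_kspan be.
suff ve1 : e = v by move: lv; rewrite -ve1.
pose u := e - v.
have Cu : u \in kC by rewrite rpredB.
have ue : u * e = u by rewrite mulrBl (block_idem be) ve.
have eu : e * u = u by rewrite eC.
have Lu : lopP u = 0.
  rewrite gopB -!th_lop // -th_eK -linearB; apply/th_lower/lowP_lowD.
  exact: lv.
have annv a : a \in kC -> a * e = a -> lopP a = 0 -> a * v = 0.
  move=> Ca ae La; apply: T_faithful; first exact: kspanM.
    by rewrite -mulrA ve.
  rewrite lopM ?kspan_cent_mem //; have l1 := annihilator_eK Ca ae La.
  have l2 := lowP_mull (lop_T a) (lop_fixP Ca) lv.
  by have := memvB l1 l2; rewrite mulrBr opprB addrC subrK.
have annu a : a \in kC -> a * e = a -> lopP a = 0 -> a * u = a.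
  by move=> Ca ae La; rewrite mulrBr annv // subr0 ae.
have ucu a : a \in kC -> u * a * u = u * a.
  move=> Ca; apply: annu; first exact: kspanM.
    by rewrite -mulrA -eC // mulrA ue.
  by rewrite lopPM // Lu mul0r.
(* Test the difference against the form: the coefficient at 1 of (u - e) a u x equals that of u x (u
   - e) a by symmetry, and u x (u - e) = 0 by [ucu]. *)
have cu a : a \in kC -> u * a * u = a * u.
  move=> Ca; apply/eqP; rewrite -subr_eq0; apply/eqP.
  apply: kC_coef0; first by rewrite rpredB ?kspanM.
  move=> x Cx; have Cgx := mem_kspan k Cx.
  have -> : (u * a * u - a * u) * gelt x = (u - e) * a * u * gelt x.
    by rewrite !mulrBl -[e * a * u]mulrA [e * (a * u)]eC ?kspanM // -[a * u * e]mulrA ue.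
  rewrite -mulrA coef1C mulrA.
  have -> : u * gelt x * (u - e) = 0.
    by rewrite mulrBr ucu // -[u * gelt x * e]mulrA -eC // mulrA ue subrr.
  rewrite mul0r.
  by rewrite ffunE.
have Zu : u \in 'Z(kC)%VS.
  apply/centerP; split=> // x Cx; apply/commute_gconj; have Cgx := mem_kspan k Cx.
  by rewrite -(cu _ Cgx) ucu.
have uu : u * u = u by apply: annu.
have [eu0|eu1] := block_mul_idem be Zu uu.
  by apply/eqP; rewrite -subr_eq0 -/u -eu eu0.
(* The case u = e has to be excluded: then e_K is a proper trace, so its trace from [K] to the
   stabiliser is one as well. By transitivity and [trace_Ne_lower] so is [e], against
   [T_faithful]. *)
have v0 : v = 0.
  by apply/eqP; rewrite -oppr_eq0 -(addKr e (- v)) -/u -eu eu1 addNr.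
have : lop e \in lowP.
  have : eK \in lowP by rewrite v0 gop0 subr0 in lv.
  move/lowP_trace_Ne; rewrite -trace_trans //.
  - by move=> l1; have := memvD trace_Ne_lower l1; rewrite subrK.
  - exact: lin_actionS (stabiliser_sub G P e) actL_action.
  - exact: sPK.
  - exact: sKNe.
  exact: tau0_fix.
by move/(T_faithful Ce (block_idem be)) => e0; have /eqP := block_neq0 be.
Qed.

(** Modulo proper traces a = a e agrees with a e_K, which is itself a proper trace when a
    annihilates M_P. *)
Lemma lopP_faithful a : a \in kC -> a * e = a -> lopP a = 0 -> a = 0.
Proof.
move=> Ca ae La; apply: T_faithful => //.
have l2 := lowP_mull (lop_T a) (lop_fixP Ca) eK_lop_e.
have := memvB (annihilator_eK Ca ae La) l2.
by rewrite mulrBr opprB addrC subrK -lopM ?kspan_cent_mem ?(block_kspan be) // ae.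
Qed.

(* An x outside K would move e_K to an element with th (x e_K) = 0, yet x e_K = x e = e. *)
Lemma fusion_lift x : x \in Ne -> exists2 z, z \in N & prL c z = x.
Proof.
move=> Nx; have [/fusion_groupP[z Nz ->]|nKx] := boolP (x \in K); first by exists z.
have Ce := block_kspan be; have /eqP[] := block_neq0 be.
apply: lopP_faithful => //; first exact: block_idem be.
rewrite -th_lop //.
have ele : actL x (lop e) = lop e by rewrite actL_lop ?Ne_G // Ne_e.
have : th (actL x eK - actL x (lop e)) = 0.
  by rewrite -linearB; apply/th_lower/lowP_lowD/(lowP_act (Ne_normal Nx))/eK_lop_e.
by rewrite linearB /= ele th_actL_eK // sub0r => /eqP; rewrite oppr_eq0 => /eqP.
Qed.

Lemma lop_lowD a : a \in kspan k G -> {in P, forall x, gconj x a = a} ->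
  brauer_map P a = 0 -> lop a \in lowD.
Proof.
move=> Ga Pa /(brauer_map_lower sPG Ga Pa) la; apply: lowP_lowD.
have lopE b : linfun lop b = lop b := linfunE (gop_lin M (inL c) G) b.
rewrite -lopE; apply: lower_map la => [x Px u Gu|u Gu]; rewrite !lopE.
  by rewrite gconjlE actL_lop // (subsetP sPG).
exact: lop_T.
Qed.

(** The global analogue of [free_right]: M is projective over kH because no nontrivial element of
    [H] is conjugate into [D]. *)
Lemma free_M : exists s, \sum_(y in H) actR y s = 1.
Proof.
have [|||s es] := @trace_free k _ zT D Z act psi hT H (inR c) act_action sDZ psi_fix.
- by move=> x y _ _; apply: inRM.
- exact: inR_mem.
- move=> z y Zz Hy Dyz; have e1 : (inR c y ^ z)%g = 1%g.
    by apply: prL_inj => //; rewrite prLJ prL_inR conj1g.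
  by rewrite -(prR_inR c y) -[inR c y](conjgK z) e1 conj1g prR1.
by exists s; rewrite -psi_trace es.
Qed.

Lemma core_local_data : left_local_data c 'C_G(P) Ne 'C_H(R) MP e.
Proof.
split; [exact: right_endo_MP | exact: lopP_faithful | exact: lopP_e |].
exact: fusion_lift.
Qed.

End Core.

(** * The Brauer quotient of End_kH(M) *)

Section EndoBrauer.

Variables (k : fieldType) (p : nat) (charkp : p \in [pchar k]).
Variables (gT hT zT : finGroupType) (c : prodcoord gT hT zT).
Variables (G : {group gT}) (H : {group hT}) (Z : {group zT}).
Hypothesis memZ : forall z, (z \in Z) = (prL c z \in G) && (prR c z \in H).
Variable M : gmod k Z.

Local Notation S := 'End(M).
Local Notation act := (gact (endm M)).
Local Notation actL := (fun x => act (inL c x)).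
Local Notation lop := (gop M (inL c) G).
Local Notation T := (right_endo c H M).

Variable P : {group gT}.
Hypotheses (sPG : P \subset G) (pP : p.-group P).
Local Notation lowP := (lower actL T P).
Local Notation kC := (kspan k 'C_G(P)%g).

Variable b : grpalg k gT.
Hypothesis bb : block G b.
Local Notation kGb := (kspan k G * <[b]>)%VS.

(** T splits as kGb and a complement [W] only as a bimodule: [q] need be neither multiplicative nor
    send b to 1, so q a and [lop a] are different operators, linked only by [q_lop]. The main two
    lemmas of the section pass from [q] to [lop]. *)
Variables (q : 'Hom(grpalg k gT, S)) (W : {vspace S}).
Hypothesis q_l : {in G, forall x, {in kGb, forall a,
  q (gelt x * a) = gact M (inL c x) * q a}}.
Hypothesis q_r : {in G, forall x, {in kGb, forall a,
  q (a * gelt x) = q a * gact M (inL c x)}}.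
Hypothesis q_T : T = (q @: kGb + W)%VS.
Hypothesis q_direct : forall a w, a \in kGb -> w \in W -> q a + w = 0 -> a = 0 /\ w = 0.
Hypothesis W_stab : {in P, forall x, {in W, forall w, actL x w \in W}}.
Hypothesis W_low : forall w, w \in W -> {in P, forall x, actL x w = w} -> w \in lowP.

Lemma kGbP a : reflect (a \in kspan k G /\ a * b = a) (a \in kGb).
Proof.
have [Gb cb] := centerP _ _ (block_center bb).
rewrite -limg_amulr; apply: (iffP memv_imgP) => [[a' Ga ->]|[Ga ab]].
  by rewrite amulrE -mulrA (block_idem bb) kspanM.
by exists a; rewrite ?amulrE ?ab.
Qed.

Lemma b_fix x : x \in G -> gconj x b = b.
Proof. by have [_ cb] := centerP _ _ (block_center bb); apply: cb. Qed.

Lemma bG : b \in kspan k G. Proof. exact: block_kspan bb. Qed.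

Lemma b_kGb : b \in kGb. Proof. by apply/kGbP; rewrite bG (block_idem bb). Qed.

Lemma kGb_mull a a' : a \in kspan k G -> a' \in kGb -> a * a' \in kGb.
Proof.
by move=> Ga /kGbP[Ga' ab]; apply/kGbP; rewrite kspanM // -mulrA ab.
Qed.

Lemma kGb_gconj x a : x \in G -> a \in kGb -> gconj x a \in kGb.
Proof.
move=> Gx /kGbP[Ga ab]; apply/kGbP; rewrite mem_kspan_gconj ?(subsetP (normG G)) //.
by rewrite -{1}(b_fix Gx) -gconj_mul ab.
Qed.

Lemma q_gconj x a : x \in G -> a \in kGb -> q (gconj x a) = actL x (q a).
Proof.
move=> Gx Ga; rewrite /gconj q_r ?groupV // ?kGb_mull ?mem_kspan //.
by rewrite q_l // endmE inLV.
Qed.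

Lemma q_lop a a' : a \in kspan k G -> a' \in kGb -> q (a * a') = lop a * q a'.
Proof.
move=> Ga Ga'; rewrite {1}(kspan_sum Ga) mulr_suml linear_sum mulr_suml.
apply: eq_bigr => x Gx; rewrite -scalerAl linearZ /= q_l // lfun_scalerAl //.
Qed.

Lemma q_mem a : a \in kGb -> q a \in T.
Proof. by move=> Ga; rewrite q_T -[q a]addr0 memv_add ?memv_img ?mem0v. Qed.

Lemma T_decomp t : t \in T -> exists a w, [/\ a \in kGb, w \in W & t = q a + w].
Proof.
by rewrite q_T => /memv_addP[_ /memv_imgP[a Ga ->] [w Ww ->]]; exists a, w.
Qed.

Lemma T_decomp_fix (Q : {group gT}) a w : Q \subset P -> a \in kGb -> w \in W ->
    {in Q, forall x, actL x (q a + w) = q a + w} ->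
  {in Q, forall x, gconj x a = a} /\ {in Q, forall x, actL x w = w}.
Proof.
move=> sQP Ga Ww Qt; suff QQ x : x \in Q -> gconj x a = a /\ actL x w = w.
  by split=> x /QQ[].
move=> Qx; have Px := subsetP sQP x Qx; have Gx := subsetP sPG x Px.
have := Qt x Qx; rewrite linearD /= -q_gconj // => /eqP; rewrite -subr_eq0 opprD addrACA -linearB.
move/eqP/q_direct; case=> [||/eqP + /eqP].
- by rewrite rpredB ?kGb_gconj.
- by rewrite rpredB ?W_stab.
by rewrite !subr_eq0 => /eqP-> /eqP->.
Qed.

(** The decomposition of T is stable under [P], so a trace is computed in each summand; in kGb it is
    a proper trace of group algebra elements, which the Brauer map kills. *)
Lemma lowP_decomp t : t \in lowP ->
  exists a w, [/\ a \in kGb, brauer_map P a = 0, w \in W & t = q a + w].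
Proof.
pose brl := linfun (@brauer_map k gT P).
have brE a : brl a = brauer_map P a := linfunE (brauer_map_lin P) a.
suff sub : t \in lowP -> \1%VF t \in (q @: (kGb :&: lker brl) + W)%VS.
  move/sub; rewrite id_lfunE => /memv_addP[_ /memv_imgP[a + ->] [w Ww ->]].
  rewrite memv_cap memv_ker brE => /andP[Ga /eqP a0].
  by exists a, w.
apply: lower_ind => Q u pQ Tu Qu; rewrite id_lfunE.
have sQP := proper_sub pQ.
have [a [w [Ga Ww eu]]] := T_decomp Tu; rewrite eu in Qu *.
have [Qa Qw] := T_decomp_fix sQP Ga Ww Qu.
rewrite linearD /=; apply: memv_add; last first.
  rewrite traceE; apply: memv_suml => C CQ; have [PC _] := lcoset_repr sQP CQ.
  exact: W_stab.
have -> : trace actL Q P (q a) = q (trace (@gconjl k gT) Q P a).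
  rewrite !traceE linear_sum; apply: eq_bigr => C CQ; have [PC _] := lcoset_repr sQP CQ.
  by rewrite /= gconjlE q_gconj // (subsetP sPG).
apply: memv_img; rewrite memv_cap memv_ker brE (brauer_map_trace charkp) // eqxx andbT.
rewrite traceE; apply: memv_suml => C CQ; have [PC _] := lcoset_repr sQP CQ.
by rewrite gconjlE kGb_gconj // (subsetP sPG).
Qed.

Lemma lowP_mulr s t : t \in T -> {in P, forall x, actL x t = t} ->
  s \in lowP -> s * t \in lowP.
Proof.
move=> Tt Pt; rewrite -[s * t]mul1r mulrA -(sandwichE 1 t).
apply: lower_map => [x Px u _|u Tu]; rewrite !(sandwichE 1 t) !mul1r.
  rewrite endm_mul ?Pt //; apply: (inL_mem memZ); exact: (subsetP sPG).
exact: (T_mul memZ).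
Qed.

(** Multiplying by [q b], which is fixed by [P], gives q (a b) as a proper trace. Hence br(a b) = a
    br(b) = a vanishes. *)
Lemma endo_brauer_inj a : a \in kC -> a * brauer_map P b = a -> lop a \in lowP -> a = 0.
Proof.
move=> Ca ab la.
have Ga : a \in kspan k G by apply: subvP (kspanS _ (subsetIl _ _)) _ Ca.
have Pb : {in P, forall x, gconj x b = b} by move=> x Px; rewrite b_fix ?(subsetP sPG).
have : lop a * q b \in lowP.
  apply: lowP_mulr la; first exact: q_mem b_kGb.
  by move=> x Px; rewrite -q_gconj ?Pb ?b_kGb ?(subsetP sPG).
rewrite -q_lop ?b_kGb // => /lowP_decomp[a' [w [Ga' a0 Ww /eqP]]].
rewrite -subr_eq0 opprD addrA -linearB => /eqP/q_direct; case=> [||/eqP + _].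
- by rewrite rpredB ?kGb_mull ?b_kGb.
- by rewrite rpredN.
rewrite subr_eq0 => /eqP eab; rewrite -ab -brauer_mapMl ?eab //.
by apply: subvP (kspanS _ (subsetIr _ _)) _ Ca.
Qed.

Lemma lower_kGb a a' : {in P, forall x, gconj x a' = a'} -> a' \in kspan k G ->
  a \in lower (@gconjl k gT) (kspan k G) P -> a' * a * b \in lower (@gconjl k gT) kGb P.
Proof.
move=> Pa' Ga'; rewrite -[_ * b]amulrE -[a' * a]amullE -comp_lfunE.
have Pb : {in P, forall x, gconj x b = b} by move=> x Px; rewrite b_fix ?(subsetP sPG).
apply: lower_map => [x Px u _|u Gu]; rewrite !comp_lfunE !amulrE !amullE.
  by rewrite !gconjlE !gconj_mul Pa' ?Pb.
by rewrite -mulrA !kGb_mull ?b_kGb.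
Qed.

Lemma q_lower a : a \in lower (@gconjl k gT) kGb P -> q a \in lowP.
Proof.
apply: lower_map => [x Px u Gu|]; last exact: q_mem.
by rewrite gconjlE q_gconj // (subsetP sPG).
Qed.

(** A dimension count, since [q] alone does not produce elements of the form [lop a]. With B = kC
    br(b), the map [lop] is injective on B modulo proper traces, while the P-fixed points of T lie
    in q (B b) plus proper traces. The latter sum is no larger than lop B plus proper traces, which
    is contained in the fixed points, so equality holds. *)
Lemma endo_brauer_sur t : t \in T -> {in P, forall x, actL x t = t} ->
  exists2 a, a \in kC & t - lop a \in lowP.
Proof.
pose brb := brauer_map P b; pose B := (amulr brb @: kC)%VS.
have Pb : {in P, forall x, gconj x b = b} by move=> x Px; rewrite b_fix ?(subsetP sPG).
have sCG : (kC <= kspan k G)%VS := kspanS _ (subsetIl _ _).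
have Cbr a : a \in kspan k G -> brauer_map P a \in kC.
  exact: brauer_map_kspanI.
have brbb : brb * brb = brb by rewrite -(brauer_mapM charkp pP) // (block_idem bb).
have BP a : a \in B -> a \in kC /\ a * brb = a.
  case/memv_imgP=> a' Ca ->; rewrite amulrE -mulrA brbb; split=> //.
  by rewrite kspanM // Cbr ?bG.
pose lopl : 'Hom(grpalg k gT, S) := linfun lop.
have loplE a : lopl a = lop a := linfunE (gop_lin M (inL c) G) a.
pose F := fixed actL T P.
have PC a : a \in kC -> {in P, forall x, gconj x a = a}.
  by move=> Ca x Px; apply: (gconj_cent Ca).
have lowF : (lowP <= F)%VS.
  apply/subvP=> s ls; rewrite -[s]id_lfunE; move: ls; apply: lower_ind => Q u pQ Tu Qu.
  have sQP := proper_sub pQ; rewrite id_lfunE.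
  have aP : lin_action P actL := lin_actionS sPG (actL_action memZ M).
  apply/fixedP; split; last by move=> x Px; apply: (trace_fixed aP).
  rewrite traceE; apply: memv_suml => C CQ; have [PrC _] := lcoset_repr sQP CQ.
  by apply: (T_actL memZ) => //; rewrite (subsetP sPG).
have lopF : (lopl @: B <= F)%VS.
  apply/subvP=> _ /memv_imgP[a /BP[Ca _] ->]; rewrite loplE; apply/fixedP; split.
    exact: (lop_T memZ).
  move=> x Px; have Gx := subsetP sPG x Px.
  rewrite (act_lop memZ) ?(inL_mem memZ) // prL_inL PC //.
have capB : (B :&: lker lopl = 0)%VS.
  apply/eqP; rewrite -subv0; apply/subvP=> a; rewrite memv_cap memv_ker loplE memv0.
  case/andP=> /BP[Ca ab] /eqP l0; apply/eqP/endo_brauer_inj => //.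
  by rewrite l0 mem0v.
have capL : (lopl @: B :&: lowP = 0)%VS.
  apply/eqP; rewrite -subv0; apply/subvP=> s; rewrite memv_cap memv0.
  case/andP=> /memv_imgP[a /BP[Ca ab] ->]; rewrite loplE => la.
  by rewrite (endo_brauer_inj Ca ab la) gop0.
(* In a = a b both a and the idempotent b may be replaced by their Brauer images, the differences
   being proper traces; the [W] part is a proper trace by [W_low]. *)
have FQ : (F <= q @: (amulr b @: B) + lowP)%VS.
  apply/subvP=> s /fixedP[Ts Ps]; have [a [w [Ga Ww es]]] := T_decomp Ts.
  rewrite es in Ps; have [Pa Pw] := T_decomp_fix (subxx P) Ga Ww Ps.
  have /kGbP[Ga' ab] := Ga; pose a1 := brauer_map P a.
  have Ca1 : a1 \in kC by apply: Cbr.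
  have Ga1 : a1 \in kspan k G by apply: subvP sCG _ Ca1.
  have Pbr z : z \in kspan k G -> {in P, forall x, gconj x z = z} ->
      z - brauer_map P z \in lower (@gconjl k gT) (kspan k G) P.
    move=> Gz Pz; have Cz := Cbr z Gz; have Gbr := subvP sCG _ Cz.
    apply: brauer_map_lower => //; first by rewrite rpredB.
      by move=> x Px; rewrite -(gconjlE x) linearB /= !gconjlE Pz // (PC _ Cz).
    by rewrite brauer_mapB (brauer_map_id (brauer_map_kspan P z)) subrr.
  have l1 : q ((a - a1) * b) \in lowP.
    apply: q_lower; rewrite -[a - a1]mul1r; apply: lower_kGb (Pbr a Ga' Pa).
      by move=> x _; apply: gconj_one.
    exact: kspan1.
  have l2 : q (a1 * (b - brb) * b) \in lowP.
    by apply: q_lower; apply: lower_kGb (Pbr b bG Pb); first exact: PC.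
  have -> : s = q (a1 * brb * b) + (q ((a - a1) * b) + q (a1 * (b - brb) * b) + w).
    rewrite es addrA -!linearD /=; congr (q _ + w).
    rewrite mulrBr !mulrBl -[a1 * b * b]mulrA (block_idem bb) ab.
    by rewrite [a - _ + _]addrC addrA [a1 * brb * b + _]addrC subrK addrC subrK.
  apply: memv_add; last first.
    by apply: memvD; [apply: memvD | apply: W_low].
  by apply: memv_img; rewrite -amulrE memv_img // -amulrE memv_img.
have FE : F = (lopl @: B + lowP)%VS.
  apply/eqP; rewrite eq_sym eqEdim subv_add lopF lowF /=.
  rewrite (dimv_disjoint_sum capL) limg_dim_eq //.
  apply: leq_trans (dimvS FQ) _; apply: leq_trans (dimv_add_leqif _ _) _.
  have dim_img (U V : vectType k) (h : 'Hom(U, V)) (A : {vspace U}) :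
    (\dim (h @: A) <= \dim A)%N by rewrite -[X in (_ <= X)%N](limg_ker_dim h) leq_addl.
  by rewrite leq_add2r (leq_trans (dim_img _ _ _ _)) ?dim_img.
move=> Tt Pt; have : t \in F by apply/fixedP.
rewrite FE => /memv_addP[_ /memv_imgP[a /BP[Ca _] ->] [s ls ->]].
by exists a; rewrite // loplE addrC addKr.
Qed.

End EndoBrauer.

(** * Tensor products and duals *)

Section Tensors.

Variables (k : fieldType) (A B : vectType k).

Lemma pureE (a : A) (b : B) u : pure_tens a b u = (u a : k) *: b.
Proof. exact: (linfunE (pure_lin a b)). Qed.

Lemma pure_linl (b : B) : linear (fun a : A => pure_tens a b).
Proof.
by move=> s a a'; apply/lfunP=> u; rewrite !lfun_simp !pureE linearP scalerDl scalerA.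
Qed.

Lemma pure_linr (a : A) : linear (fun b : B => pure_tens a b).
Proof.
by move=> s b b'; apply/lfunP=> u; rewrite !lfun_simp !pureE scalerDr !scalerA mulrC.
Qed.

Lemma pureZl s (a : A) (b : B) : pure_tens (s *: a) b = s *: pure_tens a b.
Proof.
by apply/lfunP=> u; rewrite scale_lfunE !pureE linearZ scalerA.
Qed.

Lemma pureZr s (a : A) (b : B) : pure_tens a (s *: b) = s *: pure_tens a b.
Proof.
by apply/lfunP=> u; rewrite scale_lfunE !pureE !scalerA mulrC.
Qed.

Lemma pure_suml (I : finType) (P : pred I) (F : I -> A) (b : B) :
  pure_tens (\sum_(i | P i) F i) b = \sum_(i | P i) pure_tens (F i) b.
Proof.
by apply/lfunP=> u; rewrite sum_lfunE pureE linear_sum scaler_suml;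
  apply: eq_bigr => i _; rewrite pureE.
Qed.

Lemma pure_sumr (I : finType) (P : pred I) (a : A) (F : I -> B) :
  pure_tens a (\sum_(i | P i) F i) = \sum_(i | P i) pure_tens a (F i).
Proof.
by apply/lfunP=> u; rewrite sum_lfunE pureE scaler_sumr;
  apply: eq_bigr => i _; rewrite pureE.
Qed.

Lemma tens_ext (V : vectType k) (g h : 'Hom(tensv A B, V)) :
  (forall a b, g (pure_tens a b) = h (pure_tens a b)) -> g = h.
Proof.
move=> gh; apply/lfunP=> t; rewrite [t]pure_decomp !linear_sum.
by apply: eq_bigr => n _; rewrite /= gh.
Qed.

Lemma tens_hom (V : vectType k) (f : A -> B -> V) :
    (forall b, linear (f^~ b)) -> (forall a, linear (f a)) ->
  exists g : 'Hom(tensv A B, V), forall a b, g (pure_tens a b) = f a b.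
Proof.
move=> fl fr.
have fE a : linfun (f a) =1 f a := linfunE (fr a).
have l2 : linear (fun a => linfun (f a)).
  by move=> s a a'; apply/lfunP=> b; rewrite !lfun_simp !fE fl.
exists (linfun (tens_elim (linfun (fun a => linfun (f a))))) => a b.
by rewrite (linfunE (tens_elim_lin _)) tens_elim_pure (linfunE l2) fE.
Qed.

Lemma quot_proj_lift (V : vectType k) (W : {vspace V}) q :
  quot_proj W (quot_lift W q) = q.
Proof. by rewrite -comp_lfunE quot_projK id_lfunE. Qed.

Lemma quot_proj_eq0 (V : vectType k) (W : {vspace V}) v :
  (quot_proj W v == 0) = (v \in W).
Proof. by rewrite -memv_ker lker_quot_proj. Qed.

Lemma quot_hom (V V' : vectType k) (W : {vspace V}) (g : 'Hom(V, V')) :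
  (W <= lker g)%VS -> forall v, (g \o quot_lift W)%VF (quot_proj W v) = g v.
Proof.
move=> Wg v; rewrite comp_lfunE; apply/eqP; rewrite -subr_eq0 -linearB -memv_ker.
by apply: (subvP Wg); rewrite -quot_proj_eq0 linearB /= quot_proj_lift subrr.
Qed.

Section Balanced.

Variables (lT : finGroupType) (L : {group lT}).
Variables (rA : lT -> 'End(A)) (lB : lT -> 'End(B)).
Local Notation rel := (tens_rel L rA lB).

Lemma tens_relP l t : l \in L ->
  quot_proj rel (tens_map (rA l) \1%VF t) = quot_proj rel (tens_map \1%VF (lB l) t).
Proof.
move=> Ll; apply/eqP; rewrite -subr_eq0 -linearB quot_proj_eq0 memvE.
apply: (sumv_sup l) => //; rewrite -memvE -opp_lfunE -add_lfunE.
exact: memv_img (memvf _).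
Qed.

Lemma tens_quot_ext (V : vectType k) (g h : 'Hom(quotv rel, V)) :
  (forall a b, g (quot_proj rel (pure_tens a b)) = h (quot_proj rel (pure_tens a b))) ->
  g = h.
Proof.
move=> gh; have e : (g \o quot_proj rel = h \o quot_proj rel)%VF.
  by apply: tens_ext => a b; rewrite comp_lfunE [RHS]comp_lfunE gh.
apply/lfunP=> q; rewrite -(quot_proj_lift q).
by rewrite -comp_lfunE e comp_lfunE.
Qed.

(* For a finite group acting on E = A (x) B with a "projectivity" operator    *)
(* sigma, the norm map identifies coinvariants with invariants.               *)
Lemma tens_norm_iso (E : vectType k) (beta : 'Hom(tensv A B, E))
    (kappa : 'Hom(E, tensv A B)) (act : lT -> 'End(E)) (sigma : 'End(E)) :
    cancel beta kappa -> cancel kappa beta -> lin_action L act ->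
    lin_action L (fun l => rA l^-1%g) ->
    {in L, forall l t, beta (tens_map \1%VF (lB l) t) =
                       act l (beta (tens_map (rA l) \1%VF t))} ->
    (forall t, \sum_(l in L) act l (sigma (act l^-1%g t)) = t) ->
  exists g : 'Hom(quotv rel, E),
    [/\ lker g = 0%VS, limg g = fixed act fullv L
      & forall t, g (quot_proj rel t) = \sum_(l in L) act l (beta t)].
Proof.
move=> bK kB aL rL bal sig; pose N : 'End(E) := \sum_(l in L) act l.
have NE t : N t = \sum_(l in L) act l t by rewrite sum_lfunE.
have Nact l t : l \in L -> N (act l t) = N t.
  move=> Ll; rewrite !NE [RHS](reindex_inj (mulIg l)) /=.
  apply: eq_big => [x|x Lx]; first by rewrite groupMr.
  by rewrite (lin_actM _ aL).
have actN l t : l \in L -> act l (N t) = N t.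
  move=> Ll; rewrite !NE linear_sum [RHS](reindex_inj (mulgI l)) /=.
  apply: eq_big => [x|x Lx]; first by rewrite groupMl.
  by rewrite (lin_actM _ aL).
have relN : (rel <= lker (N \o beta))%VS.
  apply/subv_sumP=> l Ll; apply/subvP=> _ /memv_imgP[t _ ->].
  rewrite memv_ker comp_lfunE add_lfunE opp_lfunE !linearB /= bal //.
  by rewrite Nact // subrr.
have rK l t : l \in L -> tens_map (rA l) \1%VF (tens_map (rA l^-1%g) \1%VF t) = t.
  move=> Ll; rewrite -comp_lfunE -tens_map_comp comp_lfun1l.
  have -> : (rA l \o rA l^-1 = \1)%VF.
    have [r1 rM] := rL; have := rM l^-1%g l; rewrite groupV Ll => /(_ isT isT).
    by rewrite mulVg r1 !invgK.
  by rewrite tens_map1 id_lfunE.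
have kact l t : l \in L -> quot_proj rel (kappa (act l t)) = quot_proj rel (kappa t).
  move=> Ll; pose t' := tens_map (rA l^-1%g) \1%VF (kappa t).
  have -> : t = beta (tens_map (rA l) \1%VF t') by rewrite rK ?kB.
  by rewrite -bal // !bK -tens_relP.
pose g := ((N \o beta) \o quot_lift rel)%VF.
have gE t : g (quot_proj rel t) = N (beta t) by rewrite quot_hom ?comp_lfunE.
(* The inverse of the norm on invariants is induced by [sigma]: if t is invariant, summing the
   translates of sigma t gives t back. *)
pose h := (quot_proj rel \o kappa \o sigma)%VF.
have hE t : h t = quot_proj rel (kappa (sigma t)) by rewrite !comp_lfunE.
have hg q : h (g q) = q.
  rewrite -(quot_proj_lift q); move: (quot_lift _ _) => t; rewrite gE hE NE.
  rewrite !linear_sum /= (reindex_inj invg_inj) /=.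
  rewrite -[RHS](congr1 (quot_proj rel) (bK t)) -{2}(sig (beta t)) !linear_sum /=.
  apply: eq_big => [l|l]; rewrite groupV // => Ll.
  by rewrite kact // -(kact l) // -?(lin_actM _ aL).
exists g; split.
- apply/eqP/lker0P; exact: can_inj hg.
- apply/vspaceP=> t; apply/memv_imgP/fixedP=> [[q _ ->]|[_ Lt]].
    split=> [|l Ll]; first exact: memvf.
    by rewrite -(quot_proj_lift q) gE actN.
  exists (h t); rewrite ?memvf // hE gE kB NE -[LHS]sig.
  by apply: eq_bigr => l Ll; rewrite Lt ?groupV.
by move=> t; rewrite gE NE.
Qed.

End Balanced.

End Tensors.

Section RankOne.

Variables (k : fieldType) (V : vectType k).
Local Notation dual := 'Hom(V, k^o).

Lemma rank1_lin (v : V) (u : dual) : linear (fun w : V => (u w : k) *: v).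
Proof. by move=> s w w'; rewrite linearP scalerDl -scalerA. Qed.

Definition rank1 (v : V) (u : dual) : 'End(V) := linfun (fun w : V => (u w : k) *: v).

Lemma rank1E v u w : rank1 v u w = (u w : k) *: v.
Proof. exact: (linfunE (rank1_lin v u)). Qed.

Lemma rank1_compl s v u : s * rank1 v u = rank1 (s v) u.
Proof. by apply/lfunP=> w; rewrite mul_lfunE !rank1E linearZ. Qed.

Lemma rank1_compr s v u : rank1 v u * s = rank1 v (u \o s)%VF.
Proof. by apply/lfunP=> w; rewrite mul_lfunE !rank1E comp_lfunE. Qed.

Lemma rank1_linl u : linear (fun v => rank1 v u).
Proof.
by move=> s v v'; apply/lfunP=> w; rewrite !lfun_simp !rank1E scalerDr !scalerA mulrC.
Qed.

Lemma rank1_linr v : linear (rank1 v).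
Proof.
by move=> s u u'; apply/lfunP=> w; rewrite !lfun_simp !rank1E !lfun_simp scalerDl !scalerA.
Qed.

Lemma dual_decomp (u : dual) :
  u = \sum_(n < \dim {:V}) u (vbasis {:V})`_n *: dual_coord n.
Proof.
apply/lfunP=> a; rewrite {1}(coord_vbasis (memvf a)) linear_sum sum_lfunE /=.
apply: eq_bigr => n _; rewrite linearZ scale_lfunE dual_coordE.
exact: mulrC.
Qed.

Lemma rank1_decomp (t : 'End(V)) :
  t = \sum_(n < \dim {:V}) rank1 (t (vbasis {:V})`_n) (dual_coord n).
Proof.
apply/lfunP=> w; rewrite {1}(coord_vbasis (memvf w)) linear_sum sum_lfunE /=.
by apply: eq_bigr => n _; rewrite linearZ rank1E dual_coordE.
Qed.

Lemma tens_endl : exists (beta : 'Hom(tensv V dual, 'End(V)))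
    (kappa : 'Hom('End(V), tensv V dual)),
  [/\ forall v u, beta (pure_tens v u) = rank1 v u, cancel beta kappa & cancel kappa beta].
Proof.
have [beta bE] := tens_hom rank1_linl rank1_linr.
have kl : linear (fun t : 'End(V) =>
    \sum_(n < \dim {:V}) pure_tens (t (vbasis {:V})`_n) (dual_coord n)).
  move=> s t t'; rewrite scaler_sumr -big_split; apply: eq_bigr => n _ /=.
  by rewrite !lfun_simp (pure_linl (dual_coord n)).
pose kappa := linfun (fun t : 'End(V) =>
    \sum_(n < \dim {:V}) pure_tens (t (vbasis {:V})`_n) (dual_coord n)).
have kE t : kappa t = _ := linfunE kl t.
exists beta, kappa; split=> // t; last first.
  by rewrite kE linear_sum [RHS]rank1_decomp; apply: eq_bigr => n _; apply: bE.
suff e : (kappa \o beta = \1)%VF by rewrite -comp_lfunE e id_lfunE.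
apply: tens_ext => v u; rewrite comp_lfunE bE kE id_lfunE [in RHS](dual_decomp u) pure_sumr.
by apply: eq_bigr => n _; rewrite rank1E pureZl pureZr.
Qed.

Lemma tens_endr : exists (beta : 'Hom(tensv dual V, 'End(V)))
    (kappa : 'Hom('End(V), tensv dual V)),
  [/\ forall v u, beta (pure_tens u v) = rank1 v u, cancel beta kappa & cancel kappa beta].
Proof.
have [beta bE] := tens_hom (f := fun u v => rank1 v u) rank1_linr rank1_linl.
have kl : linear (fun t : 'End(V) =>
    \sum_(n < \dim {:V}) pure_tens (dual_coord n) (t (vbasis {:V})`_n)).
  move=> s t t'; rewrite scaler_sumr -big_split; apply: eq_bigr => n _ /=.
  by rewrite !lfun_simp (pure_linr (dual_coord n)).
pose kappa := linfun (fun t : 'End(V) =>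
    \sum_(n < \dim {:V}) pure_tens (dual_coord n) (t (vbasis {:V})`_n)).
have kE t : kappa t = _ := linfunE kl t.
exists beta, kappa; split=> [v u|t|t]; first exact: bE.
  suff e : (kappa \o beta = \1)%VF by rewrite -comp_lfunE e id_lfunE.
  apply: tens_ext => u v; rewrite comp_lfunE bE kE id_lfunE [in RHS](dual_decomp u) pure_suml.
  by apply: eq_bigr => n _; rewrite rank1E pureZl pureZr.
by rewrite kE linear_sum [RHS]rank1_decomp; apply: eq_bigr => n _; apply: bE.
Qed.

End RankOne.

Lemma quom_gact (k : fieldType) (gT : finGroupType) (G : {group gT}) (M : gmod k G)
    (W : {vspace M}) (sW : {in G, forall x, (gact M x @: W <= W)%VS}) x v : x \in G ->
  gact (quom sW) x (quot_proj W v) = quot_proj W (gact M x v).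
Proof.
move=> Gx; rewrite /= quom_actE; apply/eqP; rewrite -subr_eq0 -!linearB quot_proj_eq0.
apply: (subvP (sW x Gx)); apply: memv_img.
by rewrite -quot_proj_eq0 linearB /= quot_proj_lift subrr.
Qed.

Section TensorBimodules.

Variables (k : fieldType) (gT lT hT : finGroupType).
Variables (G : {group gT}) (L : {group lT}) (H : {group hT}).
Variables (A : gmod k (setX_group G L)) (B : gmod k (setX_group L H)).

Definition tclass (a : A) (b : B) : tensb A B :=
  quot_proj (tens_rel L (ract A) (lact B)) (pure_tens a b).

Lemma tensb_ext (V : vectType k) (g h : 'Hom(tensb A B, V)) :
  (forall a b, g (tclass a b) = h (tclass a b)) -> g = h.
Proof. exact: tens_quot_ext. Qed.

Lemma tclass_gact x y a b : x \in G -> y \in H ->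
  gact (tensb A B) (x, y) (tclass a b) =
    tclass (gact A (x, 1%g) a) (gact B (1%g, y) b).
Proof.
move=> Gx Hy; rewrite quom_gact ?inE /= ?Gx //.
by rewrite /tensb_act0 tens_map_pure.
Qed.

Lemma tclass_bal l a b : l \in L ->
  tclass (gact A (1%g, l^-1%g) a) b = tclass a (gact B (l, 1%g) b).
Proof.
move=> Ll; have := tens_relP (ract A) (lact B) (pure_tens a b) Ll.
by rewrite !tens_map_pure !id_lfunE.
Qed.

Lemma tclass_hom (V : vectType k) (f : A -> B -> V) :
    (forall b, linear (f^~ b)) -> (forall a, linear (f a)) ->
    {in L, forall l a b, f (gact A (1%g, l^-1%g) a) b = f a (gact B (l, 1%g) b)} ->
  exists g : 'Hom(tensb A B, V), forall a b, g (tclass a b) = f a b.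
Proof.
move=> fl fr bal.
have fE a : linfun (f a) =1 f a := linfunE (fr a).
have l2 : linear (fun a => linfun (f a)).
  by move=> s a a'; apply/lfunP=> b; rewrite !lfun_simp !fE fl.
have [|g gE _] := @tens_universal _ _ L A B (ract A) (lact B) V (linfun (fun a => linfun (f a))).
  by move=> l Ll a b; rewrite !(linfunE l2) !fE bal.
by exists g => a b; rewrite gE (linfunE l2) fE.
Qed.

End TensorBimodules.

Section TensorDual.

Variables (k : fieldType) (gT hT : finGroupType) (G : {group gT}) (H : {group hT}).
Variable M : gmod k (setX_group G H).
Local Notation act := (gact (endm M)).

Lemma dualmE h g (u : 'Hom(M, k^o)) :
  gact (dualm M) (h, g) u = (u \o gact M (g^-1, h^-1)%g)%VF.
Proof. exact: (linfunE (dual_lin (M := M) (h, g))). Qed.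

Lemma mem_stdZ z : (z \in setX_group G H) =
  (prL (stdcoord gT hT) z \in G) && (prR (stdcoord gT hT) z \in H).
Proof. by case: z => x y; rewrite inE. Qed.

Lemma mem_stdZ_swap z : (z \in setX_group G H) =
  (prL (prodswap (stdcoord gT hT)) z \in H) && (prR (prodswap (stdcoord gT hT)) z \in G).
Proof. by case: z => x y; rewrite inE andbC. Qed.

(** Before passing to the quotient the tensor product is End_k(M), on which [H] acts by conjugation.
    Right multiplication by [s] serves as the operator [sigma] of [tens_norm_iso], and the
    invariants are End_kH(M). *)
Lemma tensb_dual_iso s : \sum_(h in H) act (1%g, h) s = 1 ->
  exists g : 'Hom(tensb M (dualm M), 'End(M)),
    [/\ lker g = 0%VS, limg g = right_endo (stdcoord gT hT) H M
      & {in G &, forall x x' v, g (gact (tensb M (dualm M)) (x, x') v) =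
           gact M (x, 1%g) * g v * gact M (x'^-1%g, 1%g)}].
Proof.
move=> es; have [beta [kappa [bE bK kB]]] := tens_endl M.
have aH := actR_action mem_stdZ M.
have inH l : l \in H -> (1%g, l) \in setX_group G H by move=> Hl; rewrite inE /= group1.
have inG l : l \in G -> (l, 1%g) \in setX_group G H by move=> Gl; rewrite inE /= Gl group1.
have l1 l : ((1%g : gT, l) * (1%g, l^-1))%g = 1%g :> (gT * hT)%type.
  by congr pair; rewrite ?mulg1 ?mulgV.
have [|||g [kg lg gE]] := @tens_norm_iso k M (dualm M) hT H (ract M) (lact (dualm M)) _
  beta kappa (fun y => act (1%g, y)) (sandwich 1 s) bK kB aH.
- split=> [|x y Hx Hy]; first by rewrite /ract invg1 invg1 (gact1 M).
  by rewrite /ract !invgK -gactMr ?inH //; congr (gact M (_, _)); rewrite mulg1.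
- move=> l Hl t.
  suff e : (beta \o tens_map \1 (lact (dualm M) l) =
       act (1%g, l) \o (beta \o tens_map (ract M l) \1))%VF.
    by move/lfunP/(_ t): e; rewrite comp_lfunE => ->; rewrite !comp_lfunE.
  apply: tens_ext => v u; rewrite comp_lfunE [RHS]comp_lfunE [X in _ = act _ X]comp_lfunE.
  rewrite !tens_map_pure !id_lfunE !bE endmE rank1_compl rank1_compr.
  rewrite /lact dualmE /ract; congr (rank1 _ (_ \o gact M _)%VF).
  by rewrite -gactMv ?inH ?groupV // l1 gact1v.
- move=> t; rewrite (eq_bigr (fun l => t * act (1%g, l) s)).
    by rewrite -mulr_sumr es mulr1.
  move=> l Hl; rewrite (sandwichE 1 s) mul1r endm_mul ?inH //; congr (_ * _).
  by rewrite -gactMv ?inH ?groupV // l1 gact1v.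
exists g; split=> // x x' Gx Gx' v.
suff e : (g \o gact (tensb M (dualm M)) (x, x') =
   sandwich (gact M (x, 1%g)) (gact M (x'^-1%g, 1%g)) \o g)%VF.
  by move/lfunP/(_ v): e; rewrite comp_lfunE => ->; rewrite comp_lfunE sandwichE.
apply: tensb_ext => m u; rewrite comp_lfunE [RHS]comp_lfunE tclass_gact // !gE.
rewrite sandwichE mulr_sumr mulr_suml; apply: eq_bigr => l Hl.
rewrite !bE dualmE invg1 -rank1_compl -rank1_compr !endmE.
have lV : (1%g, l)^-1%g = (1%g, l^-1%g) :> gT * hT by congr pair; rewrite ?invg1.
have c1 := lr_commute M Gx Hl; have c2 : _ = _ := lr_commute M (groupVr Gx') (groupVr Hl).
rewrite !comp_lfun_mulE in c1 c2; rewrite lV !mulrA -c1 -!mulrA; congr (_ * (_ * (_ * _))).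
exact: c2.
Qed.

(** Not the previous lemma with the factors exchanged: the dual now stands on the left, so the outer
    left action of [H] becomes precomposition and the right one postcomposition. *)
Lemma tensb_dual_iso_swap s : \sum_(x in G) act (x, 1%g) s = 1 ->
  exists g : 'Hom(tensb (dualm M) M, 'End(M)),
    [/\ lker g = 0%VS, limg g = right_endo (prodswap (stdcoord gT hT)) G M
      & {in H &, forall y y' v, g (gact (tensb (dualm M) M) (y, y') v) =
           gact M (1%g, y') * g v * gact M (1%g, y^-1%g)}].
Proof.
move=> es; have [beta [kappa [bE bK kB]]] := tens_endr M.
have aG := actR_action mem_stdZ_swap M.
have inH l : l \in H -> (1%g, l) \in setX_group G H by move=> Hl; rewrite inE /= group1.
have inG l : l \in G -> (l, 1%g) \in setX_group G H by move=> Gl; rewrite inE /= Gl group1.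
have l1 l : ((l, 1%g : hT) * (l^-1, 1%g))%g = 1%g :> (gT * hT)%type.
  by congr pair; rewrite ?mulg1 ?mulgV.
have lV l : (l, 1%g)^-1%g = (l^-1%g, 1%g) :> gT * hT by congr pair; rewrite ?invg1.
have [|||g [kg lg gE]] := @tens_norm_iso k (dualm M) M gT G (ract (dualm M)) (lact M) _
  beta kappa (fun x => act (x, 1%g)) (sandwich 1 s) bK kB aG.
- split=> [|x y Gx Gy]; apply/lfunP=> u; rewrite /ract ?mul_lfunE !dualmE !invgK.
    by rewrite !invg1 (gact1 M : gact M (1%g, 1%g) = _) comp_lfun1r one_lfunE.
  rewrite -comp_lfunA; congr (_ \o _)%VF; rewrite !invg1 -gactM ?inG ?groupV //.
  by congr (gact M (_, _)); rewrite ?invMg ?invg1 ?mulg1.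
- move=> l Hl t.
  suff e : (beta \o tens_map \1 (lact M l) =
       act (l, 1%g) \o (beta \o tens_map (ract (dualm M) l) \1))%VF.
    by move/lfunP/(_ t): e; rewrite comp_lfunE => ->; rewrite !comp_lfunE.
  apply: tens_ext => u v; rewrite comp_lfunE [RHS]comp_lfunE [X in _ = act _ X]comp_lfunE.
  rewrite !tens_map_pure !id_lfunE !bE /ract dualmE invgK invg1 -rank1_compr endmE lV.
  by rewrite -[RHS]mulrA -[rank1 v u * _ * _]mulrA -gactMr ?inG ?groupV // l1
     (gact1 M) [rank1 v u * _]mulr1 rank1_compl.
- move=> t; rewrite (eq_bigr (fun l => t * act (l, 1%g) s)).
    by rewrite -mulr_sumr es mulr1.
  move=> l Gl; rewrite (sandwichE 1 s) mul1r endm_mul ?inG //; congr (_ * _).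
  by rewrite -gactMv ?inG ?groupV // l1 gact1v.
exists g; split=> // y y' Hy Hy' v.
suff e : (g \o gact (tensb (dualm M) M) (y, y') =
   sandwich (gact M (1%g, y')) (gact M (1%g, y^-1%g)) \o g)%VF.
  by move/lfunP/(_ v): e; rewrite comp_lfunE => ->; rewrite comp_lfunE sandwichE.
apply: tensb_ext => u m; rewrite comp_lfunE [RHS]comp_lfunE tclass_gact // !gE.
rewrite sandwichE mulr_sumr mulr_suml; apply: eq_bigr => l Gl.
rewrite !bE dualmE invg1 -rank1_compl -rank1_compr !endmE lV.
have c1 := lr_commute M Gl Hy'; have c2 : _ = _ := lr_commute M (groupVr Gl) (groupVr Hy).
rewrite !comp_lfun_mulE in c1 c2; rewrite !mulrA c1 -!mulrA; congr (_ * (_ * (_ * _))).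
exact: esym.
Qed.

End TensorDual.

Lemma sum_lcosets (gT : finGroupType) (V : zmodType) (L G : {group gT}) (F : gT -> V) :
  L \subset G ->
  \sum_(g in G) F g = \sum_(C in lcosets L G) \sum_(u in L) F (repr C * u)%g.
Proof.
move=> sLG; rewrite (partition_big (fun g => g *: L)%g (mem (lcosets L G))) /=.
  apply: eq_bigr => C CL; have [GC eC] := lcoset_repr sLG CL.
  rewrite (reindex_inj (mulgI (repr C))) /=; apply: eq_bigl => u.
  rewrite {3}eC; apply/andP/idP=> [[_ /eqP e]|Lu].
    have : (repr C * u)%g \in (repr C *: L)%g by apply/lcoset_eqP.
    by rewrite mem_lcoset mulKg.
  split; first by rewrite groupM // (subsetP sLG).
  by apply/eqP/lcoset_eqP; rewrite mem_lcoset mulKg.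
by move=> g Gg; apply/lcosetsP; exists g.
Qed.

(** * Relative projectivity of the bimodules kGi and jkH *)

Section Bimod.

Variables (k : fieldType) (gT : finGroupType).
Implicit Types (G L : {group gT}) (i : grpalg k gT).

Lemma bimod_gact G i L x y (a : bimod G i L) : x \in G -> y \in L ->
  vsval (gact (bimod G i L) (x, y) a) = gelt x * vsval a * gelt y^-1%g.
Proof.
move=> Gx Ly; rewrite /bimod subm_gact ?inE /= ?Gx //.
exact: (linfunE (bireg_lin (x, y))).
Qed.

Section Left.

Variables (G L : {group gT}) (i : grpalg k gT).
Hypotheses (sLG : L \subset G) (Gi : i \in kspan k G).
Hypotheses (Li : {in L, forall x, gconj x i = i}) (ii : i * i = i).

Lemma bimodlP a :
  reflect (a \in kspan k G /\ a * i = a) (a \in kspan k G * <[i]> * kspan k L)%VS.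
Proof.
rewrite bimod_space // => [|l Ll]; last by apply/commute_gconj/Li.
rewrite -limg_amulr; apply: (iffP memv_imgP) => [[a' Ga ->]|[Ga ab]].
  by rewrite amulrE -mulrA ii kspanM.
by exists a; rewrite ?amulrE ?ab.
Qed.

Lemma bimodl_mem (a : bimod G i L) : vsval a \in kspan k G.
Proof. by have /bimodlP[] := subvsP a. Qed.

Lemma bimodl_id (a : bimod G i L) : vsval a * i = vsval a.
Proof. by have /bimodlP[] := subvsP a. Qed.

Definition bimodl_gen : bimod G i L := vsproj _ i.

Lemma bimodl_genE : vsval bimodl_gen = i.
Proof. by rewrite /bimodl_gen vsprojK //; apply/bimodlP. Qed.

Variables (B : vectType k) (lB : gT -> 'End(B)).
Hypothesis lB_act : lin_action L lB.

Local Notation A := (bimod G i L).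
Local Notation rel := (tens_rel L (ract A) lB).

(** [r] is induced by the projection of kG onto kL that keeps the coefficients on [L]. The last
    clause says that the G-conjugates of io r over the cosets of [L] add up to the identity, since
    [a] is the sum of its parts on these cosets and a i = a. The composite r io is the identity for
    i = 1, but not in general. *)
Lemma tens_left : exists (io : 'Hom(B, quotv rel)) (r : 'Hom(quotv rel, B)),
  [/\ forall b, io b = quot_proj rel (pure_tens bimodl_gen b),
      forall a b, r (quot_proj rel (pure_tens a b)) =
        \sum_(u in L) (vsval a u : k) *: lB u b,
      {in L, forall l b, quot_proj rel (pure_tens (gact A (l, 1%g) bimodl_gen) b) =
                         io (lB l b)},
      {in L, forall l a b, r (quot_proj rel (pure_tens (gact A (l, 1%g) a) b)) =
                         lB l (r (quot_proj rel (pure_tens a b)))}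
    & forall a b, \sum_(C in lcosets L G)
        quot_proj rel (pure_tens (gact A (repr C, 1%g) bimodl_gen)
          (r (quot_proj rel (pure_tens (gact A ((repr C)^-1%g, 1%g) a) b)))) =
        quot_proj rel (pure_tens a b)].
Proof.
have iol : linear (fun b => quot_proj rel (pure_tens bimodl_gen b)).
  by move=> s b b'; rewrite (pure_linr bimodl_gen) linearP.
pose f (a : A) (b : B) := \sum_(u in L) (vsval a u : k) *: lB u b.
have fl b : linear (f^~ b).
  move=> s a a'; rewrite /f scaler_sumr -big_split; apply: eq_bigr => u _ /=.
  by rewrite !ffunE /= scalerDl scalerA.
have fr a : linear (f a).
  move=> s b b'; rewrite /f scaler_sumr -big_split; apply: eq_bigr => u _ /=.
  by rewrite linearP scalerDr !scalerA mulrC.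
have fE a : linfun (f a) =1 f a := linfunE (fr a).
have l2 : linear (fun a => linfun (f a)).
  by move=> s a a'; apply/lfunP=> b; rewrite !lfun_simp !fE fl.
have ractE l a : l \in L -> vsval (ract A l a) = vsval a * gelt l.
  by move=> Ll; rewrite /ract bimod_gact ?groupV // invgK [gelt 1]gelt1E mul1r.
have [|r rE _] := @tens_universal _ _ L A B (ract A) lB B (linfun (fun a => linfun (f a))).
  move=> l Ll a b; rewrite !(linfunE l2) !fE /f [LHS](reindex_inj (mulIg l)) /=.
  apply: eq_big => [u|u Lu]; first by rewrite groupMr.
  rewrite ractE // gmul_geltr mulgK; congr (_ *: _).
  by rewrite (lin_actM _ lB_act) // -(groupMr _ Ll).
have {}rE a b : r (quot_proj rel (pure_tens a b)) = f a b.
  by rewrite rE (linfunE l2) fE.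
have [io ioE] : exists io : 'Hom(B, quotv rel),
    forall b, io b = quot_proj rel (pure_tens bimodl_gen b).
  by exists (linfun (fun b => quot_proj rel (pure_tens bimodl_gen b))) => b; apply: (linfunE iol).
exists io, r.
split=> [b|a b|l Ll b|l Ll a b|a b]; [exact: ioE | exact: rE | | |].
- have := tens_relP (ract A) lB (pure_tens bimodl_gen b) Ll.
  rewrite ioE !tens_map_pure !id_lfunE => <-; congr (quot_proj rel (pure_tens _ b)).
  suff e : vsval (gact A (l, 1%g) bimodl_gen) = vsval (ract A l bimodl_gen) by apply: val_inj e.
  rewrite ractE // bimod_gact ?group1 ?(subsetP sLG) // bimodl_genE invg1.
  by rewrite [gelt 1]gelt1E mulr1 (commute_gconj l i).2 ?Li.
- rewrite !rE /f linear_sum [LHS](reindex_inj (mulgI l)) /=.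
  apply: eq_big => [u|u Lu]; first by rewrite groupMl.
  rewrite linearZ /= bimod_gact ?group1 ?(subsetP sLG) // invg1 [gelt 1]gelt1E mulr1.
  rewrite gmul_geltl mulKg; congr (_ *: _).
  by rewrite (lin_actM _ lB_act) // -(groupMl _ Ll).
rewrite (eq_bigr (fun C => \sum_(u in L) quot_proj rel (pure_tens
   ((vsval a (repr C * u)%g : k) *: vsproj (kspan k G * <[i]> * kspan k L)%VS (gelt (repr C * u)%g * i)) b))).
  rewrite -(sum_lcosets (fun g => quot_proj rel (pure_tens ((vsval a g : k) *:
     vsproj (kspan k G * <[i]> * kspan k L)%VS (gelt g * i)) b)) sLG).
  rewrite -linear_sum -pure_suml; congr (quot_proj rel (pure_tens _ b)).
  apply: val_inj; rewrite /= linear_sum /= -[RHS]bimodl_id {2}(kspan_sum (bimodl_mem a)).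
  rewrite mulr_suml; apply: eq_bigr => g Gg; rewrite -scalerAl vsprojK //.
  by apply/bimodlP; rewrite kspanM ?mem_kspan // -mulrA ii.
move=> C CL; have [GC eC] := lcoset_repr sLG CL.
rewrite rE pure_sumr linear_sum; apply: eq_bigr => u Lu /=.
rewrite pureZr pureZl !linearZ /=; congr (_ *: _).
  rewrite bimod_gact ?groupV // invg1 [gelt 1]gelt1E mulr1.
  by rewrite gmul_geltl invgK.
have := tens_relP (ract A) lB (pure_tens (gact A (repr C, 1%g) bimodl_gen) b) Lu.
rewrite !tens_map_pure !id_lfunE => <-; congr (quot_proj rel (pure_tens _ b)).
apply: val_inj; rewrite /= ractE // bimod_gact ?group1 // bimodl_genE invg1.
rewrite vsprojK.
  by rewrite [gelt 1]gelt1E mulr1 geltM -!mulrA (commute_gconj u i).2 ?Li.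
have Gu := subsetP sLG u Lu.
by apply/bimodlP; rewrite kspanM ?mem_kspan ?groupM // -mulrA ii.
Qed.

End Left.

End Bimod.

Lemma lfun_lincomb (k : fieldType) (U V : vectType k) (h : 'Hom(U, V)) (I : finType)
    (A : pred I) (s : I -> k) (x : I -> U) :
  h (\sum_(v | A v) s v *: x v) = \sum_(v | A v) s v *: h (x v).
Proof. by rewrite linear_sum; apply: eq_bigr => v _; rewrite linearZ. Qed.

Lemma vsval_lincomb (k : fieldType) (V : vectType k) (U : {vspace V}) (I : finType)
    (A : pred I) (s : I -> k) (x : I -> subvs_of U) :
  vsval (\sum_(v | A v) s v *: x v) = \sum_(v | A v) s v *: vsval (x v).
Proof. by rewrite linear_sum; apply: eq_bigr => v _; rewrite linearZ. Qed.

(** * Induction and the source of M *)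

Section Chain.

Variables (k : fieldType) (zT : finGroupType) (Z Z1 D : {group zT}).
Hypotheses (sZ1Z : Z1 \subset Z) (sDZ1 : D \subset Z1).
Variables (X : gmod k Z) (Y : gmod k Z1).
Variables (io : 'Hom(Y, X)) (r : 'Hom(X, Y)).
Hypothesis io_eq : {in Z1, forall z y, io (gact Y z y) = gact X z (io y)}.
Hypothesis r_eq : {in Z1, forall z x, r (gact X z x) = gact Y z (r x)}.

(** Conjugation by the pair (io, r) moves trace forms from [Y] to [X], whether [X] is built from [Y]
    by a tensor product or is a direct summand of it. *)
Definition transfer (s : 'End(Y)) : 'End(X) := (io \o s \o r)%VF.

Lemma transferE s x : transfer s x = io (s (r x)).
Proof. by rewrite !comp_lfunE. Qed.

Lemma transfer_lin : linear transfer.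
Proof. by move=> a s t; apply/lfunP=> x; rewrite !lfun_simp /= linearP. Qed.

Lemma transfer_act z s : z \in Z1 ->
  transfer (gact (endm Y) z s) = gact (endm X) z (transfer s).
Proof.
move=> Zz; apply/lfunP=> x; rewrite transferE !endmE !mul_lfunE transferE.
by rewrite -r_eq ?groupV // io_eq.
Qed.

Lemma transfer_fix s : {in D, forall d, gact (endm Y) d s = s} ->
  {in D, forall d, gact (endm X) d (transfer s) = transfer s}.
Proof. by move=> Ds d Dd; rewrite -transfer_act ?Ds ?(subsetP sDZ1). Qed.

(** Transitivity of the trace through [Z1]: the inner trace of [s] is 1 and commutes with
    [transfer], so the outer one is the trace of io r, which is 1. *)
Lemma trace_transfer s : trace (gact (endm X)) Z1 Z (transfer 1) = 1 ->
    {in D, forall d, gact (endm Y) d s = s} -> trace (gact (endm Y)) D Z1 s = 1 ->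
  trace (gact (endm X)) D Z (transfer s) = 1.
Proof.
move=> X1 Ds Y1; rewrite (trace_trans (gact_action (endm X)) sDZ1 sZ1Z); last first.
  exact: transfer_fix.
rewrite -X1; congr (trace _ _ _ _).
pose tr : 'Hom('End(Y), 'End(X)) := linfun transfer.
have trE t : tr t = transfer t := linfunE transfer_lin t.
rewrite -!trE -Y1; apply/esym/(trace_map (act' := gact (endm X))) => // d Dd.
by rewrite !trE transfer_act.
Qed.

End Chain.

Section RightBimod.

Variables (k : fieldType) (gT hT : finGroupType) (G : {group gT}) (R H : {group hT}).
Variable j : grpalg k hT.
Hypotheses (sRH : R \subset H) (Hj : j \in kspan k H).
Hypotheses (Rj : {in R, forall x, gconj x j = j}) (jj : j * j = j).
Variable X : gmod k (setX_group G R).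
Local Notation B := (bimod R j H).

Lemma bimodrP a :
  reflect (a \in kspan k H /\ j * a = a) (a \in kspan k R * <[j]> * kspan k H)%VS.
Proof.
apply: (iffP idP) => [|[Ha ja]]; last first.
  by have := memv_mul (memv_mul (kspan1 k R) (memv_line j)) Ha; rewrite mul1r ja.
pose W := (kspan k H :&: lker (amull j - 1))%VS.
have WP x : reflect (x \in kspan k H /\ j * x = x) (x \in W).
  rewrite memv_cap memv_ker add_lfunE opp_lfunE id_lfunE amullE subr_eq0.
  by apply: (iffP andP) => -[? /eqP].
have HR : (kspan k R <= kspan k H)%VS by apply: kspanS.
have sjH : (<[j]> * kspan k H <= W)%VS.
  apply/prodvP=> _ v /vlineP[s ->] Hv; apply/WP; split.
    by rewrite kspanM ?memvZ.
  by rewrite -scalerAl -scalerAr mulrA jj.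
suff sub : (kspan k R * (<[j]> * kspan k H) <= W)%VS.
  by rewrite -prodvA => /(subvP sub)/WP.
apply/prodvP=> u v Ru /(subvP sjH)/WP[Hv jv]; have Hu := subvP HR u Ru.
apply/WP; rewrite kspanM //; split=> //.
have ju : j * u = u * j.
  rewrite (kspan_sum Ru) mulr_sumr mulr_suml; apply: eq_bigr => x Rx.
  by rewrite -scalerAl -scalerAr (commute_gconj x j).2 ?Rj.
by rewrite mulrA ju -mulrA jv.
Qed.

Lemma bimodr_mem (a : B) : vsval a \in kspan k H.
Proof. by have /bimodrP[] := subvsP a. Qed.

Lemma bimodr_id (a : B) : j * vsval a = vsval a.
Proof. by have /bimodrP[] := subvsP a. Qed.

Definition bimodr_proj (a : grpalg k hT) : B := vsproj _ a.

Lemma bimodr_proj_lin : linear bimodr_proj.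
Proof. by move=> s a b; rewrite /bimodr_proj linearP. Qed.

Lemma bimodr_projK (a : B) : bimodr_proj (vsval a) = a.
Proof. exact: vsvalK. Qed.

Lemma bimodr_proj_sum (I : finType) (A : pred I) (s : I -> k) (a : I -> grpalg k hT) :
  bimodr_proj (\sum_(v | A v) s v *: a v) = \sum_(v | A v) s v *: bimodr_proj (a v).
Proof.
rewrite -[bimodr_proj _](linfunE bimodr_proj_lin) lfun_lincomb.
by apply: eq_bigr => v _; rewrite (linfunE bimodr_proj_lin).
Qed.

Definition bimodr_gen : B := vsproj _ j.

Lemma bimodr_genE : vsval bimodr_gen = j.
Proof. by rewrite /bimodr_gen vsprojK //; apply/bimodrP. Qed.

Lemma bimodr_gact x y (a : B) : x \in R -> y \in H ->
  vsval (gact B (x, y) a) = gelt x * vsval a * gelt y^-1%g.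
Proof. exact: bimod_gact. Qed.

Local Notation T := (tensb X B).

Lemma bimodr_bal v x : v \in R ->
  tclass x (gact B (1%g, v) bimodr_gen) = tclass (gact X (1%g, v) x) bimodr_gen :> T.
Proof.
move=> Rv; have Hv := subsetP sRH v Rv.
rewrite -[v in RHS]invgK tclass_bal ?groupV //; congr (tclass _ _).
suff e : vsval (gact B (1%g, v) bimodr_gen) = vsval (gact B (v^-1%g, 1%g) bimodr_gen).
  by apply: val_inj e.
rewrite !bimodr_gact ?group1 ?groupV // bimodr_genE invg1 [gelt 1]gelt1E mulr1 mul1r.
by rewrite (commute_gconj v^-1%g j).2 ?Rj ?groupV.
Qed.

(** Right counterpart of [tens_left]: here (1, v^-1) acts as right multiplication by v, so [r] sends
    x (x) b to the sum of b(v) x v over v in [R]. The last clause features [galg_opp j] because (1,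
    y) acts as right multiplication by y^-1. *)
Lemma tens_right : exists (io : 'Hom(X, T)) (r : 'Hom(T, X)),
  [/\ {in setX_group G R, forall z x, io (gact X z x) = gact T z (io x)},
      {in setX_group G R, forall z t, r (gact T z t) = gact X z (r t)},
      trace (gact (endm T)) (setX_group G R) (setX_group G H) (io \o r)%VF = 1
    & forall x, gop T (fun y => (1%g, y)) H (galg_opp j) (io x) = io x].
Proof.
have iol : linear (fun x => tclass x bimodr_gen : T).
  by move=> s x x'; rewrite /tclass (pure_linl bimodr_gen) linearP.
have [io ioE] : exists io : 'Hom(X, T), forall x, io x = tclass x bimodr_gen.
  by exists (linfun (fun x => tclass x bimodr_gen : T)); apply: (linfunE iol).
have XG g : g \in G -> (g, 1%g : hT) \in setX_group G R by move=> Gg; rewrite inE /= Gg group1.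
have XR v : v \in R -> (1%g : gT, v) \in setX_group G R by move=> Rv; rewrite inE /= Rv group1.
have inv1 (v : hT) : (1%g, v)^-1%g = (1%g, v^-1%g) :> gT * hT by congr pair; rewrite ?invg1.
have XM g v x : g \in G -> v \in R -> gact X (g, 1%g) (gact X (1%g, v) x) = gact X (g, v) x.
  move=> Gg Rv; rewrite -gactMv ?XG ?XR //; congr (gact X (_, _) _); by rewrite ?mulg1 ?mul1g.
have XM' g v x : g \in G -> v \in R -> gact X (1%g, v) (gact X (g, 1%g) x) = gact X (g, v) x.
  move=> Gg Rv; rewrite -gactMv ?XG ?XR //; congr (gact X (_, _) _); by rewrite ?mulg1 ?mul1g.
have [r rE] : exists r : 'Hom(T, X), forall x (b : B),
    r (tclass x b) = \sum_(v in R) (vsval b v : k) *: gact X (1%g, v^-1%g) x.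
  apply: (tclass_hom (f := fun x (b : B) =>
    \sum_(v in R) (vsval b v : k) *: gact X (1%g, v^-1%g) x)) => [b s x x'|x s b b'|l Rl x b].
  - rewrite scaler_sumr -big_split; apply: eq_bigr => v _ /=.
    by rewrite linearP scalerDr !scalerA mulrC.
  - rewrite scaler_sumr -big_split; apply: eq_bigr => v _ /=.
    by rewrite !ffunE /= scalerDl scalerA.
  have Hl := subsetP sRH l Rl; rewrite [RHS](reindex_inj (mulgI l)) /=.
  apply: eq_big => [v|v Rv]; first by rewrite groupMl.
  rewrite bimodr_gact ?group1 // invg1 [gelt 1]gelt1E mulr1 gmul_geltl mulKg.
  rewrite -gactMv ?XR ?groupV //; congr (_ *: gact X (_, _) x); first by rewrite mulg1.
  by rewrite invMg.
exists io, r.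
have ioeq : {in setX_group G R, forall z x, io (gact X z x) = gact T z (io x)}.
  case=> g v /setXP[Gg' Rv'] x; have Gg : g \in G := Gg'; have Rv : v \in R := Rv'.
  rewrite !ioE tclass_gact ?(subsetP sRH) // bimodr_bal //.
  by rewrite XM'.
have req : {in setX_group G R, forall z t, r (gact T z t) = gact X z (r t)}.
  case=> g v /setXP[Gg' Rv'] t; have Gg : g \in G := Gg'; have Rv : v \in R := Rv'.
  have Hv := subsetP sRH v Rv.
  suff e : (r \o gact T (g, v) = gact X (g, v) \o r)%VF.
    by rewrite -[LHS]comp_lfunE e comp_lfunE.
  apply: tensb_ext => x b; rewrite comp_lfunE [RHS]comp_lfunE tclass_gact // !rE.
  rewrite linear_sum [RHS](reindex_inj (mulIg v)) /=.
  apply: eq_big => [w|w Rw]; first by rewrite groupMr.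
  rewrite linearZ /= bimodr_gact ?group1 // [gelt 1]gelt1E mul1r gmul_geltr invgK.
  congr (_ *: _); rewrite XM' ?groupV // -gactMv ?XR ?groupV ?groupM //; last first.
    by rewrite inE /= Gg.
  by congr (gact X (_, _) x); rewrite ?mulg1 // invMg mulKVg.
split=> //.
  have HZ y : y \in H -> (1%g : gT, y) \in setX_group G H by move=> Hy; rewrite inE /= Hy group1.
  have sXX : setX_group G R \subset setX_group G H by apply: setXS.
  rewrite (@trace_reindex _ _ _ (gact (endm T)) (setX_group G R) (setX_group G H) _
     (mem (lcosets R H)) (fun C => (1%g : gT, repr C))).
  - suff e : \sum_(C in lcosets R H) gact (endm T) (1%g, repr C) (io \o r)%VF = \1%VF by [].
    apply: tensb_ext => x b; rewrite sum_lfunE id_lfunE.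
    transitivity (\sum_(g in H) tclass x
         ((vsval b g : k) *: bimodr_proj (j * gelt g)) : T).
      rewrite [RHS](reindex_inj invg_inj) [RHS](eq_bigl (mem H)) => [|g]; last first.
        by rewrite /= groupV.
      rewrite (sum_lcosets (fun g => tclass x ((vsval b g^-1%g : k) *:
         bimodr_proj (j * gelt g^-1%g)) : T) sRH).
      apply: eq_bigr => C CR; have [HC eC] := lcoset_repr sRH CR.
      rewrite endmE !mul_lfunE comp_lfunE inv1 tclass_gact ?group1 ?groupV //.
      rewrite (gact1 X : gact X (1%g, 1%g) = _) id_lfunE rE !lfun_lincomb.
      rewrite (reindex_inj invg_inj); apply: eq_big => [u|u Ru']; first by rewrite /= groupV.
      have Ru : u \in R by move: Ru'; rewrite /= groupV.
      rewrite ioE tclass_gact ?group1 // (gact1 X : gact X (1%g, 1%g) = _) id_lfunE.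
      rewrite bimodr_gact ?group1 ?groupV // [gelt 1]gelt1E mul1r gmul_geltr !invgK invMg.
      have -> : tclass (gact X (1%g, u) x) (gact B (1%g, repr C) bimodr_gen) =
         tclass x (gact B (u^-1%g, 1%g) (gact B (1%g, repr C) bimodr_gen)) :> T.
        by rewrite -[u in LHS]invgK tclass_bal ?groupV.
      rewrite /tclass -linearZ -pureZr; congr (quot_proj _ (pure_tens x _)).
      have Hu : (u^-1 * (repr C)^-1)%g \in H by rewrite groupM ?groupV //; apply: (subsetP sRH).
      suff e : vsval (gact B (u^-1%g, 1%g) (gact B (1%g, repr C) bimodr_gen)) =
               j * gelt (u^-1 * (repr C)^-1)%g.
        congr (_ *: _); rewrite -[LHS]bimodr_projK e //.
      rewrite !bimodr_gact ?group1 ?groupV // bimodr_genE invg1 [gelt 1]gelt1E mulr1 mul1r.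
      by rewrite mulrA (commute_gconj u^-1%g j).2 ?Rj ?groupV // geltM mulrA.
    rewrite /tclass -linear_sum -pure_sumr; congr (quot_proj _ (pure_tens x _)).
    rewrite -bimodr_proj_sum -[RHS]bimodr_projK; congr (bimodr_proj _).
    rewrite -[RHS]bimodr_id [in RHS](kspan_sum (bimodr_mem b)) mulr_sumr.
    by apply: eq_bigr => g _; rewrite -scalerAr.
  - exact: gact_action.
  - exact: sXX.
  - move=> z Rz; apply/lfunP=> t; rewrite endmE !mul_lfunE !(comp_lfunE io r).
    by rewrite req ?groupV // ioeq ?groupV // gactVKv // (subsetP sXX).
  - by move=> C CR; have [HC _] := lcoset_repr sRH CR; apply: HZ.
  - move=> C C' CR CR'; have [HC eC] := lcoset_repr sRH CR.
    have [HC' eC'] := lcoset_repr sRH CR'; rewrite mem_lcoset inv1 inE /= => /andP[_].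
    by rewrite -mem_lcoset => cc; rewrite eC eC'; apply/lcoset_eqP.
  case=> g y /setXP[/= Gg Hy]; pose C := (y *: R)%g.
  have CR : C \in lcosets R H by apply/lcosetsP; exists y.
  exists C => //; have [HC eC] := lcoset_repr sRH CR.
  rewrite mem_lcoset inv1 inE /= mul1g Gg -mem_lcoset -eC /=.
  exact: lcoset_refl.
move=> x; rewrite ioE gopE.
rewrite (eq_bigr (fun y => tclass x ((galg_opp j y : k) *: gact B (1%g, y) bimodr_gen) : T)).
  rewrite /tclass -linear_sum -pure_sumr; congr (quot_proj _ (pure_tens x _)).
  suff e : vsval (\sum_(y in H) (galg_opp j y : k) *: gact B (1%g, y) bimodr_gen) =
      vsval bimodr_gen by apply: val_inj e.
  rewrite vsval_lincomb bimodr_genE.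
  transitivity (\sum_(y in H) (j y^-1%g : k) *: (j * gelt y^-1%g)); last first.
    apply: esym; rewrite -[LHS]jj [X in _ * X = _](kspan_sum Hj) mulr_sumr.
    rewrite [LHS](reindex_inj invg_inj); apply: eq_big => [y|y _]; first by rewrite /= groupV.
    by rewrite -scalerAr.
  apply: eq_bigr => y Hy; rewrite bimodr_gact ?group1 // bimodr_genE ffunE.
  by rewrite [gelt 1]gelt1E mul1r.
move=> y Hy; rewrite tclass_gact ?group1 // (gact1 X : gact X (1%g, 1%g) = _) id_lfunE.
by rewrite /tclass -linearZ -pureZr.
Qed.

End RightBimod.

Lemma gop_equivariant (k : fieldType) (zT T : finGroupType) (Z Z1 : {group zT})
    (X : gmod k Z) (Y : gmod k Z1) (h : 'Hom(Y, X)) (j : T -> zT) (K : {group T}) a y :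
  {in K, forall x v, h (gact Y (j x) v) = gact X (j x) (h v)} ->
  h (gop Y j K a y) = gop X j K a (h y).
Proof.
move=> heq; rewrite !gopE lfun_lincomb; apply: eq_bigr => x Kx.
by rewrite heq.
Qed.

Section LeftBimod.

Variables (k : fieldType) (gT hT : finGroupType) (P G : {group gT}) (R : {group hT}).
Variable i : grpalg k gT.
Hypotheses (sPG : P \subset G) (Gi : i \in kspan k G).
Hypotheses (Pi : {in P, forall x, gconj x i = i}) (ii : i * i = i).
Variable Y : gmod k (setX_group P R).
Local Notation A := (bimod G i P).
Local Notation T := (tensb A Y).

Lemma tens_leftb : exists (io : 'Hom(Y, T)) (r : 'Hom(T, Y)),
  [/\ {in setX_group P R, forall z x, io (gact Y z x) = gact T z (io x)},
      {in setX_group P R, forall z t, r (gact T z t) = gact Y z (r t)},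
      trace (gact (endm T)) (setX_group P R) (setX_group G R) (io \o r)%VF = 1
    & forall y, gop T (fun x => (x, 1%g)) G i (io y) = io y].
Proof.
have YP u : u \in P -> (u, 1%g : hT) \in setX_group P R by move=> Pu; rewrite inE /= Pu group1.
have YR v : v \in R -> (1%g : gT, v) \in setX_group P R by move=> Rv; rewrite inE /= Rv group1.
have aP : lin_action P (lact Y).
  split=> [|x y Px Py]; first exact: (gact1 Y).
  rewrite /lact -gactMr ?YP //; congr (gact Y (_, _)); by rewrite ?mulg1.
have [io [r [ioE rE E1 E2 E3]]] := tens_left sPG Gi Pi ii aP.
have YM u v y : u \in P -> v \in R -> gact Y (u, 1%g) (gact Y (1%g, v) y) = gact Y (u, v) y.
  move=> Pu Rv; rewrite -gactMv ?YP ?YR //; congr (gact Y (_, _) _); by rewrite ?mulg1 ?mul1g.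
have YM' u v y : u \in P -> v \in R -> gact Y (1%g, v) (gact Y (u, 1%g) y) = gact Y (u, v) y.
  move=> Pu Rv; rewrite -gactMv ?YP ?YR //; congr (gact Y (_, _) _); by rewrite ?mulg1 ?mul1g.
have {}ioE y : io y = tclass (bimodl_gen G P i) y := ioE y.
have {}rE a y : r (tclass a y) = \sum_(u in P) (vsval a u : k) *: gact Y (u, 1%g) y := rE a y.
have {}E1 l y : l \in P -> tclass (gact A (l, 1%g) (bimodl_gen G P i)) y = io (gact Y (l, 1%g) y).
  by move=> Pl; apply: E1.
have {}E2 l a y : l \in P -> r (tclass (gact A (l, 1%g) a) y) = gact Y (l, 1%g) (r (tclass a y)).
  by move=> Pl; apply: E2.
have ioeq : {in setX_group P R, forall z x, io (gact Y z x) = gact T z (io x)}.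
  case=> u v /setXP[Pu' Rv'] x; have Pu : u \in P := Pu'; have Rv : v \in R := Rv'.
  by rewrite [io x]ioE tclass_gact ?(subsetP sPG) // E1 // YM.
have req : {in setX_group P R, forall z t, r (gact T z t) = gact Y z (r t)}.
  case=> u v /setXP[Pu' Rv'] t; have Pu : u \in P := Pu'; have Rv : v \in R := Rv'.
  suff e : (r \o gact T (u, v) = gact Y (u, v) \o r)%VF.
    by rewrite -[LHS]comp_lfunE e comp_lfunE.
  apply: tensb_ext => a y; rewrite comp_lfunE [RHS]comp_lfunE tclass_gact ?(subsetP sPG) //.
  have e : r (tclass a (gact Y (1%g, v) y)) = gact Y (1%g, v) (r (tclass a y)).
    by rewrite !rE lfun_lincomb; apply: eq_bigr => w Pw; rewrite YM // YM'.
  by rewrite E2 // e YM.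
have sXX : setX_group P R \subset setX_group G R by apply: setXS.
have inv1 (x : gT) : (x, 1%g)^-1%g = (x^-1%g, 1%g) :> gT * hT by congr pair; rewrite ?invg1.
have Y1 y : gact Y (1%g, 1%g) y = y by rewrite (gact1 Y : gact Y (1%g, 1%g) = _) id_lfunE.
exists io, r; split=> //.
  rewrite (@trace_reindex _ _ _ (gact (endm T)) (setX_group P R) (setX_group G R) _
     (mem (lcosets P G)) (fun C => (repr C, 1%g : hT))).
  - suff e : \sum_(C in lcosets P G) gact (endm T) (repr C, 1%g) (io \o r)%VF = \1%VF by [].
    apply: tensb_ext => a y; rewrite sum_lfunE id_lfunE -[RHS](E3 a y).
    apply: eq_bigr => C CP; have [GC eC] := lcoset_repr sPG CP.
    rewrite endmE !mul_lfunE (comp_lfunE io r) inv1 tclass_gact ?group1 ?groupV //.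
    by rewrite Y1 ioE tclass_gact ?group1 // Y1.
  - exact: gact_action.
  - exact: sXX.
  - move=> z Rz; apply/lfunP=> t; rewrite endmE !mul_lfunE !(comp_lfunE io r).
    by rewrite req ?groupV // ioeq ?groupV // gactVKv // (subsetP sXX).
  - by move=> C CP; have [GC _] := lcoset_repr sPG CP; rewrite inE /= GC group1.
  - move=> C C' CP CP'; have [GC eC] := lcoset_repr sPG CP.
    have [GC' eC'] := lcoset_repr sPG CP'; rewrite mem_lcoset inv1 inE /= => /andP[+ _].
    by rewrite -mem_lcoset => cc; rewrite eC eC'; apply/lcoset_eqP.
  case=> g v /setXP[/= Gg Rv]; pose C := (g *: P)%g.
  have CP : C \in lcosets P G by apply/lcosetsP; exists g.
  exists C => //; have [GC eC] := lcoset_repr sPG CP.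
  rewrite mem_lcoset inv1 inE /= mul1g Rv andbT -mem_lcoset -eC /=.
  exact: lcoset_refl.
move=> y; rewrite ioE gopE.
rewrite (eq_bigr (fun x => tclass ((i x : k) *: gact A (x, 1%g) (bimodl_gen G P i)) y : T)).
  rewrite /tclass -linear_sum -pure_suml; congr (quot_proj _ (pure_tens _ y)).
  suff e : vsval (\sum_(x in G) (i x : k) *: gact A (x, 1%g) (bimodl_gen G P i)) =
      vsval (bimodl_gen G P i) by apply: val_inj e.
  rewrite vsval_lincomb bimodl_genE //.
  transitivity (\sum_(x in G) (i x : k) *: (gelt x * i)); last first.
    apply: esym; rewrite -[LHS]ii {1}(kspan_sum Gi) mulr_suml.
    by apply: eq_bigr => x _; rewrite -scalerAl.
  apply: eq_bigr => x Gx; rewrite bimod_gact ?group1 // bimodl_genE // invg1.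
  by rewrite [gelt 1]gelt1E mulr1.
move=> x Gx; rewrite tclass_gact ?group1 // Y1.
by rewrite /tclass -linearZ -pureZl.
Qed.

End LeftBimod.

Section Induction.

Variables (k : fieldType) (gT : finGroupType) (G L : {group gT}).
Hypothesis sLG : L \subset G.
Variable V : gmod k L.

(* This characterises Ind_L^G(V) up to isomorphism. *)
Definition induced_from (W : gmod k G) : Prop :=
  exists (io : 'Hom(V, W)) (r : 'Hom(W, V)),
  [/\ {in L, forall z x, io (gact V z x) = gact W z (io x)},
      {in L, forall z t, r (gact W z t) = gact V z (r t)},
      trace (gact (endm W)) L G (io \o r)%VF = 1,
      cancel io r
    & {in G, forall x v, x \notin L -> r (gact W x (io v)) = 0}].

Lemma indm_induced : induced_from (indm G V).
Proof.
have G1 : (1 : grpalg k gT) \in kspan k G by apply: kspan1.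
have L1 : {in L, forall x, gconj x 1 = 1 :> grpalg k gT} by move=> x _; apply: gconj_one.
have [io [r [ioE rE E1 E2 E3]]] := tens_left sLG G1 L1 (mulr1 _) (gact_action V).
set A := bimod G 1 L in io r ioE rE E1 E2 E3 *; set gen := bimodl_gen G L 1 in ioE E1 E3 *.
pose W := indm G V.
pose cl (a : A) (v : V) : W := quot_proj (tens_rel L (ract A) (gact V)) (pure_tens a v).
have {}ioE y : io y = cl gen y := ioE y.
have {}rE a y : r (cl a y) = \sum_(u in L) (vsval a u : k) *: gact V u y := rE a y.
have {}E1 l y : l \in L -> cl (gact A (l, 1%g) gen) y = io (gact V l y) by move=> Ll; apply: E1.
have {}E2 l a y : l \in L -> r (cl (gact A (l, 1%g) a) y) = gact V l (r (cl a y)).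
  by move=> Ll; apply: E2.
have {}E3 a b : \sum_(C in lcosets L G) cl (gact A (repr C, 1%g) gen)
   (r (cl (gact A ((repr C)^-1%g, 1%g) a) b)) = cl a b := E3 a b.
have clG x a v : x \in G -> gact W x (cl a v) = cl (gact A (x, 1%g) a) v.
  move=> Gx; rewrite /W /cl quom_gact //= /tensm_act0 tens_map_pure id_lfunE //.
have W_ext (V' : vectType k) (g h : 'Hom(W, V')) : (forall a b, g (cl a b) = h (cl a b)) -> g = h.
  exact: tens_quot_ext.
have genE : vsval gen = 1 := bimodl_genE sLG G1 L1 (mulr1 _).
have ioeq : {in L, forall z x, io (gact V z x) = gact W z (io x)}.
  by move=> l Ll x; rewrite [io x]ioE clG ?(subsetP sLG) // E1.
have req : {in L, forall z t, r (gact W z t) = gact V z (r t)}.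
  move=> l Ll t; suff e : (r \o gact W l = gact V l \o r)%VF.
    by rewrite -[LHS]comp_lfunE e comp_lfunE.
  by apply: W_ext => a b; rewrite comp_lfunE [RHS]comp_lfunE clG ?(subsetP sLG) // E2.
exists io, r; split=> //.
- rewrite traceE.
  suff e : \sum_(C in lcosets L G) gact (endm W) (repr C) (io \o r)%VF = \1%VF by [].
  apply: W_ext => a b; rewrite sum_lfunE id_lfunE -[RHS](E3 a b).
  apply: eq_bigr => C CL; have [GC eC] := lcoset_repr sLG CL.
  by rewrite endmE !mul_lfunE (comp_lfunE io r) clG ?groupV // ioE clG.
- move=> v; rewrite ioE rE genE (bigD1 1%g) //= -gelt1E geltE eqxx scale1r gact1v.
  rewrite big1 ?addr0 // => u /andP[_ ne]; by rewrite geltE (negPf ne) scale0r.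
move=> x Gx v nLx; rewrite ioE clG // rE big1 // => u Lu.
rewrite bimod_gact ?group1 // genE mulr1 invg1 [gelt 1]gelt1E mulr1 geltE.
by case: eqP => [e|_]; [rewrite e (negPf nLx) in Lu | rewrite scale0r].
Qed.

Lemma induced_trace (W : gmod k G) (io : 'Hom(V, W)) (r : 'Hom(W, V)) (D : {group gT}) s :
    D \subset L ->
    {in L, forall z x, io (gact V z x) = gact W z (io x)} ->
    {in L, forall z t, r (gact W z t) = gact V z (r t)} ->
    trace (gact (endm W)) L G (io \o r)%VF = 1 ->
    {in D, forall d, gact (endm V) d s = s} -> trace (gact (endm V)) D L s = 1 ->
  {in D, forall d, gact (endm W) d (transfer io r s) = transfer io r s} /\
  trace (gact (endm W)) D G (transfer io r s) = 1.
Proof.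
move=> sDL ioeq req tr1 Ds trs; split.
  exact: (transfer_fix sDL ioeq req Ds).
apply: (trace_transfer sLG sDL ioeq req _ Ds trs).
by rewrite /transfer comp_lfun1r.
Qed.

End Induction.

Section SourceTrace.

Variables (k : fieldType) (gT hT : finGroupType) (G P : {group gT}) (H R : {group hT}).
Variables (D : {group gT * hT}) (M : gmod k (setX_group G H)) (V : gmod k D).
Variables (i : grpalg k gT) (j : grpalg k hT).
Hypotheses (sPG : P \subset G) (sRH : R \subset H) (sDPR : D \subset setX_group P R).
Hypotheses (Gi : i \in kspan k G) (Hj : j \in kspan k H).
Hypotheses (Pi : {in P, forall x, gconj x i = i}) (ii : i * i = i).
Hypotheses (Rj : {in R, forall x, gconj x j = j}) (jj : j * j = j).
Hypothesis M_summand :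
     dsummand M (tensb (tensb (bimod G i P) (indm (setX_group P R) V)) (bimod R j H)).

Local Notation act := (gact (endm M)).

(* Higman's criterion for M, with a trace form supported on i (x) j. *)
Lemma source_trace : exists psi : 'End(M),
  [/\ {in D, forall d, act d psi = psi}, trace act D (setX_group G H) psi = 1,
      gop M (fun x => (x, 1%g)) G i * psi = psi
    & gop M (fun y => (1%g, y)) H (galg_opp j) * psi = psi].
Proof.
have [io0 [r0 [ioe0 re0 tr0 _ _]]] := indm_induced sDPR V.
pose U := indm (setX_group P R) V.
(* The identity of [V] is the initial trace form, from [D] to [D]. It is transferred through the
   induction to P x R, the tensor product with kGi, the one with jkH, and finally to the summand
   [M]. The maps [io1] and [io2] take values fixed by i and j, and the later maps respect these
   actions. *)
have aD1 : {in D, forall d, gact (endm V) d 1 = 1} by move=> d Dd; apply: endm_one.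
have tr1V : trace (gact (endm V)) D D 1 = 1 by apply: trace_id.
have [f0 t0] := induced_trace sDPR (subxx D) ioe0 re0 tr0 aD1 tr1V.
set psi0 := transfer io0 r0 1 in f0 t0.
have sXX1 : setX_group P R \subset setX_group G R by apply: setXS.
have sXX2 : setX_group G R \subset setX_group G H by apply: setXS.
have [io1 [r1 [ioe1 re1 tr1 i1]]] := tens_leftb sPG Gi Pi ii U.
have [f1 t1] := induced_trace sXX1 sDPR ioe1 re1 tr1 f0 t0.
set psi1 := transfer io1 r1 psi0 in f1 t1.
have [io2 [r2 [ioe2 re2 tr2 j2]]] := tens_right sRH Hj Rj jj (tensb (bimod G i P) U).
have [f2 t2] := induced_trace sXX2 (subset_trans sDPR sXX1) ioe2 re2 tr2 f1 t1.
set psi2 := transfer io2 r2 psi1 in f2 t2.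
have [io [r [ioe re rio]]] := dsummand_retract M_summand.
have sDZ := subset_trans (subset_trans sDPR sXX1) sXX2.
exists (transfer r io psi2); split.
- exact: (transfer_fix sDZ re ioe f2).
- pose tr : 'Hom('End(tensb (tensb (bimod G i P) U) (bimod R j H)), 'End(M)) := linfun (transfer r io).
  have trE t : tr t = transfer r io t := linfunE (transfer_lin r io) t.
  rewrite -trE -(trace_map (act := gact (endm (tensb (tensb (bimod G i P) U) (bimod R j H))))) //.
    rewrite t2 trE; apply/lfunP=> v; rewrite transferE !one_lfunE.
    exact: rio.
  by move=> z Zz; rewrite !trE (transfer_act re ioe).
- apply/lfunP=> v; rewrite mul_lfunE !transferE.
  rewrite -(gop_equivariant (h := r)); last first.
    by move=> x Gx w; apply: re; rewrite inE /= Gx group1.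
  rewrite -(gop_equivariant (h := io2)); last first.
    by move=> x Gx w; apply: ioe2; rewrite inE /= Gx group1.
  by rewrite i1.
apply/lfunP=> v; rewrite mul_lfunE !transferE.
rewrite -(gop_equivariant (h := r)); last first.
  by move=> y Hy w; apply: re; rewrite inE /= Hy group1.
by rewrite j2.
Qed.

End SourceTrace.

Lemma brauer_ker_lower (k : fieldType) (gT : finGroupType) (L P : {group gT})
    (A : gmod k L) : brauer_ker A P = lower (gact A) fullv P.
Proof.
apply: eq_bigr => Q _; congr (_ @: _)%VS; by rewrite /fixed capfv.
Qed.

Lemma fixvP (k : fieldType) (gT : finGroupType) (L P : {group gT}) (A : gmod k L) v :
  reflect {in P, forall x, gact A x v = v} (v \in fixv A P).
Proof.
have -> : fixv A P = fixed (gact A) fullv P by rewrite /fixed capfv.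
by apply: (iffP (fixedP _ _ _ _)) => [[]//|]; split; rewrite ?memvf.
Qed.

(** * The slash map *)

Section Cut.

Variables (k : fieldType) (p : nat) (gT : finGroupType) (G P N : {group gT}).
Variables (M : gmod k G) (e : grpalg k gT).
Hypothesis sN : N \subset stabiliser G P e.
Hypothesis sPN : P \subset N.
Local Notation E := (galg_act M e).
Hypothesis EE : E * E = E.
Local Notation eM := (cutm M sN).
Local Notation U := (limg E).
Local Notation act := (gact (endm M)).

Lemma stab_memG z : z \in N -> z \in G.
Proof. by move/(subsetP sN)/(subsetP (stabiliser_sub G P e)). Qed.

Lemma cut_idem_fix z : z \in N -> act z E = E.
Proof.
move=> Nz; apply/endm_commute; first exact: stab_memG.
have /(subsetP sN)/setIdP[_ /eqP ez] := Nz.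
exact: galg_act_comm (stab_memG Nz) ez.
Qed.

Lemma cut_idem_id v : v \in U -> E v = v.
Proof. by case/memv_imgP=> w _ ->; rewrite -mul_lfunE EE. Qed.

Definition cut_in : 'Hom(eM, M) := linfun (vsval : subvs_of U -> M).
Definition cut_out : 'Hom(M, eM) := (linfun (vsproj U) \o E)%VF.

Lemma cut_inE (v : eM) : cut_in v = vsval v. Proof. by rewrite /cut_in lfunE. Qed.

Lemma cut_in_out v : cut_in (cut_out v) = E v.
Proof.
by rewrite cut_inE /cut_out comp_lfunE lfunE /= vsprojK ?memv_img ?memvf.
Qed.

Lemma cut_out_in v : cut_out (cut_in v) = v.
Proof.
rewrite cut_inE /cut_out comp_lfunE cut_idem_id ?subvsP // lfunE /=; exact: vsvalK.
Qed.

Lemma cut_in_act z v : z \in N -> cut_in (gact eM z v) = gact M z (cut_in v).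
Proof. by move=> Nz; rewrite !cut_inE subm_gact. Qed.

Lemma cut_out_act z v : z \in N -> cut_out (gact M z v) = gact eM z (cut_out v).
Proof.
move=> Nz; apply: (can_inj cut_out_in); rewrite cut_in_act // !cut_in_out.
have /endm_commute := cut_idem_fix Nz; move=> /(_ (stab_memG Nz))/lfunP/(_ v).
by rewrite !mul_lfunE.
Qed.

(** [cut] and [uncut] identify End_k(eM) with the corner E End_k(M) E. As [cut] compresses, it is
    multiplicative only in the form [cutM], with E between the factors. *)
Definition cut (y : 'End(M)) : 'End(eM) := (cut_out \o y \o cut_in)%VF.
Definition uncut (t : 'End(eM)) : 'End(M) := (cut_in \o t \o cut_out)%VF.

Lemma cutE y v : cut y v = cut_out (y (cut_in v)). Proof. by rewrite !comp_lfunE. Qed.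
Lemma uncutE y v : uncut y v = cut_in (y (cut_out v)). Proof. by rewrite !comp_lfunE. Qed.

Lemma cut_lin : linear cut.
Proof.
by move=> s y y'; apply/lfunP=> v; rewrite !(cutE, add_lfunE, scale_lfunE) linearP.
Qed.

Lemma uncut_lin : linear uncut.
Proof.
by move=> s y y'; apply/lfunP=> v; rewrite !(uncutE, add_lfunE, scale_lfunE) linearP.
Qed.

Lemma cut_act z y : z \in N -> cut (act z y) = gact (endm eM) z (cut y).
Proof.
move=> Nz; apply/lfunP=> v; rewrite cutE !endmE !mul_lfunE cutE.
by rewrite cut_out_act // cut_in_act ?groupV.
Qed.

Lemma uncut_act z t : z \in N -> uncut (gact (endm eM) z t) = act z (uncut t).
Proof.
move=> Nz; apply/lfunP=> v; rewrite uncutE !endmE !mul_lfunE uncutE.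
by rewrite cut_in_act // cut_out_act ?groupV.
Qed.

Lemma cutK t : cut (uncut t) = t.
Proof. by apply/lfunP=> v; rewrite cutE uncutE !cut_out_in. Qed.

Lemma uncutK y : uncut (cut y) = E * y * E.
Proof. by apply/lfunP=> v; rewrite uncutE cutE !cut_in_out !mul_lfunE. Qed.

Lemma cutM y y' : cut (y * E * y') = cut y * cut y'.
Proof.
by apply/lfunP=> v; rewrite cutE !mul_lfunE -cut_in_out -!cutE.
Qed.

Lemma cut_El y : cut (E * y) = cut y.
Proof.
apply/lfunP=> v; rewrite !cutE mul_lfunE; apply: (can_inj cut_out_in).
by rewrite !cut_in_out -mul_lfunE EE.
Qed.

Lemma cut_Er y : cut (y * E) = cut y.
Proof. by apply/lfunP=> v; rewrite !cutE mul_lfunE -cut_in_out cut_out_in. Qed.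

Lemma cut_gact z : z \in N -> cut (gact M z) = gact eM z.
Proof. by move=> Nz; apply/lfunP=> v; rewrite cutE cut_out_act // cut_out_in. Qed.

Variable MP : gmod k N.

(** The slash isomorphism read on End_k(M) itself, which avoids the quotient and the submodule eM.
    Injectivity holds only on the image of the fixed points, so the clause about the kernel asks for
    a fixed y and returns its compression. *)
Definition slash_map (th : 'Hom('End(M), 'End(MP))) : Prop :=
  [/\ forall y, y \in lower act fullv P -> th y = 0,
      forall y, {in P, forall d, act d y = y} -> th y = 0 -> E * y * E \in lower act fullv P,
      forall t, exists y, {in P, forall d, act d y = y} /\ th y = t
    & [/\ forall y y', {in P, forall d, act d y = y} -> {in P, forall d, act d y' = y'} ->
            th (y * E * y') = th y * th y',
      forall y, th (E * y) = th y,
      forall y, th (y * E) = th y,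
      {in N, forall z y, {in P, forall d, act d y = y} ->
        th (act z y) = gact (endm MP) z (th y)}
    & {in 'C_G(P), forall z, th (gact M z) = gact MP z}]].

Lemma slashed_map : slashed p M sN MP -> exists th, slash_map th.
Proof.
move=> [sPC _ [theta [kth ith thM tha thg]]].
pose A := endm eM.
pose cutl : 'Hom('End(M), 'End(eM)) := linfun cut.
have cutlE y : cutl y = cut y := linfunE cut_lin y.
pose uncutl : 'Hom('End(eM), 'End(M)) := linfun uncut.
have uncutlE y : uncutl y = uncut y := linfunE uncut_lin y.
pose th : 'Hom('End(M), 'End(MP)) := (theta \o brauer_proj A P \o cutl)%VF.
have thE y : th y = theta (brauer_proj A P (cut y)) by rewrite !comp_lfunE cutlE.
have Pcut y : {in P, forall d, act d y = y} -> cut y \in fixv A P.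
  by move=> Py; apply/fixvP=> d Pd; rewrite -cut_act ?Py // (subsetP sPN).
exists th; split.
- move=> y ly; rewrite thE; suff -> : brauer_proj A P (cut y) = 0 by rewrite linear0.
  apply/eqP; rewrite quot_proj_eq0 brauer_ker_lower -cutlE.
  apply: lower_map ly => [d Pd u _|u _]; last exact: memvf.
  by rewrite !cutlE cut_act // (subsetP sPN).
- move=> y Py y0; rewrite -uncutK -uncutlE.
  have: cut y \in lower (gact A) fullv P.
    rewrite -brauer_ker_lower -quot_proj_eq0 -memv0 -kth memv_cap memv_ker.
    by rewrite -thE y0 eqxx andbT; apply/memv_img/Pcut.
  apply: lower_map => [d Pd u _|u _]; last exact: memvf.
  by rewrite !uncutlE uncut_act // (subsetP sPN).
- move=> t; have : t \in fullv by apply: memvf.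
  rewrite -ith => /memv_imgP[_ /memv_imgP[f Pf ->] ->]; exists (uncut f).
  split; last by rewrite thE cutK.
  move=> d Pd; rewrite -uncut_act ?(subsetP sPN) //; congr (uncut _).
  by have /fixvP := Pf; apply.
split.
- by move=> y y' Py Py'; rewrite !thE cutM thM ?Pcut.
- by move=> y; rewrite !thE cut_El.
- by move=> y; rewrite !thE cut_Er.
- by move=> z Nz y Py; rewrite !thE cut_act // tha ?Pcut.
move=> z Cz; have Nz : z \in N.
  by apply: (subsetP sPC); rewrite -[z]mul1g mem_mulg.
by rewrite thE cut_gact // thg.
Qed.

End Cut.

Section TensorIdempotent.

Variables (k : fieldType) (gT hT : finGroupType).
Implicit Types (a e : grpalg k gT) (b f : grpalg k hT).

Lemma galg_tensE a b x y : galg_tens a b (x, y) = (a x : k) * b y.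
Proof. by rewrite ffunE. Qed.

Lemma gconj_tens a b x y : gconj (x, y) (galg_tens a b) = galg_tens (gconj x a) (gconj y b).
Proof. by apply/ffunP=> -[u v]; rewrite gconjE [RHS]galg_tensE !gconjE ffunE. Qed.

Lemma grpalg_neq0 (rT : finGroupType) (c : grpalg k rT) : c != 0 -> exists x, c x != 0.
Proof.
move=> nz; apply/existsP; apply: contraNT nz; rewrite negb_exists => /forallP c0.
by apply/eqP/ffunP=> x; rewrite ffunE; apply/eqP; move: (c0 x); rewrite negbK.
Qed.

(** Equal nonzero pure tensors have proportional factors; between two nonzero idempotents the
    proportionality scalar is a nonzero idempotent of the field, hence 1. *)
Lemma galg_tens_inj a e b f : a * a = a -> e * e = e -> e != 0 -> f != 0 ->
  galg_tens a b = galg_tens e f -> a = e /\ b = f.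
Proof.
move=> aa ee e0 f0 abef.
have ab x y : (a x : k) * b y = (e x : k) * f y by rewrite -!galg_tensE abef.
have [y0 fy] := grpalg_neq0 f0; have [x0 ex] := grpalg_neq0 e0.
pose s : k := b y0 / f y0.
have es : e = s *: a.
  apply/ffunP=> x; rewrite ffunE /= /s [_ *: _]mulrC mulrA ab mulfK //.
have ss : s * s = s.
  have : (s * s) *: a = s *: a by rewrite -[RHS]es -[RHS]ee es -scalerAl -scalerAr scalerA aa.
  move/eqP; rewrite -subr_eq0 -scalerBl scaler_eq0 subr_eq0 => /orP[/eqP//|/eqP a0].
  by rewrite es a0 scaler0 eqxx in e0.
have s0 : s != 0 by apply: contraNneq e0 => s0; rewrite es s0 scale0r.
have s1 : s = 1 by apply: (mulfI s0); rewrite mulr1.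
have ae : a = e by rewrite es s1 scale1r.
split=> //; apply/ffunP=> y; apply: (mulfI ex); by rewrite -ab ae.
Qed.

Variables (G : {group gT}) (H : {group hT}) (M : gmod k (setX_group G H)).

Lemma galg_act_tens a b : galg_act M (galg_tens a b) =
  gop M (inL (stdcoord gT hT)) G a * gop M (inR (stdcoord gT hT)) H b.
Proof.
rewrite /galg_act /gop mulr_suml.
rewrite (eq_bigr (fun x => \sum_(y in H) ((a x : k) * b y) *: gact M (x, y))) => [|x Gx].
  by rewrite pair_big; apply: eq_big => [[x y]|[x y] _] /=; rewrite ?inE ?galg_tensE.
rewrite mulr_sumr; apply: eq_bigr => y Hy.
rewrite -lfun_scalerAl -lfun_scalerAr scalerA -gactMr ?inE /= ?Gx ?Hy ?group1 //.
by congr (_ *: gact M (_, _)); rewrite ?mul1g ?mulg1.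
Qed.

End TensorIdempotent.

(** * Projectivity and the stable equivalence *)

Section HigmanProjective.

Variables (k : fieldType) (gT : finGroupType) (G : {group gT}).
Implicit Types M N : gmod k G.

(* Higman's criterion for projectivity. *)
Definition higman M : Prop :=
  exists s : 'End(M), forall v, \sum_(x in G) gact M x (s (gact M x^-1%g v)) = v.

Lemma higman_retract M N : retract M N -> higman N -> higman M.
Proof.
move=> [io [r [ioe re rio]]] [s sE]; exists (transfer r io s) => v.
rewrite -[RHS]rio -[io v]sE linear_sum; apply: eq_bigr => x Gx.
by rewrite transferE ioe ?groupV //= re.
Qed.

Lemma higman_dsum M N : higman M -> higman N -> higman (dsum M N).
Proof.
move=> [s sE] [t tE].
have l : linear (fun v : M * N => (s v.1, t v.2)) by move=> a u v /=; rewrite !linearP.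
exists (linfun (fun v : M * N => (s v.1, t v.2) : dsum M N)) => -[u v].
rewrite -[u in RHS]sE -[v in RHS]tE.
rewrite (eq_bigr (fun x => (gact M x (s (gact M x^-1%g u)), gact N x (t (gact N x^-1%g v))))).
  rewrite (surjective_pairing (\sum_(x in G) _)).
  by congr pair; [apply: (big_morph (@fst M N)) | apply: (big_morph (@snd M N))].
by move=> x Gx; rewrite !dsumE (linfunE l).
Qed.

Lemma higman_gmod0 : higman (gmod0 k G).
Proof.
exists 0 => v; rewrite big1 => [|x _]; last by rewrite zero_lfunE linear0.
by apply/rowP=> -[].
Qed.

Lemma higman_dsums n M : higman M -> higman (dsums (nseq n M)).
Proof.
by move=> hM; elim: n => [|n IHn]; [exact: higman_gmod0 | exact: higman_dsum].
Qed.

(** The form is a -> a(1) e: its x-conjugate sends a to a(x) x e, and these add up to a e = a. *)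
Lemma higman_bimod (e : grpalg k gT) : e \in 'Z(kspan k G)%VS -> e * e = e ->
  higman (lresm (bimod G e G)).
Proof.
move=> /centerP[Ge Ze] ee; pose B := bimod G e G.
have BP := bimodlP (subxx G) Ge Ze ee.
pose pr (a : grpalg k gT) : B := vsproj _ a.
have prE a : a \in kspan k G -> a * e = a -> vsval (pr a) = a.
  by move=> Ga ae; rewrite /pr vsprojK //; apply/BP.
have l : linear (fun a : B => (vsval a 1%g : k) *: pr e).
  by move=> s a b; rewrite !ffunE /= scalerDl scalerA.
have [s sE] : exists s : 'End(B), forall a, s a = (vsval a 1%g : k) *: pr e.
  by exists (linfun (fun a : B => (vsval a 1%g : k) *: pr e)); apply: (linfunE l).
exists s => a.
suff e1 : vsval (\sum_(x in G) gact B (x, 1%g) (s (gact B (x^-1%g, 1%g) a))) = vsval a.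
  exact: val_inj e1.
have /BP[Ga ae] := subvsP a.
rewrite (eq_bigr (fun x => (vsval a x : k) *: gact B (x, 1%g) (pr e))).
  rewrite vsval_lincomb -[RHS]ae [X in _ = X * _](kspan_sum Ga) mulr_suml.
  apply: eq_bigr => x Gx; rewrite -scalerAl; congr (_ *: _).
  by rewrite bimod_gact ?group1 // prE // invg1 [gelt 1]gelt1E mulr1.
move=> x Gx; rewrite sE linearZ; congr (_ *: _).
by rewrite bimod_gact ?groupV ?group1 // invg1 [gelt 1]gelt1E mulr1 gmul_geltl invgK mulg1.
Qed.

Lemma projective_higman (e : grpalg k gT) M : e \in 'Z(kspan k G)%VS -> e * e = e ->
  projective e M -> higman M.
Proof.
move=> Ze ee [n /dsummand_retract rM]; apply: higman_retract rM _.
exact/higman_dsums/higman_bimod.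
Qed.

(** Projectivity restricts along an injective homomorphism: this is [trace_free] for the trivial
    subgroup, whose conjugates meet the image of [K] trivially. *)
Lemma higman_restrict M (T : finGroupType) (K : {group T}) (j : T -> gT) :
    {in K &, {morph j : x y / (x * y)%g}} -> {in K, forall x, j x \in G} ->
    {in K, forall x, j x = 1%g -> x = 1%g} -> higman M ->
  exists s : 'End(M), forall v, \sum_(x in K) gact M (j x) (s (gact M (j x)^-1%g v)) = v.
Proof.
move=> jM jK j1 [s sE].
have aG := gact_action (endm M); have a1 := gact1 (endm M).
have [|||||t tE] := @trace_free _ _ _ 1%G G (gact (endm M)) s T K j aG.
- exact: sub1G.
- by move=> x /set1P->; rewrite a1 id_lfunE.
- exact: jM.
- exact: jK.
- move=> z x Gz Kx /set1P e; apply: j1 => //.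
  by apply: (conjg_inj z); rewrite e conj1g.
exists t => v; rewrite -[RHS]sE.
transitivity ((\sum_(x in K) gact (endm M) (j x) t) v).
  by rewrite sum_lfunE; apply: eq_bigr => x Kx; rewrite endmE !mul_lfunE.
rewrite -tE trace1 // sum_lfunE; apply: eq_bigr => x Gx.
by rewrite endmE !mul_lfunE.
Qed.

End HigmanProjective.

Section TensAlgebra.

Variables (k : fieldType) (gT hT : finGroupType) (G : {group gT}) (H : {group hT}).
Implicit Types (a : grpalg k gT) (b : grpalg k hT).

Lemma galg_tensM a a' b b' :
  galg_tens a b * galg_tens a' b' = galg_tens (a * a') (b * b').
Proof.
apply/ffunP=> -[u v]; rewrite [RHS]galg_tensE !gmulE mulr_suml.
rewrite (eq_bigr (fun x => \sum_y (a x * a' (x^-1 * u)%g) * (b y * b' (y^-1 * v)%g))).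
  by rewrite pair_bigA; apply: eq_bigr => -[x y] _; rewrite !ffunE /= mulrACA.
by move=> x _; rewrite mulr_sumr.
Qed.

Lemma galg_tens_center a b : a \in 'Z(kspan k G)%VS -> b \in 'Z(kspan k H)%VS ->
  galg_tens a b \in 'Z(kspan k (setX_group G H))%VS.
Proof.
move=> /centerP[/kspanP Ga Za] /centerP[/kspanP Hb Zb]; apply/centerP; split.
  apply/kspanP=> -[x y]; rewrite inE /= negb_and galg_tensE => /orP[/Ga->|/Hb->].
    exact: mul0r.
  exact: mulr0.
by case=> x y /setXP[/= Gx Hy]; rewrite gconj_tens Za ?Zb.
Qed.

Lemma galg_opp_center b : b \in 'Z(kspan k H)%VS -> galg_opp b \in 'Z(kspan k H)%VS.
Proof.
move=> /centerP[Hb Zb]; apply/centerP; split=> [|x Hx]; first by rewrite mem_galg_opp.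
by rewrite -galg_opp_gconj Zb.
Qed.

Lemma block_opp b : block H b -> block H (galg_opp b).
Proof.
have opp0 : galg_opp 0 = 0 :> grpalg k hT by apply/ffunP=> x; rewrite !ffunE.
have oppD (x y : grpalg k hT) : galg_opp (x + y) = galg_opp x + galg_opp y.
  by apply/ffunP=> z; rewrite !ffunE.
move=> [Zb nz bb prim]; split; first exact: galg_opp_center.
- by apply: contraNneq nz => b0; rewrite -(galg_oppK b) b0 opp0.
- by rewrite -galg_oppM bb.
move=> f g Zf Zg ff gg fg gf e.
have [|||||||f0|g0] := prim (galg_opp f) (galg_opp g).
- exact: galg_opp_center.
- exact: galg_opp_center.
- by rewrite -galg_oppM ff.
- by rewrite -galg_oppM gg.
- by rewrite -galg_oppM gf opp0.
- by rewrite -galg_oppM fg opp0.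
- by rewrite -oppD -e galg_oppK.
- by left; rewrite -(galg_oppK f) f0 opp0.
by right; rewrite -(galg_oppK g) g0 opp0.
Qed.

Lemma brauer_map_opp (R : {group hT}) b : brauer_map R (galg_opp b) = galg_opp (brauer_map R b).
Proof. by apply/ffunP=> x; rewrite !ffunE groupV. Qed.

End TensAlgebra.

Section EndoBrauerIso.

Variables (k : fieldType) (p : nat) (charkp : p \in [pchar k]).
Variables (gT hT zT : finGroupType) (c : prodcoord gT hT zT).
Variables (G : {group gT}) (H : {group hT}) (Z : {group zT}).
Hypothesis memZ : forall z, (z \in Z) = (prL c z \in G) && (prR c z \in H).
Variable M : gmod k Z.

Local Notation act := (gact (endm M)).
Local Notation actL := (fun x => act (inL c x)).
Local Notation lop := (gop M (inL c) G).
Local Notation T := (right_endo c H M).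

Variable P : {group gT}.
Hypotheses (sPG : P \subset G) (pP : p.-group P) (nP : P :!=: 1%g).
Local Notation lowP := (lower actL T P).
Local Notation kC := (kspan k 'C_G(P)%g).

Variables (b : grpalg k gT) (bb : block G b).
Local Notation kGb := (kspan k G * <[b]>)%VS.

Variables (X W : gmod k (setX_group G G)) (h : 'Hom(dsum X W, 'End(M))).
Variable t : 'Hom(grpalg k gT, X).
Hypothesis W_higman : higman W.
Hypothesis h_inj : lker h = 0%VS.
Hypothesis h_T : limg h = T.
Hypothesis h_diag : {in G, forall x v, h (gact (dsum X W) (x, x) v) = actL x (h v)}.
Hypothesis t_inj : {in kGb, forall a, t a = 0 -> a = 0}.
Hypothesis t_sur : forall v : X, exists2 a, a \in kGb & t a = v.
Hypothesis t_l : {in G, forall x, {in kGb, forall a,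
  h (t (gelt x * a), 0) = gact M (inL c x) * h (t a, 0)}}.
Hypothesis t_r : {in G, forall x, {in kGb, forall a,
  h (t (a * gelt x), 0) = h (t a, 0) * gact M (inL c x)}}.

(** Bridge from a bimodule isomorphism of X + W with End_kH(M) to the subspaces required by the two
    lemmas on T. The map [t] leaves open how kGb is identified with X: by the identity on the left,
    by inversion on the right. *)
Lemma endo_brauer_iso :
  (forall a, a \in kC -> a * brauer_map P b = a -> lop a \in lowP -> a = 0) /\
  (forall s, s \in T -> {in P, forall x, actL x s = s} ->
    exists2 a, a \in kC & s - lop a \in lowP).
Proof.
have hD u w : h (u, w) = h (u, 0) + h (0, w).
  by rewrite -linearD; congr (h (_, _)); rewrite /= ?addr0 ?add0r.
have h0 v : h v = 0 -> v = 0.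
  by move=> e; apply/eqP; rewrite -memv0 -h_inj memv_ker e.
have ql : linear (fun a => h (t a, 0)).
  by move=> s a a'; rewrite -linearP; congr (h (_, _)); rewrite /= ?linearP ?scaler0 ?addr0.
have wl : linear (fun w => h (0, w)).
  by move=> s a a'; rewrite -linearP; congr (h (_, _)); rewrite /= ?scaler0 ?addr0.
pose q : 'Hom(grpalg k gT, 'End(M)) := linfun (fun a => h (t a, 0)).
have qE a : q a = h (t a, 0) := linfunE ql a.
pose w_ : 'Hom(W, 'End(M)) := linfun (fun w => h (0, w)).
have wE w : w_ w = h (0, w) := linfunE wl w.
have W_act x w : x \in G -> actL x (h (0, w)) = h (0, gact W (x, x) w).
  by move=> Gx; rewrite -h_diag // dsumE linear0.
have q_l : {in G, forall x, {in kGb, forall a, q (gelt x * a) = gact M (inL c x) * q a}}.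
  by move=> x Gx a Ga; rewrite !qE t_l.
have q_r : {in G, forall x, {in kGb, forall a, q (a * gelt x) = q a * gact M (inL c x)}}.
  by move=> x Gx a Ga; rewrite !qE t_r.
have q_T : T = (q @: kGb + limg w_)%VS.
  rewrite -h_T; apply/vspaceP=> v; apply/memv_imgP/memv_addP.
    move=> [[u w] _ ->]; have [a Ga ta] := t_sur u.
    exists (q a); rewrite ?memv_img //; exists (w_ w); rewrite ?memv_img ?memvf //.
    by rewrite hD qE wE ta.
  move=> [_ /memv_imgP[a Ga ->] [_ /memv_imgP[w _ ->] ->]].
  by exists (t a, w); rewrite ?memvf // qE wE -hD.
have q_direct a v : a \in kGb -> v \in limg w_ -> q a + v = 0 -> a = 0 /\ v = 0.
  move=> Ga /memv_imgP[w _ ->]; rewrite qE wE -hD => /h0 [ta ->].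
  by split; [apply: t_inj | apply: (linear0 h)].
have W_stab : {in P, forall x, {in limg w_, forall w, actL x w \in limg w_}}.
  move=> x Px _ /memv_imgP[w _ ->]; rewrite wE W_act ?(subsetP sPG) //.
  by rewrite -wE memv_img ?memvf.
(* Restricted to the diagonal copy of [P], the projective [W] is still projective, so its fixed
   vectors are traces from the trivial group; these are proper because [P] is nontrivial. *)
have W_low v : v \in limg w_ -> {in P, forall x, actL x v = v} -> v \in lowP.
  move=> /memv_imgP[w _ ->]; rewrite wE => Pw.
  have Pw0 x : x \in P -> gact W (x, x) w = w.
    move=> Px; have := Pw x Px; rewrite W_act ?(subsetP sPG) // => /eqP.
    by rewrite -subr_eq0 -linearB => /eqP/h0 [] _ /eqP; rewrite subr_eq0 => /eqP.
  have jZ x : x \in P -> (x, x) \in setX_group G G.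
    by move=> Px; rewrite inE /= !(subsetP sPG).
  have [|||s sE] := @higman_restrict k _ _ W gT P (fun x => (x, x)) _ _ _ W_higman.
  - by [].
  - exact: jZ.
  - by move=> x _ [].
  have -> : w = \sum_(x in P) gact W (x, x) (s w).
    rewrite -{1}[w]sE; apply: eq_bigr => x Px; congr (gact W _ (s _)).
    by rewrite -[in LHS](Pw0 x Px) gactKv ?jZ.
  rewrite -wE linear_sum (eq_bigr (fun x => actL x (w_ (s w)))); last first.
    by move=> x Px; rewrite /= !wE W_act // (subsetP sPG).
  have aP : lin_action P actL := lin_actionS sPG (actL_action memZ M).
  have a1 : actL 1%g = 1 by rewrite /= inL1; apply: (gact1 (endm M)).
  rewrite -(trace1 (act := actL)) //; apply: (mem_lower (act := actL)).
  - by rewrite proper1G.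
  - by rewrite q_T -[X in X \in _]add0r memv_add ?mem0v ?memv_img ?memvf.
  by move=> x /set1P->; rewrite a1 one_lfunE.
split=> [a Ca ab la|s Ts Ps].
  exact: (endo_brauer_inj charkp memZ sPG pP bb q_l q_r q_T q_direct W_stab Ca ab la).
exact: (endo_brauer_sur charkp memZ sPG pP bb q_l q_r q_T q_direct W_stab W_low).
Qed.

End EndoBrauerIso.

Section GraphFacts.

Variables (gT hT : finGroupType) (P : {group gT}) (R : {group hT}).
Variable phi : {morphism P >-> hT}.
Local Notation D := (graph phi).

Lemma graphP z : reflect (exists2 u, u \in P & z = (u, phi u)) (z \in D).
Proof. exact: imsetP. Qed.

Lemma graph_fst : P :=: [set z.1 | z in D].
Proof.
apply/setP=> u; apply/idP/imsetP=> [Pu|[_ /graphP[v Pv ->] ->//]].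
by exists (u, phi u) => //; apply/graphP; exists u.
Qed.

Lemma graph_pgroup p : p.-group P -> p.-group D.
Proof.
by move=> pP; rewrite /pgroup card_imset // => u v [].
Qed.

Hypothesis iso_phi : isom P R phi.

Lemma graph_snd : R :=: [set z.2 | z in D].
Proof.
have [_ <-] := isomP iso_phi; apply/setP=> y; apply/morphimP/imsetP.
  by move=> [u _ Pu ->]; exists (u, phi u) => //; apply/graphP; exists u.
by move=> [_ /graphP[u Pu ->] ->]; exists u.
Qed.

Lemma graph_fst1 : {in D, forall z, z.1 = 1%g -> z = 1%g}.
Proof. by move=> _ /graphP[u Pu ->] /= ->; rewrite morph1. Qed.

Lemma graph_snd1 : {in D, forall z, z.2 = 1%g -> z = 1%g}.
Proof.
move=> _ /graphP[u Pu ->] /= e; suff -> : u = 1%g by rewrite morph1.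
have [inj _] := isomP iso_phi; apply: (injmP inj) => //.
by rewrite morph1.
Qed.

Lemma graph_sub : D \subset setX_group P R.
Proof.
apply/subsetP=> z Dz; have /graphP[u Pu e] := Dz; rewrite inE {1}e /= Pu.
have -> : gval R = [set z.2 | z in D] by apply: graph_snd.
exact: imset_f.
Qed.

End GraphFacts.

Lemma defect_groupP (k : fieldType) (gT : finGroupType) (p : nat) (G : {group gT})
  (b : grpalg k gT) (P : {group gT}) : defect_group p G b P ->
  [/\ P \subset G, p.-group P & brauer_map P b != 0].
Proof. by move=> /maxgroupP[/and3P[]]. Qed.

Section StableBrauer.

Variables (k : fieldType) (p : nat) (charkp : p \in [pchar k]).
Variables (gT hT : finGroupType) (G P : {group gT}) (H R : {group hT}).
Variables (b : grpalg k gT) (c : grpalg k hT).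
Hypotheses (bb : block G b) (bc : block H c).
Variable M : gmod k (setX_group G H).
Hypothesis M_stable : stable_equivalence_of_Morita_type b c M.
Hypotheses (sPG : P \subset G) (pP : p.-group P) (nP : P :!=: 1%g).
Hypotheses (sRH : R \subset H) (pR : p.-group R) (nR : R :!=: 1%g).

Local Notation act := (gact (endm M)).
Local Notation cL := (stdcoord gT hT).
Local Notation cR := (prodswap (stdcoord gT hT)).

(** Transport of structure: the norm map identifies End_kH(M) with the tensor product of M and its
    dual, which the stable equivalence splits as kGb plus a projective bimodule. The form [s]
    witnesses projectivity of M over kH. *)
Lemma stable_brauer_l (s : 'End(M)) : \sum_(y in H) act (1%g, y) s = 1 ->
  (forall a, a \in kspan k 'C_G(P)%g -> a * brauer_map P b = a ->
    gop M (inL cL) G a \in lower (fun x => act (inL cL x)) (right_endo cL H M) P -> a = 0) /\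
  (forall s, s \in right_endo cL H M -> {in P, forall x, act (inL cL x) s = s} ->
    exists2 a, a \in kspan k 'C_G(P)%g &
     s - gop M (inL cL) G a \in lower (fun x => act (inL cL x)) (right_endo cL H M) P).
Proof.
move=> /tensb_dual_iso[g [kg ig gE]].
have [_ _ [W W_proj /giso_inv[F [F' [Feq F'eq FK F'K]]]] _] := M_stable.
have [Zb eb] := (block_center bb, block_idem bb).
have Gb := block_kspan bb; have Gfix : {in G, forall x, gconj x b = b} by case/centerP: Zb.
have W_higman : higman W.
  apply: projective_higman W_proj; first exact: galg_tens_center Zb (galg_opp_center Zb).
  by rewrite galg_tensM -galg_oppM eb.
have BP := bimodlP (subxx G) Gb Gfix eb.
have BE : (kspan k G * <[b]> * kspan k G = kspan k G * <[b]>)%VS.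
  by apply: bimod_space => // x Gx; apply/commute_gconj/Gfix.
pose X := bimod G b G.
pose t : 'Hom(grpalg k gT, X) := linfun (vsproj (kspan k G * <[b]> * kspan k G)).
have tE a : a \in (kspan k G * <[b]>)%VS -> vsval (t a) = a.
  by move=> Ga; rewrite lfunE /= vsprojK // BE.
have tX x y a : x \in G -> y \in G -> a \in (kspan k G * <[b]>)%VS ->
    t (gelt x * a * gelt y^-1%g) = gact X (x, y) (t a).
  move=> Gx Gy Ga; apply: val_inj; rewrite [RHS]bimod_gact // (tE a Ga); apply: tE.
  have /BP[Ga1 ab] : a \in (kspan k G * <[b]> * kspan k G)%VS by rewrite BE.
  rewrite -BE; apply/BP; split.
    by rewrite !kspanM ?mem_kspan ?groupV.
  have -> : gelt x * a * gelt y^-1%g * b = gelt x * (a * b) * gelt y^-1%g.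
    rewrite -!mulrA; congr (_ * (_ * _)); apply/commute_gconj/Gfix.
    by rewrite groupV.
  by rewrite ab.
apply: (@endo_brauer_iso _ _ charkp _ _ _ cL G H _ (@mem_stdZ _ _ G H) M P sPG pP nP b bb X W
  (g \o F')%VF t W_higman).
- apply/eqP/lker0P => u v; rewrite !comp_lfunE => e.
  by apply: (can_inj F'K); have /eqP/lker0P := kg; apply.
- rewrite limg_comp -ig; congr (g @: _)%VS; apply/vspaceP=> v; rewrite memvf.
  by apply/memv_imgP; exists (F v); rewrite ?memvf // FK.
- move=> x Gx v. have XX : (x, x) \in setX_group G G by rewrite inE /= Gx.
  by rewrite !comp_lfunE F'eq // gE // endmE -inLV.
- by move=> a Ga e; rewrite -(tE a Ga) e.
- move=> v; have Gv : vsval v \in (kspan k G * <[b]>)%VS by have := subvsP v; rewrite {2}BE.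
  by exists (vsval v) => //; apply: val_inj; apply: tE.
- move=> x Gx a Ga; have XX : (x, 1%g) \in setX_group G G by rewrite inE /= Gx group1.
  have := tX x 1%g a Gx (group1 G) Ga; rewrite invg1 gelt1E mulr1 => ->.
  transitivity (g (F' (gact (dsum X W) (x, 1%g) (t a, 0)))).
    by rewrite comp_lfunE dsumE linear0.
  by rewrite F'eq // gE // invg1 (gact1 M) mulr1 comp_lfunE.
move=> x Gx a Ga; have XX : (1%g, x^-1%g) \in setX_group G G by rewrite inE /= groupV Gx group1.
have := tX 1%g x^-1%g a (group1 G) (groupVr Gx) Ga; rewrite gelt1E mul1r invgK => ->.
transitivity (g (F' (gact (dsum X W) (1%g, x^-1%g) (t a, 0)))).
  by rewrite comp_lfunE dsumE linear0.
by rewrite F'eq // gE ?groupV // invgK (gact1 M) mul1r comp_lfunE.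
Qed.

(** Here [H] acts from the left through inverses, so kHc is read through [galg_opp], which exchanges
    its two sides and replaces [c] by [galg_opp c]. *)
Lemma stable_brauer_r (s : 'End(M)) : \sum_(x in G) act (x, 1%g) s = 1 ->
  (forall a, a \in kspan k 'C_H(R)%g -> a * brauer_map R (galg_opp c) = a ->
    gop M (inL cR) H a \in lower (fun x => act (inL cR x)) (right_endo cR G M) R -> a = 0) /\
  (forall s, s \in right_endo cR G M -> {in R, forall x, act (inL cR x) s = s} ->
    exists2 a, a \in kspan k 'C_H(R)%g &
     s - gop M (inL cR) H a \in lower (fun x => act (inL cR x)) (right_endo cR G M) R).
Proof.
move=> /tensb_dual_iso_swap[g [kg ig gE]].
have [_ _ _ [W W_proj /giso_inv[F [F' [Feq F'eq FK F'K]]]]] := M_stable.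
have bo := block_opp bc; set d := galg_opp c in bo *.
have [Zc ec] := (block_center bc, block_idem bc).
have Hc := block_kspan bc; have Hfix : {in H, forall x, gconj x c = c} by case/centerP: Zc.
have Hd := block_kspan bo; have Hfixd : {in H, forall x, gconj x d = d}.
  by case/centerP: (block_center bo).
have W_higman : higman W.
  apply: projective_higman W_proj; first exact: galg_tens_center Zc (galg_opp_center Zc).
  by rewrite galg_tensM -galg_oppM ec.
have CP := bimodlP (subxx H) Hc Hfix ec.
have DP := bimodlP (subxx H) Hd Hfixd (block_idem bo).
have DE : (kspan k H * <[d]> * kspan k H = kspan k H * <[d]>)%VS.
  by apply: bimod_space => // x Hx; apply/commute_gconj/Hfixd.
have opp_mem a : a \in (kspan k H * <[d]>)%VS -> galg_opp a \in (kspan k H * <[c]> * kspan k H)%VS.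
  move=> Ha; have /DP[Ha1 ad] : a \in (kspan k H * <[d]> * kspan k H)%VS by rewrite DE.
  apply/CP; rewrite mem_galg_opp; split=> //.
  rewrite -(center_commute Zc) ?mem_galg_opp // -[c]galg_oppK -/d -galg_oppM ad.
  by [].
pose X := bimod H c H.
pose t : 'Hom(grpalg k hT, X) :=
  linfun (fun a => vsproj (kspan k H * <[c]> * kspan k H) (galg_opp a) : X).
have t_lin : linear (fun a => vsproj (kspan k H * <[c]> * kspan k H) (galg_opp a) : X).
  by move=> u a a'; rewrite galg_opp_lin linearP.
have tE a : a \in (kspan k H * <[d]>)%VS -> vsval (t a) = galg_opp a.
  by move=> Ha; rewrite (linfunE t_lin) /= vsprojK ?opp_mem.
have tX x y a : x \in H -> y \in H -> a \in (kspan k H * <[d]>)%VS ->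
    t (gelt x * a * gelt y^-1%g) = gact X (y, x) (t a).
  move=> Hx Hy Ha; apply: val_inj; rewrite [RHS]bimod_gact // (tE a Ha).
  transitivity (galg_opp (gelt x * a * gelt y^-1%g)); last first.
    by rewrite !galg_oppM !galg_opp_gelt invgK mulrA.
  apply: tE; have /DP[Ha1 ad] : a \in (kspan k H * <[d]> * kspan k H)%VS by rewrite DE.
  rewrite -DE; apply/DP; split.
    by rewrite !kspanM ?mem_kspan ?groupV.
  have -> : gelt x * a * gelt y^-1%g * d = gelt x * (a * d) * gelt y^-1%g.
    rewrite -!mulrA; congr (_ * (_ * _)); apply/commute_gconj/Hfixd.
    by rewrite groupV.
  by rewrite ad.
apply: (@endo_brauer_iso _ _ charkp _ _ _ cR H G _ (@mem_stdZ_swap _ _ G H) M R sRH pR nR d bo X W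
  (g \o F')%VF t W_higman).
- apply/eqP/lker0P => u v; rewrite !comp_lfunE => e.
  by apply: (can_inj F'K); have /eqP/lker0P := kg; apply.
- rewrite limg_comp -ig; congr (g @: _)%VS; apply/vspaceP=> v; rewrite memvf.
  by apply/memv_imgP; exists (F v); rewrite ?memvf // FK.
- move=> x Hx v; have XX : (x, x) \in setX_group H H by rewrite inE /= Hx.
  by rewrite !comp_lfunE F'eq // gE // endmE -inLV.
- move=> a Ha e; apply: (can_inj (@galg_oppK k hT)); rewrite -tE // e.
  by apply/ffunP=> z; rewrite !ffunE.
- move=> v; have /CP[Hv vc] : vsval v \in (kspan k H * <[c]> * kspan k H)%VS by apply: subvsP.
  have Hv' : galg_opp (vsval v) \in (kspan k H * <[d]>)%VS.
    rewrite -DE; apply/DP; rewrite mem_galg_opp; split=> //.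
    by rewrite -galg_oppM (center_commute Zc) // vc.
  exists (galg_opp (vsval v)) => //; apply: val_inj.
  by rewrite -[RHS]galg_oppK; apply: tE.
- move=> x Hx a Ha; have XX : (1%g, x) \in setX_group H H by rewrite inE /= Hx group1.
  have := tX x 1%g a Hx (group1 H) Ha; rewrite invg1 gelt1E mulr1 => ->.
  transitivity (g (F' (gact (dsum X W) (1%g, x) (t a, 0)))).
    by rewrite comp_lfunE dsumE linear0.
  by rewrite F'eq // gE // invg1 (gact1 M) mulr1 comp_lfunE.
move=> x Hx a Ha; have XX : (x^-1%g, 1%g) \in setX_group H H by rewrite inE /= groupV Hx group1.
have := tX 1%g x^-1%g a (group1 H) (groupVr Hx) Ha; rewrite gelt1E mul1r invgK => ->.
transitivity (g (F' (gact (dsum X W) (x^-1%g, 1%g) (t a, 0)))).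
  by rewrite comp_lfunE dsumE linear0.
by rewrite F'eq // gE ?groupV // invgK (gact1 M) mul1r comp_lfunE.
Qed.

End StableBrauer.

Lemma mem_tens_stabiliser (k : fieldType) (gT hT : finGroupType) (C : {group gT})
    (C' : {group hT}) (Z D : {group gT * hT}) (e : grpalg k gT) (f : grpalg k hT) z :
    block C e -> block C' f ->
  (z \in stabiliser Z D (galg_tens e f)) =
    [&& z \in Z, z \in 'N(D)%g, gconj z.1 e == e & gconj z.2 f == f].
Proof.
move=> be bf; rewrite inE [z \in 'N_Z(D)%g]inE -!andbA.
case Zz: (z \in Z) => //=; case: (z \in 'N(D)%g) => //=; case: z Zz => x y _ /=.
rewrite gconj_tens; apply/eqP/andP => [E|[/eqP-> /eqP->]] //.
have [] := galg_tens_inj _ (block_idem be) (block_neq0 be) (block_neq0 bf) E.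
  by rewrite -gconj_mul (block_idem be).
by move=> -> ->; rewrite !eqxx.
Qed.

Section SlashedLocal.

Variables (k : closedFieldType) (p : nat) (charkp : p \in [pchar k]).
Variables (gT hT : finGroupType) (G : {group gT}) (H : {group hT}).
Variables (b : grpalg k gT) (c : grpalg k hT).
Hypotheses (block_b : block G b) (block_c : block H c).
Variable M : gmod k (setX_group G H).
Hypothesis M_stable : stable_equivalence_of_Morita_type b c M.
Variables (P : {group gT}) (R : {group hT}).
Hypotheses (defect_P : defect_group p G b P) (defect_R : defect_group p H c R).
Variables (i : grpalg k gT) (j : grpalg k hT).
Hypotheses (source_i : source_idempotent G b P i) (source_j : source_idempotent H c R j).
Variables (phi : {morphism P >-> hT}) (iso_phi : isom P R phi).
Variable V : gmod k (graph phi).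
Hypothesis M_summand :
     dsummand M
       (tensb (tensb (bimod G i P) (indm (setX_group P R) V)) (bimod R j H)).
Hypothesis P_nontriv : P :!=: 1%g.
Variables (e : grpalg k gT) (f : grpalg k hT).
Hypotheses (block_e : block 'C_G(P) e) (i_e : brauer_map P i * e != 0).
Hypotheses (block_f : block 'C_H(R) f) (j_f : brauer_map R j * f != 0).
Let N := stabiliser (setX_group G H) (graph phi) (galg_tens e (galg_opp f)).
Variable MP : gmod k N.
Hypothesis MP_slashed : slashed p M (subxx N) MP.

Local Notation Z := (setX_group G H).
Local Notation D := (graph phi).
Local Notation act := (gact (endm M)).
Local Notation cL := (stdcoord gT hT).
Local Notation cR := (prodswap (stdcoord gT hT)).
Local Notation f1 := (galg_opp f).
Local Notation lop := (gop M (inL cL) G).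
Local Notation rop := (gop M (inL cR) H).

Lemma slashed_local_data :
  [/\ {in D, forall d, gact MP d = 1},
      exists s, trace (gact (endm MP)) D N s = 1,
      left_local_data cL 'C_G(P) (stabiliser G P e) 'C_H(R) MP e
    & left_local_data cR 'C_H(R) (stabiliser H R f1) 'C_G(P) MP f1].
Proof.
have [sPG pP _] := defect_groupP defect_P; have [sRH pR _] := defect_groupP defect_R.
have sDPR := graph_sub iso_phi; have sXX : setX_group P R \subset Z by apply: setXS.
have sDZ := subset_trans sDPR sXX; have pD := graph_pgroup phi pP.
have nR : R :!=: 1%g by rewrite -(isog_eq1 (isom_isog _ _ iso_phi)).
have [Gi Pi ib ii] := source_idem_fix block_b sPG source_i.
have [Hj Rj jc jj] := source_idem_fix block_c sRH source_j.
have [bie ebb] := source_brauer_block charkp block_b sPG pP source_i block_e i_e.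
have [bjf fbc] := source_brauer_block charkp block_c sRH pR source_j block_f j_f.
have bf1 := block_opp block_f.
have [psi [psi_fix psi_tr ipsi jpsi]] := source_trace sPG sRH sDPR Gi Hj Pi ii Rj jj M_summand.
have memL := @mem_stdZ _ _ G H; have memR := @mem_stdZ_swap _ _ G H.
have GS : (kspan k 'C_G(P)%g <= kspan k G)%VS by apply/kspanS/subsetIl.
have HS : (kspan k 'C_H(R)%g <= kspan k H)%VS by apply/kspanS/subsetIl.
have Ge := subvP GS _ (block_kspan block_e); have Hf := subvP HS _ (block_kspan bf1).
have eps_idem : galg_act M (galg_tens e f1) * galg_act M (galg_tens e f1) =
    galg_act M (galg_tens e f1).
  rewrite galg_act_tens -[LHS]mulrA [X in _ * X]mulrA -(lop_ropC memL M e f1) -[X in _ * X]mulrA.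
  rewrite -(ropM memL M Hf Hf) (block_idem bf1) mulrA -(lopM memL M Ge Ge) (block_idem block_e).
  by [].
have Pe : {in P, forall x, gconj x e = e} by move=> x Px; apply: gconj_cent (block_kspan block_e) Px.
have Rf : {in R, forall x, gconj x f1 = f1} by move=> x Rx; apply: gconj_cent (block_kspan bf1) Rx.
have memN z : (z \in N) =
    [&& z \in Z, z \in 'N(D)%g, gconj z.1 e == e & gconj z.2 f1 == f1].
  exact: mem_tens_stabiliser block_e bf1.
have memN' z : (z \in N) =
    [&& z \in Z, z \in 'N(D)%g, gconj z.2 f1 == f1 & gconj z.1 e == e].
  by rewrite memN [X in [&& _, _ & X]]andbC.
have sDN : D \subset N.
  apply/subsetP=> z Dz; rewrite memN (subsetP sDZ) // (subsetP (normG D)) //=.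
  have /(subsetP sDPR) := Dz; rewrite inE => /andP[Pz Rz].
  by rewrite Pe // Rf // !eqxx.
have [th [th_lower th_ker th_sur [thM th_l th_r th_act th_gact]]] :=
  slashed_map sDN eps_idem MP_slashed.
have defP := graph_fst phi; have defR := graph_snd iso_phi.
have fst_inj := @graph_fst1 _ _ P phi; have snd_inj := graph_snd1 iso_phi.
have [sH sHE] := free_M memL sDZ fst_inj psi_fix psi_tr.
have [sG sGE] := free_M memR sDZ snd_inj psi_fix psi_tr.
have [Tl_f Tl_b] := stable_brauer_l charkp block_b M_stable sPG pP P_nontriv sHE.
have [Tr_f Tr_b] := stable_brauer_r charkp block_c M_stable sRH pR nR sGE.
have eC a : a \in kspan k 'C_G(P)%g -> e * a = a * e.
  exact: center_commute (block_center block_e).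
have fC a : a \in kspan k 'C_H(R)%g -> f * a = a * f.
  exact: center_commute (block_center block_f).
have epsE := galg_act_tens M e f1.
have epsC : lop e * rop f1 = rop f1 * lop e := lop_ropC memL M e f1.
have lop_fix : {in D, forall d, act d (lop e) = lop e}.
  move=> d Dd; rewrite (act_lop memL) ?(subsetP sDZ) // Pe //.
  by have /(subsetP sDPR) := Dd; rewrite inE => /andP[].
(* As psi = i psi, the difference is (i - e i) psi, and br_P(i - e i) = br(i) - e br(i) = 0. So i -
   e i acts as a proper trace, and multiplication by the D-fixed [psi] keeps it one. *)
have psi_e : psi - lop e * psi \in lower act fullv D.
  have -> : psi - lop e * psi = lop (i - e * i) * psi.
    rewrite gopB (lopM memL M Ge Gi) mulrBl -[lop e * lop i * psi]mulrA.
    by rewrite ipsi.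
  apply: (lowD_mulr sDZ) => //; apply: (lop_lowD memL M sDZ defP).
  - by rewrite memvB ?kspanM.
  - by move=> x Px; rewrite -!gconjlE linearB /= !gconjlE gconj_mul Pe // Pi.
  rewrite brauer_mapB brauer_mapMl; last first.
    by apply: subvP (block_kspan block_e); apply/kspanS/subsetIr.
  by rewrite eC ?brauer_map_kspanI // bie subrr.
have psi_f : psi - rop f1 * psi \in lower act fullv D.
  have -> : psi - rop f1 * psi = rop (galg_opp j - f1 * galg_opp j) * psi.
    have Hj1 : galg_opp j \in kspan k H by rewrite mem_galg_opp.
    rewrite gopB (ropM memL M Hf Hj1) mulrBl -[rop f1 * rop _ * psi]mulrA.
    by rewrite jpsi.
  apply: (lowD_mulr sDZ) => //; apply: (lop_lowD memR M sDZ defR).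
  - by rewrite memvB ?kspanM // mem_galg_opp.
  - move=> x Rx; rewrite -!gconjlE linearB /= !gconjlE gconj_mul Rf //.
    by rewrite -galg_opp_gconj Rj.
  rewrite brauer_mapB brauer_mapMl; last first.
    by apply: subvP (block_kspan bf1); apply/kspanS/subsetIr.
  by rewrite brauer_map_opp -galg_oppM bjf subrr.
have psi_eps : psi - lop e * rop f1 * psi \in lower act fullv D.
  have -> : psi - lop e * rop f1 * psi = (psi - lop e * psi) + lop e * (psi - rop f1 * psi).
    by rewrite mulrBr addrA subrK mulrA.
  by apply: memvD => //; apply: (lowD_mull sDZ).
have {}memN' : forall z, (z \in N) =
    [&& z \in Z, z \in 'N(D)%g, gconj (prL cR z) f1 == f1 & gconj (prR cR z) e == e] := memN'.
have psi_eps' : psi - rop f1 * lop e * psi \in lower act fullv D by rewrite -epsC.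
rewrite epsE in th_ker thM th_l th_r.
split.
- move=> d Dd.
  exact: (D_trivial (c := cL) charkp sDZ pD defP defR block_e bf1 memN th_sur th_act Dd).
- exists (th psi); exact: (normal_N_trace memL sDZ defP defR block_e bf1 memN th_lower
    (fun y _ => th_l y) th_act th_gact psi_fix psi_eps psi_tr).
- apply: (core_local_data memL sDZ fst_inj defP defR block_e bf1 memN th_lower th_ker th_sur
    (fun y _ => th_l y) (fun y _ => th_r y) th_act th_gact psi_fix psi_eps psi_tr Tl_b).
  (* [Tl_f] asks for a br_P(b) = a, which follows from a e = a and e br_P(b) = e. *)
  move=> a Ca ae; apply: Tl_f => //.
  by rewrite -[in LHS]ae -mulrA ebb.
rewrite epsC in th_ker th_l th_r.
apply: (core_local_data memR sDZ snd_inj defR defP bf1 block_e memN' th_lower th_ker th_sur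
    (fun y _ => th_l y) (fun y _ => th_r y) th_act th_gact psi_fix psi_eps' psi_tr Tr_b).
move=> a Ca af; apply: Tr_f => //.
rewrite brauer_map_opp -[in LHS]af -mulrA -galg_oppM -fC ?fbc //.
exact/brauer_map_kspanI/(block_kspan block_c).
Qed.

End SlashedLocal.

(* Mackey's formula for a normal subgroup D acting trivially. *)
Lemma trace_restrict (k : fieldType) (V : vectType k) (gT : finGroupType)
    (D N T : {group gT}) (act : gT -> 'End(V)) v : lin_action N act -> D \subset N ->
    N \subset 'N(D) -> {in D, forall d, act d = 1} -> T \subset N ->
  exists s, trace act D N v = trace act (D :&: T)%G T s.
Proof.
move=> aN sDN nDN Dv sTN; have aT := lin_actionS sTN aN.
suff : trace act D N v \in limg (trace act (D :&: T)%G T) by case/memv_imgP=> s _ ->; exists s.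
rewrite traceE; apply: (orbit_sum_mem (a := fun x C => (x *: C)%g) aT) => //.
- by move=> C; rewrite lcoset1.
- by move=> x y Tx Ty C; rewrite lcosetM.
- by move=> x Tx C CD; rewrite lcosets_translate ?(subsetP sTN).
- move=> x Tx C CD; apply: (act_repr_translate aN sDN) => //; last exact: (subsetP sTN).
  by move=> d Dd; rewrite Dv ?one_lfunE.
move=> C Q CD eQ; suff -> : Q = (D :&: T)%G by apply: memv_img (memvf _).
have [NC eC] := lcoset_repr sDN CD; apply/val_inj/setP=> x; rewrite /= eQ !inE andbC.
congr (_ && _); rewrite {1 2}eC -lcosetM; apply/eqP/idP => [|Dx].
  move=> e; have : (x * repr C)%g \in (repr C *: D)%g by rewrite -e lcoset_refl.
  by rewrite mem_lcoset -conjgE memJ_norm // (subsetP nDN).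
by apply/lcoset_eqP; rewrite mem_lcoset -conjgE memJ_norm // (subsetP nDN).
Qed.

(** * p-permutation modules *)

Section PermutationFunctions.

Variables (k : fieldType) (gT : finGroupType) (G : {group gT}) (U : vectType k).
Local Notation F := {ffun {set gT} -> U}.

Lemma perm_fun_lin x : linear (fun h : F => [ffun C : {set gT} => h (x^-1 *: C)%g] : F).
Proof. by move=> s h h'; apply/ffunP=> C; rewrite !ffunE. Qed.

Definition perm_fun_act x : 'End(F) :=
  linfun (fun h : F => [ffun C : {set gT} => h (x^-1 *: C)%g] : F).

Lemma perm_fun_actE x h C : perm_fun_act x h C = h (x^-1 *: C)%g.
Proof. by rewrite (linfunE (perm_fun_lin x)) ffunE. Qed.

Lemma perm_fun_act1 : perm_fun_act 1%g = \1%VF.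
Proof.
by apply/lfunP=> h; apply/ffunP=> C; rewrite perm_fun_actE id_lfunE invg1 lcoset1.
Qed.

Lemma perm_fun_actM :
  {in G &, forall x y, perm_fun_act (x * y)%g = (perm_fun_act x \o perm_fun_act y)%VF}.
Proof.
move=> x y _ _; apply/lfunP=> h; apply/ffunP=> C.
by rewrite comp_lfunE !perm_fun_actE invMg lcosetM.
Qed.

(** Functions on all subsets of [gT], not only on the cosets of a fixed subgroup: translation still
    permutes a basis, and the module does not depend on that subgroup. *)
Definition perm_fun : gmod k G := GMod perm_fun_act1 perm_fun_actM.

Lemma perm_fun_permutation : permutation_module perm_fun.
Proof.
pose dl C u : F := [ffun C' => if C' == C then u else 0].
pose X : seq perm_fun := [seq dl C u | C <- enum {set gT}, u <- vbasis {:U}].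
exists X; split.
  rewrite basisEdim; apply/andP; split.
    apply/subvP=> h _.
    have -> : (h : F) = \sum_C \sum_(n < \dim {:U}) coord (vbasis {:U}) n (h C) *: dl C (vbasis {:U})`_n.
      apply/ffunP=> C; rewrite sum_ffunE (bigD1 C) //= [X in _ + X]big1 ?addr0.
        rewrite sum_ffunE [LHS](coord_vbasis (memvf _)); apply: eq_bigr => n _.
        by rewrite !ffunE eqxx.
      move=> C' ne; rewrite sum_ffunE big1 // => n _.
      by rewrite !ffunE eq_sym (negPf ne) scaler0.
    apply: memv_suml => C _; apply: memv_suml => n _; apply: memvZ; apply: memv_span.
    apply/allpairsP; exists (C, (vbasis {:U})`_n); split=> //=; first exact: mem_enum.
    by rewrite mem_nth // size_tuple.
  by rewrite size_allpairs -cardE size_tuple !dimvf.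
move=> x Gx _ /allpairsP[[C u] /= [_ Uu ->]]; apply/allpairsP.
exists ((x *: C)%g, u); split=> //=; first exact: mem_enum.
apply/ffunP=> C'; rewrite perm_fun_actE !ffunE; congr (if _ then _ else _).
apply/eqP/eqP=> [<-|->]; by rewrite ?lcosetKV ?lcosetK.
Qed.

End PermutationFunctions.

(** Send w to the function C -> be (x^-1 w), with x representing the coset C, and return by summing
    x al (h C). The composite is the trace of al be, hence the identity. Both maps are equivariant
    because [al] and [be] do not see [D], so the choice of representatives is harmless. *)
Lemma trace_p_permutation (k : fieldType) (gT : finGroupType) (G D : {group gT})
    (W : gmod k G) (U : vectType k) (al : 'Hom(U, W)) (be : 'Hom(W, U)) :
    D \subset G -> {in D, forall d u, gact W d (al u) = al u} ->
    {in D, forall d w, be (gact W d w) = be w} ->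
    trace (gact (endm W)) D G (al \o be)%VF = 1 -> p_permutation W.
Proof.
move=> sDG ald bed tr1; pose F := perm_fun G U.
exists F; first exact: perm_fun_permutation.
apply: retract_dsummand.
have ioL : linear (fun w : W =>
    [ffun C : {set gT} => if C \in lcosets D G then be (gact W (repr C)^-1%g w) else 0] : F).
  by move=> s w w'; apply/ffunP=> C; rewrite !ffunE; case: ifP => _; rewrite ?linearP ?scaler0 ?addr0.
have rL : linear (fun h : F => \sum_(C in lcosets D G) gact W (repr C) (al ((h : {ffun _ -> _}) C))).
  move=> s h h'; rewrite scaler_sumr -big_split; apply: eq_bigr => C _ /=.
  by rewrite !ffunE !linearP.
pose io : 'Hom(W, F) := linfun (fun w : W =>
  [ffun C : {set gT} => if C \in lcosets D G then be (gact W (repr C)^-1%g w) else 0] : F).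
pose r : 'Hom(F, W) := linfun
  (fun h : F => \sum_(C in lcosets D G) gact W (repr C) (al ((h : {ffun _ -> _}) C))).
have ioE w (C : {set gT}) : (io w : {ffun _ -> _}) C =
    if C \in lcosets D G then be (gact W (repr C)^-1%g w) else 0.
  by rewrite (linfunE ioL) ffunE.
have rE h : r h = \sum_(C in lcosets D G) gact W (repr C) (al ((h : {ffun _ -> _}) C)) := linfunE rL h.
have transl x C : x \in G -> C \in lcosets D G ->
    exists d, [/\ d \in D, repr C \in G & repr (x *: C)%g = (x * repr C * d)%g].
  move=> Gx CD; have [GC eC] := lcoset_repr sDG CD.
  have : repr (x *: C)%g \in (x *: C)%g.
    by apply: (mem_repr (x * repr C)%g); rewrite mem_lcoset mulKg {2}eC lcoset_refl.
  rewrite {2}eC -lcosetM => /lcosetP[d Dd ->]; by exists d.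
exists io, r; split.
- move=> x Gx w; apply/ffunP=> C; rewrite [RHS](perm_fun_actE x (io w) C) !ioE.
  have -> : ((x^-1 *: C)%g \in lcosets D G) = (C \in lcosets D G).
    apply/idP/idP => [|CD]; last by rewrite lcosets_translate ?groupV.
    by move/(lcosets_translate Gx); rewrite lcosetKV.
  case: ifP => // CD; have [d [Dd GC ->]] := transl x^-1%g C (groupVr Gx) CD.
  have Gd := subsetP sDG d Dd; rewrite !invMg invgK [in RHS]gactMv ?groupM ?groupV //.
  by rewrite [RHS]bed ?groupV // gactMv ?groupV.
- move=> x Gx h; rewrite !rE linear_sum /= [LHS](reindex (fun C => x *: C)%g) /=; last first.
    by exists (fun C => x^-1 *: C)%g => C _; rewrite ?lcosetKV ?lcosetK.
  apply: eq_big => [C|C]; have eqC : ((x *: C)%g \in lcosets D G) = (C \in lcosets D G).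
  + apply/idP/idP => [|CD]; last by rewrite lcosets_translate.
    by move/(lcosets_translate (groupVr Gx)); rewrite lcosetK.
  + exact: eqC.
  + apply/idP/idP => [|CD]; last by rewrite lcosets_translate.
    by move/(lcosets_translate (groupVr Gx)); rewrite lcosetK.
  rewrite eqC => CD; rewrite [X in al X](perm_fun_actE x h) lcosetK.
  have [d [Dd GC ->]] := transl x C Gx CD; have Gd := subsetP sDG d Dd.
  by rewrite !gactMv ?groupM // ald.
move=> w; rewrite rE -[RHS]one_lfunE -tr1 traceE sum_lfunE; apply: eq_bigr => C CD.
by rewrite endmE !mul_lfunE comp_lfunE ioE CD.
Qed.

(** The form io s r factors through [V], on which [D] acts trivially, so it serves both as a trace
    form of [W] and as the input of [trace_p_permutation]. *)
Lemma induced_p_permutation (k : fieldType) (gT : finGroupType) (G T D : {group gT})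
    (V : gmod k T) (W : gmod k G) s :
    T \subset G -> D \subset T -> induced_from V W ->
    {in D, forall d, gact V d = 1} -> trace (gact (endm V)) D T s = 1 ->
  p_permutation W /\ exists psi, {in D, forall d, gact (endm W) d psi = psi} /\
    trace (gact (endm W)) D G psi = 1.
Proof.
move=> sTG sDT [io [r [ioeq req tr1 _ _]]] D1 trs.
have Ds : {in D, forall d, gact (endm V) d s = s}.
  by move=> d Dd; rewrite endmE !D1 ?groupV // mul1r mulr1.
have [psif psit] := induced_trace sTG sDT ioeq req tr1 Ds trs.
split; last by exists (transfer io r s).
apply: (@trace_p_permutation _ _ G D W V (io \o s)%VF r) => //.
- exact: subset_trans sTG.
- move=> d Dd u; rewrite comp_lfunE -ioeq ?(subsetP sDT) // D1 //.
  by rewrite one_lfunE.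
by move=> d Dd w; rewrite req ?(subsetP sDT) // D1 // one_lfunE.
Qed.

Lemma gop_commute (k : fieldType) (zT T : finGroupType) (Z : {group zT}) (M : gmod k Z)
    (j : T -> zT) (K : {group T}) a (t : 'End(M)) :
  {in K, forall y, gact M (j y) * t = t * gact M (j y)} -> gop M j K a * t = t * gop M j K a.
Proof.
move=> jt; rewrite mulr_suml mulr_sumr; apply: eq_bigr => y Ky.
by rewrite -lfun_scalerAl -lfun_scalerAr jt.
Qed.

(** * Morita equivalences from induced modules *)

Section OrbitIdempotent.

Variables (k : fieldType) (gT : finGroupType) (X X0 : {group gT}) (e : grpalg k gT).
Hypothesis memX0 : forall x, (x \in X0) = (x \in X) && (gconj x e == e).
Hypothesis e_orth : {in X, forall x, gconj x e = e \/ gconj x e * e = 0}.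
Hypotheses (Xe : e \in kspan k X) (ee : e * e = e).

(** A relative trace from the stabiliser of e, so that each conjugate is counted once. *)
Definition orbit_idem : grpalg k gT := trace (@gconjl k gT) X0 X e.
Local Notation b := orbit_idem.

Lemma orbit_idemE : b = \sum_(C in lcosets X0 X) gconj (repr C) e.
Proof. by rewrite /b traceE; apply: eq_bigr => C _; rewrite gconjlE. Qed.

Lemma orbit_sub : X0 \subset X.
Proof. by apply/subsetP=> x; rewrite memX0 => /andP[]. Qed.

Lemma orbit_repr (C : {set gT}) : C \in lcosets X0 X -> repr C \in X.
Proof. by move/(lcoset_repr orbit_sub) => []. Qed.

Lemma orbit_coset : gval X0 \in lcosets X0 X.
Proof. by apply/lcosetsP; exists 1%g; rewrite ?group1 // lcoset1. Qed.

Lemma orbit_coset_repr (C : {set gT}) : C \in lcosets X0 X -> (repr C \in X0) = (C == X0).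
Proof.
move=> CX; have [_ eC] := lcoset_repr orbit_sub CX.
by apply/idP/eqP => [cX|->]; [rewrite eC lcoset_id | exact: mem_repr (group1 X0)].
Qed.

Lemma orbit_orth x : x \in X -> x \notin X0 -> gconj x e * e = 0 /\ e * gconj x e = 0.
Proof.
move=> Xx; rewrite memX0 Xx /= => /eqP ne; split.
  by case: (e_orth Xx).
case: (e_orth (groupVr Xx)) => [ex|/(congr1 (gconj x))].
  by case: ne; rewrite -{1}ex gconjVK.
rewrite gconj_mul gconjVK => ->; by rewrite -gconjlE linear0.
Qed.

Lemma orbit_fix x : x \in X -> gconj x b = b.
Proof.
move=> Xx; rewrite -gconjlE; apply: trace_fixed Xx; [exact: gconjl_action | exact: orbit_sub |].
by move=> y; rewrite memX0 gconjlE => /andP[_ /eqP].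
Qed.

Lemma orbit_kspan : b \in kspan k X.
Proof.
rewrite orbit_idemE memv_suml // => C CX; apply: mem_kspan_gconj => //.
by rewrite (subsetP (normG X)) // orbit_repr.
Qed.

Lemma orbit_idem_mul : e * b = e.
Proof.
rewrite orbit_idemE mulr_sumr (bigD1 (gval X0)) ?orbit_coset //= big1 ?addr0.
  have : repr X0 \in X0 by apply: mem_repr (group1 X0).
  by rewrite memX0 => /andP[_ /eqP->].
move=> C /andP[CX ne]; apply: (orbit_orth _ _).2; first exact: orbit_repr.
by rewrite orbit_coset_repr.
Qed.

Lemma orbit_idem_idem : b * b = b.
Proof.
rewrite {1}orbit_idemE mulr_suml orbit_idemE; apply: eq_bigr => C CX.
by rewrite -orbit_idemE -{1}(orbit_fix (orbit_repr CX)) -gconj_mul orbit_idem_mul.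
Qed.

End OrbitIdempotent.

(* The left half of a Morita equivalence between kX.b and its counterpart over Y. *)
Definition left_faithful (k : fieldType) (gT hT zT : finGroupType)
    (c : prodcoord gT hT zT) (X : {group gT}) (Y : {group hT}) (Z : {group zT})
    (L : gmod k Z) (b : grpalg k gT) : Prop :=
  [/\ forall t : 'End(L), {in Y, forall y, gact (endm L) (inR c y) t = t} ->
        exists2 a, a \in kspan k X /\ a * b = a & t = gop L (inL c) X a,
      forall a, a \in kspan k X -> a * b = a -> gop L (inL c) X a = 0 -> a = 0
    & gop L (inL c) X b = 1].

(** * Inducing the local bimodule: endomorphisms and faithfulness *)

Section FinalLeft.

Variables (k : fieldType) (gT hT zT : finGroupType) (c : prodcoord gT hT zT).
Variables (X C X0 : {group gT}) (Y C' : {group hT}) (Z T : {group zT}).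
Hypothesis memZ : forall z, (z \in Z) = (prL c z \in X) && (prR c z \in Y).
Hypothesis sTZ : T \subset Z.
Variables (U : gmod k T) (L : gmod k Z).
Hypothesis L_ind : induced_from U L.
Hypotheses (sCX : C \subset X) (sCY : C' \subset Y).
Hypothesis inL_T : {in X, forall x, (inL c x \in T) = (x \in C)}.
Hypothesis inR_T : {in C', forall y, inR c y \in T}.
Variables (e : grpalg k gT) (f : grpalg k hT).
Hypotheses (Ce : e \in kspan k C) (ee : e * e = e) (Cf : f \in kspan k C').
Hypothesis memX0 : forall x, (x \in X0) = (x \in X) && (gconj x e == e).
Hypothesis e_orth : {in X, forall x, gconj x e = e \/ gconj x e * e = 0}.
Hypothesis f_orth : {in Y, forall y, gconj y f = f \/ gconj y f * f = 0}.
Hypothesis lift_l : {in X, forall x, gconj x e = e -> exists2 z, z \in T & prL c z = x}.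
Hypothesis lift_r : {in Y, forall y, gconj y f = f -> exists2 z, z \in T & prR c z = y}.
Hypothesis U_endo : forall t : 'End(U), {in C', forall y, gact (endm U) (inR c y) t = t} ->
  exists2 a, a \in kspan k C & t = gop U (inL c) C a.
Hypothesis U_faithful : forall a, a \in kspan k C -> a * e = a ->
  gop U (inL c) C a = 0 -> a = 0.
Hypotheses (U_e : gop U (inL c) C e = 1) (U_f : gop U (inR c) C' f = 1).

Local Notation lop := (gop L (inL c) X).
Local Notation rop := (gop L (inR c) Y).
Local Notation b := (orbit_idem X X0 e).
Local Notation E := (right_endo c Y L).

Let sX0X : X0 \subset X := orbit_sub memX0.
Let Xe : e \in kspan k X. Proof. exact: subvP (kspanS k sCX) _ Ce. Qed.
Let Yf : f \in kspan k Y. Proof. exact: subvP (kspanS k sCY) _ Cf. Qed.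

Let lopM' a a' v : a \in kspan k X -> a' \in kspan k X -> lop (a * a') v = lop a (lop a' v).
Proof. by move=> Xa Xa'; rewrite (lopM memZ L Xa Xa') mul_lfunE. Qed.

Let lop_gelt x v : x \in X -> lop (gelt x) v = gact L (inL c x) v.
Proof. by move=> Xx; rewrite gop_gelt. Qed.

Let inLZ x : x \in X -> inL c x \in Z := fun Xx => inL_mem memZ Xx.
Let inRZ y : y \in Y -> inR c y \in Z := fun Yy => inR_mem memZ Yy.

Let E_comm t y v : t \in E -> y \in Y -> t (gact L (inR c y) v) = gact L (inR c y) (t v).
Proof.
move=> /right_endoP Et Yy; have /(endm_commute _ (inRZ Yy))/lfunP/(_ v) := Et y Yy.
by rewrite !mul_lfunE.
Qed.

Section Maps.

Variables (io : 'Hom(U, L)) (r : 'Hom(L, U)).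
Hypothesis io_eq : {in T, forall z x, io (gact U z x) = gact L z (io x)}.
Hypothesis r_eq : {in T, forall z t, r (gact L z t) = gact U z (r t)}.
Hypothesis tr1 : trace (gact (endm L)) T Z (io \o r)%VF = 1.
Hypothesis ioK : cancel io r.
Hypothesis r0 : {in Z, forall x v, x \notin T -> r (gact L x (io v)) = 0}.

Let lop_io a u : a \in kspan k C -> lop a (io u) = io (gop U (inL c) C a u).
Proof.
move=> Ca; rewrite (gopS L _ sCX Ca) (gop_equivariant (h := io)) // => x Cx v.
by apply: io_eq; rewrite inL_T // (subsetP sCX).
Qed.

Let rop_io a u : a \in kspan k C' -> rop a (io u) = io (gop U (inR c) C' a u).
Proof.
move=> Ca; rewrite (gopS L _ sCY Ca) (gop_equivariant (h := io)) // => x Cx v.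
by apply: io_eq; rewrite inR_T.
Qed.

Let e_io u : lop e (io u) = io u. Proof. by rewrite lop_io // U_e one_lfunE. Qed.
Let f_io u : rop f (io u) = io u. Proof. by rewrite rop_io // U_f one_lfunE. Qed.

Let ind_span v : v = \sum_(D in lcosets T Z)
  gact L (repr D) (io (r (gact L (repr D)^-1%g v))).
Proof.
rewrite -[LHS]one_lfunE -tr1 traceE sum_lfunE; apply: eq_bigr => D _.
by rewrite endmE !mul_lfunE comp_lfunE.
Qed.

Let reprZ (D : {set zT}) : D \in lcosets T Z -> repr D \in Z.
Proof. by move/(lcoset_repr sTZ) => []. Qed.

(** [L] is spanned by the translates z io u, and z = (1, y) (x, 1); endomorphisms commuting with [Y]
    are thus determined by their values on the x io u. *)
Let E_ext s t : s \in E -> t \in E ->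
  {in X, forall x u, s (gact L (inL c x) (io u)) = t (gact L (inL c x) (io u))} -> s = t.
Proof.
move=> Es Et st; apply/lfunP=> v; rewrite [v]ind_span !linear_sum /=.
apply: eq_bigr => D DT; have Zz := reprZ DT; rewrite (inRL c (repr D)).
have Xz := prL_mem memZ Zz; have Yz := prR_mem memZ Zz.
rewrite gactMv ?inLZ ?inRZ // !E_comm //; congr (gact L _ _); exact: st.
Qed.

Lemma ind_orbit_idem : lop b = 1.
Proof.
have bfix := orbit_fix memX0; have Xb : b \in kspan k X := orbit_kspan memX0 Xe.
apply: E_ext; first exact: lop_T.
  by apply/right_endoP=> y Yy; rewrite endm_one ?inRZ.
move=> x Xx u; rewrite one_lfunE -lop_gelt // -lopM' ?mem_kspan //.
have -> : b * gelt x = gelt x * b by apply/esym/commute_gconj/bfix.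
rewrite lopM' ?mem_kspan // !lop_gelt //; congr (gact L _ _).
rewrite orbit_idemE gop_sum sum_lfunE (bigD1 (gval X0)) ?orbit_coset //= big1 ?addr0.
  have : repr X0 \in X0 by apply: mem_repr (group1 X0).
  by rewrite memX0 => /andP[_ /eqP->].
move=> D /andP[DX ne]; have XD := orbit_repr memX0 DX.
rewrite -e_io -lopM' //; last by rewrite mem_kspan_gconj // (subsetP (normG X)).
rewrite (orbit_orth memX0 e_orth XD _).1 ?gop0 ?zero_lfunE //.
by rewrite (orbit_coset_repr memX0).
Qed.

(** Translate a so that a nonzero coefficient sits at 1, then keep the coefficients on [C] only. The
    truncation [pa] acts on [U] as r a2 io, because r kills x io u for x outside [C]; so it acts as
    0 and vanishes, against its coefficient at 1. Truncation respects right multiplication by e, as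
    e is supported on [C]. *)
Let faithful_e a : a \in kspan k X -> a * e = a -> lop a = 0 -> a = 0.
Proof.
move=> Xa ae a0; apply/eqP; apply: contraT => /grpalg_neq0[x0 ax0].
have Xx0 : x0 \in X by apply: contraR ax0 => nx; apply/eqP; move/kspanP: Xa; apply.
pose a2 := gelt x0^-1%g * a; pose pa : grpalg k gT := [ffun u => if u \in C then a2 u else 0].
have Xa2 : a2 \in kspan k X by rewrite kspanM ?mem_kspan ?groupV.
have a2e : a2 * e = a2 by rewrite -mulrA ae.
have a21 : a2 1%g = a x0 by rewrite [LHS]gmul_geltl invgK mulg1.
have Cpa : pa \in kspan k C by apply/kspanP=> u nCu; rewrite ffunE (negPf nCu).
suff : pa = 0 by move/ffunP/(_ 1%g); rewrite [LHS]ffunE group1 a21 [RHS]ffunE => e1; rewrite e1 eqxx in ax0.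
apply: U_faithful => //.
  apply/ffunP=> u; rewrite gmulE [RHS]ffunE -[in RHS]a2e gmulE.
  case: ifP => Cu; last first.
    apply: big1 => v _; rewrite ffunE; case: ifP => Cv; last by rewrite mul0r.
    by move/kspanP: Ce => ->; rewrite ?mulr0 // groupMl ?groupV // Cu.
  apply: eq_bigr => v _; rewrite ffunE; case: ifP => // /negbT Cv.
  rewrite mul0r; move/kspanP: Ce => ->; rewrite ?mulr0 // groupMr //.
  by rewrite groupV.
apply/lfunP=> u; rewrite zero_lfunE gopE -[RHS](linear0 r).
have -> : 0 = lop a2 (io u).
  by rewrite lopM' ?mem_kspan ?groupV // a0 zero_lfunE linear0.
rewrite gopE linear_sum [RHS](bigID (mem C)) /= addrC [X in X + _]big1 ?add0r.
  rewrite [in RHS](eq_bigl (mem C)) => [|x]; last first.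
    by rewrite /= andb_idl // => /(subsetP sCX).
  apply: eq_bigr => x Cx; rewrite ffunE Cx linearZ /= r_eq ?inL_T ?(subsetP sCX) //.
  by rewrite ioK.
move=> x /andP[Xx nCx]; rewrite linearZ /= r0 ?scaler0 ?inLZ //.
by rewrite inL_T.
Qed.

(** a = a b is the sum of the a x e x^-1, and each a x e falls under [faithful_e]. *)
Lemma ind_faithful a : a \in kspan k X -> a * b = a -> lop a = 0 -> a = 0.
Proof.
move=> Xa ab a0; have axe x : x \in X -> a * gelt x * e = 0.
  move=> Xx; apply: faithful_e; first by rewrite !kspanM ?mem_kspan.
    by rewrite -mulrA ee.
  apply/lfunP=> v; rewrite -mulrA lopM' ?kspanM ?mem_kspan // a0 !zero_lfunE //.
rewrite -ab orbit_idemE mulr_sumr big1 // => D DX.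
by rewrite /gconj !mulrA axe ?mul0r //; apply: orbit_repr DX.
Qed.

(** On the copy of [U] in [L], t decomposes along the Z-translates of that copy. The idempotent f
    excludes the translates whose right component moves f; the other ones are translates by some x
    in [X], and there t is given by an endomorphism of [U] commuting with [C'], which comes from
    kC. *)
Lemma ind_io t : t \in E -> exists2 a, a \in kspan k X & forall u, t (io u) = lop a (io u).
Proof.
move=> Et; have Fl : linear (fun a => lop a \o io)%VF.
  by move=> s a a'; apply/lfunP=> u; rewrite gop_lin !(comp_lfunE, add_lfunE, scale_lfunE).
pose F : 'Hom(grpalg k gT, 'Hom(U, L)) := linfun (fun a => lop a \o io)%VF.
have FE a : F a = (lop a \o io)%VF := linfunE Fl a.
suff /memv_imgP[a Xa ta] : (t \o io)%VF \in (F @: kspan k X)%VS.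
  by exists a => // u; rewrite -[LHS]comp_lfunE ta FE comp_lfunE.
(* f acts as 1 on io u and commutes with t, so it can be inserted in front of each component. *)
have -> : (t \o io)%VF = \sum_(D in lcosets T Z)
    (rop f \o gact L (repr D) \o io \o r \o gact L (repr D)^-1%g \o t \o io)%VF.
  apply/lfunP=> u; rewrite sum_lfunE comp_lfunE -{1}f_io.
  have -> : t (rop f (io u)) = rop f (t (io u)).
    rewrite -!mul_lfunE gop_commute // => y Yy.
    by apply/endm_commute; [exact: inRZ | move/right_endoP: Et; apply].
  rewrite {1}[t (io u)]ind_span linear_sum; apply: eq_bigr => D _.
  by rewrite 6!comp_lfunE.
apply: memv_suml => D DT; have Zz := reprZ DT; set z := repr D in Zz *.
set y := prR c z; have Yy : y \in Y := prR_mem memZ Zz.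
have fz v : rop f (gact L z v) = gact L z (rop (gconj y^-1%g f) v).
  have := act_rop memZ L (gconj y^-1%g f) Zz; rewrite -/y gconjVK endmE => <-.
  by rewrite !mul_lfunE gactKv.
have [fy|fy] := f_orth (groupVr Yy); last first.
  suff -> : (rop f \o gact L z \o io \o r \o gact L z^-1%g \o t \o io)%VF = 0 by apply: mem0v.
  apply/lfunP=> u; rewrite 6!comp_lfunE zero_lfunE fz -[io (r _)]f_io -[X in gact L z X]mul_lfunE.
  rewrite -(ropM memZ L) //; last by rewrite mem_kspan_gconj // (subsetP (normG Y)) ?groupV.
  by rewrite fy gop0 zero_lfunE linear0.
have fy' : gconj y f = f by rewrite -{1}fy gconjVK.
have [w Tw wy] := lift_r Yy fy'; have Zw := subsetP sTZ w Tw.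
pose x := (prL c z * (prL c w)^-1)%g.
have Xx : x \in X by rewrite groupM ?groupV ?(prL_mem memZ).
have zE : z = (inL c x * w)%g.
  by apply: (prod_eq (c := c)); rewrite ?prLM ?prRM ?prL_inL ?prR_inL ?mul1g ?wy // mulgKV.
(* The component of t in the translate x io U, read back in [U]. It commutes with [C'] because right
   elements commute with x and t, and those of [C'] lie in [T]. *)
pose s : 'End(U) := (r \o gact L (inL c x)^-1%g \o t \o io)%VF.
have [a Ca sa] : exists2 a, a \in kspan k C & s = gop U (inL c) C a.
  apply: U_endo => y' Cy'; have Ty' := inR_T Cy'; have Yy' := subsetP sCY _ Cy'.
  apply/(endm_commute _ Ty')/lfunP=> u; rewrite !mul_lfunE 6!comp_lfunE.
  rewrite -r_eq // io_eq // E_comm //; congr (r _).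
  rewrite -!gactMv ?inRZ ?groupV ?inLZ // -!inLV inLRC //.
apply/memv_imgP; exists (gelt x * a); first by rewrite kspanM ?mem_kspan // (subvP (kspanS k sCX)).
apply/lfunP=> u; rewrite FE [RHS]comp_lfunE lopM' ?mem_kspan ?(subvP (kspanS k sCX)) //.
rewrite lop_gelt // lop_io // -sa 6!comp_lfunE 3!comp_lfunE fz fy.
rewrite f_io zE invMg !gactMv ?groupV ?inLZ //.
by rewrite [r (gact L w^-1%g _)]r_eq ?groupV // -io_eq // gactVKv.
Qed.

(** [ind_io] treats t on io U; applied to t x for representatives x of the cosets of [X0] in [X], it
    gives one element for each coset. The orthogonality of the conjugates of e glues these into a
    single a. *)
Lemma ind_endo t : t \in E -> exists2 a, a \in kspan k X /\ a * b = a & t = lop a.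
Proof.
move=> Et; have EL x : x \in X -> gact L (inL c x) \in E.
  by move=> Xx; apply/right_endoP=> y Yy; apply/endm_commute;
  rewrite ?inRZ // -!gactMr ?inRZ ?inLZ // inLRC.
have Xx (D : {set gT}) : D \in lcosets X0 X -> repr D \in X := @orbit_repr _ _ _ _ _ memX0 D.
(* A choice over the finite type of all subsets, with the default 0 at those that are not cosets. *)
have /fin_all_exists[be beP] : forall D : {set gT}, exists a, D \in lcosets X0 X ->
    a \in kspan k X /\ forall u, t (gact L (inL c (repr D)) (io u)) = lop a (io u).
  move=> D; have [DX|] := boolP (D \in lcosets X0 X); last by exists 0.
  have [a Xa ta] := ind_io (T_mul memZ Et (EL _ (Xx D DX))).
  by exists a => _; split=> // u; rewrite -ta mul_lfunE.
(* On x' io u the summand of a representative x involves e (x^-1 x') e. This is 0 unless x^-1 x'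
   stabilises e, so only the coset of x' acts. *)
pose a := \sum_(D in lcosets X0 X) be D * e * gelt (repr D)^-1%g.
have XD D : D \in lcosets X0 X -> be D * e * gelt (repr D)^-1%g \in kspan k X.
  by move=> DX; rewrite !kspanM ?mem_kspan ?groupV ?Xx //; have [] := beP D DX.
have Xa : a \in kspan k X by apply: memv_suml.
have Xb : b \in kspan k X := orbit_kspan memX0 Xe.
suff ta : t = lop a.
  exists (a * b); first by rewrite kspanM // -mulrA (orbit_idem_idem memX0 e_orth ee).
  by rewrite (lopM memZ L Xa Xb) ind_orbit_idem mulr1.
apply: E_ext => // [|x' Xx' u]; first exact: lop_T.
pose D := (x' *: X0)%g; have DX : D \in lcosets X0 X by apply/lcosetsP; exists x'.
have [_ eD] := lcoset_repr sX0X DX; set x := repr D in eD *.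
have Xx0 : x \in X := Xx D DX.
pose s := (x^-1 * x')%g.
have X0s : s \in X0 by rewrite -mem_lcoset -eD lcoset_refl.
have x'E : x' = (x * s)%g by rewrite mulKVg.
have /andP[Xs /eqP es] : (s \in X) && (gconj s e == e) by rewrite -memX0.
have [Xbe tbe] := beP D DX; rewrite -/x in tbe.
transitivity (lop (be D) (gact L (inL c s) (io u))); last first.
  rewrite gop_sum [RHS]sum_lfunE (bigD1 D DX) /= [X in _ + X]big1 ?addr0 => [|D' /andP[D'X ne]].
    rewrite -[gact L (inL c x') _]lop_gelt // -lopM' ?mem_kspan ?XD // -/x -mulrA -geltM -/s.
    rewrite -[in RHS]e_io -[RHS]lopM' ?kspanM ?mem_kspan // -!mulrA.
    have -> : e * (gelt s * e) = gelt s * e.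
      by rewrite gelt_gconj es mulrA ee.
    by rewrite mulrA [RHS]lopM' ?kspanM ?mem_kspan // e_io lopM' ?mem_kspan // lop_gelt.
  have [Xbe' _] := beP D' D'X.
  rewrite -[gact L (inL c x') _]lop_gelt // -lopM' ?mem_kspan ?XD // -e_io.
  rewrite -lopM' ?kspanM ?mem_kspan ?XD ?groupV ?Xx //.
  pose s' := ((repr D')^-1 * x')%g; have Xs' : s' \in X by rewrite groupM ?groupV ?Xx.
  have ns' : s' \notin X0.
    have [_ eD'] := lcoset_repr sX0X D'X; apply: contra ne => X0s'.
    by rewrite eD'; apply/eqP/esym/lcoset_eqP; rewrite mem_lcoset.
  have -> : be D' * e * gelt (repr D')^-1%g * gelt x' * e = be D' * (e * (gelt s' * e)).
    by rewrite geltM !mulrA.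
  rewrite (gelt_gconj s' e) [e * (_ * _)]mulrA (orbit_orth memX0 e_orth Xs' ns').2 mul0r mulr0.
  by rewrite gop0 zero_lfunE.
(* s stabilises e, hence is the left component of some w in [T]. It differs from w by a right
   factor, which t and [lop] let through, and w preserves the copy of [U]. *)
have [w Tw ws] := lift_l Xs es; have Zw := subsetP sTZ w Tw.
pose y := prR c w; have Yy : y \in Y := prR_mem memZ Zw.
have sE : inL c s = (inR c y^-1 * w)%g.
  by apply: (prod_eq (c := c)); rewrite ?prLM ?prRM ?prL_inL ?prR_inL ?prL_inR ?prR_inR ?mul1g ?mulVg.
have io_s : gact L (inL c s) (io u) = gact L (inR c y^-1) (io (gact U w u)).
  by rewrite sE gactMv ?inRZ ?groupV // io_eq.
rewrite x'E inLM gactMv ?inLZ // io_s.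
have Et' := T_mul memZ Et (EL x Xx0); rewrite -[LHS]mul_lfunE E_comm ?groupV // mul_lfunE tbe.
by rewrite [RHS]E_comm ?groupV ?lop_T.
Qed.

Lemma ind_left_faithful : left_faithful c X Y L b.
Proof.
by split; [move=> t Et; apply/ind_endo/right_endoP | exact: ind_faithful | exact: ind_orbit_idem].
Qed.

End Maps.

Lemma induced_left_faithful : left_faithful c X Y L b.
Proof. by have [io [r [h1 h2 h3 h4 h5]]] := L_ind; apply: ind_left_faithful h1 h2 h3 h4 h5. Qed.

End FinalLeft.

(** * From faithful two-sided actions to a Morita equivalence *)

Section Morita.

Variables (k : fieldType) (gT hT : finGroupType) (X : {group gT}) (Y : {group hT}).
Variable L : gmod k (setX_group X Y).
Variables (b : grpalg k gT) (c : grpalg k hT).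
Hypotheses (Zb : b \in 'Z(kspan k X)%VS) (bb : b * b = b).
Hypotheses (Zc : c \in 'Z(kspan k Y)%VS) (cc : c * c = c).
Local Notation cL := (stdcoord gT hT).
Local Notation cR := (prodswap (stdcoord gT hT)).
Local Notation act := (gact (endm L)).
Local Notation lop := (gop L (inL cL) X).
Local Notation rop := (gop L (inL cR) Y).
Hypothesis left_b : left_faithful cL X Y L b.
Hypothesis right_c : left_faithful cR Y X L (galg_opp c).
Variables (sX sY : 'End(L)).
Hypothesis sXE : \sum_(x in X) act (x, 1%g) sX = 1.
Hypothesis sYE : \sum_(y in Y) act (1%g, y) sY = 1.

Let memL := @mem_stdZ _ _ X Y.
Let memR := @mem_stdZ_swap _ _ X Y.

Lemma giso_of_image (G : finGroupType) (K : {group G}) (A B : gmod k K) (E : vectType k)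
    (g : 'Hom(A, E)) (h : 'Hom(B, E)) (W : G -> 'End(E)) :
    lker g = 0%VS -> lker h = 0%VS -> limg g = limg h ->
    {in K, forall x v, g (gact A x v) = W x (g v)} ->
    {in K, forall x v, h (gact B x v) = W x (h v)} -> giso A B.
Proof.
move=> kg kh igh gW hW; pose f : 'Hom(A, B) := (h^-1 \o g)%VF.
have hf v : h (f v) = g v by rewrite comp_lfunE limg_lfunVK // -igh memv_img ?memvf.
have hI : injective h by apply/lker0P/eqP.
have gI : injective g by apply/lker0P/eqP.
exists f; split.
- by apply/eqP/lker0P => u v e; apply: gI; rewrite -!hf e.
- apply/vspaceP=> v; rewrite memvf; have : h v \in limg g by rewrite igh memv_img ?memvf.
  by case/memv_imgP=> u _ e; apply/memv_imgP; exists u; rewrite ?memvf //; apply: hI; rewrite hf.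
apply: equivariant_giso => x Kx v; apply: hI.
by rewrite hf gW // hW // hf.
Qed.

Lemma left_bimod_giso : giso (tensb L (dualm L)) (bimod X b X).
Proof.
have [Lsur Linj Lb] := left_b; have [g [kg ig gE]] := tensb_dual_iso sYE.
have [Xb bfix] := centerP _ _ Zb; have BP := bimodlP (subxx X) Xb bfix bb.
pose B := bimod X b X.
have hl : linear (fun a : B => lop (vsval a)) by move=> s a a'; rewrite linearP /= gop_lin.
pose h : 'Hom(B, 'End(L)) := linfun (fun a : B => lop (vsval a)).
have hE a : h a = lop (vsval a) := linfunE hl a.
apply: (giso_of_image (h := h)
  (W := fun z => sandwich (gact L (z.1, 1%g)) (gact L (z.2^-1%g, 1%g)))) kg _ _ _ _.
- apply/eqP/lker0P => u v e; apply: val_inj; apply/eqP; rewrite -subr_eq0; apply/eqP.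
  have /BP[Xu ub] := subvsP u; have /BP[Xv vb] := subvsP v.
  apply: Linj; rewrite ?memvB // ?mulrBl ?ub ?vb // gopB -!hE e subrr //.
- rewrite ig; apply/vspaceP=> t; apply/idP/memv_imgP => [/right_endoP/Lsur[a [Xa ab] ->]|[a _ ->]].
    have Ba : a \in (kspan k X * <[b]> * kspan k X)%VS by apply/BP.
    by exists (vsproj _ a); rewrite ?memvf // hE vsprojK.
  by rewrite hE; apply: (lop_T memL).
- by case=> x x' /setXP[Xx Xx'] v; rewrite sandwichE gE.
case=> x x' /setXP[Xx Xx'] a; rewrite sandwichE !hE bimod_gact //.
have /BP[Xa _] := subvsP a.
rewrite !(lopM memL) ?kspanM ?mem_kspan ?groupV // !gop_gelt ?groupV //.
Qed.

Lemma right_bimod_giso : giso (tensb (dualm L) L) (bimod Y c Y).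
Proof.
have [Lsur Linj Lb] := right_c; have [g [kg ig gE]] := tensb_dual_iso_swap sXE.
have [Yc cfix] := centerP _ _ Zc; have BP := bimodlP (subxx Y) Yc cfix cc.
pose B := bimod Y c Y.
have hl : linear (fun a : B => rop (galg_opp (vsval a))).
  by move=> s a a'; rewrite linearP /= galg_opp_lin gop_lin.
pose h : 'Hom(B, 'End(L)) := linfun (fun a : B => rop (galg_opp (vsval a))).
have hE a : h a = rop (galg_opp (vsval a)) := linfunE hl a.
have oppc a : a \in kspan k Y -> a * c = a -> galg_opp a * galg_opp c = galg_opp a.
  by move=> Ya ac; rewrite -galg_oppM (center_commute Zc Ya) ac.
apply: (giso_of_image (h := h)
  (W := fun z => sandwich (gact L (1%g, z.2)) (gact L (1%g, z.1^-1%g)))) kg _ _ _ _.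
- apply/eqP/lker0P => u v e; apply: val_inj; apply: (can_inj (@galg_oppK k hT)).
  apply/eqP; rewrite -subr_eq0; apply/eqP.
  have /BP[Yu uc] := subvsP u; have /BP[Yv vc] := subvsP v.
  by apply: Linj; rewrite ?memvB ?mem_galg_opp // ?mulrBl ?oppc // gopB -!hE e subrr.
- rewrite ig; apply/vspaceP=> t; apply/idP/memv_imgP => [/right_endoP/Lsur[a [Ya ac] ->]|[a _ ->]].
    have Ba : galg_opp a \in (kspan k Y * <[c]> * kspan k Y)%VS.
      apply/BP; rewrite mem_galg_opp; split=> //.
      by rewrite -{2}ac galg_oppM galg_oppK (center_commute Zc) ?mem_galg_opp.
    by exists (vsproj _ (galg_opp a)); rewrite ?memvf // hE vsprojK // galg_oppK.
  by rewrite hE; apply: (lop_T memR).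
- by case=> y y' /setXP[Yy Yy'] v; rewrite sandwichE gE.
case=> y y' /setXP[Yy Yy'] a; rewrite sandwichE !hE bimod_gact //.
have /BP[Ya _] := subvsP a; have Ya' : galg_opp (vsval a) \in kspan k Y by rewrite mem_galg_opp.
rewrite !galg_oppM !galg_opp_gelt invgK mulrA.
by rewrite !(lopM memR) ?kspanM ?mem_kspan ?groupV // !gop_gelt ?groupV.
Qed.

Lemma bimodule_block : galg_act L (galg_tens b (galg_opp c)) = 1.
Proof.
have [_ _ Lb] := left_b; have [_ _ Rc] := right_c.
by rewrite galg_act_tens Lb mul1r; apply: Rc.
Qed.

Lemma dual_bimodule_block : galg_act (dualm L) (galg_tens c (galg_opp b)) = 1.
Proof.
apply/lfunP=> u; rewrite one_lfunE.
suff -> : galg_act (dualm L) (galg_tens c (galg_opp b)) u =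
    (u \o galg_act L (galg_tens b (galg_opp c)))%VF.
  by rewrite bimodule_block; apply: comp_lfun1r.
apply/lfunP=> v; rewrite comp_lfunE /galg_act [X in u X]sum_lfunE linear_sum !sum_lfunE /=.
rewrite [RHS](reindex_inj (inv_inj (fun z : gT * hT => invgK z))) /=.
rewrite [RHS](reindex (fun z : hT * gT => (z.2, z.1))) /=; last first.
  by exists (fun z : gT * hT => (z.2, z.1)) => -[].
apply: eq_big => [[y x]|[y x] _]; first by rewrite groupV !inE andbC.
rewrite !scale_lfunE linearZ dualmE comp_lfunE; congr (_ *: _).
by rewrite !galg_tensE !ffunE /= invgK mulrC.
Qed.

Lemma faithful_morita : morita_equivalence b c L.
Proof.
split; first exact: bimodule_block.
exists (dualm L); split; [exact: dual_bimodule_block | exact: left_bimod_giso |].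
exact: right_bimod_giso.
Qed.

End Morita.

(** * Brauer correspondents *)

Section BrauerIdempotent.

Variables (k : fieldType) (p : nat) (charkp : p \in [pchar k]) (gT : finGroupType).
Implicit Types (a w e b : grpalg k gT) (x y u : gT) (P X : {group gT}).

Lemma gelt_stab_set a : group_set [set x | gelt x * a == a].
Proof.
apply/group_setP; split=> [|x y]; first by rewrite inE gelt1E mul1r.
by rewrite !inE geltM -mulrA => /eqP xa /eqP->; rewrite xa.
Qed.

Lemma pgroup_fixed_vector P (W : {vspace grpalg k gT}) : p.-group P ->
    {in P, forall x, {in W, forall a, gelt x * a \in W}} -> W != 0%VS ->
  exists a, [/\ a \in W, a != 0 & {in P, forall x, gelt x * a = a}].
Proof.
move=> pP stW W0; pose act x : 'End(grpalg k gT) := amull (gelt x).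
have actE x a : act x a = gelt x * a := amullE _ _.
pose gP (Q : {group gT}) := (Q \subset P) && (fixed act W Q != 0%VS).
have gP1 : gP 1%G.
  rewrite /gP sub1G; apply: contra W0 => /eqP f0; rewrite -subv0; apply/subvP=> a Wa.
  rewrite -f0; apply/fixedP; split=> // x /set1P->.
  by rewrite actE gelt1E mul1r.
have [Q /maxgroupP[/andP[sQP fQ] Qmax] _] := maxgroup_exists gP1.
have [eQP|] := eqVproper sQP.
  have /fixedP[Wa fa] := memv_pick (fixed act W Q).
  exists (vpick (fixed act W Q)); rewrite vpick0 fQ; split=> // x Px.
  by rewrite -actE fa // eQP.
move/(nilpotent_proper_norm (pgroup_nil pP))/properP=> [_ [x /setIP[Px Nx] nQx]].
pose a := vpick (fixed act W Q); have a0 : a != 0 by rewrite vpick0.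
have /fixedP[Wa fa] : a \in fixed act W Q := memv_pick _.
(* For x of order p^n, Frobenius gives d^(p^n) = x^(p^n) - 1 = 0. *)
pose d : grpalg k gT := gelt x - 1.
have dn0 : exists m, d ^+ m * a == 0.
  have [n xn] : exists n, #[x]%g = (p ^ n)%N by have /p_natP[n ->] := mem_p_elt pP Px; exists n.
  exists (p ^ n)%N; have chA : p \in [pchar grpalg k gT].
    move/andP: charkp => [pr /eqP p0]; apply/andP; split=> //.
    by rewrite -scaler_nat p0 scale0r.
  have -> : d ^+ (p ^ n) = 0; last by rewrite mul0r.
  have frob v : v ^+ (p ^ n) = iter n (pFrobenius_aut chA) v.
    elim: n {xn} => // n IHn; by rewrite iterS -IHn pFrobenius_autE -exprM expnSr.
  have geltX m : (gelt x : grpalg k gT) ^+ m = gelt (x ^+ m)%g.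
    by elim: m => [|m IHm]; rewrite ?gelt1E // expgS exprS IHm geltM.
  have iterB m (v : grpalg k gT) : iter m (pFrobenius_aut chA) (v - 1) =
      iter m (pFrobenius_aut chA) v - 1.
    elim: m => // m IHm; rewrite !iterS IHm pFrobenius_autB_comm ?pFrobenius_aut1 //.
    exact: commr1.
  by rewrite frob iterB -frob geltX -xn expg_order gelt1E subrr.
(* The least power of d killing a is not the zeroth, as a is nonzero. The power just before it sends
   a to a nonzero vector that d kills, that is, one fixed by x. *)
case: (ex_minnP dn0) => -[|m] /eqP dm mmin; first by rewrite -dm expr0 mul1r eqxx in a0.
pose a' := d ^+ m * a.
have a'0 : a' != 0 by apply/negP=> /mmin; rewrite ltnn.
have step n : d ^+ n * a \in W /\ {in Q, forall q, gelt q * (d ^+ n * a) = d ^+ n * a}.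
  elim: n => [|n [Wn fn]].
    by rewrite expr0 mul1r; split=> // q Qq; rewrite -actE; apply: fa.
  rewrite exprS -mulrA; set v := d ^+ n * a in Wn fn *.
  rewrite mulrBl mul1r; split; first by rewrite memvB // stW.
  move=> q Qq; rewrite mulrBr (fn q Qq) mulrA -geltM.
  have -> : (q * x = x * q ^ x)%g by rewrite conjgE !mulgA mulgV mul1g.
  by rewrite geltM -mulrA fn // memJ_norm.
have [Wa' fa'] := step m.
pose K := Group (gelt_stab_set a').
have sRK : (Q <*> <[x]>)%G \subset K.
  rewrite join_subG cycle_subG inE; apply/andP; split.
    by apply/subsetP=> q Qq; rewrite inE fa'.
  by rewrite -subr_eq0 -[X in _ - X]mul1r -mulrBl mulrA -exprS dm.
have gR : gP (Q <*> <[x]>)%G.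
  rewrite /gP join_subG sQP cycle_subG Px; apply/eqP=> f0.
  have : a' \in fixed act W (Q <*> <[x]>)%G.
    apply/fixedP; split=> // y /(subsetP sRK); rewrite inE actE => /eqP //.
  by rewrite f0 memv0 (negPf a'0).
have := Qmax _ gR (joing_subl _ _) => e; case/negP: nQx.
by rewrite -e /= mem_gen // inE cycle_id orbT.
Qed.

(* The norm of P kills w, as proper traces have zero norm; but a nonzero left ideal kXw would *)
(* contain a nonzero P-fixed vector, which is a norm multiple. *)
Lemma normal_brauer_idem0 P X w : p.-group P -> P \subset X -> X \subset 'N(P)%g ->
    w \in 'Z(kspan k X)%VS -> w * w = w -> brauer_map P w = 0 -> w = 0.
Proof.
move=> pP sPX nPX /[dup] Zw /centerP[Xw fw] ww brw.
pose n : grpalg k gT := \sum_(u in P) gelt u.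
have gn u : u \in P -> gelt u * n = n.
  move=> Pu; rewrite mulr_sumr [RHS](reindex_inj (mulgI u)) /=.
  by apply: eq_big => [v|v Pv]; rewrite ?groupMl // geltM.
have ng u : u \in P -> n * gelt u = n.
  move=> Pu; rewrite mulr_suml [RHS](reindex_inj (mulIg u)) /=.
  by apply: eq_big => [v|v Pv]; rewrite ?groupMr // geltM.
have gan a y : a \in kspan k X -> y \in P -> gelt y * a * n = a * n.
  move=> Xa Py; rewrite (kspan_sum Xa) [X in X * n = _]mulr_sumr [LHS]mulr_suml [RHS]mulr_suml.
  apply: eq_bigr => g Xg.
  rewrite -scalerAr -!scalerAl -geltM; congr (_ *: _).
  have -> : (y * g = g * y ^ g)%g by rewrite conjgE !mulgA mulgV mul1g.
  by rewrite geltM -mulrA gn // memJ_norm // (subsetP nPX).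
have wn : w * n = 0.
  have lw := brauer_map_lower sPX Xw (fun x Px => fw x (subsetP sPX x Px)) brw.
  rewrite -amulrE; apply/eqP; rewrite -memv0; apply: lower_ind lw => Q u pQ Xu Qu.
  have sQP := proper_sub pQ; rewrite amulrE traceE mulr_suml memv0.
  rewrite (eq_bigr (fun _ => u * n)) => [|C CQ].
    by rewrite sumr_const -scaler_nat (index_pchar_eq0 charkp pP pQ) scale0r.
  have [PC _] := lcoset_repr sQP CQ; rewrite gconjlE /gconj -mulrA gn ?groupV //.
  exact: gan.
apply/eqP; apply: contraT => w0; pose W := (amulr w @: kspan k X)%VS.
have Ww : w \in W by rewrite -{1}[w]mul1r -amulrE memv_img // kspan1.
have [||a [/memv_imgP[a0 Xa0 ea] anz fa]] := @pgroup_fixed_vector P W pP.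
- move=> x Px _ /memv_imgP[a Xa ->]; rewrite amulrE mulrA -amulrE.
  by rewrite memv_img // kspanM ?mem_kspan // (subsetP sPX).
- by apply: contraNneq w0 => W0; rewrite -memv0 -W0.
have wa : w * a = a by rewrite ea amulrE -(center_commute Zw Xa0) mulrA ww.
suff wa0 : w * a = 0 by rewrite -wa wa0 eqxx in anz.
(* Since [P] fixes a, the coefficient of w a at z groups along the left cosets of [P]: a is constant
   on each group, and the sum of w over a coset is a coefficient of w n, which is 0. *)
apply/ffunP=> z; rewrite gmulE [RHS]ffunE.
rewrite (eq_bigl (mem [set: gT]%G)) => [|x]; last by rewrite /= in_setT.
rewrite (sum_lcosets _ (subsetT P)) big1 // => C _.
rewrite (eq_bigr (fun u => w (repr C * u)%g * a ((repr C)^-1 * z)%g)) => [|u Pu].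
  rewrite -mulr_suml; suff -> : \sum_(u in P) (w (repr C * u)%g : k) = 0 by rewrite mul0r.
  have /ffunP/(_ (repr C)) := wn; rewrite mulr_sumr sum_ffunE ffunE => e0.
  rewrite -[RHS]e0 [LHS](reindex_inj invg_inj) /=.
  by apply: eq_big => [u|u _]; rewrite ?groupV // [in RHS]gmul_geltr.
by congr (_ * _); rewrite -[in RHS](fa u Pu) [in RHS]gmul_geltl invMg mulgA.
Qed.

(** The orbit sum c is a central idempotent of kX supported on C(P) and absorbed by br(b), so br(b
    c) = c is nonzero and primitivity of b forces b c = b. Then br(b) = c, and b - c is a central
    idempotent with zero Brauer image. *)
Lemma orbit_idem_brauer P X X0 b e :
    p.-group P -> P \subset X -> X \subset 'N(P)%g -> block X b ->
    (forall x, (x \in X0) = (x \in X) && (gconj x e == e)) ->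
    {in X, forall x, gconj x e = e \/ gconj x e * e = 0} ->
    e \in kspan k X -> e \in kspan k 'C(P)%g -> e * e = e -> e != 0 ->
    e * brauer_map P b = e -> brauer_map P b * e = e ->
  orbit_idem X X0 e = b.
Proof.
move=> pP sPX nPX bX memX0 e_orth Xe Ce ee e0 ebr bre; set c := orbit_idem X X0 e.
have bfix : {in X, forall x, gconj x b = b} by case/centerP: (block_center bX).
have cC : c \in kspan k 'C(P)%g.
  rewrite /c orbit_idemE memv_suml // => D DX; apply: mem_kspan_gconj => //.
  rewrite (subsetP (norms_cent nPX)) //; exact: (orbit_repr memX0 DX).
have Pb : {in P, forall x, gconj x b = b} by move=> x Px; apply/bfix/(subsetP sPX).
have cbr : c * brauer_map P b = c.
  rewrite {1}/c orbit_idemE mulr_suml /c orbit_idemE; apply: eq_bigr => D DX.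
  have XD := orbit_repr memX0 DX; have ND := subsetP nPX _ XD.
  by rewrite -{1}(bfix _ XD) (brauer_map_gconj _ ND) -gconj_mul ebr.
have Xc : c \in kspan k X := orbit_kspan memX0 Xe.
have Zc : c \in 'Z(kspan k X)%VS by apply/centerP; split=> // x Xx; apply: orbit_fix memX0 x Xx.
have cc : c * c = c := orbit_idem_idem memX0 e_orth ee.
have brcb : brauer_map P (c * b) = c by rewrite brauer_mapMl.
have c0 : c != 0.
  by apply: contraNneq e0 => c0; rewrite -(orbit_idem_mul memX0 e_orth ee) -/c c0 mulr0.
have bc : b * c = c * b by apply: center_commute (block_center bX) Xc.
have bcE : b * c = b.
  have [bc0|//] := block_mul_idem bX Zc cc.
  by rewrite -brcb -bc bc0 in c0; case/eqP: c0; apply/ffunP=> x; rewrite !ffunE if_same.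
have brb : brauer_map P b = c by rewrite -[in LHS]bcE bc.
apply/eqP; rewrite -subr_eq0; apply/eqP; apply: (normal_brauer_idem0 pP sPX nPX).
- by rewrite memvB // (block_center bX).
- by rewrite mulrBl !mulrBr cc -bc bcE (block_idem bX) subrr subr0.
by rewrite brauer_mapB brb (brauer_map_id cC) subrr.
Qed.

End BrauerIdempotent.

(** * The theorem *)

Section StabIdempotent.

Variables (k : fieldType) (gT : finGroupType) (G P X : {group gT}) (e : grpalg k gT).
Hypotheses (be : block 'C_G(P) e) (sCX : 'C_G(P) \subset X) (nX : X \subset 'N_G(P)).
Local Notation X0 := (stabiliser X X e).

(** [stabiliser] is used with both group arguments equal to [X]: as N_X(X) = X, it becomes the plain
    stabiliser of e in [X]. *)
Lemma stab_self x : (x \in X0) = (x \in X) && (gconj x e == e).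
Proof.
rewrite inE [x \in 'N_X(X)%g]inE; case Xx: (x \in X) => //=.
by rewrite (subsetP (normG X)).
Qed.

Lemma block_orbit_orth : {in X, forall x, gconj x e = e \/ gconj x e * e = 0}.
Proof.
move=> x /(subsetP nX)/mem_norm_cent Nx; case: (block_gconj_orth be Nx) => [->|e0]; first by left.
right; rewrite -(center_commute (block_center be)) //.
exact: block_kspan (block_gconj_normal be Nx).
Qed.

Lemma orbit_idem_center : orbit_idem X X0 e \in 'Z(kspan k X)%VS.
Proof.
apply/centerP; split; last by move=> x Xx; apply: (orbit_fix stab_self Xx).
by apply: (orbit_kspan stab_self); apply: subvP (kspanS k sCX) _ (block_kspan be).
Qed.

Lemma orbit_idem_stable : {in X, forall x, gconj x e = e} -> orbit_idem X X0 e = e.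
Proof.
move=> Xe; have -> : X0 = X.
  by apply/val_inj/setP=> x; rewrite stab_self andb_idr // => /Xe->.
by apply: trace_id => x /Xe; rewrite gconjlE.
Qed.

End StabIdempotent.

Section SlashedInduced.

Variables (k : fieldType) (gT hT : finGroupType) (G P : {group gT}) (H R : {group hT}).
Variables (e : grpalg k gT) (f : grpalg k hT).
Hypotheses (be : block 'C_G(P) e) (bf : block 'C_H(R) f).
Variables (D N : {group gT * hT}) (MP : gmod k N) (s : 'End(MP)).
Hypotheses (sDN : D \subset N) (nDN : N \subset 'N(D)%g).
Hypothesis D1 : {in D, forall d, gact MP d = 1}.
Hypothesis trs : trace (gact (endm MP)) D N s = 1.
Hypothesis fst1 : {in D, forall d, d.1 = 1%g -> d = 1%g}.
Hypothesis snd1 : {in D, forall d, d.2 = 1%g -> d = 1%g}.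
Variables (K : {group gT}) (K' : {group hT}).
Hypothesis locL : left_local_data (stdcoord gT hT) 'C_G(P) K 'C_H(R) MP e.
Hypothesis locR : left_local_data (prodswap (stdcoord gT hT)) 'C_H(R) K' 'C_G(P) MP f.
Variables (X : {group gT}) (Y : {group hT}) (T : {group gT * hT}) (sTN : T \subset N).
Hypothesis sTXY : T \subset setX_group X Y.
Hypotheses (sCX : 'C_G(P) \subset X) (nX : X \subset 'N_G(P)).
Hypotheses (sCY : 'C_H(R) \subset Y) (nY : Y \subset 'N_H(R)).
Hypothesis inl_T : {in X, forall x, ((x, 1%g) \in T) = (x \in 'C_G(P)%g)}.
Hypothesis inr_T : {in Y, forall y, ((1%g, y) \in T) = (y \in 'C_H(R)%g)}.
Hypothesis lift_l : {in X, forall x, gconj x e = e -> exists2 z, z \in T & z.1 = x}.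
Hypothesis lift_r : {in Y, forall y, gconj y f = f -> exists2 z, z \in T & z.2 = y}.
Variable L : gmod k (setX_group X Y).
Hypothesis L_ind : induced_from (resm sTN MP) L.

Local Notation b := (orbit_idem X (stabiliser X X e) e).
Local Notation c := (orbit_idem Y (stabiliser Y Y f) f).

(** Common form of the three parts of the theorem, for any [T] inside [N] and any X, Y between the
    centralisers and the normalisers. Its hypotheses ask that [T] meet each factor in the
    centraliser and cover the stabilisers of e and f. *)
Lemma slashed_induced : p_permutation L /\ morita_equivalence b (galg_opp c) L.
Proof.
have memL := @mem_stdZ _ _ X Y; have memR := @mem_stdZ_swap _ _ X Y.
have actD1 : {in D, forall d, gact (endm MP) d = 1}.
  by move=> d Dd; apply/lfunP=> u; rewrite endmE !D1 ?groupV // mul1r mulr1 one_lfunE.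
(* [T] need not contain [D], so the trace form is first restricted to one from the intersection of
   [D] and [T]. *)
have [t Et] := trace_restrict s (gact_action (endm MP)) sDN nDN actD1 sTN.
have sDT : (D :&: T)%G \subset T := subsetIr _ _.
have DT d : d \in (D :&: T)%G -> d \in D by case/setIP.
have DT1 : {in (D :&: T)%G, forall d, gact (resm sTN MP) d = 1} by move=> d /DT/D1.
have trt : trace (gact (endm (resm sTN MP))) (D :&: T)%G T t = 1 by rewrite -trs Et.
have [pL [psi [psi_fix psi_tr]]] := induced_p_permutation sTXY sDT L_ind DT1 trt.
split=> //.
have sDZ := subset_trans sDT sTXY.
have [sX sXE] := free_M memR sDZ (fun d Dd => snd1 (DT d Dd)) psi_fix psi_tr.
have [sY sYE] := free_M memL sDZ (fun d Dd => fst1 (DT d Dd)) psi_fix psi_tr.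
have [Lsur Linj Le _] := locL; have [Rsur Rinj Rf _] := locR.
have Tl y : y \in 'C_H(R)%g -> (1%g, y) \in T by move=> Cy; rewrite inr_T // (subsetP sCY).
have Tr x : x \in 'C_G(P)%g -> (x, 1%g) \in T by move=> Cx; rewrite inl_T // (subsetP sCX).
have left_b : left_faithful (stdcoord gT hT) X Y L b.
  exact: (induced_left_faithful memL sTXY L_ind sCX sCY inl_T Tl (block_kspan be)
    (block_idem be) (block_kspan bf) (stab_self X e) (block_orbit_orth be nX)
    (block_orbit_orth bf nY) lift_l lift_r Lsur Linj Le Rf).
have right_c : left_faithful (prodswap (stdcoord gT hT)) Y X L c.
  exact: (induced_left_faithful memR sTXY L_ind sCY sCX inr_T Tr (block_kspan bf)
    (block_idem bf) (block_kspan be) (stab_self Y f) (block_orbit_orth bf nY)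
    (block_orbit_orth be nX) lift_r lift_l Rsur Rinj Rf Le).
apply: (faithful_morita _ _ _ _ left_b _ sXE sYE).
- exact: (orbit_idem_center be sCX).
- exact: (orbit_idem_idem (stab_self X e) (block_orbit_orth be nX) (block_idem be)).
- exact/galg_opp_center/(orbit_idem_center bf sCY).
- by rewrite -galg_oppM (orbit_idem_idem (stab_self Y f) (block_orbit_orth bf nY) (block_idem bf)).
by rewrite galg_oppK.
Qed.

End SlashedInduced.

Section GraphNormaliser.

Variables (gT hT : finGroupType) (P : {group gT}) (R : {group hT}).
Variable phi : {morphism P >-> hT}.
Hypothesis iso_phi : isom P R phi.
Local Notation D := (graph phi).

Lemma graph_norm z u : z \in 'N(D)%g -> u \in P ->
  (u ^ z.1)%g \in P /\ phi (u ^ z.1)%g = (phi u ^ z.2)%g.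
Proof.
case: z => x y /= Nz Pu; have Du : (u, phi u) \in D by apply/graphP; exists u.
have : (((u, phi u) : gT * hT) ^ (x, y))%g \in D by rewrite memJ_norm.
case/graphP=> v Pv E; have [e1 e2] : (u ^ x = v)%g /\ (phi u ^ y = phi v)%g by case: E.
by rewrite e1 e2.
Qed.

Lemma graph_norm_fst z : z \in 'N(D)%g -> z.1 \in 'N(P)%g.
Proof.
move=> Nz; rewrite inE; apply/subsetP=> _ /imsetP[u Pu ->].
by have [] := graph_norm Nz Pu.
Qed.

Lemma graph_norm_snd z : z \in 'N(D)%g -> z.2 \in 'N(R)%g.
Proof.
have [_ phiP] := isomP iso_phi; move=> Nz; rewrite inE; apply/subsetP=> _ /imsetP[v Rv ->].
have := Rv; rewrite -{1}phiP => /morphimP[u _ Pu ->].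
by have [Pux <-] := graph_norm Nz Pu; rewrite -phiP mem_morphim.
Qed.

Lemma graph_norm_inl x : (x, 1%g) \in 'N(D)%g -> x \in 'C(P)%g.
Proof.
have [/injmP inj _] := isomP iso_phi.
move=> Nz; apply/centP=> u Pu; have [/= Pux] := graph_norm Nz Pu; rewrite conjg1.
by move/(inj _ _ Pux Pu) => e; apply/esym/commgP/conjg_fixP.
Qed.

Lemma graph_norm_inr y : (1%g, y) \in 'N(D)%g -> y \in 'C(R)%g.
Proof.
have [_ phiP] := isomP iso_phi.
move=> Nz; apply/centP=> v Rv; have := Rv; rewrite -{1}phiP => /morphimP[u _ Pu ->].
have [/= _] := graph_norm Nz Pu; rewrite conjg1 => e.
by apply/esym/commgP/conjg_fixP.
Qed.

End GraphNormaliser.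

(** Lets the first part of the theorem, where nothing is induced, count as a case of induction. *)
Lemma induced_self (k : fieldType) (gT : finGroupType) (G : {group gT}) (V : gmod k G) :
  induced_from V V.
Proof.
exists \1%VF, \1%VF; split.
- by move=> z Gz x; rewrite !id_lfunE.
- by move=> z Gz x; rewrite !id_lfunE.
- rewrite comp_lfun1l; apply: trace_id => d Dd; exact: endm_one.
- by move=> v; rewrite !id_lfunE.
by move=> x Gx v; rewrite Gx.
Qed.

Theorem corollary1p5
  (k : closedFieldType) (p : nat) (charkp : p \in [pchar k])
  (gT hT : finGroupType) (G : {group gT}) (H : {group hT})
  (b : grpalg k gT) (c : grpalg k hT)
  (block_b : block G b) (block_c : block H c)
  (M : gmod k (setX_group G H))
  (M_indec : indecomposable M)
  (M_stable : stable_equivalence_of_Morita_type b c M)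
  (M_endo : exists (D : {group gT * hT}) (U : gmod k D),
     [/\ vertex M D, source M U & endopermutation U])
  (P : {group gT}) (R : {group hT})
  (defect_P : defect_group p G b P) (defect_R : defect_group p H c R)
  (i : grpalg k gT) (j : grpalg k hT)
  (source_i : source_idempotent G b P i) (source_j : source_idempotent H c R j)
  (phi : {morphism P >-> hT}) (iso_phi : isom P R phi)
  (V : gmod k (graph phi))
  (V_indec : indecomposable V) (V_endo : endopermutation V)
  (M_summand :
     dsummand M
       (tensb (tensb (bimod G i P) (indm (setX_group P R) V)) (bimod R j H)))
  (P_nontriv : P :!=: 1%g)
  (e : grpalg k gT) (f : grpalg k hT)
  (block_e : block 'C_G(P) e) (i_e : brauer_map P i * e != 0)
  (block_f : block 'C_H(R) f) (j_f : brauer_map R j * f != 0)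
  (GP : {group gT}) (HP : {group hT})
  (cent_GP : 'C_G(P) \subset GP) (GP_stab : GP \subset stabiliser G P e)
  (* HP / C_H(R) is the image of GP / C_G(P): both act on P and R = phi(P). *)
  (HP_def : HP :=: [set y in stabiliser H R f |
     [exists x in GP, [forall u in P, phi (u ^ x) == phi u ^ y]]]%g)
  (N := stabiliser (setX_group G H) (graph phi) (galg_tens e (galg_opp f)))
  (MP : gmod k N)
  (MP_slashed : slashed p M (subxx N) MP) :
  [/\ let M1 := resm (cent_sub_stabiliser iso_phi block_e block_f) MP in
      p_permutation M1 /\ morita_equivalence e f M1,
      let M2 := indm (setX_group GP HP) (resm (subsetIl N (setX GP HP)) MP) in
      p_permutation M2 /\ morita_equivalence e f M2
    & forall (b' : grpalg k gT) (c' : grpalg k hT),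
      brauer_correspondent p G P b b' -> brauer_correspondent p H R c c' ->
      let M3 := indm (setX_group 'N_G(P) 'N_H(R)) MP in
      p_permutation M3 /\ morita_equivalence b' c' M3].
Proof.
have [sPG pP _] := defect_groupP defect_P; have [sRH pR _] := defect_groupP defect_R.
have [bie ebb] := source_brauer_block charkp block_b sPG pP source_i block_e i_e.
have [bjf fbc] := source_brauer_block charkp block_c sRH pR source_j block_f j_f.
have bf1 := block_opp block_f; set f1 := galg_opp f in bf1 *.
have [D1 [s trs] locL locR] := slashed_local_data charkp block_b block_c M_stable
  defect_P defect_R source_i source_j iso_phi M_summand P_nontriv block_e i_e block_f j_f MP_slashed.
rewrite -/f1 in locR.
have memN z : (z \in N) = [&& z \in setX_group G H, z \in 'N(graph phi)%g, gconj z.1 e == e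
    & gconj z.2 f1 == f1] by apply: mem_tens_stabiliser block_e bf1.
have nDN : N \subset 'N(graph phi)%g by apply/subsetP=> z; rewrite memN => /and4P[].
have sub_N := cent_sub_stabiliser (G := G) (H := H) iso_phi block_e block_f.
have sDN : graph phi \subset N.
  apply/subsetP=> z Dz; have /(subsetP (graph_sub iso_phi)) := Dz.
  rewrite inE => /andP[Pz Rz]; rewrite memN (subsetP (normG _) _ Dz) inE /=.
  rewrite (subsetP sPG) // (subsetP sRH) //=.
  by rewrite (gconj_cent (block_kspan block_e) Pz) (gconj_cent (block_kspan bf1) Rz) !eqxx.
have N_fst z : z \in N -> z.1 \in 'N_G(P)%g.
  rewrite memN inE => /and4P[/andP[Gz _] Nz _ _]; apply/setIP; split=> //.
  exact: graph_norm_fst Nz.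
have N_snd z : z \in N -> z.2 \in 'N_H(R)%g.
  rewrite memN inE => /and4P[/andP[_ Hz] Nz _ _]; apply/setIP; split=> //.
  exact: (graph_norm_snd iso_phi Nz).
have cent_l x : ((x, 1%g) \in N) = (x \in 'C_G(P)%g).
  apply/idP/idP=> [|Cx]; last by apply: (subsetP sub_N); rewrite inE /= Cx group1.
  rewrite memN inE => /and4P[/andP[Gx _] Nx _ _]; apply/setIP; split=> //.
  exact: (graph_norm_inl iso_phi Nx).
have cent_r y : ((1%g, y) \in N) = (y \in 'C_H(R)%g).
  apply/idP/idP=> [|Cy]; last by apply: (subsetP sub_N); rewrite inE /= Cy group1.
  rewrite memN inE => /and4P[/andP[_ Hy] Ny _ _]; apply/setIP; split=> //.
  exact: (graph_norm_inr iso_phi Ny).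
have sCN : 'C_G(P) \subset 'N_G(P) by apply/setIS/cent_sub.
have sCN' : 'C_H(R) \subset 'N_H(R) by apply/setIS/cent_sub.
have final := slashed_induced block_e bf1 sDN nDN D1 trs (@graph_fst1 _ _ P phi)
  (graph_snd1 iso_phi) locL locR.
have [_ _ _ fus_l] := locL; have [_ _ _ fus_r] := locR.
have stab_f1 y : (y \in stabiliser H R f1) = (y \in stabiliser H R f).
  rewrite !inE -galg_opp_gconj; congr (_ && _).
  by apply/eqP/eqP=> [/(can_inj (@galg_oppK k hT))|->].
split.
(* Here [T] is the whole product of the two centralisers; these fix e and f, so both orbit sums have
   a single term. *)
- have e_st : {in 'C_G(P)%g, forall x, gconj x e = e} := fun x Cx => block_gconj block_e Cx.
  have f_st : {in 'C_H(R)%g, forall x, gconj x f1 = f1} := fun x Cx => block_gconj bf1 Cx.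
  have eE := orbit_idem_stable e_st; have fE := orbit_idem_stable f_st.
  have := final _ _ _ (sub_N : _ \subset N) (subxx _) (subxx _) sCN (subxx _) sCN' _ _ _ _ _
    (induced_self (resm (cent_sub_stabiliser iso_phi block_e block_f) MP)).
  rewrite eE fE galg_oppK; apply.
  + by move=> x Cx; rewrite inE /= Cx group1.
  + by move=> y Cy; rewrite inE /= Cy group1.
  + by move=> x Cx _; exists (x, 1%g) => //; apply/setXP.
  by move=> y Cy _; exists (1%g, y) => //; apply/setXP.
- have memHP y : (y \in HP) = (y \in stabiliser H R f) &&
      [exists x in GP, [forall u in P, phi (u ^ x)%g == phi u ^ y]]%g by rewrite HP_def inE.
  have sCH : 'C_H(R) \subset HP.
    apply/subsetP=> y Cy; rewrite memHP; apply/andP; split.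
      by apply/setIdP; split; [exact: (subsetP sCN') | exact/eqP/(block_gconj block_f)].
    apply/exists_inP; exists 1%g => //; apply/forall_inP=> u Pu; rewrite conjg1.
    have [_ phiP] := isomP iso_phi; have Ru : phi u \in R by rewrite -phiP mem_morphim.
    by rewrite /conjg -(centP (setIP Cy).2) // mulKg.
  have nGP : GP \subset 'N_G(P).
    by apply/subsetP=> x /(subsetP GP_stab)/setIdP[].
  have nHP : HP \subset 'N_H(R).
    by apply/subsetP=> y; rewrite memHP => /andP[/setIdP[]].
  have e_st : {in GP, forall x, gconj x e = e}.
    by move=> x /(subsetP GP_stab)/setIdP[_ /eqP].
  have f_st : {in HP, forall x, gconj x f1 = f1}.
    by move=> y; rewrite memHP -stab_f1 => /andP[/setIdP[_ /eqP]].
  have sTX : (N :&: setX_group GP HP)%G \subset setX_group GP HP := subsetIr _ _.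
  have eE := orbit_idem_stable e_st; have fE := orbit_idem_stable f_st.
  have := final _ _ _ (subsetIl N (setX GP HP)) sTX cent_GP nGP sCH nHP _ _ _ _ _
    (indm_induced sTX (resm (subsetIl N (setX GP HP)) MP)).
  rewrite eE fE galg_oppK; apply.
  + move=> x GPx; rewrite in_setI cent_l; apply: andb_idr => _; exact/setXP.
  + move=> y HPy; rewrite in_setI cent_r; apply: andb_idr => _; exact/setXP.
  (* Fusion lifts x to some z in [N]; normalising the graph makes the right component of z
     correspond to x, hence lie in [HP]. *)
  + move=> x GPx _; have [z Nz ez] := fus_l x (subsetP GP_stab x GPx).
    exists z => //; rewrite in_setI Nz; case: z Nz ez => x' y /= Nz ez; apply/setXP.
    rewrite [x']ez memHP; split=> //; apply/andP; split.
      rewrite -stab_f1; apply/setIdP; split; first exact: (N_snd _ Nz).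
      by have := Nz; rewrite memN => /and4P[].
    apply/exists_inP; exists x => //; apply/forall_inP=> u Pu; rewrite -[x]ez.
    by have [_ /= ->] := graph_norm (subsetP nDN _ Nz) Pu.
  move=> y HPy _; have := HPy; rewrite memHP -stab_f1 => /andP[Sy /exists_inP[x GPx /forall_inP xy]].
  have [z Nz ez] := fus_r y Sy; exists z => //; rewrite in_setI Nz.
  case: z Nz ez => x' y' /= Nz ez; apply/setXP; rewrite [y']ez; split=> //.
  have [/injmP inj _] := isomP iso_phi.
  (* The left component x' of the lift and the x provided by [HP_def] both match y through [phi], so
     they induce the same automorphism of [P]. They differ by an element of C_G(P), which lies in
     [GP]. *)
  rewrite -[x'](mulgKV x) groupM //; apply: (subsetP cent_GP).
  have [Gz Nz1] := setIP (N_fst _ Nz); have [Gx Nx] := setIP (subsetP nGP x GPx).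
  apply/setIP; split; first by rewrite groupM ?groupV.
  apply/centP=> u Pu; apply/esym/commgP/conjg_fixP.
  rewrite conjgM; apply: (canLR (conjgK x)); apply: inj.
  + by rewrite memJ_norm.
  + by rewrite memJ_norm.
  have [_ /= ->] := graph_norm (subsetP nDN _ Nz) Pu.
  by rewrite (eqP (xy u Pu)) [y']ez.
move=> b' c' [block_b' _ brb'] [block_c' _ brc'].
have sNX : N \subset setX_group 'N_G(P) 'N_H(R).
  by apply/subsetP=> z Nz; rewrite inE N_fst ?N_snd.
have := final _ _ _ (subxx N) sNX sCN (subxx _) sCN' (subxx _) _ _ _ _ _ (indm_induced sNX MP).
have nNP : 'N_G(P) \subset 'N(P)%g by apply: subsetIr.
have nNR : 'N_H(R) \subset 'N(R)%g by apply: subsetIr.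
have sPN : P \subset 'N_G(P) by rewrite subsetI sPG normG.
have sRN : R \subset 'N_H(R) by rewrite subsetI sRH normG.
have ebE : e * brauer_map P b' = e by rewrite brb'.
have beE : brauer_map P b' * e = e.
  rewrite -(center_commute (block_center block_e)) // brb'.
  exact/brauer_map_kspanI/(block_kspan block_b).
have fcE : brauer_map R c' * f = f.
  rewrite -(center_commute (block_center block_f)) ?brc' //.
  exact/brauer_map_kspanI/(block_kspan block_c).
(* b' is recognised as the sum of the N_G(P)-conjugates of e because its Brauer image is that of b,
   which fixes e. *)
have -> : orbit_idem 'N_G(P) (stabiliser 'N_G(P) 'N_G(P) e) e = b'.
  apply: (orbit_idem_brauer charkp pP sPN nNP block_b' (stab_self _ e)) => //.
  - exact: (block_orbit_orth block_e (subxx _)).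
  - exact: subvP (kspanS k sCN) _ (block_kspan block_e).
  - by apply: subvP (block_kspan block_e); apply/kspanS/subsetIr.
  - exact: block_idem block_e.
  exact: block_neq0 block_e.
have -> : orbit_idem 'N_H(R) (stabiliser 'N_H(R) 'N_H(R) f1) f1 = galg_opp c'.
  apply: (orbit_idem_brauer charkp pR sRN nNR (block_opp block_c') (stab_self _ f1)) => //.
  - exact: (block_orbit_orth bf1 (subxx _)).
  - exact: subvP (kspanS k sCN') _ (block_kspan bf1).
  - by apply: subvP (block_kspan bf1); apply/kspanS/subsetIr.
  - exact: block_idem bf1.
  - exact: block_neq0 bf1.
  - by rewrite brauer_map_opp -galg_oppM fcE.
  by rewrite brauer_map_opp -galg_oppM brc' fbc.
rewrite galg_oppK; apply.
- by move=> x _; apply: cent_l.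
- by move=> y _; apply: cent_r.
- by move=> x Nx ex; apply: fus_l; apply/setIdP; split=> //; apply/eqP.
by move=> y Ny fy; apply: fus_r; apply/setIdP; split=> //; apply/eqP.
Qed.
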